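(* Let $\alpha,\beta>-1$ and let $h$ be a real function that is analytic and positive on $[-1,1]$ (i.e., analytic in a neighborhood of $[-1,1]$ and positive on $[-1,1]$). Let $w(x)=(1-x)^{\alpha}(1+x)^{\beta}h(x)$ on $[-1,1]$, and let $\{p_n\}_{n\ge 0}$ be the orthonormal polynomials with respect to $w(x)\,dx$ on $[-1,1]$ (with $p_n$ of degree $n$ and positive leading coefficient). For $n\in\mathbb{N}$ and $x\in(-1,1)$ let $\bm\Psi_n(x)=(\Psi_{n,1}(x),\dots,\Psi_{n,n}(x))$ with $\Psi_{n,j}(x)=\lambda_n(x)\,p_{j-1}^2(x)$, where $\lambda_n(x)=\big(\sum_{j=0}^{n-1}p_j^2(x)\big)^{-1}$, and let $$\mathcal D(\bm\Psi_n(x))=\log n-\mathcal S(\bm\Psi_n(x)),\qquad \mathcal S(\bm\Psi_n(x))=-\sum_{j=1}^n\Psi_{n,j}(x)\log\Psi_{n,j}(x).$$ Then for every $x=\cos\theta\in(-1,1)$, $\theta\in(0,\pi)$, the limit $\mathcal D_\infty(x)=\lim_{n\to\infty}\mathcal D(\bm\Psi_n(x))$ exists, and $$\mathcal D_\infty(x)=\begin{cases}1-\log 2, & \text{if } \theta/\pi\notin\mathbb{Q},\\[2mm] \log 2+2\,\widehat{\mathcal S}_{k,s}, & \text{if } \theta/\pi=s/k \text{ with } s,k\in\mathbb{N},\ s<k,\ \operatorname{GCD}(s,k)=1,\end{cases}$$ where $$\widehat{\mathcal S}_{k,s}=\frac1k\sum_{i=0}^{k-1}\mathcal F\!\left(\cos\!\Big(\big(i+\tfrac12\big)\frac{\pi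 s}{k}+\varphi\Big(\cos\frac{\pi s}{k}\Big)-\frac{\pi}{4}\Big)\right),$$ with $\mathcal F(y)=y^2\log(y^2)$ for $y\neq 0$ and $\mathcal F(0)=0$, and, for $x=\cos\theta\in(-1,1)$, $$\varphi(x)=\frac12\big((\alpha+\beta)\theta-\alpha\pi\big)+\frac{\sqrt{1-x^2}}{2\pi}\,\mathrm{p.v.}\!\int_{-1}^{1}\frac{\log h(t)}{\sqrt{1-t^2}}\,\frac{dt}{t-x},$$ the integral being a Cauchy principal value.
   Context: Throughout, whenever $x=\cos\theta\in(-1,1)$ it is understood that $\theta\in(0,\pi)$. The principal value integral is $\lim_{\varepsilon\to0}\big(\int_{-1}^{x-\varepsilon}+\int_{x+\varepsilon}^{1}\big)$. $\operatorname{GCD}$ denotes the greatest common divisor. *)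

(* Defs.v *)
From Stdlib Require Import Reals Lra Lia Arith.
From Coquelicot Require Import Coquelicot.
Open Scope R_scope.

Fixpoint sum_lt (f : nat -> R) (n : nat) : R :=
  match n with O => 0 | S m => sum_lt f m + f m end.

Definition analytic_near_interval (h : R -> R) : Prop :=
  exists d : R, 0 < d /\
    forall x0 : R, -1 - d < x0 < 1 + d ->
      exists (a : nat -> R) (r : R), 0 < r /\
        forall y : R, Rabs (y - x0) < r ->
          is_series (fun k => a k * (y - x0) ^ k) (h y).

Definition weight (alpha beta : R) (h : R -> R) (x : R) : R :=
  Rpower (1 - x) alpha * Rpower (1 + x) beta * h x.

Definition poly_deg_pos_lead (q : R -> R) (n : nat) : Prop :=
  exists c : nat -> R, 0 < c n /\ forall x : R, q x = sum_f_R0 (fun k => c k * x ^ k) n.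

Definition orthonormal_family (w : R -> R) (p : nat -> R -> R) : Prop :=
  (forall n, poly_deg_pos_lead (p n) n) /\
  (forall m n, is_RInt_gen (fun x => p m x * p n x * w x)
                 (at_right (-1)) (at_left 1) (if Nat.eqb m n then 1 else 0)).

Definition xlogx (y : R) : R := if Req_EM_T y 0 then 0 else y * ln y.

Definition Fent (y : R) : R := if Req_EM_T y 0 then 0 else y ^ 2 * ln (y ^ 2).

Definition lambda_n (p : nat -> R -> R) (n : nat) (x : R) : R :=
  / sum_lt (fun j => (p j x) ^ 2) n.

(* Psi_{n,j}(x) = lambda_n(x) p_{j-1}(x)^2, j = 1..n  (indexed here by j-1) *)
Definition Psi (p : nat -> R -> R) (n j : nat) (x : R) : R :=
  lambda_n p n x * (p j x) ^ 2.

Definition entropy (p : nat -> R -> R) (n : nat) (x : R) : R :=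
  - sum_lt (fun j => xlogx (Psi p n j x)) n.

Definition Dent (p : nat -> R -> R) (n : nat) (x : R) : R :=
  ln (INR n) - entropy p n x.

Definition is_pv_integral (f : R -> R) (a b x v : R) : Prop :=
  exists I1 I2 : R -> R,
    (forall eps, 0 < eps -> x - eps > a -> x + eps < b ->
        is_RInt_gen f (at_right a) (at_point (x - eps)) (I1 eps) /\
        is_RInt_gen f (at_point (x + eps)) (at_left b) (I2 eps)) /\
    filterlim (fun eps => I1 eps + I2 eps) (at_right 0) (locally v).

(* phi(x) with x = cos theta, given the value pv of the principal value integral
   p.v. int_{-1}^1 log h(t) / sqrt(1-t^2) dt/(t-x) *)
Definition phi_val (alpha beta theta x pv : R) : R :=
  / 2 * ((alpha + beta) * theta - alpha * PI) + sqrt (1 - x ^ 2) / (2 * PI) * pv.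

(* hat S_{k,s}, given the value ph = phi(cos(pi s / k)) *)
Definition Shat (k s : nat) (ph : R) : R :=
  / INR k * sum_lt (fun i => Fent (cos ((INR i + / 2) * (PI * INR s / INR k) + ph - PI / 4))) k.

(* Main.v *)
(* Put [x = cos y]; the weight becomes [f (y) = w (cos y) sin y] on [(0, PI)].  Let [D] be its Szego
   function: outer in the unit disc, positive at the origin, with [|D (e^{i y})|^2 = f y].  Up to a fixed
   power of [1 - z^2] that makes them regular at the endpoints, both [1/D] and [D] are approximated by
   polynomials in [z].  The approximants of [1/D] give trial polynomials for the minimal norm problem
   solved by the orthogonal polynomials, and those of [D] give, by duality, a matching lower bound; so
   [p_n (cos y)] is close in the weighted mean square sense to [sqrt (2 / PI) Re (e^{i n y} conj (1 / D (e^{i y})))].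
   Testing the difference against the Dirichlet kernel, the orthogonality of [p_n] and the regularity
   of [D] near [t] turn this into [p_n (cos t) = A cos (n t + c) + o(1)] with [A > 0].

   Then [sum_{j<n} p_j^2 ~ n A^2 / 2], and the limit of [log n - S] is [log 2 + 2 m], where [m] is the
   mean of [F (cos (j t + c))] over [j]: a finite average if [t / PI] is rational, and the mean
   [1/2 - log 2] of [F o cos] over a period otherwise.  The phase [c] comes from [arg D]; its part due to [h] is
   the conjugate function of [log h (cos y)], which the substitution [x = cos y] turns into the principal
   value integral. *)
Require Import Defs.
From Stdlib Require Import Reals Arith Lra Lia List.
From Coquelicot Require Import Coquelicot.
Open Scope R_scope.

(** Both [1/D] and [D] may blow up at [z = 1] and [z = -1], where polynomials cannot follow them
    uniformly. Truncated series of [log (1 - r z)] with [r < 1] are uniformly close to [log (1 - z)]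
    away from [z = 1]; near it their real parts are only known to exceed the true value minus a
    constant. Dividing by [(1 - z^2)^M] with [M] large makes all exponents in [1/D] and [D]
    nonpositive, and for such exponents this one-sided bound dominates the approximants up to the
    endpoints.

    Mean square closeness gives no value at a point. The Dirichlet kernel reproduces cosine
    polynomials for the measure [dy], whereas the [p_n] are orthogonal for [f y dy]. The remainder
    times [sin^(2M)] is again a cosine polynomial, and a multiple of [sin^(2M)] agreeing with [f] at
    [t] can be exchanged for [f] at the cost of a harmless kernel. The approximation error tested
    against the same kernel must be small in the Lipschitz sense near [t], to compensate the growth
    [1 / |y - t|]. *)

Lemma sum_lt_ext (a b : nat -> R) n :
  (forall k, (k < n)%nat -> a k = b k) -> sum_lt a n = sum_lt b n.
Proof.
  induction n as [|n IH]; intros H; simpl; [reflexivity|].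
  rewrite IH by (intros; apply H; lia). rewrite H by lia. reflexivity.
Qed.

Lemma sum_lt_plus (a b : nat -> R) n :
  sum_lt (fun k => a k + b k) n = sum_lt a n + sum_lt b n.
Proof. induction n as [|n IH]; simpl; [|rewrite IH]; ring. Qed.

Lemma sum_lt_scal (c : R) (a : nat -> R) n :
  sum_lt (fun k => c * a k) n = c * sum_lt a n.
Proof. induction n as [|n IH]; simpl; [|rewrite IH]; ring. Qed.

Lemma sum_lt_le (a b : nat -> R) n :
  (forall k, (k < n)%nat -> a k <= b k) -> sum_lt a n <= sum_lt b n.
Proof.
  induction n as [|n IH]; intros H; simpl; [lra|].
  apply Rplus_le_compat; [apply IH; intros|]; apply H; lia.
Qed.

Lemma sum_lt_const (c : R) n : sum_lt (fun _ => c) n = INR n * c.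
Proof. induction n as [|n IH]; [simpl; ring|]. rewrite S_INR; simpl sum_lt; rewrite IH; ring. Qed.

Lemma sum_lt_abs (a : nat -> R) n : Rabs (sum_lt a n) <= sum_lt (fun k => Rabs (a k)) n.
Proof.
  induction n as [|n IH]; simpl; [rewrite Rabs_R0; lra|].
  eapply Rle_trans; [apply Rabs_triang|lra].
Qed.

Lemma sum_lt_zero (a : nat -> R) n : (forall k, (k < n)%nat -> a k = 0) -> sum_lt a n = 0.
Proof.
  intros H. rewrite (sum_lt_ext a (fun _ => 0)) by exact H. rewrite sum_lt_const; ring.
Qed.

(** * Continuity of real functions *)

Lemma cont_const (c x : R) : continuous (fun _ : R => c) x.
Proof. apply continuous_const. Qed.
Lemma cont_id (x : R) : continuous (fun y : R => y) x.
Proof. apply continuous_id. Qed.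
Lemma cont_plus (u v : R -> R) x :
  continuous u x -> continuous v x -> continuous (fun y => u y + v y) x.
Proof. intros; now apply (continuous_plus (V := R_NormedModule) u v). Qed.
Lemma cont_opp (u : R -> R) x : continuous u x -> continuous (fun y => - u y) x.
Proof. intros; now apply (continuous_opp (V := R_NormedModule) u). Qed.
Lemma cont_minus (u v : R -> R) x :
  continuous u x -> continuous v x -> continuous (fun y => u y - v y) x.
Proof. intros; now apply (continuous_minus (V := R_NormedModule) u v). Qed.
Lemma cont_mult (u v : R -> R) x :
  continuous u x -> continuous v x -> continuous (fun y => u y * v y) x.
Proof. intros; now apply (continuous_mult (K := R_AbsRing) u v). Qed.
Lemma cont_pow (u : R -> R) n x : continuous u x -> continuous (fun y => u y ^ n) x.
Proof.
  intros H; induction n as [|n IH]; simpl; [apply continuous_const|now apply cont_mult].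
Qed.
Lemma cont_inv (u : R -> R) x :
  continuous u x -> u x <> 0 -> continuous (fun y => / u y) x.
Proof.
  intros H Hx. apply (continuous_comp u Rinv); [exact H|].
  apply continuity_pt_filterlim, continuity_pt_inv; [|exact Hx].
  apply derivable_continuous_pt, derivable_pt_id.
Qed.
Lemma cont_div (u v : R -> R) x :
  continuous u x -> continuous v x -> v x <> 0 -> continuous (fun y => u y / v y) x.
Proof. intros; apply cont_mult; [assumption|now apply cont_inv]. Qed.
Lemma cont_abs (u : R -> R) x : continuous u x -> continuous (fun y => Rabs (u y)) x.
Proof. intros H; apply (continuous_comp u Rabs); [exact H|apply continuous_Rabs]. Qed.
Lemma cont_cos (u : R -> R) x : continuous u x -> continuous (fun y => cos (u y)) x.
Proof. intros H; apply (continuous_comp u cos); [exact H|apply continuous_cos]. Qed.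
Lemma cont_sin (u : R -> R) x : continuous u x -> continuous (fun y => sin (u y)) x.
Proof. intros H; apply (continuous_comp u sin); [exact H|apply continuous_sin]. Qed.
Lemma cont_exp (u : R -> R) x : continuous u x -> continuous (fun y => exp (u y)) x.
Proof. intros H; apply (continuous_comp u exp); [exact H|apply continuous_exp]. Qed.
Lemma cont_sqrt (u : R -> R) x : continuous u x -> continuous (fun y => sqrt (u y)) x.
Proof. intros H; apply (continuous_comp u sqrt); [exact H|apply continuous_sqrt]. Qed.
Lemma cont_ln (u : R -> R) x : continuous u x -> 0 < u x -> continuous (fun y => ln (u y)) x.
Proof.
  intros H Hx; apply (continuous_comp u ln); [exact H|].
  apply continuity_pt_filterlim, derivable_continuous_pt.
  exists (/ u x). now apply derivable_pt_lim_ln.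
Qed.
Lemma cont_sum (u : nat -> R -> R) n x :
  (forall k, (k < n)%nat -> continuous (u k) x) ->
  continuous (fun y => sum_lt (fun k => u k y) n) x.
Proof.
  induction n as [|n IH]; intros H; simpl; [apply continuous_const|].
  apply cont_plus; [apply IH; intros|]; apply H; lia.
Qed.

(** Quotients, inverses and logarithms are left out because they carry side conditions. The patterns
    with a partially applied operation catch eta-reduced goals. *)
Ltac cont :=
  repeat match goal with
  | H : continuous ?u ?x |- continuous ?u ?x => exact H
  | H : forall _, continuous ?u _ |- continuous ?u _ => apply H
  | H : forall _, _ -> continuous ?u _ |- continuous ?u _ => apply H; assumption
  | H : forall _, _ -> continuous ?u _ |- continuous (fun y => ?u y) _ => apply H; assumption
  | |- continuous (fun _ => ?c) _ => apply (cont_const c)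
  | |- continuous (fun y => y) _ => apply cont_id
  | |- continuous (fun y => _ + _) _ => apply cont_plus
  | |- continuous (fun y => _ - _) _ => apply cont_minus
  | |- continuous (fun y => _ * _) _ => apply cont_mult
  | |- continuous (fun y => - _) _ => apply cont_opp
  | |- continuous (fun y => _ ^ _) _ => apply cont_pow
  | |- continuous (fun y => Rabs _) _ => apply cont_abs
  | |- continuous (fun y => cos _) _ => apply cont_cos
  | |- continuous (fun y => sin _) _ => apply cont_sin
  | |- continuous (fun y => exp _) _ => apply cont_exp
  | |- continuous (fun y => sqrt _) _ => apply cont_sqrt
  | |- continuous (Rmult ?a) _ => apply (cont_mult (fun _ => a) (fun y => y))
  | |- continuous (Rplus ?a) _ => apply (cont_plus (fun _ => a) (fun y => y))
  | |- continuous (Rminus ?a) _ => apply (cont_minus (fun _ => a) (fun y => y))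
  | |- continuous cos _ => apply continuous_cos
  | |- continuous sin _ => apply continuous_sin
  end.

(** * Integrals over (0, PI) *)

Definition integrable_weight (f : R -> R) : Prop :=
  (forall y, 0 < y < PI -> continuous f y) /\
  (forall y, 0 < y < PI -> 0 < f y) /\
  exists B, forall a b, 0 < a -> a <= b -> b < PI -> RInt f a b <= B.

(** Stands for integrability over [(0, PI)]. The majorant [1 + f] admits both bounded functions and
    bounded multiples of the weight, and singularities at the endpoints are allowed. *)
Definition dom (f u : R -> R) : Prop :=
  (forall y, 0 < y < PI -> continuous u y) /\
  exists C, forall y, 0 < y < PI -> Rabs (u y) <= C * (1 + f y).

(** At most 1, so that [2 < PI] makes every truncated interval nondegenerate. *)
Definition cut (n : nat) : R := / (INR n + 1).

Definition trunc_int (u : R -> R) (n : nat) : R := RInt u (cut n) (PI - cut n).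

(* The improper integral over [(0, PI)]; a junk value if the truncations diverge,
   which [dom f u] excludes for an integrable weight [f]. *)
Definition II (u : R -> R) : R := real (Lim_seq (trunc_int u)).

Lemma cut_bounds n : 0 < cut n <= 1.
Proof.
  unfold cut. pose proof (pos_INR n). split.
  - apply Rinv_0_lt_compat; lra.
  - rewrite <- Rinv_1. apply Rinv_le_contravar; lra.
Qed.

Lemma cut_decr n : cut (S n) <= cut n.
Proof.
  unfold cut. rewrite S_INR. pose proof (pos_INR n). apply Rinv_le_contravar; lra.
Qed.

Lemma cut_half n : 2 * cut n < PI.
Proof. pose proof (cut_bounds n). pose proof PI2_1. lra. Qed.

Lemma cut_lim : is_lim_seq cut 0.
Proof.
  apply is_lim_seq_ext with (fun n => / INR (S n)).
  - intros n; unfold cut; now rewrite S_INR.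
  - apply (is_lim_seq_incr_1 (fun n => / INR n)).
    replace (Finite 0) with (Rbar_inv p_infty) by reflexivity.
    apply is_lim_seq_inv; [apply is_lim_seq_INR|discriminate].
Qed.

Lemma cut_small d : 0 < d -> exists N, forall n, (N <= n)%nat -> cut n < d.
Proof.
  intros Hd. destruct (cut_lim (fun y => y < d)) as [N HN].
  - exists (mkposreal d Hd). intros y Hy. change (Rabs (y - 0) < d) in Hy.
    apply Rabs_def2 in Hy. lra.
  - exists N; exact HN.
Qed.

Lemma ex_RInt_open (u : R -> R) a b :
  (forall y, 0 < y < PI -> continuous u y) -> 0 < a -> a <= b -> b < PI -> ex_RInt u a b.
Proof.
  intros Hu Ha Hab Hb. apply (ex_RInt_continuous (V := R_CompleteNormedModule)).
  intros z Hz. rewrite Rmin_left, Rmax_right in Hz by lra. apply Hu; lra.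
Qed.

Lemma trunc_ex (u : R -> R) n :
  (forall y, 0 < y < PI -> continuous u y) -> ex_RInt u (cut n) (PI - cut n).
Proof.
  intros Hu. pose proof (cut_bounds n); pose proof (cut_half n).
  apply ex_RInt_open; auto; lra.
Qed.

Section Functional.
Variable f : R -> R.
Hypothesis Hf : integrable_weight f.

Let fcont : forall y, 0 < y < PI -> continuous f y := proj1 Hf.
Let fpos : forall y, 0 < y < PI -> 0 < f y := proj1 (proj2 Hf).

(** The truncated integrals of a nonnegative function increase, and they stay below [C * (PI + B)]
    with [B] the bound for the integrals of [f]. *)
Lemma trunc_mono_lim (u : R -> R) C :
  (forall y, 0 < y < PI -> continuous u y) ->
  (forall y, 0 < y < PI -> 0 <= u y <= C * (1 + f y)) ->
  exists l : R, is_lim_seq (trunc_int u) l.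
Proof.
  intros Hu Hb. destruct (proj2 (proj2 Hf)) as [B HB].
  assert (HC : 0 <= C).
  { pose proof PI_RGT_0. destruct (Hb (PI / 2)) as [H0 H1]; [lra|].
    pose proof (fpos (PI / 2)). nra. }
  apply (ex_finite_lim_seq_incr _ (C * (PI + B))).
  - intros n. unfold trunc_int.
    pose proof (cut_bounds n); pose proof (cut_bounds (S n)); pose proof (cut_decr n).
    pose proof (cut_half n); pose proof (cut_half (S n)).
    assert (E1 : ex_RInt u (cut (S n)) (cut n)) by (apply ex_RInt_open; auto; lra).
    assert (E2 : ex_RInt u (cut n) (PI - cut n)) by (apply trunc_ex; auto).
    assert (E3 : ex_RInt u (PI - cut n) (PI - cut (S n))) by (apply ex_RInt_open; auto; lra).
    rewrite <- (RInt_Chasles u (cut (S n)) (cut n) (PI - cut (S n)) E1)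
      by (eapply ex_RInt_Chasles; eauto).
    rewrite <- (RInt_Chasles u (cut n) (PI - cut n) (PI - cut (S n)) E2 E3).
    change (RInt u (cut n) (PI - cut n) <=
      RInt u (cut (S n)) (cut n) + (RInt u (cut n) (PI - cut n) + RInt u (PI - cut n) (PI - cut (S n)))).
    assert (0 <= RInt u (cut (S n)) (cut n)) by (apply RInt_ge_0; auto; intros; apply Hb; lra).
    assert (0 <= RInt u (PI - cut n) (PI - cut (S n)))
      by (apply RInt_ge_0; auto; [lra|]; intros; apply Hb; lra).
    lra.
  - intros n. unfold trunc_int. pose proof (cut_bounds n); pose proof (cut_half n).
    assert (Ef : ex_RInt f (cut n) (PI - cut n)) by (apply trunc_ex; auto).
    apply Rle_trans with (RInt (fun y => C * (1 + f y)) (cut n) (PI - cut n)).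
    + apply RInt_le; [lra|apply trunc_ex; auto| |intros; apply Hb; lra].
      apply trunc_ex; intros; cont.
    + rewrite (RInt_scal (V := R_CompleteNormedModule) (fun y => 1 + f y))
        by (apply trunc_ex; intros; cont).
      rewrite (RInt_plus (V := R_CompleteNormedModule) (fun _ => 1) f)
        by (try apply ex_RInt_const; exact Ef).
      rewrite RInt_const. change (C * ((PI - cut n - cut n) * 1 + RInt f (cut n) (PI - cut n)) <= C * (PI + B)).
      apply Rmult_le_compat_l; [exact HC|].
      specialize (HB (cut n) (PI - cut n)). lra.
Qed.

Lemma dom_one_plus : dom f (fun y => 1 + f y).
Proof.
  split; [intros; cont|]. exists 1. intros y Hy. pose proof (fpos y Hy).
  rewrite Rabs_pos_eq; lra.
Qed.

(** Shifting [u] by [C * (1 + f)] makes it nonnegative; both the shifted function and the shift have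
    monotone convergent truncations, and [u] is their difference. *)
Lemma II_lim (u : R -> R) : dom f u -> is_lim_seq (trunc_int u) (II u).
Proof.
  intros [Hu [C HC]].
  destruct (trunc_mono_lim (fun y => u y + C * (1 + f y)) (2 * C)) as [l1 H1].
  { intros; cont. }
  { intros y Hy. specialize (HC y Hy). apply Rabs_le_between in HC. lra. }
  assert (HC0 : 0 <= C).
  { pose proof PI_RGT_0. specialize (HC (PI / 2) ltac:(lra)).
    pose proof (fpos (PI / 2)). pose proof (Rabs_pos (u (PI / 2))). nra. }
  destruct (trunc_mono_lim (fun y => C * (1 + f y)) C) as [l2 H2].
  { intros; cont. }
  { intros y Hy. pose proof (fpos y Hy). split; [|lra]. apply Rmult_le_pos; lra. }
  assert (H : is_lim_seq (trunc_int u) (l1 - l2)).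
  { apply is_lim_seq_ext with
      (fun n => trunc_int (fun y => u y + C * (1 + f y)) n - trunc_int (fun y => C * (1 + f y)) n).
    - intros n. unfold trunc_int.
      rewrite (RInt_plus (V := R_CompleteNormedModule) u (fun y => C * (1 + f y)))
        by (apply trunc_ex; intros; cont).
      unfold plus; simpl; ring.
    - now apply is_lim_seq_minus'. }
  unfold II. now rewrite (is_lim_seq_unique _ _ H).
Qed.

Lemma II_eq (u : R -> R) (l : R) : is_lim_seq (trunc_int u) l -> II u = l.
Proof. intros H; unfold II; now rewrite (is_lim_seq_unique _ _ H). Qed.

Lemma II_ext (u v : R -> R) : (forall y, 0 < y < PI -> u y = v y) -> II u = II v.
Proof.
  intros H. unfold II. f_equal. apply Lim_seq_ext. intros n. apply RInt_ext.
  intros y Hy. pose proof (cut_bounds n); pose proof (cut_half n).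
  rewrite Rmin_left, Rmax_right in Hy by lra. apply H; lra.
Qed.

Lemma dom_plus u v : dom f u -> dom f v -> dom f (fun y => u y + v y).
Proof.
  intros [Hu [A HA]] [Hv [B HB]]. split; [intros; cont|]. exists (A + B).
  intros y Hy. specialize (HA y Hy); specialize (HB y Hy).
  pose proof (Rabs_triang (u y) (v y)). lra.
Qed.

Lemma dom_scal c u : dom f u -> dom f (fun y => c * u y).
Proof.
  intros [Hu [A HA]]. split; [intros; cont|]. exists (Rabs c * A).
  intros y Hy. specialize (HA y Hy). rewrite Rabs_mult.
  pose proof (Rabs_pos c). nra.
Qed.

Lemma dom_abs u : dom f u -> dom f (fun y => Rabs (u y)).
Proof.
  intros [Hu [A HA]]. split; [intros; cont|]. exists A. intros y Hy. rewrite Rabs_Rabsolu; auto.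
Qed.

Lemma dom_dominated u v :
  (forall y, 0 < y < PI -> continuous u y) -> dom f v ->
  (exists C, forall y, 0 < y < PI -> Rabs (u y) <= C * Rabs (v y)) -> dom f u.
Proof.
  intros Hu [_ [A HA]] [C HC]. split; [exact Hu|]. exists (Rabs C * A). intros y Hy.
  specialize (HC y Hy); specialize (HA y Hy). pose proof (Rabs_pos (v y)).
  pose proof (Rle_abs C). pose proof (Rabs_pos C). nra.
Qed.

Lemma dom_bounded u C :
  (forall y, 0 < y < PI -> continuous u y) ->
  (forall y, 0 < y < PI -> Rabs (u y) <= C) -> dom f u.
Proof.
  intros Hu HC. split; [exact Hu|]. exists (Rabs C). intros y Hy.
  specialize (HC y Hy). pose proof (fpos y Hy). pose proof (Rle_abs C). pose proof (Rabs_pos C). nra.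
Qed.

Lemma dom_weight u C :
  (forall y, 0 < y < PI -> continuous u y) ->
  (forall y, 0 < y < PI -> Rabs (u y) <= C) -> dom f (fun y => u y * f y).
Proof.
  intros Hu HC. split; [intros; cont|]. exists (Rabs C). intros y Hy.
  specialize (HC y Hy). pose proof (fpos y Hy). rewrite Rabs_mult, (Rabs_pos_eq (f y)) by lra.
  pose proof (Rle_abs C). pose proof (Rabs_pos C). pose proof (Rabs_pos (u y)). nra.
Qed.

Lemma dom_ext u v : (forall y, u y = v y) -> dom f u -> dom f v.
Proof.
  intros H [Hu [C HC]]. split.
  - intros y Hy. apply continuous_ext with u; auto.
  - exists C. intros y Hy. rewrite <- H; auto.
Qed.

Lemma II_plus u v : dom f u -> dom f v -> II (fun y => u y + v y) = II u + II v.
Proof.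
  intros Hu Hv. apply II_eq.
  apply is_lim_seq_ext with (fun n => trunc_int u n + trunc_int v n).
  - intros n. unfold trunc_int.
    rewrite (RInt_plus (V := R_CompleteNormedModule) u v);
      [reflexivity|apply trunc_ex; apply Hu|apply trunc_ex; apply Hv].
  - apply is_lim_seq_plus'; now apply II_lim.
Qed.

Lemma II_scal c u : dom f u -> II (fun y => c * u y) = c * II u.
Proof.
  intros Hu. apply II_eq.
  apply is_lim_seq_ext with (fun n => c * trunc_int u n).
  - intros n. unfold trunc_int.
    now rewrite (RInt_scal (V := R_CompleteNormedModule) u) by (apply trunc_ex; apply Hu).
  - apply (is_lim_seq_scal_l _ c (II u)). now apply II_lim.
Qed.

Lemma II_minus u v : dom f u -> dom f v -> II (fun y => u y - v y) = II u - II v.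
Proof.
  intros Hu Hv. rewrite (II_ext _ (fun y => u y + (-1) * v y)) by (intros; ring).
  rewrite II_plus, II_scal; auto using dom_scal. ring.
Qed.

Lemma dom_minus u v : dom f u -> dom f v -> dom f (fun y => u y - v y).
Proof.
  intros Hu Hv. apply dom_ext with (fun y => u y + (-1) * v y); [intros; ring|].
  auto using dom_plus, dom_scal.
Qed.

Lemma II_le u v : dom f u -> dom f v -> (forall y, 0 < y < PI -> u y <= v y) -> II u <= II v.
Proof.
  intros Hu Hv H. apply (is_lim_seq_le (trunc_int u) (trunc_int v) (II u) (II v)); try now apply II_lim.
  intros n. pose proof (cut_bounds n); pose proof (cut_half n).
  apply RInt_le; [lra|apply trunc_ex, Hu|apply trunc_ex, Hv|intros; apply H; lra].
Qed.

Lemma II_zero : II (fun _ => 0) = 0.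
Proof.
  apply II_eq. apply is_lim_seq_ext with (fun _ => 0); [|apply is_lim_seq_const].
  intros n. unfold trunc_int. rewrite RInt_const. unfold scal; simpl; unfold mult; simpl; ring.
Qed.

Lemma dom_zero : dom f (fun _ => 0).
Proof. apply dom_bounded with 0; intros; [cont|rewrite Rabs_R0; lra]. Qed.

Lemma II_ge_0 u : dom f u -> (forall y, 0 < y < PI -> 0 <= u y) -> 0 <= II u.
Proof. intros Hu H. rewrite <- II_zero. apply II_le; auto using dom_zero. Qed.

Lemma II_abs u : dom f u -> Rabs (II u) <= II (fun y => Rabs (u y)).
Proof.
  intros Hu. apply Rabs_le_between. split.
  - replace (- II (fun y => Rabs (u y))) with ((-1) * II (fun y => Rabs (u y))) by ring.
    rewrite <- II_scal by now apply dom_abs.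
    apply II_le; auto using dom_scal, dom_abs. intros y _.
    pose proof (Rle_abs (- u y)). rewrite Rabs_Ropp in H. lra.
  - apply II_le; auto using dom_abs. intros; apply Rle_abs.
Qed.

Lemma II_abs_le u v :
  dom f u -> dom f v -> (forall y, 0 < y < PI -> Rabs (u y) <= v y) -> Rabs (II u) <= II v.
Proof.
  intros Hu Hv H. eapply Rle_trans; [now apply II_abs|]. apply II_le; auto using dom_abs.
Qed.

(* Nonnegativity of the quadratic form [t -> II ((u - t v)^2)]. *)
Lemma II_cauchy_schwarz u v :
  dom f (fun y => u y ^ 2) -> dom f (fun y => v y ^ 2) -> dom f (fun y => u y * v y) ->
  II (fun y => u y * v y) ^ 2 <= II (fun y => u y ^ 2) * II (fun y => v y ^ 2).
Proof.
  intros Hu Hv Huv. set (A := II (fun y => u y ^ 2)). set (B := II (fun y => v y ^ 2)).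
  set (D := II (fun y => u y * v y)).
  assert (HA : 0 <= A) by (apply II_ge_0; auto; intros; apply pow2_ge_0).
  assert (HB : 0 <= B) by (apply II_ge_0; auto; intros; apply pow2_ge_0).
  assert (Q : forall s t, 0 <= s ^ 2 * A - 2 * s * t * D + t ^ 2 * B).
  { intros s t. unfold A, B, D.
    assert (E : II (fun y => (s * u y - t * v y) ^ 2) =
            s ^ 2 * II (fun y => u y ^ 2) - 2 * s * t * II (fun y => u y * v y) + t ^ 2 * II (fun y => v y ^ 2)).
    { rewrite (II_ext _ (fun y => (s ^ 2 * (u y ^ 2) + (- (2 * s * t)) * (u y * v y)) + t ^ 2 * (v y ^ 2)))
        by (intros; ring).
      rewrite II_plus, II_plus, !II_scal; auto using dom_scal, dom_plus. ring. }
    rewrite <- E. apply II_ge_0; [|intros; apply pow2_ge_0].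
    apply dom_ext with (fun y => (s ^ 2 * (u y ^ 2) + (- (2 * s * t)) * (u y * v y)) + t ^ 2 * (v y ^ 2));
      [intros; ring|]. auto using dom_scal, dom_plus. }
  destruct (Req_dec B 0) as [E|E].
  - assert (E0 : D = 0).
    { destruct (Req_dec D 0) as [|ED]; [assumption|exfalso].
      (* For [B = 0] the form is affine in its second variable, and this value makes it [-1]. *)
      pose proof (Q 1 ((A + 1) / (2 * D))) as Q1. rewrite E in Q1.
      replace (1 ^ 2 * A - 2 * 1 * ((A + 1) / (2 * D)) * D + ((A + 1) / (2 * D)) ^ 2 * 0)
        with (-1) in Q1 by (field; exact ED). lra. }
    rewrite E, E0; lra.
  - pose proof (Q B D) as Q1. assert (0 < B) by lra.
    assert (0 <= B * (A * B - D ^ 2)) by nra. nra.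
Qed.

Lemma II_FTC (u U : R -> R) :
  dom f u ->
  (forall y, 0 < y < PI -> is_derive U y (u y)) ->
  continuous U 0 -> continuous U PI -> II u = U PI - U 0.
Proof.
  intros Hu HU H0 H1. apply II_eq.
  apply is_lim_seq_ext with (fun n => U (PI - cut n) - U (cut n)).
  - intros n. pose proof (cut_bounds n); pose proof (cut_half n). symmetry.
    unfold trunc_int. apply is_RInt_unique.
    apply (is_RInt_derive (V := R_CompleteNormedModule) U u).
    + intros y Hy. rewrite Rmin_left, Rmax_right in Hy by lra. apply HU; lra.
    + intros y Hy. rewrite Rmin_left, Rmax_right in Hy by lra. apply Hu; lra.
  - apply is_lim_seq_minus'.
    + apply (is_lim_seq_continuous U (fun n => PI - cut n) PI).
      * now apply continuity_pt_filterlim.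
      * replace (Finite PI) with (Finite (PI - 0)) by (f_equal; ring).
        apply is_lim_seq_minus'; [apply is_lim_seq_const|apply cut_lim].
    + apply (is_lim_seq_continuous U cut 0); [now apply continuity_pt_filterlim|apply cut_lim].
Qed.

Lemma II_one : II (fun _ => 1) = PI.
Proof.
  rewrite (II_FTC _ (fun y => y)); [ring| | |apply cont_id|apply cont_id].
  - apply dom_bounded with 1; intros; [cont|rewrite Rabs_R1; lra].
  - intros; apply (is_derive_id (K := R_AbsRing)).
Qed.

(** The two layers of width [d] at the endpoints, where only boundedness is known, contribute at
    most [2 * d * C]. The layers can therefore be chosen after the bound [C]. *)
Lemma II_small (u : R -> R) C e d :
  (forall y, 0 < y < PI -> continuous u y) ->
  (forall y, 0 < y < PI -> Rabs (u y) <= C) ->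
  0 < d -> 2 * d <= PI -> 0 <= e ->
  (forall y, d <= y <= PI - d -> Rabs (u y) <= e) ->
  Rabs (II u) <= PI * e + 2 * d * C.
Proof.
  intros Hu HC Hd Hd2 He Hs.
  assert (Hdom : dom f u) by (eapply dom_bounded; eauto).
  assert (HC0 : 0 <= C).
  { eapply Rle_trans; [apply Rabs_pos|apply (HC (PI / 2))]. pose proof PI_RGT_0; lra. }
  assert (L : is_lim_seq (fun n => Rabs (trunc_int u n)) (Rabs (II u))).
  { apply (is_lim_seq_abs _ (II u)). now apply II_lim. }
  destruct (cut_small d Hd) as [N HN].
  apply (is_lim_seq_le_loc (fun n => Rabs (trunc_int u n)) (fun _ => PI * e + 2 * d * C)
           (Rabs (II u)) (PI * e + 2 * d * C)); [|exact L|apply is_lim_seq_const].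
  exists N. intros n Hn. specialize (HN n Hn). pose proof (cut_bounds n); pose proof (cut_half n).
  unfold trunc_int.
  assert (E1 : ex_RInt u (cut n) d) by (apply ex_RInt_open; auto; lra).
  assert (E2 : ex_RInt u d (PI - d)) by (apply ex_RInt_open; auto; lra).
  assert (E3 : ex_RInt u (PI - d) (PI - cut n)) by (apply ex_RInt_open; auto; lra).
  rewrite <- (RInt_Chasles u (cut n) d (PI - cut n) E1) by (eapply ex_RInt_Chasles; eauto).
  rewrite <- (RInt_Chasles u d (PI - d) (PI - cut n) E2 E3).
  pose proof (abs_RInt_le_const u (cut n) d C ltac:(lra) E1 ltac:(intros; apply HC; lra)) as B1.
  pose proof (abs_RInt_le_const u d (PI - d) e ltac:(lra) E2 Hs) as B2.
  pose proof (abs_RInt_le_const u (PI - d) (PI - cut n) C ltac:(lra) E3 ltac:(intros; apply HC; lra)) as B3.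
  unfold plus; simpl.
  eapply Rle_trans; [apply Rabs_triang|].
  pose proof (Rabs_triang (RInt u d (PI - d)) (RInt u (PI - d) (PI - cut n))).
  assert ((d - cut n) * C <= d * C) by nra.
  assert ((PI - d - d) * e <= PI * e) by nra.
  assert ((PI - cut n - (PI - d)) * C <= d * C) by nra. lra.
Qed.

End Functional.

Lemma weight_one : integrable_weight (fun _ => 1).
Proof.
  split; [intros; cont|]. split; [intros; lra|]. exists PI. intros a b Ha Hab Hb.
  rewrite RInt_const. unfold scal; simpl; unfold mult; simpl. lra.
Qed.

(** * Cosine polynomials *)

Definition cosn (n : nat) (y : R) : R := cos (INR n * y).
Definition sinn (n : nat) (y : R) : R := sin (INR n * y).

Lemma cosn_bound n y : Rabs (cosn n y) <= 1.
Proof. unfold cosn. apply Rabs_le. pose proof (COS_bound (INR n * y)). lra. Qed.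
Lemma sinn_bound n y : Rabs (sinn n y) <= 1.
Proof. unfold sinn. apply Rabs_le. pose proof (SIN_bound (INR n * y)). lra. Qed.
Lemma cosn_cont n y : continuous (cosn n) y.
Proof. unfold cosn. cont. Qed.
Lemma sinn_cont n y : continuous (sinn n) y.
Proof. unfold sinn. cont. Qed.
#[local] Opaque cos sin.
Lemma cosn_0 y : cosn 0 y = 1.
Proof. unfold cosn. simpl. rewrite Rmult_0_l. apply cos_0. Qed.
Lemma sinn_0 y : sinn 0 y = 0.
Proof. unfold sinn. simpl. rewrite Rmult_0_l. apply sin_0. Qed.
Lemma cosn_1 y : cosn 1 y = cos y.
Proof. unfold cosn. simpl. now rewrite Rmult_1_l. Qed.
Lemma sinn_1 y : sinn 1 y = sin y.
Proof. unfold sinn. simpl. now rewrite Rmult_1_l. Qed.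
Lemma cosn_S n y : cosn (S n) y = cosn n y * cos y - sinn n y * sin y.
Proof.
  unfold cosn, sinn. rewrite S_INR. replace ((INR n + 1) * y) with (INR n * y + y) by ring.
  apply cos_plus.
Qed.
Lemma sinn_S n y : sinn (S n) y = sinn n y * cos y + cosn n y * sin y.
Proof.
  unfold cosn, sinn. rewrite S_INR. replace ((INR n + 1) * y) with (INR n * y + y) by ring.
  apply sin_plus.
Qed.
Lemma cosn_add m n y : cosn (m + n) y = cosn m y * cosn n y - sinn m y * sinn n y.
Proof.
  unfold cosn, sinn. rewrite plus_INR, Rmult_plus_distr_r. apply cos_plus.
Qed.
Lemma cosn_sub m n y : (n <= m)%nat -> cosn (m - n) y = cosn m y * cosn n y + sinn m y * sinn n y.
Proof.
  intros H. unfold cosn, sinn. rewrite minus_INR by exact H. rewrite Rmult_minus_distr_r. apply cos_minus.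
Qed.
Lemma cosn_rec n y : cosn (S (S n)) y = 2 * cos y * cosn (S n) y - cosn n y.
Proof.
  replace (cosn n y) with (cosn (S n - 1) y) by (f_equal; lia).
  replace (S (S n)) with (S n + 1)%nat by lia.
  rewrite cosn_add, cosn_sub by lia. rewrite cosn_1, sinn_1. ring.
Qed.
Lemma cos_cosn n y : cos y * cosn (S n) y = / 2 * cosn (S (S n)) y + / 2 * cosn n y.
Proof. rewrite cosn_rec. field. Qed.

Lemma bounded_dom (u : R -> R) C :
  (forall y, continuous u y) -> (forall y, Rabs (u y) <= C) -> dom (fun _ => 1) u.
Proof. intros Hu HC. apply (dom_bounded _ weight_one u C); intros; auto. Qed.

Lemma II_cosn n : II (cosn n) = if Nat.eqb n 0 then PI else 0.
Proof.
  destruct n as [|n]; simpl Nat.eqb; cbv iota.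
  - rewrite (II_ext _ (fun _ => 1)) by (intros; apply cosn_0). exact (II_one _ weight_one).
  - pose proof (pos_INR n).
    rewrite (II_FTC (fun _ => 1) _ (fun y => / INR (S n) * sinn (S n) y)).
    + unfold sinn. rewrite Rmult_0_r, sin_0.
      replace (sin (INR (S n) * PI)) with 0; [ring|].
      clear H. induction n as [|n IH]; [simpl; rewrite Rmult_1_l, sin_PI; reflexivity|].
      rewrite S_INR. replace ((INR (S n) + 1) * PI) with (INR (S n) * PI + PI) by ring.
      rewrite neg_sin, <- IH. ring.
    + apply bounded_dom with 1; [apply cosn_cont|apply cosn_bound].
    + intros y _. unfold sinn, cosn. rewrite S_INR. auto_derive; [auto|]. field. lra.
    + apply cont_mult; [cont|apply sinn_cont].
    + apply cont_mult; [cont|apply sinn_cont].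
Qed.

Lemma cosn_cosn_dom m n : dom (fun _ => 1) (fun y => cosn m y * cosn n y).
Proof.
  apply bounded_dom with 1.
  - intros; apply cont_mult; apply cosn_cont.
  - intros y. rewrite Rabs_mult. pose proof (cosn_bound m y); pose proof (cosn_bound n y).
    pose proof (Rabs_pos (cosn m y)); pose proof (Rabs_pos (cosn n y)). nra.
Qed.
Lemma sinn_sinn_dom m n : dom (fun _ => 1) (fun y => sinn m y * sinn n y).
Proof.
  apply bounded_dom with 1.
  - intros; apply cont_mult; apply sinn_cont.
  - intros y. rewrite Rabs_mult. pose proof (sinn_bound m y); pose proof (sinn_bound n y).
    pose proof (Rabs_pos (sinn m y)); pose proof (Rabs_pos (sinn n y)). nra.
Qed.

(** The sum and the difference of the two integrals are those of [cosn (m - n)] and [cosn (m + n)];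
    the latter vanishes because [m + n] is positive. *)
Lemma II_product_cases m n : (n <= m)%nat -> (0 < m)%nat ->
  II (fun y => cosn m y * cosn n y) =
    (if Nat.eqb m n then PI / 2 else 0) /\
  II (fun y => sinn m y * sinn n y) =
    (if Nat.eqb m n then PI / 2 else 0).
Proof.
  intros H H0.
  assert (E1 : II (fun y => cosn m y * cosn n y) + II (fun y => sinn m y * sinn n y) = II (cosn (m - n))).
  { rewrite <- (II_plus _ weight_one _ _ (cosn_cosn_dom m n) (sinn_sinn_dom m n)).
    apply II_ext. intros y _. now rewrite cosn_sub. }
  assert (E2 : II (fun y => cosn m y * cosn n y) - II (fun y => sinn m y * sinn n y) = II (cosn (m + n))).
  { rewrite <- (II_minus _ weight_one _ _ (cosn_cosn_dom m n) (sinn_sinn_dom m n)).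
    apply II_ext. intros y _. now rewrite cosn_add. }
  rewrite II_cosn in E1, E2.
  replace (Nat.eqb (m + n) 0) with false in E2 by (symmetry; apply Nat.eqb_neq; lia).
  destruct (Nat.eqb_spec m n) as [E|E]; destruct (Nat.eqb_spec (m - n) 0); try lia; lra.
Qed.

Lemma II_cosn_cosn m n : (0 < m)%nat -> II (fun y => cosn m y * cosn n y) = if Nat.eqb m n then PI / 2 else 0.
Proof.
  intros H0. destruct (le_lt_dec n m) as [H|H].
  - exact (proj1 (II_product_cases m n H H0)).
  - rewrite (II_ext _ (fun y => cosn n y * cosn m y)) by (intros; ring).
    rewrite (proj1 (II_product_cases n m ltac:(lia) ltac:(lia))).
    destruct (Nat.eqb_spec m n); destruct (Nat.eqb_spec n m); try lia; reflexivity.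
Qed.

Lemma II_sinn_sinn m n : (0 < m)%nat -> II (fun y => sinn m y * sinn n y) = if Nat.eqb m n then PI / 2 else 0.
Proof.
  intros H0. destruct (le_lt_dec n m) as [H|H].
  - exact (proj2 (II_product_cases m n H H0)).
  - rewrite (II_ext _ (fun y => sinn n y * sinn m y)) by (intros; ring).
    rewrite (proj2 (II_product_cases n m ltac:(lia) ltac:(lia))).
    destruct (Nat.eqb_spec m n); destruct (Nat.eqb_spec n m); try lia; reflexivity.
Qed.

(* [low n] is the set of [y -> q (cos y)] with [q] a polynomial of degree less than [n]. *)
Definition low (n : nat) (u : R -> R) : Prop :=
  exists c : nat -> R, forall y, u y = sum_lt (fun j => c j * cosn j y) n.

(** The leading coefficient is taken in the basis [cosn]: for [n >= 1] it is [2^(1-n)] times the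
    coefficient of [cos y ^ n]. *)
Definition deg (n : nat) (b : R) (u : R -> R) : Prop :=
  exists v, low n v /\ forall y, u y = b * cosn n y + v y.

Lemma low_ext n u v : (forall y, u y = v y) -> low n u -> low n v.
Proof. intros H [c Hc]. exists c. intros y. now rewrite <- H. Qed.

Lemma low_S n u : low (S n) u <-> exists b, deg n b u.
Proof.
  split.
  - intros [c Hc]. exists (c n), (fun y => sum_lt (fun j => c j * cosn j y) n).
    split; [now exists c|]. intros y. rewrite Hc. simpl. ring.
  - intros [b [v [[c Hc] Hu]]]. exists (fun j => if Nat.eqb j n then b else c j).
    intros y. simpl. rewrite Nat.eqb_refl, Hu, Hc, Rplus_comm. f_equal.
    apply sum_lt_ext. intros k Hk. destruct (Nat.eqb_spec k n); [lia|reflexivity].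
Qed.

Lemma low_zero n : low n (fun _ => 0).
Proof. exists (fun _ => 0). intros y. rewrite sum_lt_zero; [reflexivity|intros; ring]. Qed.

Lemma low_plus n u v : low n u -> low n v -> low n (fun y => u y + v y).
Proof.
  intros [c Hc] [d Hd]. exists (fun j => c j + d j). intros y. rewrite Hc, Hd, <- sum_lt_plus.
  apply sum_lt_ext. intros; ring.
Qed.
Lemma low_scal n a u : low n u -> low n (fun y => a * u y).
Proof.
  intros [c Hc]. exists (fun j => a * c j). intros y. rewrite Hc, <- sum_lt_scal.
  apply sum_lt_ext. intros; ring.
Qed.
Lemma low_minus n u v : low n u -> low n v -> low n (fun y => u y - v y).
Proof.
  intros Hu Hv. apply low_ext with (fun y => u y + (-1) * v y); [intros; ring|].
  now apply low_plus, low_scal.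
Qed.
Lemma low_weaken1 n u : low n u -> low (S n) u.
Proof.
  intros H. apply low_S. exists 0, u. split; [exact H|intros; ring].
Qed.
Lemma low_weaken n m u : (n <= m)%nat -> low n u -> low m u.
Proof. induction 1; auto using low_weaken1. Qed.
Lemma low_cosn j n : (j < n)%nat -> low n (cosn j).
Proof.
  intros H. apply low_weaken with (S j); [lia|]. apply low_S. exists 1, (fun _ => 0).
  split; [apply low_zero|intros; ring].
Qed.
Lemma deg_low n b u : deg n b u -> low (S n) u.
Proof. intros H; apply low_S; now exists b. Qed.

(** Induction over the span of the [cosn j]. Closure under pointwise equality is a separate premise,
    in place of functional extensionality. *)
Lemma low_ind (P : (R -> R) -> Prop) n :
  P (fun _ => 0) ->
  (forall u v, P u -> P v -> P (fun y => u y + v y)) ->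
  (forall a j, (j < n)%nat -> P (fun y => a * cosn j y)) ->
  (forall u v, (forall y, u y = v y) -> P u -> P v) ->
  forall u, low n u -> P u.
Proof.
  intros P0 Pp Pc Pe u [c Hc]. apply Pe with (fun y => sum_lt (fun j => c j * cosn j y) n).
  { intros y; now rewrite Hc. }
  assert (forall m, (m <= n)%nat -> P (fun y => sum_lt (fun j => c j * cosn j y) m)); [|now apply H].
  induction m as [|m IH]; intros Hm; simpl; [exact P0|].
  apply (Pp (fun y => sum_lt (fun j => c j * cosn j y) m)); [apply IH; lia|apply Pc; lia].
Qed.

Lemma low_cont n u : low n u -> forall y, continuous u y.
Proof.
  intros [c Hc] y. apply continuous_ext with (fun y => sum_lt (fun j => c j * cosn j y) n); [intros; now rewrite Hc|].
  apply (cont_sum (fun j y => c j * cosn j y)). intros. apply cont_mult; [cont|apply cosn_cont].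
Qed.
Lemma low_bounded n u : low n u -> exists C, forall y, Rabs (u y) <= C.
Proof.
  intros [c Hc]. exists (sum_lt (fun j => Rabs (c j)) n). intros y. rewrite Hc.
  eapply Rle_trans; [apply sum_lt_abs|]. apply sum_lt_le. intros k _. rewrite Rabs_mult.
  pose proof (cosn_bound k y). pose proof (Rabs_pos (c k)). nra.
Qed.
Lemma low_dom n u : low n u -> dom (fun _ => 1) u.
Proof.
  intros H. destruct (low_bounded n u H) as [C HC]. apply bounded_dom with C; [now apply low_cont with n|exact HC].
Qed.

Lemma low_mult_cos n u : low n u -> low (S n) (fun y => cos y * u y).
Proof.
  apply (low_ind (fun u => low (S n) (fun y => cos y * u y))).
  - apply low_ext with (fun _ => 0); [intros; ring|apply low_zero].
  - intros u0 v Hu Hv. apply low_ext with (fun y => cos y * u0 y + cos y * v y); [intros; ring|].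
    now apply low_plus.
  - intros a [|j] Hj.
    + apply low_ext with (fun y => a * cosn 1 y).
      * intros y. rewrite cosn_0, cosn_1. ring.
      * apply low_scal, low_cosn. lia.
    + apply low_ext with (fun y => a * (/ 2 * cosn (S (S j)) y + / 2 * cosn j y)).
      * intros y. rewrite <- cos_cosn. ring.
      * apply low_scal, low_plus; apply low_scal, low_cosn; lia.
  - intros u0 v H. apply low_ext. intros; now rewrite H.
Qed.

(** Each factor [sin^2 = 1 - cos^2] raises the degree by 2. Even powers of the sine thus serve as a
    polynomial substitute for the weight. *)
Lemma low_mult_sin2 n M u : low n u -> low (n + 2 * M) (fun y => sin y ^ (2 * M) * u y).
Proof.
  intros H. induction M as [|M IH].
  - apply low_ext with u; [intros; simpl; ring|]. now rewrite Nat.mul_0_r, Nat.add_0_r.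
  - apply low_ext with (fun y => sin y ^ (2 * M) * u y - cos y * (cos y * (sin y ^ (2 * M) * u y))).
    + intros y. replace (2 * S M)%nat with (2 + 2 * M)%nat by lia. rewrite pow_add.
      replace (sin y ^ 2) with (1 - cos y * cos y); [ring|].
      pose proof (sin2_cos2 y). unfold Rsqr in H0. simpl. lra.
    + replace (n + 2 * S M)%nat with (S (S (n + 2 * M))) by lia.
      apply low_minus; [now do 2 apply low_weaken1|now do 2 apply low_mult_cos].
Qed.

Lemma deg_cos_pow k : exists b, 0 < b /\ deg k b (fun y => cos y ^ k).
Proof.
  induction k as [|k [b [Hb [v [Hv He]]]]].
  - exists 1. split; [lra|]. exists (fun _ => 0). split; [apply low_zero|].
    intros y. rewrite cosn_0. simpl. ring.
  (* The product [cos y * cosn 0 y] is [cosn 1 y] itself; all later products with [cos y] halve the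
     leading coefficient. *)
  - destruct k as [|k].
    + exists b. split; [exact Hb|]. exists (fun y => cos y * v y). split; [now apply low_mult_cos|].
      intros y. specialize (He y). simpl in He |- *. rewrite cosn_0 in He. rewrite cosn_1.
      replace (cos y * 1) with (cos y * (b * 1 + v y)) by (rewrite <- He; ring). ring.
    + exists (b / 2). split; [lra|]. exists (fun y => b / 2 * cosn k y + cos y * v y). split.
      * apply low_plus; [|now apply low_mult_cos]. apply low_scal, low_cosn. lia.
      * intros y. change (cos y ^ S (S k)) with (cos y * cos y ^ S k). rewrite He.
        rewrite Rmult_plus_distr_l.
        replace (cos y * (b * cosn (S k) y)) with (b * (cos y * cosn (S k) y)) by ring.
        rewrite cos_cosn. field.
Qed.

Lemma deg_polynomial (p : R -> R) n :
  poly_deg_pos_lead p n -> exists b, 0 < b /\ deg n b (fun y => p (cos y)).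
Proof.
  intros [c [Hc Hp]].
  assert (L : forall m, low (S m) (fun y => sum_f_R0 (fun k => c k * cos y ^ k) m)).
  { induction m as [|m IH]; simpl.
    - apply low_ext with (fun y => c 0%nat * cosn 0 y); [intros; rewrite cosn_0; ring|].
      apply low_scal, low_cosn; lia.
    - apply low_plus; [now apply low_weaken1|]. apply low_scal.
      destruct (deg_cos_pow (S m)) as [b [_ H]]. now apply deg_low in H. }
  destruct (deg_cos_pow n) as [b [Hb [v [Hv He]]]].
  exists (c n * b). split; [nra|].
  destruct n as [|n].
  - exists (fun y => c 0%nat * v y). split; [now apply low_scal|].
    intros y. rewrite Hp. specialize (He y). simpl in He |- *.
      replace (c 0%nat * 1) with (c 0%nat * (b * cosn 0 y + v y)) by (rewrite <- He; ring). ring.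
  - exists (fun y => sum_f_R0 (fun k => c k * cos y ^ k) n + c (S n) * v y). split.
    + apply low_plus; [apply L|now apply low_scal].
    + intros y. rewrite Hp. simpl sum_f_R0. specialize (He y). simpl in He. rewrite He. ring.
Qed.

Lemma low_cosn_dom n u m : low n u -> dom (fun _ => 1) (fun y => u y * cosn m y).
Proof.
  intros H. destruct (low_bounded n u H) as [C HC]. apply bounded_dom with C.
  - intros. apply cont_mult; [now apply low_cont with n|apply cosn_cont].
  - intros y. rewrite Rabs_mult. specialize (HC y). pose proof (cosn_bound m y).
    pose proof (Rabs_pos (u y)). pose proof (Rabs_pos (cosn m y)). nra.
Qed.

Lemma II_low_cosn n u m : low n u -> (n <= m)%nat -> II (fun y => u y * cosn m y) = 0.
Proof.
  intros Hl Hm. destruct n as [|n].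
  { destruct Hl as [c Hc]. rewrite (II_ext _ (fun _ => 0)); [exact (II_zero)|].
    intros y _. rewrite Hc. simpl. ring. }
  (* Membership in [low] is carried along because linearity of [II] requires integrability of each
     summand. *)
  assert (H : low (S n) u /\ II (fun y => u y * cosn m y) = 0); [|apply H].
  revert u Hl. apply (low_ind (fun u => low (S n) u /\ II (fun y => u y * cosn m y) = 0)).
  - split; [apply low_zero|]. rewrite (II_ext _ (fun _ => 0)); [exact II_zero|intros; ring].
  - intros u v [Lu Hu] [Lv Hv]. split; [now apply low_plus|].
    rewrite (II_ext _ (fun y => u y * cosn m y + v y * cosn m y)) by (intros; ring).
    rewrite (II_plus _ weight_one) by now apply low_cosn_dom with (S n). lra.
  - intros a j Hj. split; [now apply low_scal, low_cosn|].
    rewrite (II_ext _ (fun y => a * (cosn m y * cosn j y))) by (intros; ring).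
    rewrite (II_scal _ weight_one) by apply cosn_cosn_dom. rewrite II_cosn_cosn by lia.
    destruct (Nat.eqb_spec m j); [lia|ring].
  - intros u v E [L H]. split; [now apply low_ext with u|].
    rewrite <- H. apply II_ext. intros; now rewrite E.
Qed.

Lemma II_deg_cosn n b u : (0 < n)%nat -> deg n b u -> II (fun y => u y * cosn n y) = PI / 2 * b.
Proof.
  intros Hn [v [Hv He]].
  rewrite (II_ext _ (fun y => b * (cosn n y * cosn n y) + v y * cosn n y)) by (intros; rewrite He; ring).
  rewrite (II_plus _ weight_one); [|apply (dom_scal _ ), cosn_cosn_dom|now apply low_cosn_dom with n].
  rewrite (II_scal _ weight_one) by apply cosn_cosn_dom.
  rewrite II_cosn_cosn, Nat.eqb_refl, (II_low_cosn n v n) by auto. ring.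
Qed.

(** * Bessel's inequality and the Riemann-Lebesgue lemma *)

Lemma bounded_mult_dom (u v : R -> R) A B :
  (forall y, 0 < y < PI -> continuous u y) -> (forall y, 0 < y < PI -> continuous v y) ->
  (forall y, 0 < y < PI -> Rabs (u y) <= A) -> (forall y, 0 < y < PI -> Rabs (v y) <= B) ->
  dom (fun _ => 1) (fun y => u y * v y).
Proof.
  intros Hu Hv HA HB. apply (dom_bounded _ weight_one _ (A * B)).
  - intros; cont.
  - intros y Hy. rewrite Rabs_mult. specialize (HA y Hy); specialize (HB y Hy).
    apply Rmult_le_compat; auto using Rabs_pos.
Qed.

Lemma sum_bounded_terms_lim (a : nat -> R) B :
  (forall n, 0 <= a n) -> (forall n, sum_lt a n <= B) -> is_lim_seq a 0.
Proof.
  intros Ha HB.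
  destruct (ex_finite_lim_seq_incr (sum_lt a) B) as [l Hl].
  - intros n. simpl. specialize (Ha n). lra.
  - exact HB.
  - apply is_lim_seq_ext with (fun n => sum_lt a (S n) - sum_lt a n); [intros; simpl; ring|].
    replace (Finite 0) with (Finite (l - l)) by (f_equal; ring).
    apply is_lim_seq_minus'; [|exact Hl]. now apply (is_lim_seq_incr_1 (sum_lt a)).
Qed.

(* The squared norm of the remainder of the Fourier expansion stays nonnegative (Bessel). *)
Lemma bessel_lim (e : nat -> R -> R) (u : R -> R) C :
  (forall j y, continuous (e j) y) -> (forall j y, Rabs (e j y) <= 1) ->
  (forall j k, II (fun y => e j y * e k y) = if Nat.eqb j k then PI / 2 else 0) ->
  (forall y, 0 < y < PI -> continuous u y) -> (forall y, 0 < y < PI -> Rabs (u y) <= C) ->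
  is_lim_seq (fun j => II (fun y => u y * e j y)) 0.
Proof.
  intros He Hb Ho Hu HC. pose proof PI_RGT_0 as Hpi.
  set (c := fun j => II (fun y => u y * e j y)).
  set (r := fun N y => u y - sum_lt (fun j => 2 / PI * c j * e j y) N).
  assert (rc : forall N y, 0 < y < PI -> continuous (r N) y).
  { intros N y Hy. unfold r. apply cont_minus; [auto|].
    apply (cont_sum (fun j y => 2 / PI * c j * e j y)). intros. apply cont_mult; [cont|apply He]. }
  assert (rb : forall N, exists B, forall y, 0 < y < PI -> Rabs (r N y) <= B).
  { intros N. exists (C + sum_lt (fun j => Rabs (2 / PI * c j)) N). intros y Hy. unfold r.
    eapply Rle_trans; [apply Rabs_triang|]. rewrite Rabs_Ropp. apply Rplus_le_compat; [auto|].
    eapply Rle_trans; [apply sum_lt_abs|]. apply sum_lt_le. intros k _. rewrite Rabs_mult.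
    pose proof (Hb k y). pose proof (Rabs_pos (2 / PI * c k)). nra. }
  assert (Der : forall N j, dom (fun _ => 1) (fun y => r N y * e j y)).
  { intros N j. destruct (rb N) as [B HB]. apply (bounded_mult_dom (r N) (e j) B 1); auto. }
  assert (Dee : forall k j, dom (fun _ => 1) (fun y => e k y * e j y)).
  { intros k j. apply (bounded_mult_dom (e k) (e j) 1 1); auto. }
  assert (Drr : forall N, dom (fun _ => 1) (fun y => r N y * r N y)).
  { intros N. destruct (rb N) as [B HB]. apply (bounded_mult_dom (r N) (r N) B B); auto. }
  (* The remainder [r N] keeps all coefficients [c k] with [N <= k], so each further subtraction
     lowers its squared norm by exactly [2 / PI * c N ^ 2]. *)
  assert (K : forall N, (forall k, (N <= k)%nat -> II (fun y => r N y * e k y) = c k) /\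
              II (fun y => r N y * r N y) = II (fun y => r 0%nat y * r 0%nat y) - 2 / PI * sum_lt (fun j => c j ^ 2) N).
  { induction N as [|N [IH1 IH2]].
    - split; [|simpl; ring]. intros k _. unfold c. apply II_ext. intros; unfold r; simpl; ring.
    - assert (rS : forall y, r (S N) y = r N y - 2 / PI * c N * e N y) by (intros; unfold r; simpl; ring).
      split.
      + intros k Hk.
        rewrite (II_ext _ (fun y => r N y * e k y - (2 / PI * c N) * (e N y * e k y)))
          by (intros; rewrite rS; ring).
        rewrite (II_minus _ weight_one), (II_scal _ weight_one), Ho, IH1; auto; [|lia|now apply dom_scal].
        destruct (Nat.eqb_spec N k); [lia|ring].
      + rewrite (II_ext _ (fun y => (r N y * r N y - (2 * (2 / PI * c N)) * (r N y * e N y))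
                                   + (2 / PI * c N) ^ 2 * (e N y * e N y)))
          by (intros; rewrite rS; ring).
        rewrite (II_plus _ weight_one), (II_minus _ weight_one), !(II_scal _ weight_one), Ho, IH1, IH2;
          auto using dom_scal, dom_minus.
        rewrite Nat.eqb_refl. simpl sum_lt. field. lra. }
  apply is_lim_seq_abs_0.
  apply is_lim_seq_ext with (fun j => sqrt (c j ^ 2)).
  { intros j. rewrite <- (sqrt_Rsqr_abs (c j)). unfold Rsqr. f_equal. ring. }
  rewrite <- sqrt_0. apply (is_lim_seq_continuous sqrt (fun j => c j ^ 2) 0).
  { apply continuity_pt_filterlim, continuous_sqrt. }
  apply sum_bounded_terms_lim with (PI / 2 * II (fun y => r 0%nat y * r 0%nat y)).
  { intros; apply pow2_ge_0. }
  intros N. destruct (K N) as [_ E].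
  assert (0 <= II (fun y => r N y * r N y)).
  { apply (II_ge_0 _ weight_one); auto. intros; nra. }
  rewrite E in H.
  apply Rmult_le_reg_l with (2 / PI); [apply Rdiv_lt_0_compat; lra|].
  replace (2 / PI * (PI / 2 * II (fun y => r 0%nat y * r 0%nat y))) with (II (fun y => r 0%nat y * r 0%nat y)) by (field; lra).
  lra.
Qed.

Lemma riemann_lebesgue_cos (u : R -> R) C :
  (forall y, 0 < y < PI -> continuous u y) -> (forall y, 0 < y < PI -> Rabs (u y) <= C) ->
  is_lim_seq (fun n => II (fun y => u y * cosn n y)) 0.
Proof.
  (* Index 0 is dropped because [cosn 0] has squared norm [PI] instead of [PI / 2]. *)
  intros Hu HC. apply (is_lim_seq_incr_1 (fun n => II (fun y => u y * cosn n y))).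
  apply (bessel_lim (fun n => cosn (S n)) u C); auto.
  - intros; apply cosn_cont.
  - intros; apply cosn_bound.
  - intros j k. now rewrite II_cosn_cosn by lia.
Qed.

Lemma riemann_lebesgue_sin (u : R -> R) C :
  (forall y, 0 < y < PI -> continuous u y) -> (forall y, 0 < y < PI -> Rabs (u y) <= C) ->
  is_lim_seq (fun n => II (fun y => u y * sinn n y)) 0.
Proof.
  intros Hu HC. apply (is_lim_seq_incr_1 (fun n => II (fun y => u y * sinn n y))).
  apply (bessel_lim (fun n => sinn (S n)) u C); auto.
  - intros; apply sinn_cont.
  - intros; apply sinn_bound.
  - intros j k. now rewrite II_sinn_sinn by lia.
Qed.

(** * The Dirichlet kernel for cosine polynomials *)

Definition kappa (j : nat) : R := if Nat.eqb j 0 then / PI else 2 / PI.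

(** The reproducing kernel of [low N] for the measure [dy]; [kappa j] is the inverse squared norm of
    [cosn j]. *)
Definition dirichlet (N : nat) (t y : R) : R :=
  sum_lt (fun j => kappa j * cosn j t * cosn j y) N.

Lemma dirichlet_low N t : low N (dirichlet N t).
Proof. exists (fun j => kappa j * cosn j t). reflexivity. Qed.

Lemma low_low_dom m n u v : low m u -> low n v -> dom (fun _ => 1) (fun y => u y * v y).
Proof.
  intros Hu Hv. destruct (low_bounded m u Hu) as [A HA]. destruct (low_bounded n v Hv) as [B HB].
  apply (bounded_mult_dom u v A B); auto; intros; eapply low_cont; eauto.
Qed.

Lemma dirichlet_reproducing N t u : low N u -> II (fun y => u y * dirichlet N t y) = u t.
Proof.
  pose proof PI_RGT_0 as Hpi. revert u. induction N as [|N IH]; intros u Hu.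
  - destruct Hu as [c Hc]. rewrite Hc. simpl. rewrite (II_ext _ (fun _ => 0)); [exact II_zero|].
    intros; unfold dirichlet; simpl; ring.
  - apply low_S in Hu. destruct Hu as [b [v [Hv He]]].
    pose proof (dirichlet_low N t) as Hd.
    rewrite (II_ext _ (fun y => (b * (dirichlet N t y * cosn N y) + (b * kappa N * cosn N t) * (cosn N y * cosn N y))
        + (v y * dirichlet N t y + (kappa N * cosn N t) * (v y * cosn N y)))).
    2:{ intros y _. rewrite He. unfold dirichlet. simpl. ring. }
    assert (D1 : dom (fun _ => 1) (fun y => dirichlet N t y * cosn N y)) by now apply low_cosn_dom with N.
    assert (D2 : dom (fun _ => 1) (fun y => v y * dirichlet N t y)) by now apply low_low_dom with N N.
    assert (D3 : dom (fun _ => 1) (fun y => v y * cosn N y)) by now apply low_cosn_dom with N.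
    pose proof (cosn_cosn_dom N N) as D4.
    rewrite (II_plus _ weight_one); auto using dom_plus, dom_scal.
    rewrite (II_plus _ weight_one); auto using dom_plus, dom_scal.
    rewrite (II_plus _ weight_one _ _ D2 (dom_scal _ _ _ D3)).
    rewrite !(II_scal _ weight_one) by assumption.
    rewrite (II_low_cosn N v N), (II_low_cosn N _ N), IH, He by auto.
    unfold kappa. destruct N as [|N]; simpl Nat.eqb; cbv iota.
    + rewrite (II_ext _ (fun _ => 1)) by (intros; rewrite cosn_0; ring).
      rewrite (II_one _ weight_one). field. lra.
    + rewrite II_cosn_cosn, Nat.eqb_refl by lia. field. lra.
Qed.

(** The Christoffel-Darboux formula, by telescoping the three-term recurrence [cosn_rec]. *)
Lemma dirichlet_CD N t y :
  (cos t - cos y) * dirichlet (S N) t y = / PI * (cosn (S N) t * cosn N y - cosn N t * cosn (S N) y).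
Proof.
  pose proof PI_RGT_0 as Hpi. induction N as [|N IH].
  - unfold dirichlet, kappa. simpl. rewrite !cosn_0, !cosn_1. ring.
  - unfold dirichlet in *. change (sum_lt ?a (S (S N))) with (sum_lt a (S N) + a (S N)).
    rewrite Rmult_plus_distr_l, IH. unfold kappa. simpl Nat.eqb. cbv iota.
    rewrite !(cosn_rec N). field. lra.
Qed.

(** A bound uniform in [N]: together with [cos_diff_lower] it says that the kernel is at most a
    multiple of [1 / |y - t|]. *)
Lemma dirichlet_CD_bound N t y :
  Rabs (cos t - cos y) * Rabs (dirichlet N t y) <= 2 / PI.
Proof.
  pose proof PI_RGT_0 as Hpi. assert (H0 : 0 < / PI) by now apply Rinv_0_lt_compat.
  rewrite <- Rabs_mult. destruct N as [|N].
  - unfold dirichlet. simpl. rewrite Rmult_0_r, Rabs_R0. unfold Rdiv. nra.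
  - rewrite dirichlet_CD, Rabs_mult, (Rabs_pos_eq (/ PI)) by lra.
    replace (2 / PI) with (/ PI * 2) by (unfold Rdiv; ring). apply Rmult_le_compat_l; [lra|].
    eapply Rle_trans; [apply Rabs_triang|]. rewrite Rabs_Ropp, !Rabs_mult.
    pose proof (cosn_bound (S N) t); pose proof (cosn_bound N y); pose proof (cosn_bound N t); pose proof (cosn_bound (S N) y).
    pose proof (Rabs_pos (cosn (S N) t)); pose proof (Rabs_pos (cosn N y)); pose proof (Rabs_pos (cosn N t)); pose proof (Rabs_pos (cosn (S N) y)).
    nra.
Qed.

Lemma sum_lt_add (a : nat -> R) m n : sum_lt a (m + n) = sum_lt a m + sum_lt (fun i => a (m + i)%nat) n.
Proof.
  induction n as [|n IH]; [rewrite Nat.add_0_r; simpl; ring|].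
  rewrite Nat.add_succ_r. simpl. rewrite IH. ring.
Qed.

(** From [sin (z/2) >= (z/2) cos (z/2)] follows [sin z >= z cos^2 (z/2) = z (1 + cos z) / 2], and
    [cos z >= 0]. *)
Lemma sin_half_lower z : 0 <= z <= PI / 2 -> z / 2 <= sin z.
Proof.
  intros Hz.
  assert (H : z / 2 * cos (z / 2) <= sin (z / 2)).
  { destruct (Req_dec z 0) as [->|Hz0]; [rewrite Rdiv_0_l, sin_0; lra|].
    destruct (MVT_gen sin 0 (z / 2) cos) as [x [Hx E]].
    - intros x _. apply is_derive_Reals, derivable_pt_lim_sin.
    - intros x _. apply continuity_pt_filterlim, continuous_sin.
    - rewrite Rmin_left, Rmax_right in Hx by lra. rewrite sin_0 in E.
      assert (cos (z / 2) <= cos x) by (apply cos_decr_1; lra). nra. }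
  assert (Hc : 0 <= cos (z / 2)) by (apply cos_ge_0; lra).
  assert (Hc2 : 0 <= cos z) by (apply cos_ge_0; lra).
  pose proof (cos_2a_cos (z / 2)) as E. replace (2 * (z / 2)) with z in E by field.
  pose proof (sin_2a (z / 2)) as E2. replace (2 * (z / 2)) with z in E2 by field.
  rewrite E2. nra.
Qed.

(** In [cos t - cos y = 2 sin ((t+y)/2) sin ((y-t)/2)] the first sine is at least the smaller of
    [sin (t/2)] and [cos (t/2)], since [(t+y)/2] lies between [t/2] and [(t+PI)/2]. *)
Lemma cos_diff_lower t : 0 < t < PI ->
  exists c, 0 < c /\ forall y, 0 < y < PI -> c * Rabs (y - t) <= Rabs (cos t - cos y).
Proof.
  intros Ht. set (m := Rmin (sin (t / 2)) (cos (t / 2))). exists (m / 2).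
  assert (H1 : 0 < sin (t / 2)) by (apply sin_gt_0; lra).
  assert (H2 : 0 < cos (t / 2)) by (apply cos_gt_0; lra).
  assert (Hm : 0 < m) by (now apply Rmin_glb_lt).
  split; [lra|]. intros y Hy.
  assert (E : cos t - cos y = 2 * (sin ((t + y) / 2) * sin ((y - t) / 2))).
  { replace (cos t) with (cos ((t + y) / 2 - (y - t) / 2)) by (f_equal; field).
    replace (cos y) with (cos ((t + y) / 2 + (y - t) / 2)) by (f_equal; field).
    rewrite cos_minus, cos_plus. ring. }
  assert (L1 : m <= sin ((t + y) / 2)).
  { destruct (Rle_dec ((t + y) / 2) (PI / 2)) as [L|L].
    - apply Rle_trans with (sin (t / 2)); [apply Rmin_l|]. apply sin_incr_1; lra.
    - apply Rle_trans with (cos (t / 2)); [apply Rmin_r|]. rewrite <- sin_shift.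
      replace (sin ((t + y) / 2)) with (sin (PI - (t + y) / 2)) by apply sin_PI_x.
      apply sin_incr_1; lra. }
  assert (L2 : Rabs (y - t) / 4 <= Rabs (sin ((y - t) / 2))).
  { destruct (Rle_dec 0 (y - t)) as [L|L].
    - rewrite (Rabs_pos_eq (y - t)) by lra. eapply Rle_trans; [|apply Rle_abs].
      pose proof (sin_half_lower ((y - t) / 2) ltac:(lra)). lra.
    - rewrite (Rabs_left (y - t)), <- Rabs_Ropp, <- sin_neg by lra. eapply Rle_trans; [|apply Rle_abs].
      pose proof (sin_half_lower (- ((y - t) / 2)) ltac:(lra)). lra. }
  rewrite E, !Rabs_mult, (Rabs_pos_eq 2), (Rabs_pos_eq (sin ((t + y) / 2))) by lra.
  pose proof (Rabs_pos (y - t)). nra.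
Qed.

(** * Polynomials on the unit circle *)

Definition ei (y : R) : Complex.C := (cos y, sin y).
Definition zn (n : nat) (y : R) : Complex.C := (cosn n y, sinn n y).

(* A list is read as the real coefficients, constant term first, of a polynomial in [z = e^{i y}]. *)
Fixpoint ev (l : list R) (y : R) : Complex.C :=
  match l with
  | nil => RtoC 0
  | a :: l' => (RtoC a + ei y * ev l' y)%C
  end.

Lemma zn_S n y : zn (S n) y = (ei y * zn n y)%C.
Proof.
  unfold zn, ei. apply injective_projections; simpl; rewrite ?cosn_S, ?sinn_S; ring.
Qed.

Lemma Cmod_le_sum (c : Complex.C) : Cmod c <= Rabs (Re c) + Rabs (Im c).
Proof.
  assert (E : c = (RtoC (Re c) + Ci * RtoC (Im c))%C).
  { destruct c as [p q]. apply injective_projections; simpl; ring. }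
  rewrite E at 1.
  eapply Rle_trans; [apply Cmod_triangle|]. rewrite Cmod_mult, Cmod_Ci, !Cmod_R. lra.
Qed.
Lemma im_le_Cmod (c : Complex.C) : Rabs (Im c) <= Cmod c.
Proof. eapply Rle_trans; [|apply Rmax_Cmod]. apply Rmax_r. Qed.

Lemma Cmod_ei y : Cmod (ei y) = 1.
Proof.
  unfold Cmod, ei. rewrite <- sqrt_1. f_equal. pose proof (sin2_cos2 y) as H.
  unfold Rsqr in H. simpl fst; simpl snd. lra.
Qed.
Lemma Cmod_zn n y : Cmod (zn n y) = 1.
Proof. exact (Cmod_ei (INR n * y)). Qed.

(** The coefficients of [l] are placed on the frequencies [n, n+1, ...] in [hpol] and on
    [n, n-1, ...] in [hconj]. The latter gives trial polynomials of degree [n], the former test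
    functions orthogonal to all lower degrees. *)
Definition hpol (n : nat) (l : list R) (y : R) : R := Re (zn n y * ev l y)%C.
Definition hconj (n : nat) (l : list R) (y : R) : R := Re (zn n y * Cconj (ev l y))%C.

Lemma hpol_cons n a l y : hpol n (a :: l) y = a * cosn n y + hpol (S n) l y.
Proof.
  unfold hpol. rewrite zn_S. simpl ev. destruct (ev l y) as [p q]. unfold ei, zn. simpl. ring.
Qed.
Lemma hconj_cons n a l y : hconj (S n) (a :: l) y = a * cosn (S n) y + hconj n l y.
Proof.
  unfold hconj. rewrite zn_S. simpl ev. destruct (ev l y) as [p q]. unfold ei, zn. simpl.
  rewrite cosn_S. pose proof (sin2_cos2 y) as E. unfold Rsqr in E.
  set (c := cos y) in *; set (s := sin y) in *; set (C := cosn n y); set (S' := sinn n y).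
  replace (C * p) with (C * p * (s * s + c * c)) by (rewrite E; ring).
  replace (S' * - q) with (S' * - q * (s * s + c * c)) by (rewrite E; ring). ring.
Qed.

(** The length condition keeps the descending frequencies from going below 0. *)
Lemma hconj_deg n l : (length l <= S n)%nat -> deg n (hd 0 l) (hconj n l).
Proof.
  revert n. induction l as [|a l IH]; intros n Hn.
  - exists (fun _ => 0). split; [apply low_zero|]. intros y. unfold hconj. simpl. ring.
  - simpl in Hn. destruct n as [|n].
    + destruct l; [|simpl in Hn; lia]. exists (fun _ => 0). split; [apply low_zero|].
      intros y. unfold hconj, zn. simpl. rewrite sinn_0. ring.
    + exists (hconj n l). split; [|intros; apply hconj_cons].
      apply deg_low with (hd 0 l). apply IH. lia.
Qed.

Lemma hpol_low_dom n u m l : low n u -> dom (fun _ => 1) (fun y => u y * hpol m l y).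
Proof.
  intros Hu. revert m. induction l as [|a l IH]; intros m.
  - apply dom_ext with (fun _ => 0); [|apply (dom_zero _ weight_one)]. intros; unfold hpol; simpl; ring.
  - apply dom_ext with (fun y => a * (u y * cosn m y) + u y * hpol (S m) l y).
    + intros; rewrite hpol_cons; ring.
    + apply dom_plus; [apply dom_scal; now apply low_cosn_dom with n|apply IH].
Qed.

Lemma II_low_hpol n u m l : low n u -> (n <= m)%nat -> II (fun y => u y * hpol m l y) = 0.
Proof.
  intros Hu. revert m. induction l as [|a l IH]; intros m Hm.
  - rewrite (II_ext _ (fun _ => 0)); [exact II_zero|]. intros; unfold hpol; simpl; ring.
  - rewrite (II_ext _ (fun y => a * (u y * cosn m y) + u y * hpol (S m) l y))
      by (intros; rewrite hpol_cons; ring).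
    rewrite (II_plus _ weight_one);
      [|apply dom_scal; now apply low_cosn_dom with n|now apply hpol_low_dom with n].
    rewrite (II_scal _ weight_one), (II_low_cosn n), IH; auto; [ring|now apply low_cosn_dom with n].
Qed.

(** Only the constant coefficient of [l] meets the top frequency of [u]. This pairing, bounded by
    Cauchy-Schwarz, yields the lower bound for the norm of a polynomial with prescribed leading
    coefficient. *)
Lemma II_deg_hpol n b u l : (0 < n)%nat -> deg n b u ->
  II (fun y => u y * hpol n l y) = PI / 2 * b * hd 0 l.
Proof.
  intros Hn Hu. pose proof (deg_low n b u Hu) as Hl. destruct l as [|a l].
  - rewrite (II_ext _ (fun _ => 0)); [rewrite II_zero; simpl; ring|]. intros; unfold hpol; simpl; ring.
  - rewrite (II_ext _ (fun y => a * (u y * cosn n y) + u y * hpol (S n) l y))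
      by (intros; rewrite hpol_cons; ring).
    assert (D : dom (fun _ => 1) (fun y => u y * cosn n y)) by now apply low_cosn_dom with (S n).
    rewrite (II_plus _ weight_one); [|now apply dom_scal|now apply hpol_low_dom with (S n)].
    rewrite (II_scal _ weight_one), (II_deg_cosn n b), (II_low_hpol (S n)) by auto. simpl; ring.
Qed.

(** * Arithmetic of coefficient lists *)

Fixpoint ladd (l m : list R) : list R :=
  match l, m with
  | nil, _ => m
  | _, nil => l
  | a :: l', b :: m' => (a + b) :: ladd l' m'
  end.
Definition lscal (c : R) (l : list R) : list R := map (Rmult c) l.
Fixpoint lmul (l m : list R) : list R :=
  match l with
  | nil => nil
  | a :: l' => ladd (lscal a m) (0 :: lmul l' m)
  end.
Fixpoint lpow (l : list R) (n : nat) : list R :=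
  match n with O => 1 :: nil | S n => lmul l (lpow l n) end.

Lemma ev_ladd l m y : ev (ladd l m) y = (ev l y + ev m y)%C.
Proof.
  revert m. induction l as [|a l IH]; intros [|b m]; simpl; try ring.
  rewrite IH, RtoC_plus. ring.
Qed.
Lemma ev_lscal c l y : ev (lscal c l) y = (RtoC c * ev l y)%C.
Proof. induction l as [|a l IH]; simpl; [ring|]. rewrite IH, RtoC_mult. ring. Qed.
Lemma ev_lmul l m y : ev (lmul l m) y = (ev l y * ev m y)%C.
Proof.
  induction l as [|a l IH]; [simpl; ring|].
  simpl lmul. rewrite ev_ladd, ev_lscal. simpl. rewrite IH. ring.
Qed.
Lemma ev_lpow l n y : ev (lpow l n) y = (ev l y ^ n)%C.
Proof. induction n as [|n IH]; [simpl; ring|]. simpl lpow. rewrite ev_lmul, IH. reflexivity. Qed.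

Lemma hd_ladd l m : hd 0 (ladd l m) = hd 0 l + hd 0 m.
Proof. destruct l, m; simpl; ring. Qed.
Lemma hd_lscal c l : hd 0 (lscal c l) = c * hd 0 l.
Proof. destruct l; simpl; ring. Qed.
Lemma hd_lmul l m : hd 0 (lmul l m) = hd 0 l * hd 0 m.
Proof.
  destruct l as [|a l]; [simpl; ring|]. simpl lmul. rewrite hd_ladd, hd_lscal. simpl. ring.
Qed.
Lemma hd_lpow l n : hd 0 (lpow l n) = hd 0 l ^ n.
Proof. induction n as [|n IH]; [reflexivity|]. simpl lpow. rewrite hd_lmul, IH. reflexivity. Qed.

(** * Continuity and Lipschitz bounds for complex-valued functions *)

Definition ccont (F : R -> Complex.C) (x : R) : Prop :=
  continuous (fun y => Re (F y)) x /\ continuous (fun y => Im (F y)) x.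

Lemma ccont_const c x : ccont (fun _ => c) x.
Proof. split; cont. Qed.
Lemma ccont_plus F G x : ccont F x -> ccont G x -> ccont (fun y => (F y + G y)%C) x.
Proof. intros [A B] [A' B']. split; simpl; now apply cont_plus. Qed.
Lemma ccont_mult F G x : ccont F x -> ccont G x -> ccont (fun y => (F y * G y)%C) x.
Proof.
  intros [A B] [A' B']. unfold Cmult. split; simpl.
  - apply cont_minus; now apply cont_mult.
  - apply cont_plus; now apply cont_mult.
Qed.
Lemma ccont_conj F x : ccont F x -> ccont (fun y => Cconj (F y)) x.
Proof. intros [A B]. split; simpl; [exact A|now apply cont_opp]. Qed.
Lemma ccont_real (u : R -> R) x : continuous u x -> ccont (fun y => RtoC (u y)) x.
Proof. intros H; split; simpl; [exact H|cont]. Qed.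
Lemma ccont_mod F x : ccont F x -> continuous (fun y => Cmod (F y)) x.
Proof. intros [A B]. unfold Cmod. apply cont_sqrt. apply cont_plus; now apply cont_pow. Qed.
Lemma ccont_opp F x : ccont F x -> ccont (fun y => (- F y)%C) x.
Proof. intros [A B]. split; simpl; now apply cont_opp. Qed.
Lemma ccont_minus F G x : ccont F x -> ccont G x -> ccont (fun y => (F y - G y)%C) x.
Proof. intros; now apply ccont_plus, ccont_opp. Qed.
Lemma ccont_ei x : ccont ei x.
Proof. split; simpl; cont. Qed.
Lemma ccont_zn n x : ccont (zn n) x.
Proof. split; [apply cosn_cont|apply sinn_cont]. Qed.
Lemma ccont_ev l x : ccont (ev l) x.
Proof.
  induction l as [|a l IH]; simpl; [apply ccont_const|].
  apply ccont_plus; [apply ccont_const|now apply ccont_mult, IH; apply ccont_ei].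
Qed.

Lemma cos_lip x y : Rabs (cos x - cos y) <= Rabs (x - y).
Proof.
  destruct (MVT_gen cos y x (fun z => - sin z)) as [c [_ E]].
  - intros; apply is_derive_Reals, derivable_pt_lim_cos.
  - intros; apply continuity_pt_filterlim, continuous_cos.
  - rewrite E, Rabs_mult, Rabs_Ropp. pose proof (SIN_bound c).
    assert (Rabs (sin c) <= 1) by (apply Rabs_le; lra). pose proof (Rabs_pos (x - y)). nra.
Qed.
Lemma sin_lip x y : Rabs (sin x - sin y) <= Rabs (x - y).
Proof.
  destruct (MVT_gen sin y x cos) as [c [_ E]].
  - intros; apply is_derive_Reals, derivable_pt_lim_sin.
  - intros; apply continuity_pt_filterlim, continuous_sin.
  - rewrite E, Rabs_mult. pose proof (COS_bound c).
    assert (Rabs (cos c) <= 1) by (apply Rabs_le; lra). pose proof (Rabs_pos (x - y)). nra.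
Qed.

Lemma ev_bounded l : exists B, 0 <= B /\ forall y, Cmod (ev l y) <= B.
Proof.
  induction l as [|a l [B [HB H]]].
  - exists 0. split; [lra|]. intros; simpl. rewrite Cmod_0. lra.
  - exists (Rabs a + B). split; [pose proof (Rabs_pos a); lra|]. intros y. simpl.
    eapply Rle_trans; [apply Cmod_triangle|]. rewrite Cmod_mult, Cmod_ei, Cmod_R. specialize (H y). lra.
Qed.

Lemma ev_lipschitz l : exists B, 0 <= B /\ forall x y, Cmod (ev l x - ev l y) <= B * Rabs (x - y).
Proof.
  induction l as [|a l [B [HB H]]].
  - exists 0. split; [lra|]. intros; simpl. replace (0 - 0)%C with (RtoC 0) by ring. rewrite Cmod_0. lra.
  - destruct (ev_bounded l) as [D [HD HD']]. exists (2 * D + B). split; [lra|]. intros x y. simpl.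
    replace (a + ei x * ev l x - (a + ei y * ev l y))%C
      with ((ei x - ei y) * ev l x + ei y * (ev l x - ev l y))%C by ring.
    eapply Rle_trans; [apply Cmod_triangle|]. rewrite !Cmod_mult, Cmod_ei.
    assert (Cmod (ei x - ei y) <= 2 * Rabs (x - y)).
    { eapply Rle_trans; [apply Cmod_le_sum|]. unfold ei; simpl.
      pose proof (cos_lip x y); pose proof (sin_lip x y). unfold Rminus in *. lra. }
    specialize (H x y). specialize (HD' x). pose proof (Cmod_ge_0 (ei x - ei y)).
    pose proof (Cmod_ge_0 (ev l x)). pose proof (Rabs_pos (x - y)). nra.
Qed.

(* [Re (w)^2 = |w|^2 / 2 + Re (w^2) / 2] and the second half oscillates. *)
Lemma osc_square_lim (G : R -> Complex.C) (w : R -> R) C :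
  (forall y, 0 < y < PI -> ccont G y) -> (forall y, 0 < y < PI -> continuous w y) ->
  (forall y, 0 < y < PI -> 0 <= w y) ->
  (forall y, 0 < y < PI -> Cmod (G y) ^ 2 * w y <= C) ->
  is_lim_seq (fun n => II (fun y => Re (zn n y * G y)%C ^ 2 * w y)) (/ 2 * II (fun y => Cmod (G y) ^ 2 * w y)).
Proof.
  intros HG Hw Hw0 HC.
  set (U1 := fun y => Re (G y * G y)%C * w y). set (U2 := fun y => Im (G y * G y)%C * w y).
  assert (c1 : forall y, 0 < y < PI -> continuous U1 y).
  { intros y Hy. apply cont_mult; [|auto]. exact (proj1 (ccont_mult G G y (HG y Hy) (HG y Hy))). }
  assert (c2 : forall y, 0 < y < PI -> continuous U2 y).
  { intros y Hy. apply cont_mult; [|auto]. exact (proj2 (ccont_mult G G y (HG y Hy) (HG y Hy))). }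
  assert (b1 : forall y, 0 < y < PI -> Rabs (U1 y) <= C).
  { intros y Hy. unfold U1. rewrite Rabs_mult, (Rabs_pos_eq (w y)) by auto.
    eapply Rle_trans; [|apply (HC y Hy)]. apply Rmult_le_compat_r; [auto|].
    eapply Rle_trans; [apply re_le_Cmod|]. rewrite Cmod_mult. simpl. lra. }
  assert (b2 : forall y, 0 < y < PI -> Rabs (U2 y) <= C).
  { intros y Hy. unfold U2. rewrite Rabs_mult, (Rabs_pos_eq (w y)) by auto.
    eapply Rle_trans; [|apply (HC y Hy)]. apply Rmult_le_compat_r; [auto|].
    eapply Rle_trans; [apply im_le_Cmod|]. rewrite Cmod_mult. simpl. lra. }
  assert (D0 : dom (fun _ => 1) (fun y => Cmod (G y) ^ 2 * w y)).
  { apply (dom_bounded _ weight_one _ C).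
    - intros y Hy. apply cont_mult; [|auto]. apply cont_pow, ccont_mod; auto.
    - intros y Hy. rewrite Rabs_pos_eq; auto. apply Rmult_le_pos; auto using pow2_ge_0. }
  assert (D1 : forall n, dom (fun _ => 1) (fun y => U1 y * cosn n y)).
  { intros n. apply (bounded_mult_dom U1 (cosn n) C 1); auto; intros; [apply cosn_cont|apply cosn_bound]. }
  assert (D2 : forall n, dom (fun _ => 1) (fun y => U2 y * sinn n y)).
  { intros n. apply (bounded_mult_dom U2 (sinn n) C 1); auto; intros; [apply sinn_cont|apply sinn_bound]. }
  apply is_lim_seq_ext with
    (fun n => / 2 * II (fun y => Cmod (G y) ^ 2 * w y) +
      / 2 * (II (fun y => U1 y * cosn (n + n) y) - II (fun y => U2 y * sinn (n + n) y))).
  - intros n.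
    rewrite (II_ext (fun y => Re (zn n y * G y)%C ^ 2 * w y)
      (fun y => / 2 * (Cmod (G y) ^ 2 * w y) + / 2 * (U1 y * cosn (n + n) y - U2 y * sinn (n + n) y))).
    + rewrite (II_plus _ weight_one), !(II_scal _ weight_one), (II_minus _ weight_one);
        auto using dom_scal, dom_minus.
    + intros y _. unfold U1, U2. rewrite Cmod2_alt, cosn_add.
      replace (sinn (n + n) y) with (2 * (sinn n y * cosn n y)).
      2:{ unfold sinn, cosn. rewrite plus_INR, Rmult_plus_distr_r, sin_plus. ring. }
      destruct (G y) as [p q]. unfold zn. simpl.
      pose proof (sin2_cos2 (INR n * y)) as E. unfold Rsqr in E.
      unfold cosn, sinn in *. set (c := cos (INR n * y)) in *. set (s := sin (INR n * y)) in *.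
      replace (/ 2 * ((p * (p * 1) + q * (q * 1)) * w y))
        with (/ 2 * ((p * (p * 1) + q * (q * 1)) * w y) * (s * s + c * c)) by (rewrite E; ring).
      field.
  - replace (Finite (/ 2 * II (fun y => Cmod (G y) ^ 2 * w y)))
      with (Finite (/ 2 * II (fun y => Cmod (G y) ^ 2 * w y) + / 2 * (0 - 0))) by (f_equal; ring).
    apply is_lim_seq_plus'; [apply is_lim_seq_const|].
    apply (is_lim_seq_scal_l _ (/ 2) (0 - 0)). 
    (* The oscillating half has frequency [2 n], so the Riemann-Lebesgue limits are taken along even
       indices. *)
    assert (Hsub : filterlim (fun n => (n + n)%nat) eventually eventually).
    { intros Q [N HN]. exists N. intros n Hn. apply HN. lia. }
    apply is_lim_seq_minus'.
    + apply (is_lim_seq_subseq (fun n => II (fun y => U1 y * cosn n y)) 0 (fun n => (n + n)%nat) Hsub).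
      now apply riemann_lebesgue_cos with C.
    + apply (is_lim_seq_subseq (fun n => II (fun y => U2 y * sinn n y)) 0 (fun n => (n + n)%nat) Hsub).
      now apply riemann_lebesgue_sin with C.
Qed.

(** * Pointwise asymptotics of orthonormal polynomials *)

(** The polynomial [(1 - z^2)^M]; on the circle [|1 - z^2| = 2 |sin y|]. *)
Definition lsin (M : nat) : list R := lpow (1 :: 0 :: -1 :: nil) M.

Lemma lsin_mod M y : Cmod (ev (lsin M) y) ^ 2 = 4 ^ M * sin y ^ (2 * M).
Proof.
  unfold lsin. rewrite ev_lpow, Cmod_pow, <- pow_mult, Nat.mul_comm, pow_mult, Cmod2_alt.
  rewrite (pow_mult (sin y)), <- Rpow_mult_distr. f_equal.
  pose proof (sin2_cos2 y) as E. unfold Rsqr in E. simpl.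
  set (c := cos y) in *. set (s := sin y) in *.
  replace (1 + (c * (0 + (c * (-1 + (c * 0 - s * 0)) - s * (0 + (c * 0 + s * 0)))) -
    s * (0 + (c * (0 + (c * 0 + s * 0)) + s * (-1 + (c * 0 - s * 0)))))) with (2 * (s * s)) by (rewrite <- E; ring).
  match goal with |- _ + ?i * (?i * 1) = _ => replace i with (- (2 * (s * c))) by ring end.
  replace (4 * (s * (s * 1))) with (4 * (s * s) * (s * s + c * c)) by (rewrite E; ring). ring.
Qed.

Lemma hd_lsin M : hd 0 (lsin M) = 1.
Proof. unfold lsin. rewrite hd_lpow. simpl. apply pow1. Qed.

(** For the exact functions [1/D] and [D] it vanishes, since [|D|^2 = f] gives
    [conj (1/D) f = D]. *)
Definition defect (f : R -> R) (lR lg : list R) (y : R) : Complex.C :=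
  (Cconj (ev lR y) * RtoC (f y) - ev lg y)%C.

(* [l1] and [l2] play the roles of [1/D] and [D], where [D] is the Szego function, i.e.
   the outer function with [|D|^2 = f], each divided by the common factor [(1 - z^2)^M]. *)
Definition szego_pair (f : R -> R) (M : nat) (t d : R) (w0 : Complex.C) (e : R) (l1 l2 : list R) : Prop :=
  let lR := lmul (lsin M) l1 in let lg := lmul (lsin M) l2 in
  0 < hd 0 l1 /\ 0 < hd 0 l2 /\ 1 - e <= hd 0 l1 * hd 0 l2 /\
  II (fun y => Cmod (ev lR y) ^ 2 * f y) <= PI + e /\
  II (fun y => Cmod (ev lg y) ^ 2 * / f y) <= PI + e /\
  II (fun y => Cmod (defect f lR lg y)) <= e /\
  Cmod (defect f lR lg t) <= e /\
  (forall y, Rabs (y - t) < d -> Cmod (defect f lR lg y - defect f lR lg t) <= e * Rabs (y - t)) /\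
  Cmod (ev lR t - w0) <= e.

Section Pointwise.
Variable f : R -> R.
Hypothesis Hf : integrable_weight f.
Variables (P : nat -> R -> R) (b : nat -> R).
Hypothesis Hb : forall n, 0 < b n.
Hypothesis HP : forall n, deg n (b n) (P n).
Hypothesis Horth : forall m n, II (fun y => P m y * P n y * f y) = if Nat.eqb m n then 1 else 0.
Variables (M : nat) (Cb : R).
Hypothesis HMf : forall y, 0 < y < PI -> sin y ^ (2 * M) * f y <= Cb.
Hypothesis HMi : forall y, 0 < y < PI -> sin y ^ (2 * M) <= Cb * f y.
Variables (t d L m0 : R).
Hypothesis Ht : 0 < t < PI.
Hypothesis Hd : 0 < d.
Hypothesis Hnear : forall y, Rabs (y - t) < d -> 0 < y < PI /\ m0 <= f y /\ Rabs (f y - f t) <= L * Rabs (y - t).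
Hypothesis Hm0 : 0 < m0.

Let fcont : forall y, 0 < y < PI -> continuous f y := proj1 Hf.
Let fpos : forall y, 0 < y < PI -> 0 < f y := proj1 (proj2 Hf).
(** Unlike [f], this factor maps cosine polynomials to cosine polynomials. Within the section it
    hides the successor, written [Datatypes.S]. *)
Let S (y : R) : R := sin y ^ (2 * M).

Lemma low_low_f_dom m n u v : low m u -> low n v -> dom f (fun y => u y * v y * f y).
Proof.
  intros Hu Hv. destruct (low_bounded m u Hu) as [A HA]. destruct (low_bounded n v Hv) as [B HB].
  apply (dom_weight _ Hf (fun y => u y * v y) (A * B)).
  - intros; apply cont_mult; [now apply low_cont with m|now apply low_cont with n].
  - intros y _. rewrite Rabs_mult. apply Rmult_le_compat; auto using Rabs_pos.
Qed.

Lemma P_low n : low (Datatypes.S n) (P n).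
Proof. exact (deg_low _ _ _ (HP n)). Qed.

(** Induction on the degree: subtracting the multiple [a / b n] of [P n] removes the top
    frequency. *)
Lemma orth_low n m u : low n u -> (n <= m)%nat -> II (fun y => P m y * u y * f y) = 0.
Proof.
  revert u. induction n as [|n IH]; intros u Hu Hm.
  - destruct Hu as [c Hc]. rewrite (II_ext _ (fun _ => 0)); [exact II_zero|].
    intros y _. rewrite Hc. simpl. ring.
  - apply low_S in Hu. destruct Hu as [a [v [Hv He]]]. destruct (HP n) as [p [Hp Hpe]].
    pose proof (Hb n) as Hbn.
    set (v' := fun y => v y - a / b n * p y).
    assert (Hv' : low n v') by (apply low_minus; [exact Hv|now apply low_scal]).
    rewrite (II_ext _ (fun y => a / b n * (P m y * P n y * f y) + P m y * v' y * f y)).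
    2:{ intros y _. unfold v'. rewrite He, (Hpe y). field. lra. }
    rewrite (II_plus _ Hf), (II_scal _ Hf), Horth, IH; auto; try lia.
    + destruct (Nat.eqb_spec m n); [lia|ring].
    + apply low_low_f_dom with (Datatypes.S m) (Datatypes.S n); apply P_low.
    + apply dom_scal. apply low_low_f_dom with (Datatypes.S m) (Datatypes.S n); apply P_low.
    + apply low_low_f_dom with (Datatypes.S m) n; [apply P_low|exact Hv'].
Qed.

Lemma orth_deg n a u : deg n a u -> II (fun y => P n y * u y * f y) = a / b n.
Proof.
  intros [v [Hv He]]. destruct (HP n) as [p [Hp Hpe]]. pose proof (Hb n) as Hbn.
  set (v' := fun y => v y - a / b n * p y).
  assert (Hv' : low n v') by (apply low_minus; [exact Hv|now apply low_scal]).
  rewrite (II_ext _ (fun y => a / b n * (P n y * P n y * f y) + P n y * v' y * f y)).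
  2:{ intros y _. unfold v'. rewrite He, (Hpe y). field. lra. }
  rewrite (II_plus _ Hf), (II_scal _ Hf), Horth, (orth_low n), Nat.eqb_refl; auto; try ring.
  - apply low_low_f_dom with (Datatypes.S n) (Datatypes.S n); apply P_low.
  - apply dom_scal. apply low_low_f_dom with (Datatypes.S n) (Datatypes.S n); apply P_low.
  - apply low_low_f_dom with (Datatypes.S n) n; [apply P_low|exact Hv'].
Qed.

Lemma S_cont y : continuous S y.
Proof. unfold S. cont. Qed.
Lemma S_bound y : 0 <= S y <= 1.
Proof.
  unfold S. rewrite pow_mult. pose proof (sin2_cos2 y) as E. unfold Rsqr in E.
  assert (0 <= sin y ^ 2 <= 1) by (simpl; nra). split.
  - apply pow_le; lra.
  - rewrite <- (pow1 M). apply pow_incr. lra.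
Qed.

(** Prepares the splitting of [e (S + f)] into [e sqrt f] and [(S + f) / sqrt f] for Cauchy-Schwarz.
    The square of the second factor is [S^2 / f + 2 S + f], where [S^2 <= S <= Cb f]. *)
Lemma SF_dom : dom f (fun y => ((S y + f y) / sqrt (f y)) ^ 2).
Proof.
  split.
  - intros y Hy. apply cont_pow, cont_div; [pose proof (S_cont y); cont|cont|].
    apply Rgt_not_eq, sqrt_lt_R0. auto.
  - exists (Rabs Cb + 3). intros y Hy. pose proof (fpos y Hy) as F. pose proof (S_bound y).
    rewrite Rabs_pos_eq by apply pow2_ge_0.
    replace (((S y + f y) / sqrt (f y)) ^ 2) with ((S y + f y) ^ 2 / f y).
    2:{ unfold Rdiv. rewrite Rpow_mult_distr, pow_inv, pow2_sqrt by lra. reflexivity. }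
    apply Rle_div_l; [lra|]. pose proof (HMi y Hy) as Hi. fold (S y) in Hi. pose proof (Rle_abs Cb).
    pose proof (Rabs_pos Cb).
    assert (S y * S y <= Rabs Cb * f y) by nra. nra.
Qed.

(* [e] stands for the remainder [P n - s Q n]; the hypotheses on [f] near [t] make
   [(rho S - f) * dirichlet n t] bounded by a multiple of [S + f]. *)
Lemma kernel_bound : exists A, 0 <= A /\ forall n y, 0 < y < PI ->
  Rabs ((f t / S t * S y - f y) * dirichlet n t y) <= A * (S y + f y).
Proof.
  destruct (cos_diff_lower t Ht) as [c [Hc Hcl]].
  pose proof PI_RGT_0 as Hpi. pose proof (fpos t Ht) as Ft.
  assert (St : 0 < S t) by (apply pow_lt, sin_gt_0; lra).
  (* With this ratio [rho * S - f] vanishes at [t], and its Lipschitz bound cancels the factor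
     [1 / |y - t|] from the kernel. *)
  set (rho := f t / S t). assert (Hrho : 0 < rho) by (now apply Rdiv_lt_0_compat).
  assert (Hlip : exists LS, 0 <= LS /\ forall x y, Rabs (S x - S y) <= LS * Rabs (x - y)).
  { assert (G : forall k, exists LS, 0 <= LS /\ forall x y, Rabs (sin x ^ k - sin y ^ k) <= LS * Rabs (x - y)).
    { induction k as [|k [K [HK IH]]].
      - exists 0. split; [lra|]. intros; simpl. rewrite Rminus_diag, Rabs_R0. lra.
      - exists (1 + K). split; [lra|]. intros x y. simpl.
        replace (sin x * sin x ^ k - sin y * sin y ^ k)
          with ((sin x - sin y) * sin x ^ k + sin y * (sin x ^ k - sin y ^ k)) by ring.
        eapply Rle_trans; [apply Rabs_triang|]. rewrite !Rabs_mult, <- RPow_abs.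
        assert (B : forall z, Rabs (sin z) <= 1) by (intros z; apply Rabs_le; pose proof (SIN_bound z); lra).
        assert (Rabs (sin x) ^ k <= 1).
        { rewrite <- (pow1 k). apply pow_incr. split; [apply Rabs_pos|apply B]. }
        assert (0 <= Rabs (sin x) ^ k) by (apply pow_le, Rabs_pos).
        pose proof (sin_lip x y). pose proof (Rabs_pos (sin x - sin y)). specialize (IH x y).
        pose proof (B y). pose proof (Rabs_pos (sin y)). pose proof (Rabs_pos (x - y)).
        pose proof (Rabs_pos (sin x ^ k - sin y ^ k)). nra. }
    apply G. }
  destruct Hlip as [LS [HLS HS]].
  assert (HL : 0 <= L).
  { destruct (Hnear (t + d / 2)) as [_ [_ H]].
    - replace (t + d / 2 - t) with (d / 2) by ring. rewrite Rabs_pos_eq; lra.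
    - replace (t + d / 2 - t) with (d / 2) in H by ring. rewrite (Rabs_pos_eq (d / 2)) in H by lra.
      pose proof (Rabs_pos (f (t + d / 2) - f t)). nra. }
  (* [A1] serves [|y - t| < d], where the difference is Lipschitz and [f >= m0]; [A2] serves the
     rest, where the kernel itself is bounded. *)
  set (A1 := (rho * LS + L) * (2 / PI) / c / m0). set (A2 := (rho + 1) * (2 / PI) / (c * d)).
  assert (H2pi : 0 < 2 / PI) by (apply Rdiv_lt_0_compat; lra).
  assert (HA1 : 0 <= A1).
  { unfold A1. apply Rdiv_le_0_compat; [|lra]. apply Rdiv_le_0_compat; [|lra].
    apply Rmult_le_pos; [nra|lra]. }
  assert (HA2 : 0 <= A2).
  { unfold A2. apply Rdiv_le_0_compat; [|nra]. apply Rmult_le_pos; lra. }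
  exists (A1 + A2). split; [lra|]. intros n y Hy. pose proof (fpos y Hy) as F. pose proof (S_bound y) as SB.
  rewrite Rabs_mult. pose proof (dirichlet_CD_bound n t y) as CD. specialize (Hcl y Hy).
  set (K := Rabs (dirichlet n t y)) in *. assert (HK : 0 <= K) by apply Rabs_pos.
  assert (CD' : c * Rabs (y - t) * K <= 2 / PI) by nra.
  destruct (Rlt_dec (Rabs (y - t)) d) as [N|N].
  - destruct (Hnear y N) as [_ [Hm Hl]].
    assert (B : Rabs (rho * S y - f y) <= (rho * LS + L) * Rabs (y - t)).
    { replace (rho * S y - f y) with (rho * (S y - S t) + - (f y - f t)) by (unfold rho; field; lra).
      eapply Rle_trans; [apply Rabs_triang|]. rewrite Rabs_Ropp, Rabs_mult, (Rabs_pos_eq rho) by lra.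
      specialize (HS y t). nra. }
    assert (B2 : Rabs (rho * S y - f y) * K <= (rho * LS + L) * (2 / PI) / c).
    { apply (proj1 (Rle_div_r _ _ c Hc)). assert (0 <= rho * LS + L) by nra.
      apply Rle_trans with ((rho * LS + L) * Rabs (y - t) * K * c).
      2:{ replace ((rho * LS + L) * Rabs (y - t) * K * c) with ((rho * LS + L) * (c * Rabs (y - t) * K)) by ring.
          now apply Rmult_le_compat_l. }
      apply Rmult_le_compat_r; [lra|]. now apply Rmult_le_compat_r. }
    assert (B3 : (rho * LS + L) * (2 / PI) / c <= A1 * f y).
    { replace ((rho * LS + L) * (2 / PI) / c) with (A1 * m0) by (unfold A1; field; lra). nra. }
    nra.
  - apply Rnot_lt_le in N.
    assert (B : Rabs (rho * S y - f y) <= (rho + 1) * (S y + f y)).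
    { eapply Rle_trans; [apply Rabs_triang|]. rewrite Rabs_Ropp, (Rabs_pos_eq (f y)), Rabs_pos_eq by nra. nra. }
    assert (B2 : K <= (2 / PI) / (c * d)).
    { apply (proj1 (Rle_div_r _ _ (c * d) ltac:(nra))). assert (c * d <= c * Rabs (y - t)) by nra. nra. }
    apply Rle_trans with ((rho + 1) * (S y + f y) * ((2 / PI) / (c * d))).
    + apply Rmult_le_compat; auto using Rabs_pos.
    + replace ((rho + 1) * (S y + f y) * (2 / PI / (c * d))) with (A2 * (S y + f y)) by (unfold A2; field; lra). nra.
Qed.

(** Multiplication by [S] raises the degree by [2 * M], so that many more frequencies must be
    reproduced. Each contributes at most 1, since [kappa] does not exceed 1. *)
Lemma tail_kernel_bound n y : Rabs (dirichlet (n + 2 * M) t y - dirichlet n t y) <= INR (2 * M).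
Proof.
  pose proof PI_RGT_0 as Hpi. pose proof PI2_1 as Hpi2.
  unfold dirichlet. rewrite sum_lt_add.
  match goal with |- Rabs (?a + ?s - ?a) <= _ => replace (a + s - a) with s by ring end.
  eapply Rle_trans; [apply sum_lt_abs|]. rewrite <- (Rmult_1_r (INR (2 * M))), <- sum_lt_const.
  apply sum_lt_le. intros k _. rewrite !Rabs_mult.
  assert (0 <= Rabs (kappa (n + k)) <= 1).
  { split; [apply Rabs_pos|]. unfold kappa. assert (0 < / PI) by (now apply Rinv_0_lt_compat).
    assert (2 / PI <= 1) by (apply Rle_div_l; lra).
    destruct (Nat.eqb (n + k) 0); rewrite Rabs_pos_eq; unfold Rdiv in *; lra. }
  pose proof (cosn_bound (n + k) t). pose proof (cosn_bound (n + k) y).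
  pose proof (Rabs_pos (cosn (n + k) t)). pose proof (Rabs_pos (cosn (n + k) y)). 
  rewrite <- (Rmult_1_l 1), <- (Rmult_1_l (1 * 1)), <- Rmult_assoc.
  apply Rmult_le_compat; try lra; [nra|]. nra.
Qed.

(** Turns a mean square bound into a bound at [t]. The first term pays for exchanging [rho * S] with
    [f] and for shortening the kernel from order [n + 2 * M] to [n]; the second is left for the
    orthogonality of [P n]. *)
Lemma remainder_bound : exists A, 0 <= A /\ forall n e, low n e ->
  f t * Rabs (e t) <= A * sqrt (II (fun y => e y ^ 2 * f y)) + Rabs (II (fun y => e y * f y * dirichlet n t y)).
Proof.
  destruct kernel_bound as [A [HA HK]].
  set (V := II (fun y => ((S y + f y) / sqrt (f y)) ^ 2)).
  pose proof (fpos t Ht) as Ft.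
  assert (St : 0 < S t) by (apply pow_lt, sin_gt_0; lra).
  set (rho := f t / S t). assert (Hrho : 0 < rho) by (now apply Rdiv_lt_0_compat).
  pose proof (pos_INR (2 * M)) as HM.
  exists ((A + rho * INR (2 * M)) * sqrt V). split; [apply Rmult_le_pos; [nra|apply sqrt_pos]|].
  intros n e He.
  assert (HSe : low (n + 2 * M) (fun y => S y * e y)) by now apply low_mult_sin2.
  destruct (low_bounded n e He) as [Be HBe].
  assert (De1 : dom f (fun y => Rabs (e y) * (S y + f y))).
  { apply (dom_dominated _ _ (fun y => 1 + f y)).
    - intros y Hy. apply cont_mult; [apply cont_abs; now apply low_cont with n|]. pose proof (S_cont y). cont.
    - now apply dom_one_plus.
    - exists Be. intros y Hy. pose proof (fpos y Hy). pose proof (S_bound y). pose proof (HBe y).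
      pose proof (Rabs_pos (e y)).
      rewrite !Rabs_mult, Rabs_Rabsolu, !(Rabs_pos_eq (_ + f y)) by lra. apply Rmult_le_compat; lra. }
  assert (CS : II (fun y => Rabs (e y) * (S y + f y)) <= sqrt V * sqrt (II (fun y => e y ^ 2 * f y))).
  { assert (X1 : forall y, 0 < y < PI -> (Rabs (e y) * sqrt (f y)) ^ 2 = e y ^ 2 * f y).
    { intros y Hy. pose proof (fpos y Hy). rewrite Rpow_mult_distr, pow2_sqrt, pow2_abs by lra. reflexivity. }
    assert (X2 : forall y, 0 < y < PI -> Rabs (e y) * sqrt (f y) * ((S y + f y) / sqrt (f y)) = Rabs (e y) * (S y + f y)).
    { intros y Hy. pose proof (sqrt_lt_R0 _ (fpos y Hy)). field. lra. }
    assert (ec : forall y, continuous e y) by (now apply low_cont with n).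
    assert (D1 : dom f (fun y => (Rabs (e y) * sqrt (f y)) ^ 2)).
    { apply (dom_dominated _ _ (fun y => e y * e y * f y)).
      - intros; cont.
      - now apply low_low_f_dom with n n.
      - exists 1. intros y Hy. rewrite X1 by auto. apply Req_le. rewrite Rmult_1_l. f_equal. ring. }
    assert (D2 : dom f (fun y => Rabs (e y) * sqrt (f y) * ((S y + f y) / sqrt (f y)))).
    { apply (dom_dominated _ _ (fun y => Rabs (e y) * (S y + f y))); auto.
      - intros y Hy. apply cont_mult; [cont|]. apply cont_div; [pose proof (S_cont y); cont|cont|].
        apply Rgt_not_eq, sqrt_lt_R0; auto.
      - exists 1. intros y Hy. rewrite X2 by auto. lra. }
    pose proof (II_cauchy_schwarz _ Hf _ _ D1 SF_dom D2) as Q. cbv beta in Q.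
    rewrite (II_ext _ _ X1), (II_ext _ _ X2) in Q. fold V in Q.
    rewrite <- sqrt_mult_alt.
    - apply Rsqr_incr_0_var; [|apply sqrt_pos]. rewrite Rsqr_sqrt; [unfold Rsqr; lra|].
      apply Rle_trans with (2 := Rle_refl _). eapply Rle_trans; [apply pow2_ge_0|]. rewrite Rmult_comm. exact Q.
    - apply (II_ge_0 _ Hf); [apply SF_dom|]. intros; apply pow2_ge_0. }
  set (DT := fun y => dirichlet (n + 2 * M) t y - dirichlet n t y).
  assert (lowDT : low (n + 2 * M) DT).
  { apply low_minus; [apply dirichlet_low|]. apply low_weaken with n; [lia|apply dirichlet_low]. }
  assert (ec : forall y, continuous e y) by (now apply low_cont with n).
  assert (kc : forall y, continuous (dirichlet n t) y) by (apply low_cont with n, dirichlet_low).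
  assert (tc : forall y, continuous DT y) by (now apply low_cont with (n + 2 * M)%nat).
  assert (DomT1 : dom f (fun y => e y * ((rho * S y - f y) * dirichlet n t y))).
  { apply (dom_dominated _ _ (fun y => Rabs (e y) * (S y + f y))); auto.
    - intros y Hy. pose proof (S_cont y). cont.
    - exists A. intros y Hy. pose proof (fpos y Hy). pose proof (S_bound y).
      rewrite (Rabs_mult (e y)). rewrite (Rabs_pos_eq (_ * (_ + _))) by (pose proof (Rabs_pos (e y)); nra).
      specialize (HK n y Hy). fold rho in HK. pose proof (Rabs_pos (e y)). nra. }
  assert (DomT2 : dom f (fun y => e y * f y * dirichlet n t y)).
  { apply dom_ext with (fun y => e y * dirichlet n t y * f y); [intros; ring|].
    apply low_low_f_dom with n n; [exact He|apply dirichlet_low]. }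
  assert (DomT3 : dom f (fun y => e y * S y * DT y)).
  { apply (dom_dominated _ _ (fun y => Rabs (e y) * (S y + f y))); auto.
    - intros y Hy. pose proof (S_cont y). cont.
    - exists (INR (2 * M)). intros y Hy. pose proof (fpos y Hy). pose proof (S_bound y).
      rewrite !Rabs_mult, (Rabs_pos_eq (S y)), Rabs_Rabsolu, (Rabs_pos_eq (_ + _)) by lra.
      pose proof (tail_kernel_bound n y) as TB. fold (DT y) in TB. pose proof (Rabs_pos (e y)).
      pose proof (Rabs_pos (DT y)).
      apply Rle_trans with (Rabs (e y) * S y * INR (2 * M)).
      + apply Rmult_le_compat_l; [apply Rmult_le_pos; lra|exact TB].
      + assert (0 <= INR (2 * M) * (Rabs (e y) * f y)) by (repeat apply Rmult_le_pos; lra). lra. }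
  (* Since [f t = rho * S t], the left side is [rho] times the value at [t] of [S * e], reproduced
     by the kernel of order [n + 2 * M]. *)
  assert (E : f t * e t = II (fun y => e y * ((rho * S y - f y) * dirichlet n t y))
      + II (fun y => e y * f y * dirichlet n t y) + rho * II (fun y => e y * S y * DT y)).
  { rewrite <- (II_scal _ Hf), <- (II_plus _ Hf), <- (II_plus _ Hf); auto using dom_plus, dom_scal.
    rewrite (II_ext _ (fun y => rho * ((S y * e y) * dirichlet (n + 2 * M) t y))) by (intros; unfold DT; ring).
    rewrite (II_scal _ weight_one).
    - rewrite (dirichlet_reproducing _ _ _ HSe). unfold rho. field. lra.
    - apply low_low_dom with (n + 2 * M)%nat (n + 2 * M)%nat; [exact HSe|apply dirichlet_low]. }
  assert (B1 : Rabs (II (fun y => e y * ((rho * S y - f y) * dirichlet n t y))) <= A * II (fun y => Rabs (e y) * (S y + f y))).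
  { rewrite <- (II_scal _ Hf) by auto. apply (II_abs_le _ Hf); auto using dom_scal.
    intros y Hy. rewrite Rabs_mult. specialize (HK n y Hy). fold rho in HK. pose proof (Rabs_pos (e y)). nra. }
  assert (B3 : Rabs (II (fun y => e y * S y * DT y)) <= INR (2 * M) * II (fun y => Rabs (e y) * (S y + f y))).
  { rewrite <- (II_scal _ Hf) by auto. apply (II_abs_le _ Hf); auto using dom_scal.
    intros y Hy. pose proof (fpos y Hy). pose proof (S_bound y).
    rewrite !Rabs_mult, (Rabs_pos_eq (S y)) by lra.
    pose proof (tail_kernel_bound n y) as TB. fold (DT y) in TB. pose proof (Rabs_pos (e y)).
    pose proof (Rabs_pos (DT y)).
    apply Rle_trans with (Rabs (e y) * S y * INR (2 * M)).
    + apply Rmult_le_compat_l; [apply Rmult_le_pos; lra|exact TB].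
    + assert (0 <= INR (2 * M) * (Rabs (e y) * f y)) by (repeat apply Rmult_le_pos; lra). lra. }
  rewrite <- (Rabs_pos_eq (f t)) by lra. rewrite <- Rabs_mult, E.
  eapply Rle_trans; [apply Rabs_triang|].
  pose proof (Rabs_triang (II (fun y => e y * ((rho * S y - f y) * dirichlet n t y))) (II (fun y => e y * f y * dirichlet n t y))).
  rewrite (Rabs_mult rho), (Rabs_pos_eq rho) by lra.
  set (X := II (fun y => Rabs (e y) * (S y + f y))) in *.
  set (Y := sqrt (II (fun y => e y ^ 2 * f y))) in *.
  assert (rho * Rabs (II (fun y => e y * S y * DT y)) <= rho * (INR (2 * M) * X)) by (apply Rmult_le_compat_l; lra).
  assert ((A + rho * INR (2 * M)) * X <= (A + rho * INR (2 * M)) * (sqrt V * Y)) by (apply Rmult_le_compat_l; nra).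
  nra.
Qed.

End Pointwise.

Lemma sin_sinn n y : sin y * sinn (S n) y = / 2 * cosn n y - / 2 * cosn (S (S n)) y.
Proof.
  rewrite cosn_rec, sinn_S, cosn_S. pose proof (sin2_cos2 y) as E. unfold Rsqr in E.
  replace (sin y * (sinn n y * cos y + cosn n y * sin y))
    with (sinn n y * sin y * cos y + cosn n y * (1 - cos y * cos y)) by (rewrite <- E; ring). field.
Qed.

(* Subtracting from [eta] the values at [t] costs only terms orthogonal to the kernel,
   or projected by it onto a single frequency, and removes the singularity at [t]. *)
Lemma oscillating_kernel_bound f t d :
  integrable_weight f -> 0 < t < PI -> 0 < d ->
  exists A, 0 <= A /\ forall (e : R) (eta : R -> Complex.C) n,
    (forall y, 0 < y < PI -> ccont eta y) ->
    dom f (fun y => Cmod (eta y)) ->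
    Cmod (eta t) <= e ->
    (forall y, Rabs (y - t) < d -> Cmod (eta y - eta t) <= e * Rabs (y - t)) ->
    II (fun y => Cmod (eta y)) <= e ->
    Rabs (II (fun y => Re (zn (S n) y * eta y)%C * dirichlet (S n) t y)) <= A * e.
Proof.
  intros Hf Ht Hd.
  destruct (cos_diff_lower t Ht) as [c [Hc Hcl]]. pose proof PI_RGT_0 as Hpi.
  assert (Hs : 0 < sin t) by (apply sin_gt_0; lra).
  assert (Hsi : 0 < / sin t) by now apply Rinv_0_lt_compat.
  assert (H2pi : 0 < 2 / PI) by (apply Rdiv_lt_0_compat; lra).
  set (q := 2 + / sin t).
  set (A0 := (2 / PI) / c * q + (2 / PI) / (c * d) * q).
  assert (Ha : 0 < (2 / PI) / c) by (now apply Rdiv_lt_0_compat).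
  assert (Hb : 0 < (2 / PI) / (c * d)) by (apply Rdiv_lt_0_compat; [lra|nra]).
  assert (Hq : 2 < q) by (unfold q; lra).
  assert (HA0 : 0 <= A0) by (unfold A0; nra).
  exists (A0 * (PI + 1) + / 2 * / sin t). split; [nra|].
  intros e eta n Hc1 Hdom He Hl HI.
  assert (He0 : 0 <= e) by (eapply Rle_trans; [apply Cmod_ge_0|exact He]).
  (* The imaginary part is corrected by a multiple of [sin y] and not by a constant, because
     [sin y * sinn (S n) y] is a cosine polynomial. *)
  set (a := Re (eta t)). set (b := Im (eta t) / sin t).
  assert (Hab : Rabs a <= e) by (eapply Rle_trans; [apply re_le_Cmod|exact He]).
  assert (Hbb : Rabs b <= e * / sin t).
  { unfold b, Rdiv. rewrite Rabs_mult, (Rabs_pos_eq (/ sin t)) by lra.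
    apply Rmult_le_compat_r; [lra|]. eapply Rle_trans; [apply im_le_Cmod|exact He]. }
  set (K := dirichlet (S n) t). assert (KL : low (S n) K) by apply dirichlet_low.
  assert (Kc : forall y, continuous K y) by now apply low_cont with (S n).
  set (w := fun y => (cosn (S n) y * (Re (eta y) - a) - sinn (S n) y * (Im (eta y) - b * sin y)) * K y).
  assert (wb : forall y, 0 < y < PI -> Rabs (w y) <= A0 * (e + Cmod (eta y))).
  { intros y Hy. unfold w. rewrite Rabs_mult.
    assert (B1 : Rabs (cosn (S n) y * (Re (eta y) - a) - sinn (S n) y * (Im (eta y) - b * sin y))
              <= Rabs (Re (eta y) - a) + Rabs (Im (eta y) - b * sin y)).
    { eapply Rle_trans; [apply Rabs_triang|]. rewrite Rabs_Ropp, !Rabs_mult.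
      pose proof (cosn_bound (S n) y). pose proof (sinn_bound (S n) y).
      pose proof (Rabs_pos (Re (eta y) - a)). pose proof (Rabs_pos (Im (eta y) - b * sin y)). nra. }
    pose proof (dirichlet_CD_bound (S n) t y) as CD. fold K in CD. specialize (Hcl y Hy).
    set (k := Rabs (K y)) in *. assert (Hk : 0 <= k) by apply Rabs_pos.
    set (r := Rabs (y - t)) in *. assert (Hr : 0 <= r) by apply Rabs_pos.
    pose proof (Cmod_ge_0 (eta y)) as Hm.
    set (X := Rabs (Re (eta y) - a) + Rabs (Im (eta y) - b * sin y)) in *.
    apply Rle_trans with (X * k); [now apply Rmult_le_compat_r|].
    assert (CD' : r * k <= (2 / PI) / c).
    { apply (proj1 (Rle_div_r _ _ c Hc)). nra. }
    destruct (Rlt_dec r d) as [N|N].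
    - specialize (Hl y N). fold r in Hl.
      assert (X <= q * e * r).
      { unfold X, q.
        assert (Rabs (Re (eta y) - a) <= e * r).
        { eapply Rle_trans; [|exact Hl]. eapply Rle_trans; [|apply re_le_Cmod]. right. reflexivity. }
        assert (Rabs (Im (eta y) - b * sin y) <= e * r + e * / sin t * r).
        { replace (Im (eta y) - b * sin y) with (Im (eta y - eta t)%C + b * (sin t - sin y)).
          2:{ unfold b. simpl. unfold Im. field. lra. }
          eapply Rle_trans; [apply Rabs_triang|]. apply Rplus_le_compat.
          - eapply Rle_trans; [apply im_le_Cmod|exact Hl].
          - rewrite Rabs_mult. apply Rmult_le_compat; auto using Rabs_pos.
            unfold r. rewrite (Rabs_minus_sym y t). apply sin_lip. }
        lra. }
      apply Rle_trans with (q * e * (r * k)); [nra|].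
      apply Rle_trans with (q * e * ((2 / PI) / c)); [apply Rmult_le_compat_l; nra|].
      unfold A0. assert (0 <= (2 / PI) / c * q * Cmod (eta y)) by (apply Rmult_le_pos; nra).
      assert (0 <= (2 / PI) / (c * d) * q * (e + Cmod (eta y))) by (apply Rmult_le_pos; nra). lra.
    - apply Rnot_lt_le in N.
      assert (k <= (2 / PI) / (c * d)).
      { apply (proj1 (Rle_div_r _ _ (c * d) ltac:(nra))).
        assert (c * d <= c * r) by nra. nra. }
      assert (X <= q * (e + Cmod (eta y))).
      { unfold X, q.
        assert (Rabs (Re (eta y) - a) <= Cmod (eta y) + e).
        { eapply Rle_trans; [apply Rabs_triang|]. rewrite Rabs_Ropp. pose proof (re_le_Cmod (eta y)). lra. }
        assert (Rabs (Im (eta y) - b * sin y) <= Cmod (eta y) + e * / sin t).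
        { eapply Rle_trans; [apply Rabs_triang|]. rewrite Rabs_Ropp, Rabs_mult. pose proof (im_le_Cmod (eta y)).
          assert (Rabs (sin y) <= 1) by (apply Rabs_le; pose proof (SIN_bound y); lra).
          pose proof (Rabs_pos b). pose proof (Rabs_pos (sin y)). nra. }
        nra. }
      apply Rle_trans with (q * (e + Cmod (eta y)) * ((2 / PI) / (c * d))).
      + apply Rmult_le_compat; auto. unfold X. apply Rplus_le_le_0_compat; apply Rabs_pos.
      + unfold A0. assert (0 <= (2 / PI) / c * q * (e + Cmod (eta y))) by (apply Rmult_le_pos; nra). lra. }
  assert (wc : forall y, 0 < y < PI -> continuous w y).
  { intros y Hy. unfold w. destruct (Hc1 y Hy) as [C1 C2].
    pose proof (cosn_cont (S n) y). pose proof (sinn_cont (S n) y).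
    apply cont_mult; [|apply Kc]. apply cont_minus; (apply cont_mult; [assumption|]).
    - apply cont_minus; [exact C1|cont].
    - apply cont_minus; [exact C2|]. apply cont_mult; [cont|apply continuous_sin]. }
  assert (Wd : dom f (fun y => A0 * (e + Cmod (eta y)))).
  { apply dom_scal, dom_plus; [|exact Hdom]. apply (dom_bounded _ Hf _ e); [intros; cont|].
    intros. rewrite Rabs_pos_eq; lra. }
  assert (wd : dom f w).
  { apply (dom_dominated _ _ _ wc Wd). exists 1. intros y Hy.
    rewrite Rmult_1_l. eapply Rle_trans; [now apply wb|apply Rle_abs]. }
  assert (D1 : dom f (fun y => cosn (S n) y * K y)).
  { destruct (low_bounded _ _ KL) as [B HB]. apply (dom_bounded _ Hf _ B).
    - intros. apply cont_mult; [apply cosn_cont|apply Kc].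
    - intros. rewrite Rabs_mult. pose proof (cosn_bound (S n) y). specialize (HB y).
      pose proof (Rabs_pos (cosn (S n) y)). pose proof (Rabs_pos (K y)). nra. }
  assert (D2 : dom f (fun y => sin y * sinn (S n) y * K y)).
  { destruct (low_bounded _ _ KL) as [B HB]. apply (dom_bounded _ Hf _ B).
    - intros. apply cont_mult; [|apply Kc]. apply cont_mult; [apply continuous_sin|apply sinn_cont].
    - intros. rewrite !Rabs_mult. pose proof (sinn_bound (S n) y). specialize (HB y).
      assert (Rabs (sin y) <= 1) by (apply Rabs_le; pose proof (SIN_bound y); lra).
      pose proof (Rabs_pos (sinn (S n) y)). pose proof (Rabs_pos (K y)). pose proof (Rabs_pos (sin y)).
      assert (Rabs (sin y) * Rabs (sinn (S n) y) <= 1) by nra. nra. }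
  assert (E1 : II (fun y => cosn (S n) y * K y) = 0).
  { rewrite (II_ext _ (fun y => K y * cosn (S n) y)) by (intros; ring).
    now apply II_low_cosn with (S n). }
  assert (E2 : II (fun y => sin y * sinn (S n) y * K y) = / 2 * cosn n t).
  { rewrite (II_ext _ (fun y => / 2 * (cosn n y * K y) - / 2 * (K y * cosn (S (S n)) y)))
      by (intros; rewrite sin_sinn; ring).
    assert (Ln : low (S n) (cosn n)) by (apply low_cosn; lia).
    assert (X1 : dom (fun _ => 1) (fun y => cosn n y * K y)) by now apply low_low_dom with (S n) (S n).
    assert (X2 : dom (fun _ => 1) (fun y => K y * cosn (S (S n)) y)) by now apply low_cosn_dom with (S n).
    rewrite (II_minus _ weight_one) by now apply dom_scal.
    rewrite !(II_scal _ weight_one) by assumption.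
    unfold K at 1. rewrite (dirichlet_reproducing _ _ _ Ln), (II_low_cosn (S n)) by (auto; lia). ring. }
  rewrite (II_ext _ (fun y => w y + (a * (cosn (S n) y * K y) - b * (sin y * sinn (S n) y * K y)))).
  2:{ intros y _. unfold w, K. simpl. unfold Re, Im. destruct (eta y) as [u v]. simpl. ring. }
  rewrite (II_plus _ Hf), (II_minus _ Hf), !(II_scal _ Hf), E1, E2; auto using dom_scal, dom_minus.
  assert (Bw : Rabs (II w) <= A0 * (PI * e + II (fun y => Cmod (eta y)))).
  { assert (X : dom f (fun _ => e)).
    { apply (dom_bounded _ Hf _ e); [intros; cont|]. intros. rewrite Rabs_pos_eq; lra. }
    replace (A0 * (PI * e + II (fun y => Cmod (eta y)))) with (II (fun y => A0 * (e + Cmod (eta y)))).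
    - apply (II_abs_le _ Hf); auto.
    - rewrite (II_scal _ Hf) by now apply dom_plus. rewrite (II_plus _ Hf) by assumption.
      rewrite (II_ext (fun _ => e) (fun _ => e * 1)) by (intros; ring).
      rewrite (II_scal _ weight_one), (II_one _ weight_one).
      + ring.
      + apply (bounded_dom (fun _ => 1) 1); intros; [cont|rewrite Rabs_R1; lra]. }
  eapply Rle_trans; [apply Rabs_triang|].
  assert (Rabs (a * 0 - b * (/ 2 * cosn n t)) <= / 2 * / sin t * e).
  { replace (a * 0 - b * (/ 2 * cosn n t)) with (- (b * (/ 2 * cosn n t))) by ring.
    rewrite Rabs_Ropp, !Rabs_mult, (Rabs_pos_eq (/ 2)) by lra. pose proof (cosn_bound n t).
    pose proof (Rabs_pos b). pose proof (Rabs_pos (cosn n t)). nra. }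
  assert (A0 * II (fun y => Cmod (eta y)) <= A0 * e) by (apply Rmult_le_compat_l; lra). nra.
Qed.

Lemma deg_sub n a u v : deg n a u -> deg n a v -> low n (fun y => u y - v y).
Proof.
  intros [p [Hp Hu]] [q [Hq Hv]]. apply low_ext with (fun y => p y - q y); [intros; rewrite Hu, Hv; ring|].
  now apply low_minus.
Qed.
Lemma deg_scal n c a u : deg n a u -> deg n (c * a) (fun y => c * u y).
Proof.
  intros [p [Hp Hu]]. exists (fun y => c * p y). split; [now apply low_scal|]. intros; rewrite Hu; ring.
Qed.

Lemma PI_gt_3 : 3 < PI.
Proof. pose proof PI2_3_2. lra. Qed.

(** Here [s] is a ratio of leading coefficients, [q] the squared norm of the trial polynomial and
    [s ^ 2 * q - 1] that of the remainder. The norm bound from above and the dual bound squeeze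
    [v = PI / 2 * s ^ 2] between [1 / (1 + e)] and [(1 + e) / (1 - e)^2]. *)
Lemma scale_estimates e s k q :
  0 < e <= / 4 -> 0 < s -> 1 - e <= k -> 0 <= s ^ 2 * q - 1 -> q <= (PI + 2 * e) / 2 ->
  (PI / 2 * (s * k)) ^ 2 <= (PI + 2 * e) / 2 ->
  s ^ 2 * q - 1 <= 8 * e /\ s <= 2 /\ Rabs (s - sqrt (2 / PI)) <= 16 * e.
Proof.
  intros He Hs Hk Hq0 Hq HX. pose proof PI_gt_3 as Hpi. pose proof PI_4 as Hpi4.
  set (v := PI / 2 * s ^ 2).
  assert (H1 : v * (1 - e) ^ 2 <= 1 + e).
  { assert (A1 : s * (1 - e) <= s * k) by nra. assert (A2 : 0 <= s * (1 - e)) by nra.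
    assert (A3 : (s * (1 - e)) ^ 2 <= (s * k) ^ 2) by nra.
    assert (A4 : (PI / 2) ^ 2 * (s * (1 - e)) ^ 2 <= (PI + 2 * e) / 2).
    { eapply Rle_trans; [|exact HX]. rewrite (Rpow_mult_distr (PI / 2) (s * k)). apply Rmult_le_compat_l; [nra|exact A3]. }
    apply Rmult_le_reg_l with (PI / 2); [lra|].
    replace (PI / 2 * (v * (1 - e) ^ 2)) with ((PI / 2) ^ 2 * (s * (1 - e)) ^ 2) by (unfold v; field).
    nra. }
  assert (Hv : 0 <= v) by (unfold v; nra).
  assert (H2 : 1 <= v * (1 + e)).
  { assert (s ^ 2 * q <= s ^ 2 * ((PI + 2 * e) / 2)) by (apply Rmult_le_compat_l; nra).
    unfold v. assert (0 <= s ^ 2 * e * (PI / 2 - 1)) by (repeat apply Rmult_le_pos; nra). lra. }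
  assert (H3 : v * (1 + e) - 1 <= 8 * e).
  { apply Rmult_le_reg_r with ((1 - e) ^ 2); [nra|].
    assert (v * (1 - e) ^ 2 * (1 + e) <= (1 + e) * (1 + e)) by (apply Rmult_le_compat_r; lra).
    assert (0 <= e * (4 - 16 * e + 8 * e * e)) by (apply Rmult_le_pos; nra). nra. }
  assert (H4 : Rabs (s ^ 2 - 2 / PI) <= 8 * e).
  { replace (s ^ 2 - 2 / PI) with (2 / PI * (v - 1)) by (unfold v; field; lra).
    rewrite Rabs_mult, (Rabs_pos_eq (2 / PI)) by (apply Rlt_le, Rdiv_lt_0_compat; lra).
    assert (2 / PI <= 1) by (apply Rle_div_l; lra).
    assert (Rabs (v - 1) <= 8 * e) by (apply Rabs_le; split; nra).
    assert (0 < 2 / PI) by (apply Rdiv_lt_0_compat; lra).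
    pose proof (Rabs_pos (v - 1)). nra. }
  assert (H5 : / 2 <= sqrt (2 / PI)).
  { apply Rsqr_incr_0_var; [|apply sqrt_pos]. rewrite Rsqr_sqrt by (apply Rlt_le, Rdiv_lt_0_compat; lra).
    unfold Rsqr. apply (proj1 (Rle_div_r _ _ PI ltac:(lra))). lra. }
  assert (H6 : sqrt (2 / PI) ^ 2 = 2 / PI).
  { apply pow2_sqrt. apply Rlt_le, Rdiv_lt_0_compat; lra. }
  split; [|split].
  - assert (s ^ 2 * q <= s ^ 2 * ((PI + 2 * e) / 2)) by (apply Rmult_le_compat_l; nra).
    assert (s ^ 2 * ((PI + 2 * e) / 2) <= v * (1 + e)) by (unfold v; assert (0 <= s ^ 2 * e * (PI / 2 - 1)) by (repeat apply Rmult_le_pos; nra); lra). lra.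
  - apply Rabs_le_between in H4. assert (2 / PI <= 1) by (apply Rle_div_l; lra). nra.
  - rewrite <- H6 in H4. replace (s ^ 2 - sqrt (2 / PI) ^ 2) with ((s - sqrt (2 / PI)) * (s + sqrt (2 / PI))) in H4 by ring.
    rewrite Rabs_mult, (Rabs_pos_eq (s + _)) in H4 by lra. pose proof (Rabs_pos (s - sqrt (2 / PI))). nra.
Qed.

(** For given [e] the polynomial pair is fixed before [n] grows, so squares of oscillating functions
    may be replaced by their means. The remainder then has squared norm of order [e], which gives
    the rate [sqrt e]. *)
Theorem pointwise_asymptotics f P b M Cb t d L m0 w0 :
  integrable_weight f -> (forall n, 0 < b n) -> (forall n, deg n (b n) (P n)) ->
  (forall m n, II (fun y => P m y * P n y * f y) = if Nat.eqb m n then 1 else 0) ->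
  (forall y, 0 < y < PI -> sin y ^ (2 * M) * f y <= Cb) ->
  (forall y, 0 < y < PI -> sin y ^ (2 * M) <= Cb * f y) ->
  0 < t < PI -> 0 < d -> 0 < m0 ->
  (forall y, Rabs (y - t) < d -> 0 < y < PI /\ m0 <= f y /\ Rabs (f y - f t) <= L * Rabs (y - t)) ->
  (forall e, 0 < e -> exists l1 l2, szego_pair f M t d w0 e l1 l2) ->
  is_lim_seq (fun n => P n t - sqrt (2 / PI) * Re (zn n t * Cconj w0)%C) 0.
Proof.
  intros Hf Hb HP Horth HMf HMi Ht Hd Hm0 Hnear Hex.
  destruct (remainder_bound f Hf M Cb HMi t d L m0 Ht Hd Hnear Hm0) as [A [HA RB]].
  destruct (oscillating_kernel_bound f t d Hf Ht Hd) as [A' [HA' OB]].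
  pose proof PI_gt_3 as Hpi. pose proof (proj1 (proj2 Hf)) as fpos. pose proof (proj1 Hf) as fcont.
  pose proof (fpos t Ht) as Ft.
  set (K := (3 * A + 2 * A') / f t + 2 + 16 * Cmod w0).
  assert (HK : 2 <= K).
  { unfold K. pose proof (Cmod_ge_0 w0). assert (0 <= (3 * A + 2 * A') / f t) by (apply Rdiv_le_0_compat; lra). lra. }
  set (c0 := sqrt (2 / PI)).
  assert (Hc0 : 0 <= c0 <= 1).
  { split; [apply sqrt_pos|]. unfold c0. rewrite <- sqrt_1. apply sqrt_le_1_alt. apply Rle_div_l; lra. }
  assert (Main : forall e, 0 < e <= / 4 -> exists N, forall n, (N <= n)%nat ->
    Rabs (P n t - c0 * Re (zn n t * Cconj w0)%C) <= K * sqrt e).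
  { intros e He. destruct (Hex e (proj1 He)) as [l1 [l2 Hpair]].
    unfold szego_pair in Hpair. set (lR := lmul (lsin M) l1) in *. set (lg := lmul (lsin M) l2) in *.
    destruct Hpair as (p1 & p2 & p3 & p4 & p5 & p6 & p7 & p8 & p9).
    assert (hR : hd 0 lR = hd 0 l1) by (unfold lR; rewrite hd_lmul, hd_lsin; ring).
    assert (hg : hd 0 lg = hd 0 l2) by (unfold lg; rewrite hd_lmul, hd_lsin; ring).
    destruct (ev_bounded l1) as [B1 [HB1 HB1']]. destruct (ev_bounded l2) as [B2 [HB2 HB2']].
    assert (R1 : forall y, Cmod (ev lR y) ^ 2 = 4 ^ M * sin y ^ (2 * M) * Cmod (ev l1 y) ^ 2).
    { intros y. unfold lR. rewrite ev_lmul, Cmod_mult, Rpow_mult_distr, lsin_mod. reflexivity. }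
    assert (G1 : forall y, Cmod (ev lg y) ^ 2 = 4 ^ M * sin y ^ (2 * M) * Cmod (ev l2 y) ^ 2).
    { intros y. unfold lg. rewrite ev_lmul, Cmod_mult, Rpow_mult_distr, lsin_mod. reflexivity. }
    assert (H4M : 0 < 4 ^ M) by (apply pow_lt; lra).
    assert (Spos : forall y, 0 < y < PI -> 0 < sin y ^ (2 * M)).
    { intros y Hy. apply pow_lt, sin_gt_0; lra. }
    assert (LQ : is_lim_seq (fun n => II (fun y => hconj n lR y ^ 2 * f y)) (/ 2 * II (fun y => Cmod (ev lR y) ^ 2 * f y))).
    { rewrite (II_ext (fun y => Cmod (ev lR y) ^ 2 * f y) (fun y => Cmod (Cconj (ev lR y)) ^ 2 * f y))
        by (intros; now rewrite Cmod_conj).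
      apply (osc_square_lim (fun y => Cconj (ev lR y)) f (4 ^ M * Cb * B1 ^ 2)); auto.
      - intros; apply ccont_conj, ccont_ev.
      - intros; apply Rlt_le; auto.
      - intros y Hy. rewrite Cmod_conj, R1.
        replace (4 ^ M * sin y ^ (2 * M) * Cmod (ev l1 y) ^ 2 * f y)
          with (4 ^ M * (sin y ^ (2 * M) * f y) * Cmod (ev l1 y) ^ 2) by ring.
        pose proof (fpos y Hy). pose proof (Spos y Hy). pose proof (HMf y Hy).
        apply Rmult_le_compat; try (apply Rmult_le_compat_l; lra); try apply pow2_ge_0.
        + apply Rmult_le_pos; [lra|nra].
        + apply pow_incr. split; [apply Cmod_ge_0|apply HB1']. }
    assert (LG : is_lim_seq (fun n => II (fun y => hpol n lg y ^ 2 * / f y)) (/ 2 * II (fun y => Cmod (ev lg y) ^ 2 * / f y))).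
    { apply (osc_square_lim (ev lg) (fun y => / f y) (4 ^ M * Cb * B2 ^ 2)).
      - intros; apply ccont_ev.
      - intros y Hy. apply cont_inv; [auto|]. apply Rgt_not_eq, fpos; exact Hy.
      - intros y Hy. left. apply Rinv_0_lt_compat; auto.
      - intros y Hy. rewrite G1. pose proof (fpos y Hy). pose proof (Spos y Hy). pose proof (HMi y Hy).
        apply Rle_div_l; [lra|].
        replace (4 ^ M * Cb * B2 ^ 2 * f y) with (4 ^ M * (Cb * f y) * B2 ^ 2) by ring.
        apply Rmult_le_compat; try (apply Rmult_le_compat_l; lra); try apply pow2_ge_0.
        + apply Rmult_le_pos; lra.
        + apply pow_incr. split; [apply Cmod_ge_0|apply HB2']. }
    set (X := (PI + 2 * e) / 2).
    assert (EQ : exists N, forall n, (N <= n)%nat -> II (fun y => hconj n lR y ^ 2 * f y) <= X).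
    { destruct (LQ (fun z => z <= X)) as [N HN]; [|exists N; exact HN].
      exists (mkposreal (e / 2) ltac:(lra)). intros z Hz.
      change (Rabs (z - / 2 * II (fun y => Cmod (ev lR y) ^ 2 * f y)) < e / 2) in Hz. apply Rabs_def2 in Hz.
      unfold X. lra. }
    assert (EG : exists N, forall n, (N <= n)%nat -> II (fun y => hpol n lg y ^ 2 * / f y) <= X).
    { destruct (LG (fun z => z <= X)) as [N HN]; [|exists N; exact HN].
      exists (mkposreal (e / 2) ltac:(lra)). intros z Hz.
      change (Rabs (z - / 2 * II (fun y => Cmod (ev lg y) ^ 2 * / f y)) < e / 2) in Hz. apply Rabs_def2 in Hz.
      unfold X. lra. }
    destruct EQ as [N1 HN1]. destruct EG as [N2 HN2].
    exists (S (N1 + N2 + length lR)). intros n Hn.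
    specialize (HN1 n ltac:(lia)). specialize (HN2 n ltac:(lia)).
    pose proof (Hb n) as Hbn. pose proof (HP n) as HPn.
    assert (HQ : deg n (hd 0 lR) (hconj n lR)) by (apply hconj_deg; lia).
    pose proof (deg_low _ _ _ HPn) as PL. pose proof (deg_low _ _ _ HQ) as QL.
    (* Equalizes the leading coefficients, so that the remainder [en] has degree below [n]. *)
    set (s := b n / hd 0 lR). assert (Hs : 0 < s) by (unfold s; rewrite hR; now apply Rdiv_lt_0_compat).
    set (en := fun y => P n y - s * hconj n lR y).
    assert (Len : low n en).
    { apply deg_sub with (b n); [exact HPn|]. replace (b n) with (s * hd 0 lR) by (unfold s; rewrite hR; field; lra).
      now apply deg_scal. }
    (* lower bound for the norm of monic polynomials, by duality against [hpol n lg] *)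
    assert (CS : (PI / 2 * (s * (hd 0 l1 * hd 0 l2))) ^ 2 <= X).
    { assert (E : II (fun y => P n y * hpol n lg y) = PI / 2 * (s * (hd 0 l1 * hd 0 l2))).
      { rewrite (II_deg_hpol n (b n)), hg by (auto; lia). unfold s. rewrite hR. field. lra. }
      rewrite <- E.
      assert (fs : forall y, 0 < y < PI -> 0 < sqrt (f y)) by (intros; now apply sqrt_lt_R0, fpos).
      assert (Pc : forall y, continuous (P n) y) by now apply low_cont with (S n).
      assert (hc : forall y, continuous (hpol n lg) y).
      { intros y. exact (proj1 (ccont_mult (zn n) (ev lg) y (ccont_zn n y) (ccont_ev lg y))). }
      assert (sc : forall y, 0 < y < PI -> continuous (fun y => sqrt (f y)) y) by (intros; cont).
      assert (hb : forall y, hpol n lg y ^ 2 <= Cmod (ev lg y) ^ 2).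
      { intros y. rewrite <- (Rmult_1_l (Cmod (ev lg y))), <- (Cmod_zn n y), <- Cmod_mult, <- (pow2_abs (hpol n lg y)).
        apply pow_incr. split; [apply Rabs_pos|apply re_le_Cmod]. }
      assert (X1 : forall y, 0 < y < PI -> (P n y * sqrt (f y)) ^ 2 = P n y * P n y * f y).
      { intros y Hy. pose proof (fpos y Hy). rewrite Rpow_mult_distr, pow2_sqrt by lra. ring. }
      assert (X2 : forall y, 0 < y < PI -> (hpol n lg y / sqrt (f y)) ^ 2 = hpol n lg y ^ 2 * / f y).
      { intros y Hy. pose proof (fpos y Hy). unfold Rdiv. rewrite Rpow_mult_distr, pow_inv, pow2_sqrt by lra. reflexivity. }
      assert (X3 : forall y, 0 < y < PI -> P n y * sqrt (f y) * (hpol n lg y / sqrt (f y)) = P n y * hpol n lg y).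
      { intros y Hy. pose proof (fs y Hy). field. lra. }
      assert (D1 : dom f (fun y => (P n y * sqrt (f y)) ^ 2)).
      { apply (dom_dominated _ _ (fun y => P n y * P n y * f y)).
        - intros; cont.
        - apply (low_low_f_dom f Hf (S n) (S n)); exact PL.
        - exists 1. intros y Hy. rewrite X1, Rmult_1_l by auto. lra. }
      assert (D2 : dom f (fun y => (hpol n lg y / sqrt (f y)) ^ 2)).
      { apply (dom_bounded _ Hf _ (4 ^ M * Cb * B2 ^ 2)).
        - intros y Hy. apply cont_pow, cont_div; auto. apply Rgt_not_eq, fs; exact Hy.
        - intros y Hy. rewrite Rabs_pos_eq by apply pow2_ge_0. rewrite X2 by auto.
          pose proof (fpos y Hy). pose proof (Spos y Hy). pose proof (HMi y Hy).
          apply Rle_div_l; [lra|]. eapply Rle_trans; [apply hb|]. rewrite G1.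
          replace (4 ^ M * Cb * B2 ^ 2 * f y) with (4 ^ M * (Cb * f y) * B2 ^ 2) by ring.
          apply Rmult_le_compat; try (apply Rmult_le_compat_l; lra); try apply pow2_ge_0.
          + apply Rmult_le_pos; lra.
          + apply pow_incr. split; [apply Cmod_ge_0|apply HB2']. }
      assert (D3 : dom f (fun y => P n y * sqrt (f y) * (hpol n lg y / sqrt (f y)))).
      { destruct (low_bounded _ _ PL) as [BP HBP]. destruct (ev_bounded lg) as [Bg [HBg HBg']].
        apply (dom_bounded _ Hf _ (BP * Bg)).
        - intros y Hy. apply cont_mult; [cont|]. apply cont_div; auto. apply Rgt_not_eq, fs; exact Hy.
        - intros y Hy. rewrite X3, Rabs_mult by auto. apply Rmult_le_compat; auto using Rabs_pos.
          eapply Rle_trans; [apply re_le_Cmod|]. rewrite Cmod_mult, Cmod_zn, Rmult_1_l. apply HBg'. }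
      pose proof (II_cauchy_schwarz _ Hf _ _ D1 D2 D3) as Q. cbv beta in Q.
      rewrite (II_ext _ _ X1), (II_ext _ _ X2), (II_ext _ _ X3), Horth, Nat.eqb_refl in Q. lra. }
    (* By orthogonality the inner product of [P n] with [s * hconj n lR] is [s * hd 0 lR / b n = 1],
       so the expansion is [1 - 2 + s ^ 2 * q]. *)
    assert (EE : II (fun y => en y ^ 2 * f y) = s ^ 2 * II (fun y => hconj n lR y ^ 2 * f y) - 1).
    { rewrite (II_ext _ (fun y => (P n y * P n y * f y - 2 * s * (P n y * hconj n lR y * f y))
        + s ^ 2 * (hconj n lR y * hconj n lR y * f y))) by (intros; unfold en; ring).
      assert (D1 := low_low_f_dom f Hf (S n) (S n) _ _ PL PL).
      assert (D2 := low_low_f_dom f Hf (S n) (S n) _ _ PL QL).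
      assert (D3 := low_low_f_dom f Hf (S n) (S n) _ _ QL QL).
      rewrite (II_plus _ Hf), (II_minus _ Hf), !(II_scal _ Hf); auto using dom_scal, dom_minus.
      rewrite Horth, Nat.eqb_refl, (orth_deg f Hf P b Hb HP Horth n (hd 0 lR)) by exact HQ.
      rewrite (II_ext (fun y => hconj n lR y ^ 2 * f y) (fun y => hconj n lR y * hconj n lR y * f y)) by (intros; ring).
      unfold s. rewrite hR. field. lra. }
    assert (EE0 : 0 <= II (fun y => en y ^ 2 * f y)).
    { apply (II_ge_0 _ Hf).
      - apply dom_ext with (fun y => en y * en y * f y); [intros; ring|]. now apply (low_low_f_dom f Hf n n).
      - intros y Hy. pose proof (fpos y Hy). pose proof (pow2_ge_0 (en y)). nra. }
    destruct (scale_estimates e s (hd 0 l1 * hd 0 l2) _ He Hs p3 ltac:(rewrite <- EE; exact EE0) HN1 CS) as [S1 [S2 S3]].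
    rewrite <- EE in S1.
    (* [P n] is orthogonal to the kernel, which has lower degree. So is [hpol n lg], for the measure
       [dy]; subtracting it turns [hconj n lR * f] into the real part of [zn n * eta]. *)
    assert (Tb : Rabs (II (fun y => en y * f y * dirichlet n t y)) <= 2 * (A' * e)).
    { set (eta := defect f lR lg).
      assert (KL : low n (dirichlet n t)) by apply dirichlet_low.
      assert (KL' : low (S n) (dirichlet n t)) by now apply low_weaken1.
      assert (E : II (fun y => en y * f y * dirichlet n t y) = - s * II (fun y => Re (zn n y * eta y)%C * dirichlet n t y)).
      { rewrite (II_ext _ (fun y => P n y * dirichlet n t y * f y + (- s) * (hconj n lR y * dirichlet n t y * f y)))
          by (intros; unfold en; ring).
        assert (D1 := low_low_f_dom f Hf (S n) (S n) _ _ PL KL').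
        assert (D2 := low_low_f_dom f Hf (S n) (S n) _ _ QL KL').
        rewrite (II_plus _ Hf), !(II_scal _ Hf); auto using dom_scal.
        rewrite (orth_low f Hf P b Hb HP Horth n) by auto.
        rewrite (II_ext (fun y => Re (zn n y * eta y)%C * dirichlet n t y)
          (fun y => hconj n lR y * dirichlet n t y * f y - dirichlet n t y * hpol n lg y)).
        - rewrite (II_minus _ Hf), (II_low_hpol n _ n lg KL (le_n n)).
          + ring.
          + exact D2.
          + destruct (hpol_low_dom n (dirichlet n t) n lg KL) as [dc [C HC]].
            apply (dom_bounded _ Hf _ (C * (1 + 1))); auto.
        - intros y _. unfold eta, defect, hconj, hpol. destruct (ev lR y), (ev lg y). unfold zn. simpl. ring. }
      rewrite E, Rabs_mult, Rabs_Ropp, (Rabs_pos_eq s) by lra.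
      assert (Rabs (II (fun y => Re (zn n y * eta y)%C * dirichlet n t y)) <= A' * e).
      { destruct n as [|n']; [lia|].
        assert (ec : forall y, 0 < y < PI -> ccont eta y).
        { intros y Hy. unfold eta, defect. apply ccont_minus; [|apply ccont_ev].
          apply ccont_mult; [apply ccont_conj, ccont_ev|apply ccont_real; auto]. }
        apply OB; auto. split.
        - intros; apply ccont_mod; auto.
        - destruct (ev_bounded lR) as [b1 [Hb1 Hb1']]. destruct (ev_bounded lg) as [b2 [Hb2 Hb2']].
          exists (b1 + b2). intros y Hy. rewrite Rabs_pos_eq by apply Cmod_ge_0. pose proof (fpos y Hy).
          unfold eta, defect. eapply Rle_trans; [apply Cmod_triangle|].
          rewrite Cmod_opp, Cmod_mult, Cmod_conj, Cmod_R, (Rabs_pos_eq (f y)) by lra.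
          specialize (Hb1' y). specialize (Hb2' y). nra. }
      apply Rmult_le_compat; try lra. apply Rabs_pos. }
    pose proof (RB n en Len) as RBn.
    assert (Sq : sqrt (II (fun y => en y ^ 2 * f y)) <= 3 * sqrt e).
    { apply Rle_trans with (sqrt (3 ^ 2 * e)); [apply sqrt_le_1_alt; lra|].
      rewrite sqrt_mult_alt, sqrt_pow2 by lra. lra. }
    assert (Se : e <= sqrt e).
    { assert (0 <= sqrt e <= 1).
      { split; [apply sqrt_pos|]. rewrite <- sqrt_1. apply sqrt_le_1_alt. lra. }
      rewrite <- (sqrt_sqrt e) at 1 by lra. nra. }
    assert (F1 : Rabs (en t) <= (3 * A + 2 * A') / f t * sqrt e).
    { replace ((3 * A + 2 * A') / f t * sqrt e) with ((3 * A + 2 * A') * sqrt e / f t) by (field; lra).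
      apply (proj1 (Rle_div_r _ _ (f t) Ft)). pose proof (sqrt_pos e).
      assert (A * sqrt (II (fun y => en y ^ 2 * f y)) <= A * (3 * sqrt e)) by (apply Rmult_le_compat_l; lra).
      assert (A' * e <= A' * sqrt e) by (apply Rmult_le_compat_l; lra). lra. }
    assert (F2 : Rabs (hconj n lR t - Re (zn n t * Cconj w0)%C) <= e).
    { unfold hconj. replace (Re (zn n t * Cconj (ev lR t))%C - Re (zn n t * Cconj w0)%C)
        with (Re (zn n t * Cconj (ev lR t - w0))%C).
      - eapply Rle_trans; [apply re_le_Cmod|]. rewrite Cmod_mult, Cmod_zn, Cmod_conj. lra.
      - destruct (ev lR t), w0. unfold zn. simpl. ring. }
    assert (F3 : Rabs (Re (zn n t * Cconj w0)%C) <= Cmod w0).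
    { eapply Rle_trans; [apply re_le_Cmod|]. rewrite Cmod_mult, Cmod_zn, Cmod_conj. lra. }
    replace (P n t - c0 * Re (zn n t * Cconj w0)%C)
      with (en t + (s * (hconj n lR t - Re (zn n t * Cconj w0)%C) + (s - c0) * Re (zn n t * Cconj w0)%C))
      by (unfold en; ring).
    eapply Rle_trans; [apply Rabs_triang|].
    eapply Rle_trans; [apply Rplus_le_compat_l, Rabs_triang|]. rewrite !Rabs_mult, (Rabs_pos_eq s) by lra.
    assert (s * Rabs (hconj n lR t - Re (zn n t * Cconj w0)%C) <= 2 * sqrt e).
    { apply Rmult_le_compat; try lra. apply Rabs_pos. }
    assert (Rabs (s - c0) * Rabs (Re (zn n t * Cconj w0)%C) <= 16 * sqrt e * Cmod w0).
    { apply Rmult_le_compat; try apply Rabs_pos; auto. unfold c0. lra. }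
    unfold K. nra. }
  apply is_lim_seq_spec. intros eps. 
  set (e := Rmin (/ 4) ((eps / (2 * K)) ^ 2)).
  assert (Hek : 0 < eps / (2 * K)) by (apply Rdiv_lt_0_compat; [apply cond_pos|lra]).
  assert (He : 0 < e <= / 4).
  { split; [|apply Rmin_l]. apply Rmin_glb_lt; [lra|]. now apply pow_lt. }
  destruct (Main e He) as [N HN]. exists N. intros n Hn. specialize (HN n Hn).
  rewrite Rminus_0_r. eapply Rle_lt_trans; [exact HN|].
  assert (sqrt e <= eps / (2 * K)).
  { rewrite <- (sqrt_pow2 (eps / (2 * K))) by lra. apply sqrt_le_1_alt. apply Rmin_r. }
  apply Rle_lt_trans with (K * (eps / (2 * K))); [apply Rmult_le_compat_l; lra|].
  replace (K * (eps / (2 * K))) with (eps / 2) by (field; lra). pose proof (cond_pos eps). lra.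
Qed.

(** * Complex exponential and logarithms *)

Definition cexp (w : Complex.C) : Complex.C := (exp (Re w) * cos (Im w), exp (Re w) * sin (Im w)).

Lemma cexp_plus v w : cexp (v + w) = (cexp v * cexp w)%C.
Proof.
  unfold cexp. destruct v as [a b], w as [c d]. apply injective_projections; simpl;
    rewrite exp_plus, ?cos_plus, ?sin_plus; ring.
Qed.
Lemma Cmod_cexp w : Cmod (cexp w) = exp (Re w).
Proof.
  assert (E : cexp w = (RtoC (exp (Re w)) * ei (Im w))%C).
  { unfold cexp, ei. apply injective_projections; simpl; ring. }
  rewrite E, Cmod_mult, Cmod_ei, Cmod_R, Rabs_pos_eq; [ring|]. apply Rlt_le, exp_pos.
Qed.
Lemma cexp_R a : cexp (RtoC a) = RtoC (exp a).
Proof. unfold cexp, RtoC. simpl. rewrite cos_0, sin_0. apply injective_projections; simpl; ring. Qed.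
Lemma cexp_conj w : cexp (Cconj w) = Cconj (cexp w).
Proof.
  unfold cexp. destruct w as [a b]. apply injective_projections; simpl; rewrite ?cos_neg, ?sin_neg; ring.
Qed.
Lemma cexp_opp w : (cexp w * cexp (- w))%C = RtoC 1.
Proof.
  rewrite <- cexp_plus. replace (w + - w)%C with (RtoC 0) by ring. now rewrite cexp_R, exp_0.
Qed.
Lemma ccont_cexp F x : ccont F x -> ccont (fun y => cexp (F y)) x.
Proof.
  intros [A B]. unfold cexp. split; cbn [Re Im fst snd];
    (apply cont_mult; [now apply cont_exp|]); [now apply cont_cos|now apply cont_sin].
Qed.

(** Componentwise derivative in a real parameter; the calculus below applies it along arcs of the
    circle and along segments in the plane. *)
Definition cder (F : R -> Complex.C) (s : R) (D : Complex.C) : Prop :=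
  is_derive (fun y => Re (F y)) s (Re D) /\ is_derive (fun y => Im (F y)) s (Im D).

Lemma der_mult (u v : R -> R) (s a b : R) :
  is_derive u s a -> is_derive v s b -> is_derive (fun y => u y * v y) s (a * v s + u s * b).
Proof.
  intros Hu Hv. apply is_derive_Reals. apply is_derive_Reals in Hu, Hv.
  exact (derivable_pt_lim_mult u v s a b Hu Hv).
Qed.
Lemma der_plus (u v : R -> R) (s a b : R) :
  is_derive u s a -> is_derive v s b -> is_derive (fun y => u y + v y) s (a + b).
Proof. intros Hu Hv. exact (is_derive_plus u v s a b Hu Hv). Qed.
Lemma der_minus (u v : R -> R) (s a b : R) :
  is_derive u s a -> is_derive v s b -> is_derive (fun y => u y - v y) s (a - b).
Proof. intros Hu Hv. exact (is_derive_minus u v s a b Hu Hv). Qed.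
Lemma der_opp (u : R -> R) (s a : R) : is_derive u s a -> is_derive (fun y => - u y) s (- a).
Proof. intros Hu. exact (is_derive_opp u s a Hu). Qed.
Lemma der_const (c s : R) : is_derive (fun _ : R => c) s 0.
Proof. exact (is_derive_const c s). Qed.
Lemma der_comp (u v : R -> R) (s a b : R) :
  is_derive u (v s) a -> is_derive v s b -> is_derive (fun y => u (v y)) s (b * a).
Proof. intros Hu Hv. exact (is_derive_comp u v s a b Hu Hv). Qed.
Lemma der_eq (u : R -> R) (s a b : R) : is_derive u s a -> a = b -> is_derive u s b.
Proof. now intros H <-. Qed.

Lemma cder_eq F s D D' : cder F s D -> D = D' -> cder F s D'.
Proof. now intros H <-. Qed.
Lemma cder_ext F G s D : (forall y, F y = G y) -> cder F s D -> cder G s D.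
Proof.
  intros H [A B]. split; eapply is_derive_ext; try eassumption; intros; simpl; now rewrite H.
Qed.
Lemma cder_const c s : cder (fun _ => c) s (RtoC 0).
Proof. split; apply der_const. Qed.
Lemma cder_plus F G s D E : cder F s D -> cder G s E -> cder (fun y => (F y + G y)%C) s (D + E)%C.
Proof. intros [A B] [A' B']. split; [exact (der_plus _ _ _ _ _ A A')|exact (der_plus _ _ _ _ _ B B')]. Qed.
Lemma cder_opp F s D : cder F s D -> cder (fun y => (- F y)%C) s (- D)%C.
Proof. intros [A B]. split; [exact (der_opp _ _ _ A)|exact (der_opp _ _ _ B)]. Qed.
Lemma cder_minus F G s D E : cder F s D -> cder G s E -> cder (fun y => (F y - G y)%C) s (D - E)%C.
Proof. intros H H'. apply cder_plus; [exact H|now apply cder_opp]. Qed.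
Lemma cder_mult F G s D E :
  cder F s D -> cder G s E -> cder (fun y => (F y * G y)%C) s (D * G s + F s * E)%C.
Proof.
  intros [A B] [A' B']. split.
  - eapply der_eq; [exact (der_minus _ _ _ _ _ (der_mult _ _ _ _ _ A A') (der_mult _ _ _ _ _ B B'))|].
    destruct D, E, (F s), (G s). simpl. ring.
  - eapply der_eq; [exact (der_plus _ _ _ _ _ (der_mult _ _ _ _ _ A B') (der_mult _ _ _ _ _ B A'))|].
    destruct D, E, (F s), (G s). simpl. ring.
Qed.
Lemma cder_cexp F s D : cder F s D -> cder (fun y => cexp (F y)) s (D * cexp (F s))%C.
Proof.
  intros [A B].
  pose proof (der_comp exp _ _ _ _ (is_derive_exp _) A) as X.
  split.
  - eapply der_eq; [exact (der_mult _ _ _ _ _ X (der_comp cos _ _ _ _ (is_derive_cos _) B))|].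
    unfold cexp. destruct D, (F s). simpl. ring.
  - eapply der_eq; [exact (der_mult _ _ _ _ _ X (der_comp sin _ _ _ _ (is_derive_sin _) B))|].
    unfold cexp. destruct D, (F s). simpl. ring.
Qed.
Lemma cder_ei s : cder ei s (Ci * ei s)%C.
Proof.
  split.
  - apply (der_eq _ _ _ _ (is_derive_cos s)). unfold ei. simpl. ring.
  - apply (der_eq _ _ _ _ (is_derive_sin s)). unfold ei. simpl. ring.
Qed.
Lemma cder_affine v w s : cder (fun y => (v + RtoC y * w)%C) s w.
Proof.
  assert (H : cder RtoC s (RtoC 1)).
  { split; [exact (is_derive_id (K := R_AbsRing) s)|exact (der_const 0 s)]. }
  eapply cder_eq; [exact (cder_plus _ _ _ _ _ (cder_const v s) (cder_mult _ _ _ _ _ H (cder_const w s)))|].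
  cbv beta. ring.
Qed.

Lemma mvt_abs (u u' : R -> R) a b K :
  (forall s, Rmin a b <= s <= Rmax a b -> is_derive u s (u' s)) ->
  (forall s, Rmin a b <= s <= Rmax a b -> Rabs (u' s) <= K) ->
  Rabs (u b - u a) <= K * Rabs (b - a).
Proof.
  intros Hd Hb. destruct (MVT_gen u a b u') as [c [Hc E]].
  - intros x Hx. apply Hd. lra.
  - intros x Hx. apply continuity_pt_filterlim, (ex_derive_continuous u). exists (u' x). now apply Hd.
  - rewrite E, Rabs_mult. apply Rmult_le_compat_r; [apply Rabs_pos|auto].
Qed.

(** The factor 2 comes from using the mean value theorem for the real and the imaginary part
    separately. *)
Lemma cmvt (F D : R -> Complex.C) a b K :
  (forall s, Rmin a b <= s <= Rmax a b -> cder F s (D s)) ->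
  (forall s, Rmin a b <= s <= Rmax a b -> Cmod (D s) <= K) ->
  Cmod (F b - F a) <= 2 * K * Rabs (b - a).
Proof.
  intros Hd Hb. eapply Rle_trans; [apply Cmod_le_sum|].
  assert (H1 : Rabs (Re (F b) - Re (F a)) <= K * Rabs (b - a)).
  { apply (mvt_abs (fun s => Re (F s)) (fun s => Re (D s))); intros s Hs; [now apply Hd|].
    eapply Rle_trans; [apply re_le_Cmod|auto]. }
  assert (H2 : Rabs (Im (F b) - Im (F a)) <= K * Rabs (b - a)).
  { apply (mvt_abs (fun s => Im (F s)) (fun s => Im (D s))); intros s Hs; [now apply Hd|].
    eapply Rle_trans; [apply im_le_Cmod|auto]. }
  change (Rabs (Re (F b) - Re (F a)) + Rabs (Im (F b) - Im (F a)) <= 2 * K * Rabs (b - a)). lra.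
Qed.

(** * Taylor polynomials of the exponential *)

Fixpoint texp (j : nat) (w : Complex.C) : Complex.C :=
  match j with O => RtoC 1 | S j => (RtoC (/ INR (S j)) * w * texp j w)%C end.
Fixpoint taylor (N : nat) (w : Complex.C) : Complex.C :=
  match N with O => RtoC 1 | S N => (taylor N w + texp (S N) w)%C end.

Lemma cder_texp j F s D : cder F s D -> cder (fun y => texp (S j) (F y)) s (D * texp j (F s))%C.
Proof.
  intros HF. induction j as [|j IH].
  - apply cder_ext with F.
    + intros y. simpl. rewrite Rinv_1. ring.
    + apply (cder_eq _ _ _ _ HF). simpl. ring.
  - assert (N : INR (S (S j)) <> 0) by (apply not_0_INR; lia).
    apply (cder_ext (fun y => (RtoC (/ INR (S (S j))) * (F y * texp (S j) (F y)))%C)).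
    + intros y. change (texp (S (S j)) (F y)) with (RtoC (/ INR (S (S j))) * F y * texp (S j) (F y))%C. ring.
    + eapply cder_eq; [exact (cder_mult _ _ _ _ _ (cder_const _ _) (cder_mult _ _ _ _ _ HF IH))|].
      assert (N1 : INR (S j) <> 0) by (apply not_0_INR; lia).
      assert (E : (F s * texp j (F s))%C = (RtoC (INR (S j)) * texp (S j) (F s))%C).
      { change (texp (S j) (F s)) with (RtoC (/ INR (S j)) * F s * texp j (F s))%C.
        rewrite !Cmult_assoc, <- RtoC_mult, Rinv_r by exact N1. ring. }
      replace (F s * (D * texp j (F s)))%C with (D * (F s * texp j (F s)))%C by ring. rewrite E.
      replace (0 * (F s * texp (S j) (F s)) + RtoC (/ INR (S (S j))) * (D * texp (S j) (F s) + D * (RtoC (INR (S j)) * texp (S j) (F s))))%C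
        with ((RtoC (/ INR (S (S j))) * (RtoC 1 + RtoC (INR (S j)))) * (D * texp (S j) (F s)))%C by ring.
      rewrite <- RtoC_plus, <- RtoC_mult. rewrite (S_INR (S j)) at 1.
      replace (/ (INR (S j) + 1) * (1 + INR (S j))) with 1 by (field; rewrite <- S_INR; exact N). ring.
Qed.

Lemma cder_taylor N F s D : cder F s D ->
  cder (fun y => taylor (S N) (F y)) s (D * taylor N (F s))%C.
Proof.
  intros HF. induction N as [|N IH].
  - eapply cder_eq; [exact (cder_plus _ _ _ _ _ (cder_const _ _) (cder_texp 0 F s D HF))|]. simpl. ring.
  - eapply cder_eq; [exact (cder_plus _ _ _ _ _ IH (cder_texp (S N) F s D HF))|].
    change (taylor (S N) (F s)) with (taylor N (F s) + texp (S N) (F s))%C. ring.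
Qed.

Lemma Cmod_texp j w : Cmod (texp j w) = Cmod w ^ j / INR (fact j).
Proof.
  induction j as [|j IH]; [simpl; rewrite Cmod_1; field|].
  change (texp (S j) w) with (RtoC (/ INR (S j)) * w * texp j w)%C.
  assert (N1 : 0 < INR (S j)) by (apply lt_0_INR; lia).
  rewrite !Cmod_mult, IH, Cmod_R, Rabs_pos_eq by (apply Rlt_le, Rinv_0_lt_compat, N1).
  change (fact (S j)) with (S j * fact j)%nat. rewrite mult_INR. simpl pow. field.
  split; [apply INR_fact_neq_0|lra].
Qed.

(* The derivative of [s -> taylor N (s w) exp (- s w)] has a single term. *)
Lemma taylor_bound N w : Cmod (cexp w - taylor N w) <= 2 * (Cmod w ^ S N / INR (fact N)) * exp (2 * Cmod w).
Proof.
  assert (Hre : forall v, Rabs (Re v) <= Cmod v) by apply re_le_Cmod.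
  set (F := fun s : R => (taylor N (RtoC 0 + RtoC s * w) * cexp (- (RtoC 0 + RtoC s * w)))%C).
  set (D := fun s : R => (- w * texp N (RtoC 0 + RtoC s * w) * cexp (- (RtoC 0 + RtoC s * w)))%C).
  assert (HD : forall s, cder F s (D s)).
  { intros s. unfold F, D.
    pose proof (cder_affine (RtoC 0) w s) as A.
    pose proof (cder_cexp _ _ _ (cder_opp _ _ _ A)) as B. cbv beta in B.
    destruct N as [|N].
    - eapply cder_eq; [exact (cder_mult _ _ _ _ _ (cder_const (RtoC 1) s) B)|]. cbv beta. simpl. ring.
    - eapply cder_eq; [exact (cder_mult _ _ _ _ _ (cder_taylor N _ _ _ A) B)|]. cbv beta.
      change (taylor (S N) (RtoC 0 + RtoC s * w)) with (taylor N (RtoC 0 + RtoC s * w) + texp (S N) (RtoC 0 + RtoC s * w))%C. ring. }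
  assert (H : Cmod (F 1 - F 0) <= 2 * (Cmod w ^ S N / INR (fact N) * exp (Cmod w)) * Rabs (1 - 0)).
  { apply (cmvt F D); [intros; apply HD|]. intros s Hs. rewrite Rmin_left, Rmax_right in Hs by lra.
    unfold D. replace (RtoC 0 + RtoC s * w)%C with (RtoC s * w)%C by ring.
    rewrite !Cmod_mult, Cmod_opp, Cmod_texp, Cmod_mult, Cmod_R, Cmod_cexp, (Rabs_pos_eq s) by lra.
    pose proof (Cmod_ge_0 w) as W. pose proof (INR_fact_lt_0 N) as FN.
    replace (Cmod w ^ S N / INR (fact N) * exp (Cmod w)) with (Cmod w * (Cmod w ^ N / INR (fact N)) * exp (Cmod w))
      by (simpl; field; lra).
    apply Rmult_le_compat.
    - apply Rmult_le_pos; [exact W|]. apply Rdiv_le_0_compat; [apply pow_le; nra|exact FN].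
    - apply Rlt_le, exp_pos.
    - apply Rmult_le_compat_l; [exact W|]. apply Rmult_le_compat_r; [apply Rlt_le, Rinv_0_lt_compat, FN|].
      apply pow_incr. nra.
    - assert (Re (- (RtoC s * w))%C <= Cmod w); [|destruct (Rle_lt_or_eq_dec _ _ H); [left; now apply exp_increasing|right; now f_equal]].
      eapply Rle_trans; [apply Rle_abs|]. eapply Rle_trans; [apply Hre|].
      rewrite Cmod_opp, Cmod_mult, Cmod_R, Rabs_pos_eq by lra. nra. }
  assert (E0 : F 0 = RtoC 1).
  { unfold F. replace (RtoC 0 + RtoC 0 * w)%C with (RtoC 0) by ring.
    replace (- RtoC 0)%C with (RtoC 0) by ring. rewrite cexp_R, exp_0.
    assert (taylor N (RtoC 0) = RtoC 1); [|rewrite H0; ring].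
    induction N as [|N IH]; [reflexivity|].
    change (taylor (S N) (RtoC 0)) with (taylor N (RtoC 0) + RtoC (/ INR (S N)) * RtoC 0 * texp N (RtoC 0))%C.
    assert (X : taylor N 0 = RtoC 1).
    { clear. induction N as [|N IH]; [reflexivity|].
      change (taylor (S N) (RtoC 0)) with (taylor N (RtoC 0) + RtoC (/ INR (S N)) * RtoC 0 * texp N (RtoC 0))%C.
      rewrite IH. ring. }
    rewrite X. ring. }
  assert (E1 : (cexp w - taylor N w)%C = (- (cexp w * (F 1 - F 0)))%C).
  { rewrite E0. unfold F. replace (RtoC 0 + RtoC 1 * w)%C with w by ring.
    replace (- (cexp w * (taylor N w * cexp (- w) - RtoC 1)))%C
      with (cexp w - taylor N w * (cexp w * cexp (- w)))%C by ring. rewrite cexp_opp. ring. }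
  rewrite E1, Cmod_opp, Cmod_mult, Cmod_cexp.
  assert (exp (Re w) <= exp (Cmod w)).
  { assert (Re w <= Cmod w) by (eapply Rle_trans; [apply Rle_abs|apply Hre]).
    destruct (Rle_lt_or_eq_dec _ _ H0); [left; now apply exp_increasing|right; now f_equal]. }
  replace (2 * Cmod w) with (Cmod w + Cmod w) by ring. rewrite exp_plus.
  rewrite Rminus_0_r, Rabs_R1, Rmult_1_r in H.
  apply Rle_trans with (exp (Cmod w) * (2 * (Cmod w ^ S N / INR (fact N) * exp (Cmod w)))).
  - apply Rmult_le_compat; auto; [apply Rlt_le, exp_pos|apply Cmod_ge_0].
  - right. ring.
Qed.

Lemma exp_le x y : x <= y -> exp x <= exp y.
Proof. intros [H|H]; [left; now apply exp_increasing|right; now f_equal]. Qed.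

(** Two consecutive orders are controlled because the derivative of the error of order [S N] is the
    error of order [N]. *)
Lemma taylor_uniform rho e : 0 <= rho -> 0 < e ->
  exists N, forall w, Cmod w <= rho -> Cmod (cexp w - taylor N w) <= e /\ Cmod (cexp w - taylor (S N) w) <= e.
Proof.
  intros Hr He. pose proof (exp_pos (2 * rho)) as Hx.
  set (c := 2 * rho * exp (2 * rho) + 1). assert (Hc : 0 < c) by (unfold c; nra).
  destruct (cv_speed_pow_fact rho (e / c)) as [N HN]; [now apply Rdiv_lt_0_compat|].
  assert (B : forall n, (N <= n)%nat -> forall w, Cmod w <= rho -> Cmod (cexp w - taylor n w) <= e).
  { intros n Hn w Hw. eapply Rle_trans; [apply taylor_bound|].
    specialize (HN n Hn). unfold Rdist in HN. rewrite Rminus_0_r in HN.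
    pose proof (INR_fact_lt_0 n) as FN. pose proof (Cmod_ge_0 w) as W.
    assert (H0 : 0 <= rho ^ n / INR (fact n)) by (apply Rdiv_le_0_compat; [now apply pow_le|exact FN]).
    rewrite Rabs_pos_eq in HN by exact H0.
    apply Rle_trans with (2 * (rho * (rho ^ n / INR (fact n))) * exp (2 * rho)).
    - apply Rmult_le_compat; [| |apply Rmult_le_compat_l; [lra|]|apply exp_le; lra].
      + apply Rmult_le_pos; [lra|]. apply Rdiv_le_0_compat; [now apply pow_le|exact FN].
      + apply Rlt_le, exp_pos.
      + replace (rho * (rho ^ n / INR (fact n))) with (rho ^ S n / INR (fact n)) by (simpl; field; lra).
        apply Rmult_le_compat_r; [apply Rlt_le, Rinv_0_lt_compat, FN|]. apply pow_incr; lra.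
    - apply Rle_trans with (c * (e / c)); [|right; field; lra].
      replace (2 * (rho * (rho ^ n / INR (fact n))) * exp (2 * rho))
        with (2 * rho * exp (2 * rho) * (rho ^ n / INR (fact n))) by ring.
      apply Rmult_le_compat; [nra|exact H0|unfold c; lra|lra]. }
  exists N. intros w Hw. split; apply B; auto.
Qed.

(** The mean value theorem along the segment from [w] to [v], which stays in the disc of radius
    [rho]. *)
Lemma taylor_lipschitz N rho e v w :
  (forall z, Cmod z <= rho -> Cmod (cexp z - taylor N z) <= e) ->
  Cmod v <= rho -> Cmod w <= rho ->
  Cmod ((cexp v - taylor (S N) v) - (cexp w - taylor (S N) w)) <= 2 * e * Cmod (v - w).
Proof.
  intros HN Hv Hw.
  set (F := fun s : R => (cexp (w + RtoC s * (v - w)) - taylor (S N) (w + RtoC s * (v - w)))%C).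
  set (D := fun s : R => ((v - w) * (cexp (w + RtoC s * (v - w)) - taylor N (w + RtoC s * (v - w))))%C).
  assert (H : Cmod (F 1 - F 0) <= 2 * (Cmod (v - w) * e) * Rabs (1 - 0)).
  { apply (cmvt F D).
    - intros s _. pose proof (cder_affine w (v - w) s) as A. unfold F, D.
      eapply cder_eq; [exact (cder_minus _ _ _ _ _ (cder_cexp _ _ _ A) (cder_taylor N _ _ _ A))|]. cbv beta. ring.
    - intros s Hs. rewrite Rmin_left, Rmax_right in Hs by lra. unfold D. rewrite Cmod_mult.
      apply Rmult_le_compat_l; [apply Cmod_ge_0|]. apply HN.
      replace (w + RtoC s * (v - w))%C with (RtoC (1 - s) * w + RtoC s * v)%C by (rewrite RtoC_minus; ring).
      eapply Rle_trans; [apply Cmod_triangle|]. rewrite !Cmod_mult, !Cmod_R, !Rabs_pos_eq by lra. nra. }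
  unfold F in H. replace (w + RtoC 1 * (v - w))%C with v in H by ring.
  replace (w + RtoC 0 * (v - w))%C with w in H by ring. rewrite Rminus_0_r, Rabs_R1 in H. lra.
Qed.

(** The Taylor terms composed with the polynomial [l]. The recursion mirrors [texp], so the same
    identity holds on the circle and, through [hd 0], at [z = 0]. *)
Fixpoint ltexp (j : nat) (l : list R) : list R :=
  match j with O => 1 :: nil | S j => lscal (/ INR (S j)) (lmul l (ltexp j l)) end.
Fixpoint ltaylor (N : nat) (l : list R) : list R :=
  match N with O => 1 :: nil | S N => ladd (ltaylor N l) (ltexp (S N) l) end.

Lemma ev_ltexp j l y : ev (ltexp j l) y = texp j (ev l y).
Proof.
  induction j as [|j IH]; [simpl; ring|].
  change (ltexp (S j) l) with (lscal (/ INR (S j)) (lmul l (ltexp j l))).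
  rewrite ev_lscal, ev_lmul, IH.
  change (texp (S j) (ev l y)) with (RtoC (/ INR (S j)) * ev l y * texp j (ev l y))%C. ring.
Qed.
Lemma ev_ltaylor N l y : ev (ltaylor N l) y = taylor N (ev l y).
Proof.
  induction N as [|N IH]; [simpl; ring|].
  change (ltaylor (S N) l) with (ladd (ltaylor N l) (ltexp (S N) l)).
  now rewrite ev_ladd, ev_ltexp, IH.
Qed.
Lemma hd_ltexp j l : RtoC (hd 0 (ltexp j l)) = texp j (RtoC (hd 0 l)).
Proof.
  induction j as [|j IH]; [reflexivity|].
  change (ltexp (S j) l) with (lscal (/ INR (S j)) (lmul l (ltexp j l))).
  rewrite hd_lscal, hd_lmul, !RtoC_mult, IH.
  change (texp (S j) (RtoC (hd 0 l))) with (RtoC (/ INR (S j)) * RtoC (hd 0 l) * texp j (RtoC (hd 0 l)))%C. ring.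
Qed.
Lemma hd_ltaylor N l : RtoC (hd 0 (ltaylor N l)) = taylor N (RtoC (hd 0 l)).
Proof.
  induction N as [|N IH]; [reflexivity|].
  change (ltaylor (S N) l) with (ladd (ltaylor N l) (ltexp (S N) l)).
  now rewrite hd_ladd, RtoC_plus, IH, hd_ltexp.
Qed.

(** The error is small at [z = 0], uniformly on the circle, and in the Lipschitz sense. The last is
    what the condition on the defect near [t] requires. *)
Lemma exp_poly_approx l e : 0 < e ->
  exists l', Rabs (hd 0 l' - exp (hd 0 l)) <= e /\
    (forall y, Cmod (ev l' y - cexp (ev l y)) <= e) /\
    (forall x y, Cmod ((ev l' x - cexp (ev l x)) - (ev l' y - cexp (ev l y))) <= e * Rabs (x - y)).
Proof.
  intros He. destruct (ev_bounded l) as [B [HB HB']]. destruct (ev_lipschitz l) as [L [HL HL']].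
  set (rho := B + Rabs (hd 0 l)). pose proof (Rabs_pos (hd 0 l)) as Ha.
  set (e' := e / (2 * L + 1)). assert (He' : 0 < e') by (apply Rdiv_lt_0_compat; lra).
  assert (Hee : e' <= e /\ 2 * e' * L <= e).
  { assert (E : e' * (2 * L + 1) = e) by (unfold e'; field; lra). nra. }
  destruct (taylor_uniform rho e') as [N HN]; [unfold rho; lra|exact He'|].
  exists (ltaylor (S N) l). split; [|split].
  - rewrite <- Cmod_R, RtoC_minus, hd_ltaylor, <- cexp_R, <- Cmod_opp.
    replace (- (taylor (S N) (hd 0 l) - cexp (hd 0 l)))%C with (cexp (hd 0 l) - taylor (S N) (hd 0 l))%C by ring.
    eapply Rle_trans; [apply HN|lra]. rewrite Cmod_R. unfold rho. lra.
  - intros y. rewrite ev_ltaylor, <- Cmod_opp.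
    replace (- (taylor (S N) (ev l y) - cexp (ev l y)))%C with (cexp (ev l y) - taylor (S N) (ev l y))%C by ring.
    eapply Rle_trans; [apply HN|lra]. specialize (HB' y). unfold rho. lra.
  - intros x y. rewrite !ev_ltaylor, <- Cmod_opp.
    replace (- (taylor (S N) (ev l x) - cexp (ev l x) - (taylor (S N) (ev l y) - cexp (ev l y))))%C
      with ((cexp (ev l x) - taylor (S N) (ev l x)) - (cexp (ev l y) - taylor (S N) (ev l y)))%C by ring.
    eapply Rle_trans; [apply (taylor_lipschitz N rho e')|].
    + intros z Hz. now apply HN.
    + specialize (HB' x). unfold rho. lra.
    + specialize (HB' y). unfold rho. lra.
    + specialize (HL' x y). pose proof (Rabs_pos (x - y)). nra.
Qed.

(** * Truncated logarithmic series on the circle *)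

Fixpoint log_coefs (r : R) (k n : nat) : list R :=
  match n with O => nil | S n => - (r ^ k / INR k) :: log_coefs r (S k) n end.

(** The series of [log (1 - r z)] up to [z^n]; [log_coefs r k n] holds [n] of its coefficients from
    index [k] on. A radius [r < 1] keeps the singularity off the circle. *)
Definition llog (r : R) (n : nat) : list R := 0 :: log_coefs r 1 n.

Fixpoint geom (r : R) (k n : nat) (y : R) : Complex.C :=
  match n with O => RtoC 0 | S n => (RtoC (r ^ k) * zn k y + geom r (S k) n y)%C end.

Lemma zn_1 y : zn 1 y = ei y.
Proof. unfold zn, ei. now rewrite cosn_1, sinn_1. Qed.
Lemma zn_0 y : zn 0 y = RtoC 1.
Proof. unfold zn. now rewrite cosn_0, sinn_0. Qed.

Lemma cder_zn k s : cder (zn k) s (RtoC (INR k) * Ci * zn k s)%C.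
Proof.
  induction k as [|k IH].
  - apply (cder_ext (fun _ => RtoC 1)); [intros; now rewrite zn_0|].
    apply (cder_eq _ _ _ _ (cder_const _ _)). simpl. ring.
  - apply (cder_ext (fun y => (ei y * zn k y)%C)); [intros; now rewrite zn_S|].
    apply (cder_eq _ _ _ _ (cder_mult _ _ _ _ _ (cder_ei s) IH)).
    rewrite zn_S, S_INR, RtoC_plus. ring.
Qed.

(** Differentiation in [y] brings down [i k], which cancels the denominators and leaves a geometric
    sum with a closed form. *)
Lemma cder_log_partial r n : forall k s, (0 < k)%nat ->
  cder (fun y => (zn k y * ev (log_coefs r k n) y)%C) s (- Ci * geom r k n s)%C.
Proof.
  induction n as [|n IH]; intros k s Hk.
  - apply (cder_ext (fun _ => RtoC 0)); [intros; simpl; ring|].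
    apply (cder_eq _ _ _ _ (cder_const _ _)). simpl. ring.
  - assert (Nk : INR k <> 0) by (apply not_0_INR; lia).
    apply (cder_ext (fun y => (RtoC (- (r ^ k / INR k)) * zn k y + zn (S k) y * ev (log_coefs r (S k) n) y)%C)).
    { intros y. rewrite zn_S. simpl. ring. }
    apply (cder_eq _ _ _ _ (cder_plus _ _ _ _ _ (cder_mult _ _ _ _ _ (cder_const _ _) (cder_zn k s)) (IH (S k) s ltac:(lia)))).
    simpl geom. replace (RtoC (r ^ k)) with (RtoC (r ^ k / INR k) * RtoC (INR k))%C.
    + rewrite RtoC_opp. ring.
    + rewrite <- RtoC_mult. f_equal. now field.
Qed.

Lemma geom_closed r n : forall k y,
  ((1 - RtoC r * ei y) * geom r k n y = RtoC (r ^ k) * zn k y - RtoC (r ^ (k + n)) * zn (k + n) y)%C.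
Proof.
  induction n as [|n IH]; intros k y.
  - rewrite Nat.add_0_r. simpl. ring.
  - simpl geom. rewrite Cmult_plus_distr_l, IH. replace (S k + n)%nat with (k + S n)%nat by lia.
    rewrite (zn_S k). change (r ^ S k) with (r * r ^ k). rewrite RtoC_mult. ring.
Qed.

Lemma ev_llog r n y : ev (llog r n) y = (zn 1 y * ev (log_coefs r 1 n) y)%C.
Proof. rewrite zn_1. simpl. ring. Qed.

Lemma cder_llog r n s : cder (ev (llog r n)) s (- Ci * geom r 1 n s)%C.
Proof.
  apply (cder_ext (fun y => (zn 1 y * ev (log_coefs r 1 n) y)%C)).
  - intros; now rewrite ev_llog.
  - apply cder_log_partial. lia.
Qed.

Lemma one_minus_mod r y : Cmod (1 - RtoC r * ei y) ^ 2 = 1 - 2 * r * cos y + r ^ 2.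
Proof.
  rewrite Cmod2_alt. unfold ei. simpl. pose proof (sin2_cos2 y) as E. unfold Rsqr in E.
  replace (r * (r * 1)) with (r * r * (sin y * sin y + cos y * cos y)) by (rewrite E; ring). ring.
Qed.

Lemma one_minus_mod_pos r y : 0 < r < 1 -> 0 < 1 - r <= Cmod (1 - RtoC r * ei y).
Proof.
  intros Hr. split; [lra|]. apply Rsqr_incr_0_var; [|apply Cmod_ge_0].
  pose proof (one_minus_mod r y) as E. pose proof (COS_bound y). unfold Rsqr.
  simpl in E. rewrite Rmult_1_r in E. nra.
Qed.

Lemma one_minus_nonzero r y : 0 < r < 1 -> (1 - RtoC r * ei y)%C <> RtoC 0.
Proof.
  intros Hr. apply Cmod_gt_0. pose proof (one_minus_mod_pos r y Hr). lra.
Qed.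

Lemma geom_quotient r n y : 0 < r < 1 ->
  geom r 1 n y = (RtoC r * ei y / (1 - RtoC r * ei y) - RtoC (r ^ S n) * zn (S n) y / (1 - RtoC r * ei y))%C.
Proof.
  intros Hr. pose proof (one_minus_nonzero r y Hr) as H.
  pose proof (geom_closed r n 1 y) as E. rewrite zn_1, pow_1 in E. change (1 + n)%nat with (S n) in E.
  replace (geom r 1 n y) with ((1 - RtoC r * ei y) * geom r 1 n y / (1 - RtoC r * ei y))%C by (field; exact H).
  rewrite E. field. exact H.
Qed.

Lemma tail_mod r n y : 0 < r < 1 ->
  Cmod (RtoC (r ^ S n) * zn (S n) y / (1 - RtoC r * ei y))%C = r ^ S n / Cmod (1 - RtoC r * ei y).
Proof.
  intros Hr. rewrite Cmod_div by now apply one_minus_nonzero.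
  rewrite Cmod_mult, Cmod_zn, Cmod_R, Rabs_pos_eq; [unfold Rdiv; ring|apply pow_le; lra].
Qed.

Lemma cosn_PI k : cosn k PI = (-1) ^ k /\ sinn k PI = 0.
Proof.
  induction k as [|k [IH1 IH2]]; [rewrite cosn_0, sinn_0; simpl; auto|].
  rewrite cosn_S, sinn_S, IH1, IH2, cos_PI, sin_PI. simpl. split; ring.
Qed.

(** At [z = -1] the partial sum is real. Its derivative in [r] differs from that of [ln (1 + r)] by
    [(- r)^n / (1 + r)] up to sign, and both vanish at [r = 0]. *)
Lemma log_anchor r n : 0 < r < 1 ->
  Rabs (Re (ev (llog r n) PI) - ln (1 + r)) <= r ^ n /\ Im (ev (llog r n) PI) = 0.
Proof.
  intros Hr.
  assert (Gen : forall n k, Im (ev (log_coefs r k n) PI) = 0).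
  { induction n0 as [|n0 IH]; intros k; [reflexivity|]. simpl. specialize (IH (S k)).
    unfold Im in IH. unfold ei. simpl. rewrite IH, sin_PI. ring. }
  split.
  2:{ rewrite ev_llog. simpl. specialize (Gen n 1%nat). unfold Im in Gen. rewrite Gen.
      destruct (cosn_PI 1) as [_ ->]. ring. }
  (* The derivative in the radius. The sign [(-1) ^ k] is [z^k] at [z = -1], needed since the
     induction treats tails starting at an arbitrary index. *)
  set (U := fun k n s => sum_lt (fun j => - (-1) ^ (k + j) * s ^ (k + j - 1)) n).
  assert (HU : forall n k s, (0 < k)%nat ->
    is_derive (fun s => (-1) ^ k * Re (ev (log_coefs s k n) PI)) s (U k n s)).
  { induction n0 as [|n0 IH]; intros k s Hk.
    - apply is_derive_ext with (fun _ => 0); [intros; simpl; change (0 = (-1) ^ k * 0); ring|].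
      exact (der_const 0 s).
    - assert (Nk : INR k <> 0) by (apply not_0_INR; lia).
      apply is_derive_ext with
        (fun s => (- (-1) ^ k / INR k) * s ^ k + (-1) ^ S k * Re (ev (log_coefs s (S k) n0) PI)).
      { intros x. simpl. unfold ei. destruct (ev (log_coefs x (S k) n0) PI) as [p q]. simpl. rewrite cos_PI, sin_PI.
        unfold Rdiv. match goal with |- ?a = ?b => change (@eq R a b) end. ring. }
      apply (der_eq _ _ (- (-1) ^ k / INR k * (INR k * s ^ pred k) + U (S k) n0 s)).
      + apply der_plus; [|apply IH; lia].
        apply (is_derive_scal (fun x => x ^ k)). apply is_derive_Reals, derivable_pt_lim_pow.
      + unfold U. change (S n0) with (1 + n0)%nat. rewrite sum_lt_add. simpl sum_lt at 2.
        rewrite Nat.add_0_r. replace (pred k) with (k - 1)%nat by lia.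
        replace (sum_lt (fun i => - (-1) ^ (k + (1 + i)) * s ^ (k + (1 + i) - 1)) n0)
          with (sum_lt (fun j => - (-1) ^ (S k + j) * s ^ (S k + j - 1)) n0).
        * match goal with |- ?a = ?b => change (@eq R a b) end. field. exact Nk.
        * apply sum_lt_ext. intros i _. replace (k + (1 + i))%nat with (S k + i)%nat by lia. reflexivity. }
  assert (UC : forall n s, (1 + s) * U 1%nat n s = 1 - (- s) ^ n).
  { induction n0 as [|n0 IH]; intros s; [unfold U; simpl; ring|].
    unfold U in *. change (sum_lt ?a (S n0)) with (sum_lt a n0 + a n0). rewrite Rmult_plus_distr_l, IH.
    replace (1 + n0 - 1)%nat with n0 by lia.
    replace (- s) with (-1 * s) by ring. rewrite !Rpow_mult_distr. simpl. ring. }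
  assert (R0 : forall s, (-1) ^ 1 * Re (ev (log_coefs s 1 n) PI) = Re (ev (llog s n) PI)).
  { intros s. rewrite ev_llog. destruct (ev (log_coefs s 1 n) PI) as [p q]. unfold zn. simpl.
    destruct (cosn_PI 1) as [-> ->]. simpl. ring. }
  assert (M : Rabs ((Re (ev (llog r n) PI) - ln (1 + r)) - (Re (ev (llog 0 n) PI) - ln (1 + 0))) <= r ^ n * Rabs (r - 0)).
  { apply (mvt_abs (fun s => Re (ev (llog s n) PI) - ln (1 + s)) (fun s => U 1%nat n s - / (1 + s))).
    - intros s Hs. rewrite Rmin_left, Rmax_right in Hs by lra. apply der_minus.
      + apply is_derive_ext with (fun s => (-1) ^ 1 * Re (ev (log_coefs s 1 n) PI)); [exact R0|]. apply HU. lia.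
      + apply (der_eq _ _ (1 * / (1 + s))); [|ring]. apply (der_comp ln (fun x => 1 + x)); [apply is_derive_ln; lra|].
        apply (der_eq _ _ (0 + 1)); [|ring]. apply der_plus; [exact (der_const 1 s)|exact (is_derive_id (K := R_AbsRing) s)].
    - intros s Hs. rewrite Rmin_left, Rmax_right in Hs by lra.
      replace (U 1%nat n s - / (1 + s)) with (((1 + s) * U 1%nat n s - 1) / (1 + s)) by (field; lra).
      rewrite UC. replace (1 - (- s) ^ n - 1) with (- (- s) ^ n) by ring.
      unfold Rdiv. rewrite Rabs_mult, Rabs_Ropp, <- RPow_abs, Rabs_Ropp, (Rabs_pos_eq s), Rabs_pos_eq by (try apply Rlt_le, Rinv_0_lt_compat; lra).
      assert (/ (1 + s) <= 1) by (rewrite <- Rinv_1; apply Rinv_le_contravar; lra).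
      assert (0 < / (1 + s)) by (apply Rinv_0_lt_compat; lra).
      assert (s ^ n <= r ^ n) by (apply pow_incr; lra). assert (0 <= s ^ n) by (apply pow_le; lra). nra. }
  assert (Z : Re (ev (llog 0 n) PI) = 0).
  { rewrite ev_llog. assert (Z : forall n k, (0 < k)%nat -> ev (log_coefs 0 k n) PI = RtoC 0).
    { induction n0 as [|n0 IH]; intros k Hk; [reflexivity|]. simpl. rewrite IH by lia.
      rewrite pow_i by lia. unfold Rdiv. rewrite Rmult_0_l, Ropp_0. ring. }
    rewrite Z by lia. simpl. ring. }
  rewrite Z, Rplus_0_r, ln_1, !Rminus_0_r, (Rabs_pos_eq r) in M by lra.
  assert (0 <= r ^ n) by (apply pow_le; lra). nra.
Qed.

(** The square of [|1 - r e^{i y}|]. *)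
Definition qr (r y : R) : R := 1 - 2 * r * cos y + r ^ 2.

Lemma qr_pos r y : 0 < r < 1 -> 0 < qr r y.
Proof. intros Hr. unfold qr. pose proof (COS_bound y). nra. Qed.

Lemma qr_der r y : 0 < r < 1 -> is_derive (fun y => ln (qr r y) / 2) y (r * sin y / qr r y).
Proof.
  intros Hr. pose proof (qr_pos r y Hr).
  apply (der_eq _ _ ((2 * r * sin y * / qr r y) * / 2 + ln (qr r y) * 0)); [|field; lra].
  apply (der_mult (fun y => ln (qr r y)) (fun _ => / 2)); [|exact (der_const (/ 2) y)].
  apply (der_comp ln (qr r)); [now apply is_derive_ln|].
  unfold qr. apply (der_eq _ _ (0 - (0 * cos y + 2 * r * - sin y) + 0)); [|ring].
  apply der_plus; [|exact (der_const _ y)]. apply der_minus; [exact (der_const _ y)|].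
  apply (der_mult (fun _ => 2 * r) cos); [exact (der_const _ y)|apply is_derive_cos].
Qed.

Lemma im_quotient r y : 0 < r < 1 -> Im (RtoC r * ei y / (1 - RtoC r * ei y))%C = r * sin y / qr r y.
Proof.
  intros Hr. pose proof (qr_pos r y Hr) as Q. unfold qr in *. pose proof (one_minus_nonzero r y Hr) as H.
  assert (E : (RtoC r * ei y / (1 - RtoC r * ei y))%C
     = (RtoC (/ (1 - 2 * r * cos y + r ^ 2)) * (RtoC r * ei y * Cconj (1 - RtoC r * ei y)))%C).
  { replace (/ (1 - 2 * r * cos y + r ^ 2)) with (/ Cmod (1 - RtoC r * ei y) ^ 2) by (now rewrite one_minus_mod).
    assert (X : (RtoC (Cmod (1 - RtoC r * ei y) ^ 2) = (1 - RtoC r * ei y) * Cconj (1 - RtoC r * ei y))%C).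
    { apply Cmod2_conj. }
    assert (Hc : Cconj (1 - RtoC r * ei y) <> 0%C).
    { intros Hc. apply H. apply Cmod_eq_0. rewrite <- Cmod_conj, Hc. apply Cmod_0. }
    rewrite RtoC_inv; [rewrite X; field; split; [exact Hc|exact H]|].
    apply pow_nonzero, Rgt_not_eq, Cmod_gt_0, H. }
  rewrite E. unfold ei. simpl. field. simpl in Q. lra.
Qed.

(** The derivatives of the two sides differ by the geometric tail, at most [r ^ n / (1 - r)], and
    the values at [PI] are compared by [log_anchor]. *)
Lemma log_real_approx r n y : 0 < r < 1 -> 0 <= y <= 2 * PI ->
  Rabs (Re (ev (llog r n) y) - ln (qr r y) / 2) <= (PI / (1 - r) + 1) * r ^ n.
Proof.
  intros Hr Hy. pose proof PI_RGT_0 as Hpi.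
  set (E := fun y => Re (ev (llog r n) y) - ln (qr r y) / 2).
  assert (D : Rabs (E y - E PI) <= r ^ n / (1 - r) * Rabs (y - PI)).
  { apply (mvt_abs E (fun s => Re (- Ci * geom r 1 n s)%C - r * sin s / qr r s)).
    - intros s _. apply der_minus; [apply (cder_llog r n s)|now apply qr_der].
    - intros s _. replace (Re (- Ci * geom r 1 n s)%C) with (Im (geom r 1 n s))
        by (destruct (geom r 1 n s); simpl; ring).
      rewrite geom_quotient by exact Hr. unfold Cminus at 1. rewrite im_plus, im_opp, (im_quotient r s Hr).
      match goal with |- Rabs (?a + - ?b - ?a) <= _ => replace (a + - b - a) with (- b) by ring end.
      rewrite Rabs_Ropp. eapply Rle_trans; [apply im_le_Cmod|]. rewrite tail_mod by exact Hr.
      pose proof (one_minus_mod_pos r s Hr) as P. assert (0 <= r ^ n) by (apply pow_le; lra).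
      unfold Rdiv. apply Rmult_le_compat; [apply pow_le; lra| | |].
      + apply Rlt_le, Rinv_0_lt_compat. lra.
      + simpl. nra.
      + apply Rinv_le_contravar; lra. }
  assert (A : Rabs (E PI) <= r ^ n).
  { unfold E. destruct (log_anchor r n Hr) as [H _]. unfold qr. rewrite cos_PI.
    replace (1 - 2 * r * -1 + r ^ 2) with ((1 + r) * (1 + r)) by ring.
    rewrite ln_mult by lra. replace ((ln (1 + r) + ln (1 + r)) / 2) with (ln (1 + r)) by field. exact H. }
  fold (E y). replace (E y) with ((E y - E PI) + E PI) by ring. eapply Rle_trans; [apply Rabs_triang|].
  assert (H0 : 0 <= r ^ n) by (apply pow_le; lra).
  assert (Rabs (y - PI) <= PI) by (apply Rabs_le; lra).
  assert (r ^ n / (1 - r) * Rabs (y - PI) <= r ^ n / (1 - r) * PI).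
  { apply Rmult_le_compat_l; [|assumption]. apply Rdiv_le_0_compat; lra. }
  replace ((PI / (1 - r) + 1) * r ^ n) with (r ^ n / (1 - r) * PI + r ^ n) by (field; lra). lra.
Qed.

(* [log (1 - z)] and [log (1 + z)] on the open upper half of the unit circle. *)
Definition log1m (y : R) : Complex.C := (ln (2 - 2 * cos y) / 2, (y - PI) / 2).
Definition log1p (y : R) : Complex.C := (ln (2 + 2 * cos y) / 2, y / 2).

Lemma cos_lt_1 y : 0 < y < 2 * PI -> cos y < 1.
Proof.
  intros Hy. pose proof PI_RGT_0.
  replace (cos y) with (1 - 2 * sin (y / 2) * sin (y / 2)).
  - assert (0 < sin (y / 2)) by (apply sin_gt_0; lra). nra.
  - rewrite <- cos_2a_sin. f_equal. field.
Qed.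

Lemma one_minus_ei_nonzero y : 0 < y < 2 * PI -> (1 - ei y)%C <> RtoC 0.
Proof.
  intros Hy E. pose proof (cos_lt_1 y Hy). apply (f_equal Re) in E. unfold ei in E. simpl in E. lra.
Qed.

Lemma cder_log1m y : 0 < y < 2 * PI -> cder log1m y (- Ci * (ei y / (1 - ei y)))%C.
Proof.
  intros Hy. pose proof (cos_lt_1 y Hy) as Hc. pose proof (one_minus_ei_nonzero y Hy) as H.
  assert (E : (ei y / (1 - ei y))%C = ((- / 2)%R, (sin y / (2 - 2 * cos y))%R)).
  { assert (X : ei y = Cmult ((- / 2)%R, (sin y / (2 - 2 * cos y))%R) (1 - ei y)%C).
    { unfold ei. pose proof (sin2_cos2 y) as S. unfold Rsqr in S.
      apply injective_projections; simpl.
      - replace (sin y / (2 - 2 * cos y) * (0 + - sin y)) with (- (1 - cos y * cos y) / (2 - 2 * cos y)).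
        + field. lra.
        + rewrite <- S. field. lra.
      - field. lra. }
    rewrite X at 1. field. exact H. }
  rewrite E. split.
  - simpl. apply (der_eq _ _ ((2 * sin y * / (2 - 2 * cos y)) * / 2 + ln (2 - 2 * cos y) * 0)); [|field; lra].
    apply (der_mult (fun y => ln (2 - 2 * cos y)) (fun _ => / 2)); [|exact (der_const (/ 2) y)].
    apply (der_comp ln (fun y => 2 - 2 * cos y)); [apply is_derive_ln; lra|].
    apply (der_eq _ _ (0 - (0 * cos y + 2 * - sin y))); [|ring].
    apply der_minus; [exact (der_const _ y)|].
    apply (der_mult (fun _ => 2) cos); [exact (der_const _ y)|apply is_derive_cos].
  - simpl. apply (der_eq _ _ ((1 - 0) * / 2 + (y - PI) * 0)); [|field; lra].
    apply (der_mult (fun y => y - PI) (fun _ => / 2)); [|exact (der_const _ y)].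
    apply der_minus; [exact (is_derive_id (K := R_AbsRing) y)|exact (der_const _ y)].
Qed.

(** No polynomial follows [log (1 - z)] to its singularity, so on all of [(0, PI)] only a lower
    bound for the real part is claimed. It comes from [|1 - z| <= 2 |1 - r z|]; the constant 2
    absorbs [ln 4 / 2] and the truncation error. Away from 0 the derivatives are compared and the
    values anchored at [PI]. *)
Lemma log1m_approx d e : 0 < d < PI -> 0 < e ->
  exists l, hd 0 l = 0 /\
    (forall y, 0 < y < PI -> Re (log1m y) - 2 <= Re (ev l y)) /\
    (forall y, d <= y <= PI -> Cmod (ev l y - log1m y) <= e) /\
    (forall x y, d <= x <= PI -> d <= y <= PI ->
       Cmod ((ev l x - log1m x) - (ev l y - log1m y)) <= e * Rabs (x - y)).
Proof.
  intros Hd He. pose proof PI_RGT_0 as Hpi. pose proof PI_4 as Hpi4.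
  set (m := Cmod (1 - ei d)%C).
  assert (Hm : 0 < m) by (apply Cmod_gt_0, one_minus_ei_nonzero; lra).
  assert (mod1 : forall y, Cmod (1 - ei y) ^ 2 = 2 - 2 * cos y).
  { intros y. pose proof (one_minus_mod 1 y) as E. replace (RtoC 1 * ei y)%C with (ei y) in E by ring. rewrite E. ring. }
  assert (Hmy : forall y, d <= y <= PI -> m <= Cmod (1 - ei y)).
  { intros y Hy. apply Rsqr_incr_0_var; [|apply Cmod_ge_0]. rewrite !Rsqr_pow2. unfold m. rewrite !mod1.
    assert (cos y <= cos d) by (apply cos_decr_1; lra). lra. }
  set (e1 := Rmin (e / 16) (/ 4)). assert (He1 : 0 < e1 <= / 4) by (unfold e1; split; [apply Rmin_glb_lt; lra|apply Rmin_r]).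
  assert (He1' : e1 <= e / 16) by apply Rmin_l.
  (* [x = 1 - r]. The replacement of [z] by [r z] changes the derivative by
     [x / (|1 - r z| |1 - z|) <= 2 x / m^2] on [[d, PI]]. *)
  set (x := Rmin (/ 2) (Rmin e1 (e1 * (m * m) / 4))).
  assert (Hx : 0 < x).
  { unfold x. repeat apply Rmin_glb_lt; try lra. apply Rdiv_lt_0_compat; [|lra]. repeat apply Rmult_lt_0_compat; lra. }
  assert (Hx1 : x <= / 2) by apply Rmin_l.
  assert (Hx2 : x <= e1) by (eapply Rle_trans; [apply Rmin_r|apply Rmin_l]).
  assert (Hx3 : 2 * x / (m * m) <= e1 / 2).
  { apply Rle_div_l; [nra|]. assert (x <= e1 * (m * m) / 4) by (eapply Rle_trans; [apply Rmin_r|apply Rmin_r]). lra. }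
  set (r := 1 - x). assert (Hr : 0 < r < 1) by (unfold r; lra).
  (* The truncation length is chosen after [r], because this constant grows like [1 / (1 - r)]. *)
  set (c := PI / (1 - r) + 1 + 2 / m).
  assert (Hc : 1 <= c).
  { unfold c. assert (0 < PI / (1 - r)) by (apply Rdiv_lt_0_compat; lra). assert (0 < 2 / m) by (apply Rdiv_lt_0_compat; lra). lra. }
  destruct (pow_lt_1_zero r ltac:(rewrite Rabs_pos_eq; lra) (e1 / 2 / c)) as [n Hn].
  { apply Rdiv_lt_0_compat; lra. }
  specialize (Hn n (le_n n)). rewrite Rabs_pos_eq in Hn by (apply pow_le; lra).
  assert (H0 : 0 <= r ^ n) by (apply pow_le; lra).
  assert (Hcn : c * r ^ n <= e1 / 2).
  { replace (e1 / 2) with (c * (e1 / 2 / c)) by (field; lra). apply Rmult_le_compat_l; lra. }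
  assert (Hn1 : r ^ n <= e1 / 2) by nra.
  assert (Hn2 : (PI / (1 - r) + 1) * r ^ n <= e1 / 2).
  { eapply Rle_trans; [|exact Hcn]. apply Rmult_le_compat_r; [exact H0|]. unfold c.
    assert (0 < 2 / m) by (apply Rdiv_lt_0_compat; lra). lra. }
  assert (Hn3 : 2 / m * r ^ n <= e1 / 2).
  { eapply Rle_trans; [|exact Hcn]. apply Rmult_le_compat_r; [exact H0|]. unfold c.
    assert (0 < PI / (1 - r)) by (apply Rdiv_lt_0_compat; lra). lra. }
  assert (hm : forall y, Cmod (1 - ei y) <= 2 * Cmod (1 - RtoC r * ei y)).
  { intros y. pose proof (one_minus_mod_pos r y Hr) as P.
    replace (1 - ei y)%C with ((1 - RtoC r * ei y) + - (RtoC (1 - r) * ei y))%C by (rewrite RtoC_minus; ring).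
    eapply Rle_trans; [apply Cmod_triangle|]. rewrite Cmod_opp, Cmod_mult, Cmod_ei, Cmod_R, Rabs_pos_eq by lra. lra. }
  assert (Lip : forall u v, d <= u <= PI -> d <= v <= PI ->
       Cmod ((ev (llog r n) u - log1m u) - (ev (llog r n) v - log1m v)) <= 2 * e1 * Rabs (u - v)).
  { intros u v Hu Hv.
    apply (cmvt (fun s => (ev (llog r n) s - log1m s)%C) (fun s => (- Ci * geom r 1 n s - - Ci * (ei s / (1 - ei s)))%C)).
    - intros s Hs. assert (d <= s <= PI).
      { split; [eapply Rle_trans; [|apply Hs]; now apply Rmin_glb|eapply Rle_trans; [apply Hs|]; now apply Rmax_lub]. }
      apply cder_minus; [apply cder_llog|apply cder_log1m; lra].
    - intros s Hs. assert (Hsd : d <= s <= PI).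
      { split; [eapply Rle_trans; [|apply Hs]; now apply Rmin_glb|eapply Rle_trans; [apply Hs|]; now apply Rmax_lub]. }
      pose proof (one_minus_nonzero r s Hr) as N1. pose proof (one_minus_ei_nonzero s ltac:(lra)) as N2.
      specialize (Hmy s Hsd). specialize (hm s).
      assert (P1 : 0 < Cmod (1 - RtoC r * ei s)) by (now apply Cmod_gt_0).
      replace (- Ci * geom r 1 n s - - Ci * (ei s / (1 - ei s)))%C
        with (Ci * (RtoC (1 - r) * ei s / ((1 - RtoC r * ei s) * (1 - ei s)) + RtoC (r ^ S n) * zn (S n) s / (1 - RtoC r * ei s)))%C.
      2:{ rewrite geom_quotient by exact Hr. rewrite RtoC_minus. field. split; assumption. }
      rewrite Cmod_mult, Cmod_Ci, Rmult_1_l.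
      eapply Rle_trans; [apply Cmod_triangle|]. rewrite tail_mod by exact Hr.
      rewrite Cmod_div by (apply Cmult_neq_0; assumption).
      rewrite !Cmod_mult, Cmod_ei, Cmod_R, Rabs_pos_eq, Rmult_1_r by lra.
      replace (1 - r) with x by (unfold r; ring).
      assert (B1 : x / (Cmod (1 - RtoC r * ei s) * Cmod (1 - ei s)) <= 2 * x / (m * m)).
      { apply Rle_div_l; [apply Rmult_lt_0_compat; lra|].
        replace (2 * x / (m * m) * (Cmod (1 - RtoC r * ei s) * Cmod (1 - ei s)))
          with (x * ((2 * Cmod (1 - RtoC r * ei s)) * Cmod (1 - ei s) / (m * m))) by (field; lra).
        rewrite <- (Rmult_1_r x) at 1. apply Rmult_le_compat_l; [lra|].
        apply (proj1 (Rle_div_r _ _ (m * m) ltac:(nra))). nra. }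
      assert (B2 : r ^ S n / Cmod (1 - RtoC r * ei s) <= 2 / m * r ^ n).
      { apply Rle_div_l; [lra|].
        replace (2 / m * r ^ n * Cmod (1 - RtoC r * ei s)) with (r ^ n * (2 * Cmod (1 - RtoC r * ei s) / m)) by (field; lra).
        simpl pow. rewrite Rmult_comm. apply Rmult_le_compat_l; [exact H0|].
        apply (proj1 (Rle_div_r _ _ m Hm)). nra. }
      lra. }
  exists (llog r n). split; [reflexivity|]. split; [|split].
  - intros y Hy. pose proof (log_real_approx r n y Hr ltac:(lra)) as L. apply Rabs_le_between in L.
    assert (Q : ln (2 - 2 * cos y) <= ln 4 + ln (qr r y)).
    { pose proof (qr_pos r y Hr). rewrite <- ln_mult by lra.
      pose proof (cos_lt_1 y ltac:(lra)).
      assert (HQ : 2 - 2 * cos y <= 4 * qr r y).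
      { specialize (hm y). pose proof (Cmod_ge_0 (1 - ei y)). rewrite <- mod1.
        unfold qr. rewrite <- one_minus_mod. nra. }
      destruct (Rle_lt_or_eq_dec _ _ HQ) as [X|X]; [left; apply ln_increasing; lra|right; now f_equal]. }
    assert (L4 : ln 4 <= 2).
    { replace 4 with (2 * 2) by ring. rewrite ln_mult by lra.
      assert (ln 2 < 1); [|lra]. rewrite <- ln_exp. apply ln_increasing; [lra|].
      pose proof (exp_ineq1 1). lra. }
    change (Re (log1m y)) with (ln (2 - 2 * cos y) / 2). lra.
  - intros y Hy. specialize (Lip y PI Hy ltac:(lra)).
    destruct (log_anchor r n Hr) as [A1 A2].
    assert (A : Cmod (ev (llog r n) PI - log1m PI) <= e1 / 2 + e1).
    { assert (LR : Re (log1m PI) = ln 2).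
      { unfold log1m. simpl. rewrite cos_PI. replace (2 - 2 * -1) with (2 * 2) by ring. rewrite ln_mult by lra. field. }
      assert (LI : Im (log1m PI) = 0) by (unfold log1m; simpl; field).
      eapply Rle_trans; [apply Cmod_le_sum|].
      change (Rabs (Re (ev (llog r n) PI) - Re (log1m PI)) + Rabs (Im (ev (llog r n) PI) - Im (log1m PI)) <= e1 / 2 + e1).
      rewrite A2, LR, LI, Rminus_0_r, Rabs_R0, Rplus_0_r.
      replace (Re (ev (llog r n) PI) - ln 2)
        with ((Re (ev (llog r n) PI) - ln (1 + r)) + (ln (1 + r) - ln 2)) by ring.
      eapply Rle_trans; [apply Rabs_triang|].
      assert (Rabs (ln (1 + r) - ln 2) <= x).
      { assert (G : ln (1 + r) <= ln 2) by (left; apply ln_increasing; lra).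
        assert (G2 : ln 2 - ln (1 + r) <= x).
        { rewrite <- ln_div by lra. apply Rle_trans with (ln (exp x)); [|rewrite ln_exp; lra].
          assert (H2r : 2 / (1 + r) <= exp x).
          { apply Rle_trans with (1 + x); [|left; apply exp_ineq1; lra].
            apply Rle_div_l; [lra|]. unfold r. nra. }
          assert (0 < 2 / (1 + r)) by (apply Rdiv_lt_0_compat; lra).
          destruct (Rle_lt_or_eq_dec _ _ H2r) as [X|X]; [left; now apply ln_increasing|right; now f_equal]. }
        apply Rabs_le; lra. }
      lra. }
    replace (ev (llog r n) y - log1m y)%C
      with (((ev (llog r n) y - log1m y) - (ev (llog r n) PI - log1m PI)) + (ev (llog r n) PI - log1m PI))%C by ring.
    eapply Rle_trans; [apply Cmod_triangle|].
    assert (Rabs (y - PI) <= 4) by (apply Rabs_le; lra).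
    assert (2 * e1 * Rabs (y - PI) <= 2 * e1 * 4) by (apply Rmult_le_compat_l; lra). lra.
  - intros u v Hu Hv. eapply Rle_trans; [now apply Lip|]. apply Rmult_le_compat_r; [apply Rabs_pos|lra].
Qed.

(** The polynomial [l (- z)]. Since [- e^{i y}] is the conjugate of [e^{i (PI - y)}], it carries the
    results on [log (1 - z)] over to [log (1 + z)]. *)
Fixpoint lalt (l : list R) : list R :=
  match l with nil => nil | a :: l => a :: lscal (-1) (lalt l) end.

Lemma ev_lalt l y : ev (lalt l) y = Cconj (ev l (PI - y)).
Proof.
  induction l as [|a l IH]; [apply injective_projections; simpl; ring|].
  simpl. rewrite ev_lscal, IH. unfold ei. rewrite cos_minus, sin_minus, cos_PI, sin_PI.
  destruct (ev l (PI - y)) as [p q]. apply injective_projections; simpl; ring.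
Qed.

Lemma log1p_log1m y : log1p y = Cconj (log1m (PI - y)).
Proof.
  unfold log1p, log1m. rewrite cos_minus, cos_PI, sin_PI.
  apply injective_projections; simpl; [|field].
  do 2 f_equal. ring.
Qed.

Lemma log1p_approx d e : 0 < d < PI -> 0 < e ->
  exists l, hd 0 l = 0 /\
    (forall y, 0 < y < PI -> Re (log1p y) - 2 <= Re (ev l y)) /\
    (forall y, 0 <= y <= PI - d -> Cmod (ev l y - log1p y) <= e) /\
    (forall x y, 0 <= x <= PI - d -> 0 <= y <= PI - d ->
       Cmod ((ev l x - log1p x) - (ev l y - log1p y)) <= e * Rabs (x - y)).
Proof.
  intros Hd He. destruct (log1m_approx d e Hd He) as [l [H0 [H1 [H2 H3]]]].
  exists (lalt l). split; [|split; [|split]].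
  - destruct l; [reflexivity|exact H0].
  - intros y Hy. rewrite ev_lalt, log1p_log1m. apply (H1 (PI - y)). lra.
  - intros y Hy. rewrite ev_lalt, log1p_log1m, <- Cminus_conj, Cmod_conj. apply H2. lra.
  - intros x y Hx Hy. rewrite !ev_lalt, !log1p_log1m, <- !Cminus_conj, Cmod_conj.
    eapply Rle_trans; [apply H3; lra|]. right. f_equal.
    replace (PI - x - (PI - y)) with (- (x - y)) by ring. apply Rabs_Ropp.
Qed.

(** * Approximation of the Szego function *)

Definition rpoly (n : nat) (p : R -> R) : Prop :=
  exists c : nat -> R, forall t, p t = sum_lt (fun k => c k * t ^ k) n.

Lemma rpoly_ext n p q : (forall t, p t = q t) -> rpoly n p -> rpoly n q.
Proof. intros H [c Hc]. exists c. intros; now rewrite <- H. Qed.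
Lemma rpoly_plus n p q : rpoly n p -> rpoly n q -> rpoly n (fun t => p t + q t).
Proof.
  intros [c Hc] [d Hd]. exists (fun k => c k + d k). intros t. rewrite Hc, Hd, <- sum_lt_plus.
  apply sum_lt_ext; intros; ring.
Qed.
Lemma rpoly_scal n a p : rpoly n p -> rpoly n (fun t => a * p t).
Proof.
  intros [c Hc]. exists (fun k => a * c k). intros t. rewrite Hc, <- sum_lt_scal.
  apply sum_lt_ext; intros; ring.
Qed.
Lemma rpoly_S n p : rpoly n p -> rpoly (S n) p.
Proof.
  intros [c Hc]. exists (fun k => if Nat.eqb k n then 0 else c k). intros t. rewrite Hc. simpl.
  rewrite Nat.eqb_refl, Rmult_0_l, Rplus_0_r. apply sum_lt_ext. intros k Hk.
  destruct (Nat.eqb_spec k n); [lia|reflexivity].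
Qed.
Lemma rpoly_shift n p : rpoly n p -> rpoly (S n) (fun t => t * p t).
Proof.
  intros [c Hc]. exists (fun k => match k with O => 0 | S k => c k end). intros t.
  rewrite Hc. change (S n) with (1 + n)%nat. rewrite sum_lt_add. simpl sum_lt at 2.
  rewrite <- sum_lt_scal. rewrite Rmult_0_l, !Rplus_0_l. apply sum_lt_ext. intros; simpl; ring.
Qed.
Lemma rpoly_const a : rpoly 1 (fun _ => a).
Proof. exists (fun _ => a). intros; simpl; ring. Qed.

Lemma rpoly_primitive n p : rpoly n p -> exists q, rpoly (S n) q /\ forall t, is_derive q t (p t).
Proof.
  intros [c Hc]. set (q := fun n t => sum_lt (fun k => c k / INR (S k) * t ^ S k) n).
  exists (q n). split.
  - exists (fun k => match k with O => 0 | S k => c k / INR (S k) end). intros t.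
    change (S n) with (1 + n)%nat. unfold q. rewrite sum_lt_add. cbn [sum_lt].
    rewrite Rmult_0_l, !Rplus_0_l. apply sum_lt_ext. reflexivity.
  - intros t. rewrite Hc. clear Hc. induction n as [|n IH]; [exact (der_const 0 t)|].
    apply (der_plus (q n) (fun t => c n / INR (S n) * t ^ S n)); [exact IH|].
    apply (der_eq _ _ (c n / INR (S n) * (INR (S n) * t ^ n))).
    + apply (is_derive_scal (fun x => x ^ S n)). apply is_derive_Reals. apply (derivable_pt_lim_pow t (S n)).
    + field. apply not_0_INR. lia.
Qed.

Lemma rpoly_cos_low n p : rpoly n p -> low n (fun y => p (cos y)).
Proof.
  intros [c Hc]. apply low_ext with (fun y => sum_lt (fun k => c k * cos y ^ k) n); [intros; now rewrite Hc|].
  clear Hc. induction n as [|n IH]; [apply low_ext with (fun _ => 0); [reflexivity|apply low_zero]|].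
  simpl. apply low_plus; [now apply low_weaken1|]. apply low_scal.
  destruct (deg_cos_pow n) as [b [_ H]]. now apply deg_low in H.
Qed.

(* [bern n x F] is the expectation of [F] under the binomial law of parameters [n] and [x]. *)
Fixpoint bern (n : nat) (x : R) (F : R -> R) : R :=
  match n with
  | O => F 0
  | S n => x * bern n x (fun s => F (s + 1)) + (1 - x) * bern n x F
  end.

Lemma bern_ext n x F G : (forall s, F s = G s) -> bern n x F = bern n x G.
Proof.
  revert F G. induction n as [|n IH]; intros F G H; simpl; [apply H|].
  rewrite (IH F G H), (IH (fun s => F (s + 1)) (fun s => G (s + 1))); [reflexivity|intros; apply H].
Qed.
Lemma bern_le n x F G : 0 <= x <= 1 -> (forall s, F s <= G s) -> bern n x F <= bern n x G.
Proof.
  intros Hx. revert F G. induction n as [|n IH]; intros F G H; simpl; [apply H|].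
  apply Rplus_le_compat; (apply Rmult_le_compat_l; [lra|apply IH; intros; apply H]).
Qed.
(** Mean and variance of the binomial law; general quadratics are needed since the recursion shifts
    the argument by 1. *)
Lemma bern_quadratic n x a b c :
  bern n x (fun s => a + b * s + c * s ^ 2)
  = a + b * (INR n * x) + c * (INR n * x * (1 - x) + (INR n * x) ^ 2).
Proof.
  revert a b c. induction n as [|n IH]; intros a b c.
  - simpl. ring.
  - change (bern (S n) x ?F) with (x * bern n x (fun s => F (s + 1)) + (1 - x) * bern n x F). cbv beta.
    rewrite (bern_ext n x (fun s => a + b * (s + 1) + c * (s + 1) ^ 2)
      (fun s => (a + b + c) + (b + 2 * c) * s + c * s ^ 2)) by (intros; ring).
    rewrite !IH, S_INR. ring.
Qed.
Lemma bern_rpoly n F : exists m, rpoly m (fun t => bern n ((1 + t) / 2) F).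
Proof.
  revert F. assert (W : forall m k p, rpoly m p -> rpoly (k + m) p).
  { induction k as [|k IH]; intros; simpl; auto using rpoly_S. }
  induction n as [|n IH]; intros F.
  - exists 1%nat. exact (rpoly_const (F 0)).
  - destruct (IH (fun s => F (s + 1))) as [m1 H1]. destruct (IH F) as [m2 H2].
    exists (S (m1 + m2)).
    apply (W _ m2) in H1. apply (W _ m1) in H2. rewrite (Nat.add_comm m2) in H1.
    pose proof (rpoly_S _ _ H1) as H1'. pose proof (rpoly_S _ _ H2) as H2'.
    apply rpoly_shift in H1. apply rpoly_shift in H2.
    eapply rpoly_ext; [|apply (rpoly_plus _ _ _ (rpoly_scal _ (/ 2) _ (rpoly_plus _ _ _ H1' H1))
      (rpoly_scal _ (/ 2) _ (rpoly_plus _ _ _ H2' (rpoly_scal _ (-1) _ H2))))].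
    intros t. cbv beta. simpl bern. field.
Qed.

(** [bern_le] compares functions on the whole line, so a function given on [[-1, 1]] is extended
    through this projection. *)
Definition clamp (s : R) : R := Rmax (-1) (Rmin 1 s).

Lemma clamp_spec s : -1 <= clamp s <= 1 /\ (-1 <= s <= 1 -> clamp s = s) /\
  forall t, Rabs (clamp s - clamp t) <= Rabs (s - t).
Proof.
  unfold clamp, Rmax, Rmin. split; [|split].
  - repeat destruct Rle_dec; lra.
  - intros. repeat destruct Rle_dec; lra.
  - intros t. repeat destruct Rle_dec; unfold Rabs; repeat destruct Rcase_abs; lra.
Qed.

(** Bernstein's argument: uniform continuity near [t] and a multiple of the squared deviation
    elsewhere bound [g - g t], and the binomial variance makes the expectation of that square at
    most [1 / n]. *)
Lemma weierstrass (g : R -> R) e :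
  (forall t, -1 <= t <= 1 -> continuous g t) -> 0 < e ->
  exists n p, rpoly n p /\ forall t, -1 <= t <= 1 -> Rabs (p t - g t) <= e.
Proof.
  intros Hg He.
  assert (Hc : forall t, -1 <= t <= 1 -> continuity_pt g t).
  { intros t Ht. apply continuity_pt_filterlim. now apply Hg. }
  destruct (Heine_cor2 Hc (mkposreal (e / 2) ltac:(lra))) as [d Hd]. simpl in Hd.
  destruct (continuity_ab_maj (fun t => Rabs (g t)) (-1) 1) as [tm [HM _]]; [lra| |].
  { intros t Ht. apply continuity_pt_filterlim. apply cont_abs. now apply Hg. }
  set (M := Rabs (g tm)) in *. assert (HM0 : 0 <= M) by apply Rabs_pos. pose proof (cond_pos d) as Hd0.
  destruct (archimed_cor1 (e / 2 / (2 * M / d ^ 2 + 1))) as [n [Hn Hn0]].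
  { apply Rdiv_lt_0_compat; [lra|]. assert (0 <= 2 * M / d ^ 2); [|lra].
    apply Rdiv_le_0_compat; [lra|apply pow_lt; lra]. }
  set (K := 2 * M / d ^ 2) in *.
  assert (HK : 0 <= K) by (apply Rdiv_le_0_compat; [lra|apply pow_lt; lra]).
  assert (Nn : 0 < INR n) by (apply lt_0_INR; lia).
  set (F := fun s => g (clamp (2 * s / INR n - 1))).
  destruct (bern_rpoly n F) as [m Hm]. exists m, (fun t => bern n ((1 + t) / 2) F).
  split; [exact Hm|]. intros t Ht. set (x := (1 + t) / 2). assert (Hx : 0 <= x <= 1) by (unfold x; lra).
  assert (B : forall s, Rabs (F s - g t) <= e / 2 + K * (2 * s / INR n - 1 - t) ^ 2).
  { intros s. unfold F. destruct (clamp_spec (2 * s / INR n - 1)) as [C1 [_ C2]].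
    destruct (clamp_spec t) as [_ [C3 _]]. specialize (C2 t). rewrite (C3 Ht) in C2.
    set (z := 2 * s / INR n - 1) in *.
    assert (Q : 0 <= K * (z - t) ^ 2) by (apply Rmult_le_pos; [exact HK|apply pow2_ge_0]).
    destruct (Rlt_dec (Rabs (z - t)) d) as [L|L].
    - assert (Rabs (g (clamp z) - g t) < e / 2) by (apply Hd; lra). lra.
    - apply Rnot_lt_le in L.
      assert (d ^ 2 <= (z - t) ^ 2).
      { rewrite <- (pow2_abs (z - t)). apply pow_incr. lra. }
      assert (2 * M <= K * (z - t) ^ 2).
      { replace (2 * M) with (K * d ^ 2) by (unfold K; field; lra). now apply Rmult_le_compat_l. }
      pose proof (HM (clamp z) C1). pose proof (HM t Ht). 
      pose proof (Rabs_triang (g (clamp z)) (- g t)) as T. rewrite Rabs_Ropp in T. unfold Rminus. lra. }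
  set (q := fun s : R => (e / 2 + K * (1 + t) ^ 2) + (- (4 * K * (1 + t) / INR n)) * s + (4 * K / INR n ^ 2) * s ^ 2).
  assert (Eq : bern n x q <= e).
  { unfold q. rewrite bern_quadratic. replace (1 + t) with (2 * x) by (unfold x; field).
    replace (e / 2 + K * (2 * x) ^ 2 + - (4 * K * (2 * x) / INR n) * (INR n * x)
      + 4 * K / INR n ^ 2 * (INR n * x * (1 - x) + (INR n * x) ^ 2)) with (e / 2 + K * (4 * x * (1 - x)) * / INR n)
      by (field; lra).
    assert (X01 : 0 <= 4 * x * (1 - x) <= 1).
    { split; [repeat apply Rmult_le_pos; lra|]. pose proof (pow2_ge_0 (1 - 2 * x)). lra. }
    assert (X1 : K * (4 * x * (1 - x)) <= K + 1) by (apply Rle_trans with (K * 1); [apply Rmult_le_compat_l|]; lra).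
    assert (X2 : 0 <= K * (4 * x * (1 - x))) by (apply Rmult_le_pos; lra).
    assert (H0 : K * (4 * x * (1 - x)) * / INR n <= (K + 1) * (e / 2 / (K + 1))).
    { apply Rmult_le_compat; try lra. apply Rlt_le, Rinv_0_lt_compat, Nn. }
    replace ((K + 1) * (e / 2 / (K + 1))) with (e / 2) in H0 by (field; lra). lra. }
  assert (qs : forall s, e / 2 + K * (2 * s / INR n - 1 - t) ^ 2 = q s) by (intros; unfold q; field; lra).
  assert (lin : forall c F, bern n x (fun s => c + F s) = c + bern n x F).
  { clear. intros c. induction n as [|n IH]; intros F; simpl; [reflexivity|].
    rewrite (IH F), (IH (fun s => F (s + 1))). ring. }
  assert (neg : forall F, bern n x (fun s => - F s) = - bern n x F).
  { clear. induction n as [|n IH]; intros F; simpl; [reflexivity|].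
    rewrite (IH F), (IH (fun s => F (s + 1))). ring. }
  apply Rabs_le. split.
  - assert (bern n x (fun s => g t + - q s) <= bern n x F).
    { apply bern_le; [exact Hx|]. intros s. specialize (B s). rewrite qs in B. apply Rabs_le_between in B. lra. }
    rewrite lin, neg in H. lra.
  - assert (bern n x F <= bern n x (fun s => g t + q s)).
    { apply bern_le; [exact Hx|]. intros s. specialize (B s). rewrite qs in B. apply Rabs_le_between in B. lra. }
    rewrite lin in H. lra.
Qed.

Lemma low_real_part n u : low n u -> exists l, forall y, u y = Re (ev l y).
Proof.
  apply (low_ind (fun u => exists l, forall y, u y = Re (ev l y))).
  - exists nil. reflexivity.
  - intros u1 v [l Hl] [m Hm]. exists (ladd l m). intros y. rewrite ev_ladd, Hl, Hm. reflexivity.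
  - intros a j _. exists (lscal a (repeat 0 j ++ 1 :: nil)). intros y. rewrite ev_lscal.
    assert (E : ev (repeat 0 j ++ 1 :: nil) y = zn j y).
    { induction j as [|j IH].
      - simpl. unfold zn. rewrite cosn_0, sinn_0. apply injective_projections; simpl; ring.
      - simpl. rewrite IH, zn_S. ring. }
    rewrite E. unfold zn. simpl. ring.
  - intros u1 v H [l Hl]. exists l. intros y. now rewrite <- H.
Qed.

(** The quotient [(T_k(X) - T_k(cos t)) / (X - cos t)] at [X = cos y], with [T_k] the Chebyshev
    polynomials, built by their recurrence so that nothing is divided at [y = t]. Its integral is
    Glauert's. *)
Fixpoint cheb_quot (t : R) (k : nat) (y : R) : R :=
  match k with
  | O => 0
  | S O => 1
  | S (S j as k') => 2 * cosn k' y + 2 * cos t * cheb_quot t k' y - cheb_quot t j y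
  end.

Lemma cheb_quot_spec t k : 0 < t < PI ->
  (low k (cheb_quot t k) /\ (forall y, (cos y - cos t) * cheb_quot t k y = cosn k y - cosn k t) /\
     II (cheb_quot t k) = PI * sinn k t / sin t).
Proof.
  intros Ht. assert (Hs : 0 < sin t) by (apply sin_gt_0; lra).
  assert (H : (low k (cheb_quot t k) /\ (forall y, (cos y - cos t) * cheb_quot t k y = cosn k y - cosn k t) /\
     II (cheb_quot t k) = PI * sinn k t / sin t) /\
   (low (S k) (cheb_quot t (S k)) /\ (forall y, (cos y - cos t) * cheb_quot t (S k) y = cosn (S k) y - cosn (S k) t) /\
     II (cheb_quot t (S k)) = PI * sinn (S k) t / sin t)); [|apply H].
  induction k as [|k [[A1 [A2 A3]] [B1 [B2 B3]]]].
  - split; (split; [|split]).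
    + apply low_zero.
    + intros; simpl. rewrite !cosn_0. ring.
    + simpl cheb_quot. rewrite sinn_0. rewrite II_zero. field. lra.
    + apply low_ext with (cosn 0); [intros; apply cosn_0|apply low_cosn; lia].
    + intros; simpl. rewrite !cosn_1. ring.
    + simpl cheb_quot. rewrite sinn_1, (II_one _ weight_one). field. lra.
  - split; [auto|].
    assert (E : forall y, cheb_quot t (S (S k)) y = 2 * cosn (S k) y + (2 * cos t * cheb_quot t (S k) y - cheb_quot t k y)).
    { intros y. change (cheb_quot t (S (S k)) y) with (2 * cosn (S k) y + 2 * cos t * cheb_quot t (S k) y - cheb_quot t k y). ring. }
    split; [|split].
    + apply low_ext with (fun y => 2 * cosn (S k) y + (2 * cos t * cheb_quot t (S k) y - cheb_quot t k y)); [intros; now rewrite E|].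
      apply low_plus; [apply low_scal, low_cosn; lia|]. apply low_minus; [apply low_scal; now apply low_weaken1|].
      now do 2 apply low_weaken1.
    + intros y. rewrite E, (cosn_rec k y), (cosn_rec k t).
      replace ((cos y - cos t) * (2 * cosn (S k) y + (2 * cos t * cheb_quot t (S k) y - cheb_quot t k y)))
        with (2 * (cos y - cos t) * cosn (S k) y + 2 * cos t * ((cos y - cos t) * cheb_quot t (S k) y)
              - (cos y - cos t) * cheb_quot t k y) by ring.
      rewrite A2, B2. ring.
    + rewrite (II_ext _ _ (fun y _ => E y)).
      assert (D0 : dom (fun _ => 1) (cosn (S k))) by (apply low_dom with (S (S k)), low_cosn; lia).
      assert (D1 := low_dom _ _ B1). assert (D2 := low_dom _ _ A1).
      rewrite (II_plus _ weight_one), (II_minus _ weight_one), !(II_scal _ weight_one), A3, B3, II_cosn;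
        auto using dom_scal, dom_minus.
      assert (R1 : sinn (S (S k)) t = 2 * cos t * sinn (S k) t - sinn k t).
      { rewrite (sinn_S (S k)), (sinn_S k), (cosn_S k). pose proof (sin2_cos2 t) as S. unfold Rsqr in S.
        replace (sinn k t) with (sinn k t * (sin t * sin t + cos t * cos t)) at 4 by (rewrite S; ring). ring. }
      rewrite R1. simpl Nat.eqb. cbv iota. field. lra.
Qed.

(** For a polynomial with real coefficients, its imaginary part at [t] is [sin t / PI] times the
    integral of the difference quotient of its real part: the conjugate function without a singular
    integral. *)
Lemma conjugate_quotient t l : 0 < t < PI -> forall k,
  exists n q, low n q /\ (forall y, (cos y - cos t) * q y = hpol k l y - hpol k l t) /\
    II q = PI * Im (zn k t * ev l t)%C / sin t.
Proof.
  intros Ht. assert (Hs : 0 < sin t) by (apply sin_gt_0; lra).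
  induction l as [|a l IH]; intros k.
  - exists 0%nat, (fun _ => 0). split; [apply low_zero|]. split.
    + intros y. unfold hpol. simpl. ring.
    + rewrite II_zero. simpl. field. lra.
  - destruct (IH (S k)) as [n [q [H1 [H2 H3]]]]. destruct (cheb_quot_spec t k Ht) as [C1 [C2 C3]].
    exists (n + k)%nat, (fun y => a * cheb_quot t k y + q y). split; [|split].
    + apply low_plus; [apply low_scal; apply low_weaken with k; [lia|exact C1]|apply low_weaken with n; [lia|exact H1]].
    + intros y. rewrite !hpol_cons.
      replace ((cos y - cos t) * (a * cheb_quot t k y + q y)) with
        (a * ((cos y - cos t) * cheb_quot t k y) + (cos y - cos t) * q y) by ring.
      rewrite C2, H2. ring.
    + rewrite (II_plus _ weight_one), (II_scal _ weight_one), C3, H3.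
      * rewrite zn_S. simpl ev. destruct (ev l t) as [p r]. unfold zn, ei. simpl. field. lra.
      * now apply low_dom with k.
      * apply dom_scal. now apply low_dom with k.
      * now apply low_dom with n.
Qed.

Definition defect_fun (f : R -> R) (M : nat) (v1 v2 : R -> Complex.C) (y : R) : Complex.C :=
  (Cconj (ev (lsin M) y * v1 y) * RtoC (f y) - ev (lsin M) y * v2 y)%C.

(* Same conditions as [szego_pair], before the replacement of [1/D] and [D] by polynomials. *)
Definition szego_fun (f : R -> R) (M : nat) (t d : R) (w0 : Complex.C) (e : R)
    (v1 v2 : R -> Complex.C) (r1 r2 : R) : Prop :=
  0 < r1 /\ 0 < r2 /\ 1 - e <= r1 * r2 /\
  II (fun y => Cmod (ev (lsin M) y * v1 y) ^ 2 * f y) <= PI + e /\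
  II (fun y => Cmod (ev (lsin M) y * v2 y) ^ 2 * / f y) <= PI + e /\
  II (fun y => Cmod (defect_fun f M v1 v2 y)) <= e /\
  Cmod (defect_fun f M v1 v2 t) <= e /\
  (forall y, Rabs (y - t) < d ->
     Cmod (defect_fun f M v1 v2 y - defect_fun f M v1 v2 t) <= e * Rabs (y - t)) /\
  Cmod (ev (lsin M) t * v1 t - w0) <= e.

Lemma lsin_bound M y : Cmod (ev (lsin M) y) <= 2 ^ M.
Proof.
  apply Rsqr_incr_0_var; [|apply pow_le; lra]. rewrite !Rsqr_pow2, lsin_mod.
  replace ((2 ^ M) ^ 2) with (4 ^ M * 1).
  - apply Rmult_le_compat_l; [apply pow_le; lra|]. rewrite pow_mult, <- (pow1 M). apply pow_incr.
    pose proof (sin2_cos2 y) as E. unfold Rsqr in E. simpl. nra.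
  - rewrite <- pow_mult, Nat.mul_comm, pow_mult, Rmult_1_r. f_equal. ring.
Qed.

Lemma II_const c : II (fun _ => c) = PI * c.
Proof.
  rewrite (II_ext _ (fun _ => c * 1)) by (intros; ring).
  rewrite (II_scal _ weight_one), (II_one _ weight_one); [ring|].
  apply (bounded_dom (fun _ => 1) 1); intros; [cont|rewrite Rabs_R1; lra].
Qed.
Lemma dom_const f c : integrable_weight f -> dom f (fun _ => c).
Proof. intros Hf. apply (dom_bounded _ Hf _ (Rabs c)); intros; [cont|lra]. Qed.
Lemma dom_self f : integrable_weight f -> dom f f.
Proof.
  intros Hf. split; [apply Hf|]. exists 1. intros y Hy. pose proof (proj1 (proj2 Hf) y Hy).
  rewrite Rabs_pos_eq; lra.
Qed.

Lemma square_add_le z u B e : 0 <= z <= u + e -> 0 <= u <= B -> 0 <= e <= 1 -> z ^ 2 <= u ^ 2 + e * (2 * B + 1).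
Proof. intros Hz Hu He. assert (z ^ 2 <= (u + e) ^ 2) by (apply pow_incr; lra). nra. Qed.

Section Polynomials.
Variable f : R -> R.
Hypothesis Hf : integrable_weight f.
Variables (M : nat) (Cb t d L m0 : R).
Hypothesis HMf : forall y, 0 < y < PI -> sin y ^ (2 * M) * f y <= Cb.
Hypothesis HMi : forall y, 0 < y < PI -> sin y ^ (2 * M) <= Cb * f y.
Hypothesis Ht : 0 < t < PI.
Hypothesis Hd : 0 < d.
Hypothesis Hnear : forall y, Rabs (y - t) < d -> 0 < y < PI /\ m0 <= f y /\ Rabs (f y - f t) <= L * Rabs (y - t).

Lemma near_L_pos : 0 <= L.
Proof.
  destruct (Hnear (t + d / 2)) as [_ [_ H]].
  - replace (t + d / 2 - t) with (d / 2) by ring. rewrite Rabs_pos_eq; lra.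
  - replace (t + d / 2 - t) with (d / 2) in H by ring. rewrite (Rabs_pos_eq (d / 2)) in H by lra.
    pose proof (Rabs_pos (f (t + d / 2) - f t)). nra.
Qed.

(** Both exponentials are replaced by polynomials that are close in all three senses of
    [exp_poly_approx]; each condition is perturbed by at most [e]. *)
Lemma szego_polynomials w0 e lA lB : 0 < e ->
  szego_fun f M t d w0 e (fun y => cexp (ev lA y)) (fun y => cexp (ev lB y)) (exp (hd 0 lA)) (exp (hd 0 lB)) ->
  exists l1 l2, szego_pair f M t d w0 (2 * e) l1 l2.
Proof.
  intros He (p1 & p2 & p3 & p4 & p5 & p6 & p7 & p8 & p9).
  pose proof (proj1 (proj2 Hf)) as fpos. pose proof (proj1 Hf) as fcont. pose proof near_L_pos as HL.
  pose proof PI_RGT_0 as Hpi. pose proof (fpos t Ht) as Ft.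
  set (Z := ev (lsin M)) in *. set (v1 := fun y => cexp (ev lA y)) in *. set (v2 := fun y => cexp (ev lB y)) in *.
  set (r1 := exp (hd 0 lA)) in *. set (r2 := exp (hd 0 lB)) in *.
  assert (VB : forall l, exists B, 0 <= B /\ forall y, Cmod (cexp (ev l y)) <= B).
  { intros l. destruct (ev_bounded l) as [B [HB HB']]. exists (exp B). split; [apply Rlt_le, exp_pos|].
    intros y. rewrite Cmod_cexp. apply exp_le. eapply Rle_trans; [apply Rle_abs|].
    eapply Rle_trans; [apply re_le_Cmod|apply HB']. }
  destruct (VB lA) as [B1 [HB1 HB1']]. destruct (VB lB) as [B2 [HB2 HB2']]. clear VB.
  destruct (ev_lipschitz (lsin M)) as [LZ [HLZ HLZ']]. fold Z in HLZ'.
  assert (HZ : forall y, Cmod (Z y) <= 2 ^ M) by (intros; apply lsin_bound).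
  assert (H2M : 0 < 2 ^ M) by (apply pow_lt; lra). assert (H4M : 0 < 4 ^ M) by (apply pow_lt; lra).
  assert (Zmod : forall y, Cmod (Z y) ^ 2 = 4 ^ M * sin y ^ (2 * M)) by (intros; apply lsin_mod).
  assert (Spos : forall y, 0 < y < PI -> 0 < sin y ^ (2 * M)) by (intros; apply pow_lt, sin_gt_0; lra).
  assert (HCb : 0 <= Cb).
  { specialize (HMf t Ht). pose proof (Spos t Ht). nra. }
  assert (If : 0 <= II f) by (apply (II_ge_0 _ Hf); [now apply dom_self|intros; apply Rlt_le; auto]).
  (* One summand for each condition to be preserved, so that a single tolerance [e3 <= e / Q] serves
     them all; [e3] is also at most half of [r1] and [r2] to keep the constant coefficients
     positive. *)
  set (Q := 1 + (r1 + r2) + PI * (4 ^ M * Cb * (2 * B1 + 1)) + PI * (4 ^ M * Cb * (2 * B2 + 1)) + 2 ^ M * (II f + PI)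
            + 2 ^ M * (f t + 1) + (2 ^ M * L + 2 ^ M * f t + LZ * f t + 2 ^ M + LZ) + 2 ^ M).
  assert (N1 : 0 <= r1 + r2) by lra.
  assert (N2 : 0 <= PI * (4 ^ M * Cb * (2 * B1 + 1)))
    by (apply Rmult_le_pos; [lra|apply Rmult_le_pos; [apply Rmult_le_pos|]; lra]).
  assert (N3 : 0 <= PI * (4 ^ M * Cb * (2 * B2 + 1)))
    by (apply Rmult_le_pos; [lra|apply Rmult_le_pos; [apply Rmult_le_pos|]; lra]).
  assert (N4 : 0 <= 2 ^ M * (II f + PI)) by (apply Rmult_le_pos; lra).
  assert (N5 : 0 <= 2 ^ M * (f t + 1)) by (apply Rmult_le_pos; lra).
  assert (N6 : 0 <= 2 ^ M * L + 2 ^ M * f t + LZ * f t + 2 ^ M + LZ).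
  { assert (0 <= 2 ^ M * L) by (apply Rmult_le_pos; lra). assert (0 <= 2 ^ M * f t) by (apply Rmult_le_pos; lra).
    assert (0 <= LZ * f t) by (apply Rmult_le_pos; lra). lra. }
  assert (HQ : 1 <= Q) by (unfold Q; lra).
  set (e3 := Rmin (Rmin 1 (e / Q)) (Rmin (r1 / 2) (r2 / 2))).
  assert (He3 : 0 < e3).
  { unfold e3. repeat apply Rmin_glb_lt; try lra. apply Rdiv_lt_0_compat; lra. }
  assert (He3a : e3 <= 1) by (eapply Rle_trans; [apply Rmin_l|apply Rmin_l]).
  assert (He3b : e3 * Q <= e).
  { apply (proj2 (Rle_div_r e3 e Q ltac:(lra))). eapply Rle_trans; [apply Rmin_l|apply Rmin_r]. }
  assert (He3c : e3 <= r1 / 2) by (eapply Rle_trans; [apply Rmin_r|apply Rmin_l]).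
  assert (He3d : e3 <= r2 / 2) by (eapply Rle_trans; [apply Rmin_r|apply Rmin_r]).
  assert (Qle : forall q, q <= Q -> e3 * q <= e).
  { intros q Hq. eapply Rle_trans; [|exact He3b]. apply Rmult_le_compat_l; lra. }
  destruct (exp_poly_approx lA e3 He3) as [l1 [A1 [A2 A3]]].
  destruct (exp_poly_approx lB e3 He3) as [l2 [C1 [C2 C3]]].
  set (q1 := fun y => (ev l1 y - v1 y)%C). set (q2 := fun y => (ev l2 y - v2 y)%C).
  change (forall y, Cmod (q1 y) <= e3) in A2. change (forall x y, Cmod (q1 x - q1 y) <= e3 * Rabs (x - y)) in A3.
  change (forall y, Cmod (q2 y) <= e3) in C2. change (forall x y, Cmod (q2 x - q2 y) <= e3 * Rabs (x - y)) in C3.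
  fold r1 in A1. fold r2 in C1. apply Rabs_le_between in A1, C1.
  set (D0 := defect_fun f M v1 v2) in *.
  set (X := fun y => (Cconj (Z y * q1 y) * RtoC (f y) - Z y * q2 y)%C).
  assert (ED : forall y, defect f (lmul (lsin M) l1) (lmul (lsin M) l2) y = (D0 y + X y)%C).
  { intros y. unfold defect, D0, defect_fun, X. rewrite !ev_lmul. fold (Z y).
    replace (ev l1 y) with (v1 y + q1 y)%C by (unfold q1; ring).
    replace (ev l2 y) with (v2 y + q2 y)%C by (unfold q2; ring).
    rewrite !Cmult_conj, Cplus_conj. ring. }
  assert (XB : forall y, 0 < y < PI -> Cmod (X y) <= e3 * (2 ^ M * (f y + 1))).
  { intros y Hy. pose proof (fpos y Hy). unfold X. eapply Rle_trans; [apply Cmod_triangle|].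
    rewrite Cmod_opp, !Cmod_mult, Cmod_conj, Cmod_mult, Cmod_R, (Rabs_pos_eq (f y)) by lra.
    pose proof (HZ y). pose proof (A2 y). pose proof (C2 y). pose proof (Cmod_ge_0 (Z y)).
    pose proof (Cmod_ge_0 (q1 y)). pose proof (Cmod_ge_0 (q2 y)).
    assert (Cmod (Z y) * Cmod (q1 y) <= 2 ^ M * e3) by (apply Rmult_le_compat; assumption).
    assert (Cmod (Z y) * Cmod (q2 y) <= 2 ^ M * e3) by (apply Rmult_le_compat; assumption).
    assert (Cmod (Z y) * Cmod (q1 y) * f y <= 2 ^ M * e3 * f y) by (apply Rmult_le_compat_r; lra). lra. }
  assert (vc1 : forall y, ccont v1 y) by (intros; apply ccont_cexp, ccont_ev).
  assert (vc2 : forall y, ccont v2 y) by (intros; apply ccont_cexp, ccont_ev).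
  assert (Zc : forall y, ccont Z y) by (intros; apply ccont_ev).
  assert (D0c : forall y, 0 < y < PI -> ccont D0 y).
  { intros y Hy. unfold D0, defect_fun. apply ccont_minus; [|now apply ccont_mult].
    apply ccont_mult; [apply ccont_conj; now apply ccont_mult|apply ccont_real; auto]. }
  assert (D0d : dom f (fun y => Cmod (D0 y))).
  { split; [intros; apply ccont_mod; auto|]. exists (2 ^ M * B1 + 2 ^ M * B2). intros y Hy. pose proof (fpos y Hy).
    rewrite Rabs_pos_eq by apply Cmod_ge_0. unfold D0, defect_fun. eapply Rle_trans; [apply Cmod_triangle|].
    rewrite Cmod_opp, !Cmod_mult, Cmod_conj, Cmod_mult, Cmod_R, (Rabs_pos_eq (f y)) by lra.
    pose proof (HZ y). specialize (HB1' y). specialize (HB2' y). fold (v1 y) in HB1'. fold (v2 y) in HB2'. fold (Z y).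
    pose proof (Cmod_ge_0 (Z y)). pose proof (Cmod_ge_0 (v1 y)). pose proof (Cmod_ge_0 (v2 y)).
    assert (Cmod (Z y) * Cmod (v1 y) <= 2 ^ M * B1) by (apply Rmult_le_compat; assumption).
    assert (Cmod (Z y) * Cmod (v2 y) <= 2 ^ M * B2) by (apply Rmult_le_compat; assumption).
    assert (0 <= Cmod (Z y) * Cmod (v1 y)) by (apply Rmult_le_pos; assumption).
    assert (Cmod (Z y) * Cmod (v1 y) * f y <= 2 ^ M * B1 * f y) by (apply Rmult_le_compat_r; lra).
    assert (0 <= 2 ^ M * B2 * f y) by (apply Rmult_le_pos; [apply Rmult_le_pos|]; lra). nra. }
  (* Used for both norm conditions, with [w = f] and with [w = / f]; the common requirement is that
     [sin y ^ (2 * M) * w y] be bounded. *)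
  assert (quad : forall (v : R -> Complex.C) l B w, (forall y, ccont v y) -> (forall y, Cmod (v y) <= B) -> 0 <= B ->
      (forall y, Cmod (ev l y - v y) <= e3) -> (forall y, 0 < y < PI -> continuous w y) ->
      (forall y, 0 < y < PI -> 0 <= w y) -> (forall y, 0 < y < PI -> sin y ^ (2 * M) * w y <= Cb) ->
      e3 * (PI * (4 ^ M * Cb * (2 * B + 1))) <= e ->
      II (fun y => Cmod (Z y * v y) ^ 2 * w y) <= PI + e ->
      II (fun y => Cmod (ev (lmul (lsin M) l) y) ^ 2 * w y) <= PI + 2 * e).
  { intros v l B w vc vB HB0 Hvl wc w0' wS Hq HI.
    assert (E1 : forall y, Cmod (Z y * v y) ^ 2 * w y = 4 ^ M * (sin y ^ (2 * M) * w y) * Cmod (v y) ^ 2).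
    { intros y. rewrite Cmod_mult, Rpow_mult_distr, Zmod. ring. }
    assert (E2 : forall y, Cmod (ev (lmul (lsin M) l) y) ^ 2 * w y = 4 ^ M * (sin y ^ (2 * M) * w y) * Cmod (ev l y) ^ 2).
    { intros y. rewrite ev_lmul, Cmod_mult, Rpow_mult_distr. fold (Z y). rewrite Zmod. ring. }
    assert (wn : forall y, 0 < y < PI -> 0 <= sin y ^ (2 * M) * w y).
    { intros y Hy. apply Rmult_le_pos; [apply Rlt_le|]; auto. }
    assert (Dv : dom f (fun y => Cmod (Z y * v y) ^ 2 * w y)).
    { apply (dom_bounded _ Hf _ (4 ^ M * Cb * B ^ 2)).
      - intros y Hy. apply cont_mult; [|auto]. apply cont_pow, ccont_mod, ccont_mult; auto.
      - intros y Hy. rewrite E1. rewrite Rabs_pos_eq.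
        + apply Rmult_le_compat; [apply Rmult_le_pos; [lra|auto]|apply pow2_ge_0|apply Rmult_le_compat_l; [lra|auto]|].
          apply pow_incr. split; [apply Cmod_ge_0|apply vB].
        + apply Rmult_le_pos; [apply Rmult_le_pos; [lra|auto]|apply pow2_ge_0]. }
    assert (P : forall y, 0 < y < PI -> Cmod (ev (lmul (lsin M) l) y) ^ 2 * w y
        <= Cmod (Z y * v y) ^ 2 * w y + e3 * (4 ^ M * Cb * (2 * B + 1))).
    { intros y Hy. rewrite E1, E2.
      assert (S1 : Cmod (ev l y) ^ 2 <= Cmod (v y) ^ 2 + e3 * (2 * B + 1)).
      { apply square_add_le; [split; [apply Cmod_ge_0|]|split; [apply Cmod_ge_0|apply vB]|lra].
        replace (ev l y) with (v y + (ev l y - v y))%C by ring.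
        eapply Rle_trans; [apply Cmod_triangle|]. specialize (Hvl y). lra. }
      assert (0 <= 4 ^ M * (sin y ^ (2 * M) * w y) <= 4 ^ M * Cb).
      { split; [apply Rmult_le_pos; [lra|auto]|apply Rmult_le_compat_l; [lra|auto]]. }
      apply Rle_trans with (4 ^ M * (sin y ^ (2 * M) * w y) * (Cmod (v y) ^ 2 + e3 * (2 * B + 1))).
      - apply Rmult_le_compat_l; lra.
      - assert (4 ^ M * (sin y ^ (2 * M) * w y) * (e3 * (2 * B + 1)) <= 4 ^ M * Cb * (e3 * (2 * B + 1))).
        { apply Rmult_le_compat_r; [apply Rmult_le_pos; lra|lra]. }
        lra. }
    apply Rle_trans with (II (fun y => Cmod (Z y * v y) ^ 2 * w y + e3 * (4 ^ M * Cb * (2 * B + 1)))).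
    - apply (II_le _ Hf); [|apply dom_plus; [exact Dv|now apply dom_const]|exact P].
      apply (dom_bounded _ Hf _ (4 ^ M * Cb * (B + 1) ^ 2)).
      + intros y Hy. apply cont_mult; [|auto]. apply cont_pow, ccont_mod, ccont_ev.
      + intros y Hy. rewrite E2. rewrite Rabs_pos_eq.
        * apply Rmult_le_compat; [apply Rmult_le_pos; [lra|auto]|apply pow2_ge_0|apply Rmult_le_compat_l; [lra|auto]|].
          apply pow_incr. split; [apply Cmod_ge_0|].
          replace (ev l y) with (v y + (ev l y - v y))%C by ring.
          eapply Rle_trans; [apply Cmod_triangle|]. specialize (Hvl y). specialize (vB y). lra.
        * apply Rmult_le_pos; [apply Rmult_le_pos; [lra|auto]|apply pow2_ge_0].
    - rewrite (II_plus _ Hf), II_const by (try exact Dv; now apply dom_const). lra. }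
  exists l1, l2. unfold szego_pair. split; [lra|]. split; [lra|]. split; [|split; [|split; [|split; [|split; [|split]]]]].
  - assert (e3 * (r1 + r2) <= e) by (apply Qle; unfold Q; lra).
    assert ((r1 - e3) * (r2 - e3) <= hd 0 l1 * hd 0 l2) by (apply Rmult_le_compat; lra). nra.
  - apply (quad v1 l1 B1 f); auto.
    + intros; apply Rlt_le; auto.
    + apply Qle. unfold Q. lra.
  - apply (quad v2 l2 B2 (fun y => / f y)); auto.
    + intros y Hy. apply cont_inv; [auto|]. apply Rgt_not_eq, fpos, Hy.
    + intros y Hy. left. apply Rinv_0_lt_compat; auto.
    + intros y Hy. apply Rle_div_l; [apply fpos, Hy|auto].
    + apply Qle. unfold Q. lra.
  - apply Rle_trans with (II (fun y => Cmod (D0 y) + e3 * (2 ^ M) * (f y + 1))).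
    + apply (II_le _ Hf).
      * apply (dom_dominated _ _ (fun y => Cmod (D0 y) + e3 * 2 ^ M * (f y + 1))).
        { intros y Hy. apply ccont_mod. unfold defect. apply ccont_minus; [|apply ccont_ev].
          apply ccont_mult; [apply ccont_conj, ccont_ev|apply ccont_real; auto]. }
        { apply dom_plus; [exact D0d|]. apply dom_scal, dom_plus; [now apply dom_self|now apply dom_const]. }
        exists 1. intros y Hy. rewrite Rmult_1_l, (Rabs_pos_eq (Cmod _)) by apply Cmod_ge_0.
        eapply Rle_trans; [|apply Rle_abs]. rewrite ED. eapply Rle_trans; [apply Cmod_triangle|]. specialize (XB y Hy). lra.
      * apply dom_plus; [exact D0d|]. apply dom_scal, dom_plus; [now apply dom_self|now apply dom_const].
      * intros y Hy. rewrite ED. eapply Rle_trans; [apply Cmod_triangle|]. specialize (XB y Hy). lra.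
    + assert (Df := dom_self f Hf). assert (D1 := dom_const f 1 Hf).
      rewrite (II_plus _ Hf), (II_scal _ Hf), (II_plus _ Hf), II_const; auto using dom_plus, dom_scal.
      assert (e3 * (2 ^ M * (II f + PI)) <= e) by (apply Qle; unfold Q; lra). lra.
  - rewrite ED. eapply Rle_trans; [apply Cmod_triangle|]. specialize (XB t Ht).
    assert (e3 * (2 ^ M * (f t + 1)) <= e) by (apply Qle; unfold Q; lra). lra.
  - intros y Hy. destruct (Hnear y Hy) as [Hy' [_ Hly]]. pose proof (fpos y Hy') as Fy. rewrite !ED.
    replace (D0 y + X y - (D0 t + X t))%C with ((D0 y - D0 t) + (X y - X t))%C by ring.
    eapply Rle_trans; [apply Cmod_triangle|]. specialize (p8 y Hy).
    assert (XL : Cmod (X y - X t) <= e3 * (2 ^ M * L + 2 ^ M * f t + LZ * f t + 2 ^ M + LZ) * Rabs (y - t)).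
    { set (r := Rabs (y - t)) in *. assert (Hr : 0 <= r) by apply Rabs_pos.
      (* The product rule for increments, changing one factor at a time; every term carries a factor
         [e3 * |y - t|]. *)
      replace (X y - X t)%C with
        (Cconj (Z y * q1 y) * (RtoC (f y - f t)) + Cconj (Z y * (q1 y - q1 t)) * RtoC (f t)
         + Cconj ((Z y - Z t) * q1 t) * RtoC (f t) - (Z y * (q2 y - q2 t) + (Z y - Z t) * q2 t))%C.
      2:{ unfold X. rewrite RtoC_minus, !Cmult_conj, !Cminus_conj. ring. }
      assert (T4 : forall u1 u2 u3 u4 u5 : Complex.C, Cmod (u1 + u2 + u3 - (u4 + u5)) <= Cmod u1 + Cmod u2 + Cmod u3 + (Cmod u4 + Cmod u5)).
      { intros. eapply Rle_trans; [apply Cmod_triangle|]. rewrite Cmod_opp. apply Rplus_le_compat; [|apply Cmod_triangle].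
        eapply Rle_trans; [apply Cmod_triangle|]. apply Rplus_le_compat_r, Cmod_triangle. }
      eapply Rle_trans; [apply T4|].
      rewrite !Cmod_mult, !Cmod_conj, !Cmod_mult, !Cmod_R, (Rabs_pos_eq (f t)) by lra.
      pose proof (HZ y) as z1. pose proof (HLZ' y t) as z2. fold r in z2. pose proof (A2 y) as a1. pose proof (A2 t) as a2. pose proof (C2 t) as c2.
      pose proof (A3 y t) as a3. pose proof (C3 y t) as c3. fold r in a3, c3.
      pose proof (Cmod_ge_0 (Z y)). pose proof (Cmod_ge_0 (Z y - Z t)). pose proof (Cmod_ge_0 (q1 y)). pose proof (Cmod_ge_0 (q1 t)).
      pose proof (Cmod_ge_0 (q2 t)). pose proof (Cmod_ge_0 (q1 y - q1 t)). pose proof (Cmod_ge_0 (q2 y - q2 t)).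
      pose proof (Rabs_pos (f y - f t)).
      assert (Cmod (Z y) * Cmod (q1 y) * Rabs (f y - f t) <= 2 ^ M * e3 * (L * r)).
      { apply Rmult_le_compat; auto; [now apply Rmult_le_pos|now apply Rmult_le_compat]. }
      assert (Cmod (Z y) * Cmod (q1 y - q1 t) * f t <= 2 ^ M * (e3 * r) * f t).
      { apply Rmult_le_compat_r; [lra|]. now apply Rmult_le_compat. }
      assert (Cmod (Z y - Z t) * Cmod (q1 t) * f t <= LZ * r * e3 * f t).
      { apply Rmult_le_compat_r; [lra|]. now apply Rmult_le_compat. }
      assert (Cmod (Z y) * Cmod (q2 y - q2 t) <= 2 ^ M * (e3 * r)) by now apply Rmult_le_compat.
      assert (Cmod (Z y - Z t) * Cmod (q2 t) <= LZ * r * e3) by now apply Rmult_le_compat.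
      lra. }
    assert (e3 * (2 ^ M * L + 2 ^ M * f t + LZ * f t + 2 ^ M + LZ) <= e) by (apply Qle; unfold Q; lra).
    pose proof (Rabs_pos (y - t)).
    assert (e3 * (2 ^ M * L + 2 ^ M * f t + LZ * f t + 2 ^ M + LZ) * Rabs (y - t) <= e * Rabs (y - t)) by (apply Rmult_le_compat_r; lra).
    lra.
  - rewrite ev_lmul. fold (Z t).
    replace (Z t * ev l1 t - w0)%C with ((Z t * v1 t - w0) + Z t * q1 t)%C by (unfold q1; ring).
    eapply Rle_trans; [apply Cmod_triangle|]. rewrite (Cmod_mult (Z t) (q1 t)).
    assert (Cmod (Z t) * Cmod (q1 t) <= 2 ^ M * e3) by (apply Rmult_le_compat; auto using Cmod_ge_0).
    assert (e3 * 2 ^ M <= e) by (apply Qle; unfold Q; lra). fold (v1 t) in p9. lra.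
Qed.

End Polynomials.

(** * Difference quotients and the conjugate function *)

Definition quotient (G G' : R -> R) (x0 x : R) : R :=
  if Req_EM_T x x0 then G' x0 else (G x - G x0) / (x - x0).

Lemma quotient_spec G G' x0 x : (x - x0) * quotient G G' x0 x = G x - G x0.
Proof.
  unfold quotient. destruct (Req_EM_T x x0) as [->|N]; [ring|]. field. lra.
Qed.

Lemma quotient_cont G G' x0 x :
  is_derive G x (G' x) -> is_derive G x0 (G' x0) -> continuous (quotient G G' x0) x.
Proof.
  intros Hx H0. destruct (Req_EM_T x x0) as [->|N].
  - apply is_derive_Reals in H0. apply continuity_pt_filterlim. intros e He.
    destruct (H0 e He) as [d Hd]. exists d. split; [apply cond_pos|].
    intros z [[_ Hz] Hzd]. unfold Rdist in *. simpl in Hzd |- *. unfold Rdist in *.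
    unfold quotient. destruct (Req_EM_T x0 x0) as [_|E0]; [|contradiction].
    destruct (Req_EM_T z x0) as [->|_]; [rewrite Rminus_diag, Rabs_R0; exact He|].
    specialize (Hd (z - x0) ltac:(lra) Hzd). assert (E : forall w : R, x0 + (w - x0) = w) by (intros; ring).
    rewrite (E z) in Hd. exact Hd.
  - apply continuous_ext_loc with (fun z => (G z - G x0) / (z - x0)).
    + exists (mkposreal (Rabs (x - x0)) ltac:(apply Rabs_pos_lt; lra)). intros z Hz.
      change (Rabs (z - x) < Rabs (x - x0)) in Hz. unfold quotient.
      destruct (Req_EM_T z x0) as [->|_]; [|reflexivity].
      rewrite (Rabs_minus_sym x0 x) in Hz. lra.
    + assert (Cx : continuous G x) by (apply (ex_derive_continuous G); now exists (G' x)).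
      apply cont_div; [apply cont_minus; [exact Cx|cont]|apply cont_minus; cont|]. lra.
Qed.

Lemma lipschitz_unit_interval (u u' : R -> R) K x y :
  (forall s, -1 <= s <= 1 -> is_derive u s (u' s)) -> (forall s, -1 <= s <= 1 -> Rabs (u' s) <= K) ->
  -1 <= x <= 1 -> -1 <= y <= 1 -> Rabs (u x - u y) <= K * Rabs (x - y).
Proof.
  intros Hu HK Hx Hy. apply (mvt_abs u u'); intros s Hs; [apply Hu|apply HK];
    (split; [eapply Rle_trans; [|apply Hs]; now apply Rmin_glb|eapply Rle_trans; [apply Hs|]; now apply Rmax_lub]).
Qed.

Section ConjugateFunction.
Variables G G' : R -> R.
Hypothesis HG : forall x, -1 <= x <= 1 -> is_derive G x (G' x).
Hypothesis HG' : forall x, -1 <= x <= 1 -> continuous G' x.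
Variable t : R.
Hypothesis Ht : 0 < t < PI.

Definition cos_quotient (y : R) : R := quotient G G' (cos t) (cos y).

Lemma cos_quotient_cont y : continuous cos_quotient y.
Proof.
  apply (continuous_comp cos (quotient G G' (cos t))); [apply continuous_cos|].
  apply quotient_cont; apply HG, COS_bound.
Qed.

Lemma cos_quotient_dom : dom (fun _ => 1) cos_quotient.
Proof.
  destruct (continuity_ab_maj (fun x => Rabs (quotient G G' (cos t) x)) (-1) 1) as [m [Hm _]]; [lra| |].
  - intros x Hx. apply continuity_pt_filterlim, cont_abs, quotient_cont; apply HG; [exact Hx|apply COS_bound].
  - apply bounded_dom with (Rabs (quotient G G' (cos t) m)); [apply cos_quotient_cont|].
    intros y. apply Hm, COS_bound.
Qed.

(** The conjugate function of [G (cos y)] at [t]. The principal value of the integral of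
    [1 / (cos y - cos t)] over [(0, PI)] is 0, so [G (cos t)] may be subtracted and the integrand
    becomes continuous. *)
Definition conj_value : R := sin t / PI * II cos_quotient.

Lemma le_at_limit (u : R -> R) e :
  continuous u t -> (forall y, 0 < y < PI -> y <> t -> u y <= e) -> u t <= e.
Proof.
  intros Hc H. apply Rnot_lt_le. intros L.
  apply continuity_pt_filterlim in Hc. destruct (Hc (u t - e) ltac:(lra)) as [d [Hd Hdd]].
  set (r := Rmin (d / 2) ((PI - t) / 2)). assert (Hr : 0 < r) by (apply Rmin_glb_lt; lra).
  assert (r <= d / 2) by apply Rmin_l. assert (r <= (PI - t) / 2) by apply Rmin_r.
  specialize (H (t + r) ltac:(lra) ltac:(lra)).
  assert (Hy : Rdist (u (t + r)) (u t) < u t - e).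
  { apply Hdd. split; [split; [exact I|lra]|]. simpl. unfold Rdist.
    replace (t + r - t) with r by ring. rewrite Rabs_pos_eq; lra. }
  unfold Rdist in Hy. apply Rabs_def2 in Hy. lra.
Qed.

(** Approximating [G'] and integrating, instead of approximating [G], makes the error Lipschitz with
    constant [e]; the constant of integration makes it vanish at [t]. The difference quotients are
    then within [e], which controls the imaginary part. *)
Lemma C1_poly_approx e : 0 < e ->
  exists l, Re (ev l t) = G (cos t) /\
    (forall y, Rabs (Re (ev l y) - G (cos y)) <= e * Rabs (y - t)) /\
    (forall y, Rabs (Re (ev l y) - G (cos y)) <= 2 * e) /\
    Rabs (Im (ev l t) - conj_value) <= e.
Proof.
  intros He. assert (Hs : 0 < sin t) by (apply sin_gt_0; lra). pose proof PI_RGT_0 as Hpi.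
  destruct (weierstrass G' e HG' He) as [n [p' [Hp' Hp'e]]].
  destruct (rpoly_primitive n p' Hp') as [p0 [Hp0 Hp0d]].
  set (c := G (cos t) - p0 (cos t)). set (p := fun x => p0 x + c).
  assert (Hpt : p (cos t) = G (cos t)) by (unfold p, c; ring).
  assert (Hpl : low (S n) (fun y => p (cos y))).
  { apply low_plus; [now apply (rpoly_cos_low (S n) p0)|].
    apply low_ext with (fun y => c * cosn 0 y); [intros; rewrite cosn_0; ring|]. apply low_scal, low_cosn. lia. }
  destruct (low_real_part _ _ Hpl) as [l Hl].
  assert (D : forall x y, -1 <= x <= 1 -> -1 <= y <= 1 -> Rabs ((p x - G x) - (p y - G y)) <= e * Rabs (x - y)).
  { intros x y Hx Hy. apply (lipschitz_unit_interval (fun x => p x - G x) (fun x => p' x - G' x)); auto.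
    intros s Hs'. apply der_minus; [|now apply HG].
    apply (der_eq _ _ (p' s + 0)); [|ring]. apply der_plus; [apply Hp0d|exact (der_const c s)]. }
  exists l. split; [now rewrite <- Hl|]. split; [|split].
  - intros y. rewrite <- Hl. specialize (D (cos y) (cos t) (COS_bound y) (COS_bound t)).
    rewrite Hpt, Rminus_diag, Rminus_0_r in D. eapply Rle_trans; [exact D|].
    apply Rmult_le_compat_l; [lra|apply cos_lip].
  - intros y. rewrite <- Hl. specialize (D (cos y) (cos t) (COS_bound y) (COS_bound t)).
    rewrite Hpt, Rminus_diag, Rminus_0_r in D. eapply Rle_trans; [exact D|].
    pose proof (COS_bound y). pose proof (COS_bound t).
    assert (Rabs (cos y - cos t) <= 2) by (apply Rabs_le; lra). nra.
  - destruct (conjugate_quotient t l Ht 0) as [m [q [Hq1 [Hq2 Hq3]]]].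
    rewrite zn_0 in Hq3. replace (RtoC 1 * ev l t)%C with (ev l t) in Hq3 by ring.
    assert (Hq2' : forall y, (cos y - cos t) * q y = p (cos y) - p (cos t)).
    { intros y. rewrite Hq2. unfold hpol. rewrite !zn_0, !Hl. now rewrite !Cmult_1_l. }
    assert (B0 : forall y, 0 < y < PI -> y <> t -> Rabs (q y - cos_quotient y) <= e).
    { intros y Hy Ny. assert (Nc : cos y - cos t <> 0).
      { intros E. apply Ny. apply cos_inj; lra. }
      assert (E : (cos y - cos t) * (q y - cos_quotient y) = (p (cos y) - G (cos y)) - (p (cos t) - G (cos t))).
      { unfold cos_quotient. rewrite Rmult_minus_distr_l, Hq2', quotient_spec. ring. }
      specialize (D (cos y) (cos t) (COS_bound y) (COS_bound t)). rewrite <- E, Rabs_mult in D.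
      apply Rmult_le_reg_l with (Rabs (cos y - cos t)); [now apply Rabs_pos_lt|]. lra. }
    (* At [y = t] the defining identity of the quotients reads [0 = 0], so the bound is obtained
       there by continuity. *)
    assert (B : forall y, 0 < y < PI -> Rabs (q y - cos_quotient y) <= e).
    { intros y Hy. destruct (Req_dec y t) as [->|N]; [|now apply B0].
      apply (le_at_limit (fun y => Rabs (q y - cos_quotient y))); [|exact B0].
      apply cont_abs, cont_minus; [now apply low_cont with m|apply cos_quotient_cont]. }
    assert (Dq := low_dom _ _ Hq1). assert (Dc := cos_quotient_dom).
    assert (X : Rabs (II q - II cos_quotient) <= PI * e).
    { rewrite <- (II_minus _ weight_one) by assumption. rewrite <- II_const.
      apply (II_abs_le _ weight_one); [now apply dom_minus|apply dom_const, weight_one|exact B]. }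
    replace (Im (ev l t) - conj_value) with (sin t / PI * (II q - II cos_quotient)).
    2:{ rewrite Hq3. unfold conj_value. field. lra. }
    rewrite Rabs_mult, (Rabs_pos_eq (sin t / PI)) by (apply Rlt_le, Rdiv_lt_0_compat; lra).
    apply Rle_trans with (sin t / PI * (PI * e)).
    + apply Rmult_le_compat_l; [apply Rlt_le, Rdiv_lt_0_compat; lra|exact X].
    + replace (sin t / PI * (PI * e)) with (sin t * e) by (field; lra).
      pose proof (SIN_bound t). nra.
Qed.

End ConjugateFunction.

Lemma cexp_lipschitz rho u v : Re u <= rho -> Re v <= rho ->
  Cmod (cexp u - cexp v) <= 2 * exp rho * Cmod (u - v).
Proof.
  intros Hu Hv. set (F := fun s : R => cexp (v + RtoC s * (u - v))).
  assert (H : Cmod (F 1 - F 0) <= 2 * (Cmod (u - v) * exp rho) * Rabs (1 - 0)).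
  { apply (cmvt F (fun s => ((u - v) * cexp (v + RtoC s * (u - v)))%C)).
    - intros s _. exact (cder_cexp _ _ _ (cder_affine v (u - v) s)).
    - intros s Hs. rewrite Rmin_left, Rmax_right in Hs by lra. rewrite Cmod_mult, Cmod_cexp.
      apply Rmult_le_compat_l; [apply Cmod_ge_0|]. apply exp_le.
      destruct u as [u1 u2], v as [v1 v2]. simpl in *. nra. }
  unfold F in H. replace (v + RtoC 1 * (u - v))%C with u in H by ring.
  replace (v + RtoC 0 * (u - v))%C with v in H by ring. rewrite Rminus_0_r, Rabs_R1 in H. lra.
Qed.

Lemma cexp_near u v : Re u <= 1 -> Re v <= 1 -> Cmod (cexp u - cexp v) <= 6 * Cmod (u - v).
Proof.
  intros Hu Hv. eapply Rle_trans; [apply (cexp_lipschitz 1); assumption|].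
  pose proof exp_le_3. pose proof (Cmod_ge_0 (u - v)). nra.
Qed.

Lemma exp_near_1 x : Rabs x <= 1 -> Rabs (exp x - 1) <= 3 * Rabs x.
Proof.
  intros Hx. rewrite <- exp_0. replace (Rabs x) with (Rabs (x - 0)) by (f_equal; ring).
  apply (mvt_abs exp exp); [intros; apply is_derive_exp|]. intros s Hs.
  rewrite Rabs_pos_eq by apply Rlt_le, exp_pos. eapply Rle_trans; [|apply exp_le_3]. apply exp_le.
  apply Rabs_le_between in Hx. eapply Rle_trans; [apply Hs|]. apply Rmax_lub; lra.
Qed.

Lemma cexp_log1m y : 0 < y < 2 * PI -> cexp (log1m y) = (1 - ei y)%C.
Proof.
  intros Hy. assert (Hs : 0 < sin (y / 2)) by (apply sin_gt_0; lra).
  assert (E : exp (ln (2 - 2 * cos y) / 2) = 2 * sin (y / 2)).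
  { replace (2 - 2 * cos y) with ((2 * sin (y / 2)) * (2 * sin (y / 2))).
    - rewrite ln_mult by lra. rewrite <- (exp_ln (2 * sin (y / 2))) at 3 by lra. f_equal. field.
    - replace (cos y) with (cos (2 * (y / 2))) by (f_equal; field). rewrite cos_2a_sin. ring. }
  unfold cexp, log1m. cbn [Re Im fst snd]. rewrite E.
  replace ((y - PI) / 2) with (- (PI / 2 - y / 2)) by field. rewrite cos_neg, sin_neg, cos_shift, sin_shift.
  unfold ei. apply injective_projections; simpl.
  - replace (cos y) with (cos (2 * (y / 2))) by (f_equal; field). rewrite cos_2a_sin. ring.
  - replace (sin y) with (sin (2 * (y / 2))) by (f_equal; field). rewrite sin_2a. ring.
Qed.

Lemma cexp_log1p y : - PI < y < PI -> cexp (log1p y) = (1 + ei y)%C.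
Proof.
  intros Hy. rewrite log1p_log1m, cexp_conj, cexp_log1m by lra. unfold ei.
  rewrite cos_minus, sin_minus, cos_PI, sin_PI. apply injective_projections; simpl; ring.
Qed.

Lemma cexp_scal_nat n w : cexp (RtoC (INR n) * w) = (cexp w ^ n)%C.
Proof.
  induction n as [|n IH].
  - simpl. replace (RtoC 0 * w)%C with (RtoC 0) by ring. now rewrite cexp_R, exp_0.
  - rewrite S_INR, RtoC_plus. replace ((RtoC (INR n) + RtoC 1) * w)%C with (w + RtoC (INR n) * w)%C by ring.
    rewrite cexp_plus, IH. reflexivity.
Qed.

Lemma ev_lsin M y : 0 < y < PI -> ev (lsin M) y = cexp (RtoC (INR M) * (log1m y + log1p y)).
Proof.
  intros Hy. unfold lsin. rewrite ev_lpow, cexp_scal_nat, cexp_plus, cexp_log1m, cexp_log1p by lra.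
  f_equal. simpl. replace (RtoC (-1)) with (- RtoC 1)%C by (apply injective_projections; simpl; ring). ring.
Qed.

(** Each logarithm is a polynomial minus an approximation error, and both are Lipschitz away from
    the singularity. *)
Lemma log_lipschitz t d : 0 < d -> 0 < t - d -> t + d < PI ->
  exists K, 0 <= K /\ forall y, Rabs (y - t) < d ->
    Cmod (log1m y - log1m t) <= K * Rabs (y - t) /\ Cmod (log1p y - log1p t) <= K * Rabs (y - t).
Proof.
  intros Hd H1 H2.
  destruct (log1m_approx (t - d) 1 ltac:(lra) ltac:(lra)) as [l [_ [_ [_ Hl]]]].
  destruct (log1p_approx (PI - (t + d)) 1 ltac:(lra) ltac:(lra)) as [m [_ [_ [_ Hm]]]].
  destruct (ev_lipschitz l) as [A [HA HA']]. destruct (ev_lipschitz m) as [B [HB HB']].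
  exists (A + B + 1). split; [lra|]. intros y Hy. pose proof (Rabs_pos (y - t)). pose proof Hy as Hy'. apply Rabs_def2 in Hy'. split.
  - specialize (Hl y t ltac:(lra) ltac:(lra)). specialize (HA' y t).
    replace (log1m y - log1m t)%C with ((ev l y - ev l t) + - ((ev l y - log1m y) - (ev l t - log1m t)))%C by ring.
    eapply Rle_trans; [apply Cmod_triangle|]. rewrite Cmod_opp. nra.
  - specialize (Hm y t ltac:(lra) ltac:(lra)). specialize (HB' y t).
    replace (log1p y - log1p t)%C with ((ev m y - ev m t) + - ((ev m y - log1p y) - (ev m t - log1p t)))%C by ring.
    eapply Rle_trans; [apply Cmod_triangle|]. rewrite Cmod_opp. nra.
Qed.

(** * Approximate Szego functions for weights with algebraic endpoint behavior *)

Section SzegoFunction.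
Variable f : R -> R.
Hypothesis Hf : integrable_weight f.
Variables (a b k0 : R) (M : nat).
Hypothesis Ha : - INR M <= a <= INR M.
Hypothesis Hb : - INR M <= b <= INR M.
Variables G G' : R -> R.
Hypothesis HG : forall x, -1 <= x <= 1 -> is_derive G x (G' x).
Hypothesis HG' : forall x, -1 <= x <= 1 -> continuous G' x.
Hypothesis Hfeq : forall y, 0 < y < PI ->
  f y = exp (2 * (a * Re (log1m y) + b * Re (log1p y) + k0) + G (cos y)).
Variables (t d L : R).
Hypothesis Hd : 0 < d.
Hypothesis Htd1 : 0 < t - d.
Hypothesis Htd2 : t + d < PI.
Hypothesis HL : 0 <= L.
Hypothesis Hnear : forall y, Rabs (y - t) < d -> Rabs (f y - f t) <= L * Rabs (y - t).

Let fpos : forall y, 0 < y < PI -> 0 < f y := proj1 (proj2 Hf).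
Let fcont : forall y, 0 < y < PI -> continuous f y := proj1 Hf.

(* [log D (e^{i t})] for the Szego function [D] of [f]. *)
Definition log_szego : Complex.C :=
  (RtoC a * log1m t + RtoC b * log1p t + RtoC k0
     + ((G (cos t) / 2)%R, (conj_value G G' t / 2)%R))%C.

(** With [Lam] close to [log D], multiplication by [(1 - z^2)^M] turns the two exponentials into
    [exp (- Lam - sg)] and [exp (Lam - ta)]. The errors [sg] and [ta] combine those of the
    logarithms with the nonnegative coefficients [m + a], [m + b] and [m - a], [m - b], so the lower
    bounds on real parts dominate everything up to the endpoints. *)
Lemma szego_fun_exists e : 0 < e ->
  exists lA lB, szego_fun f M t d (cexp (- log_szego)) e
    (fun y => cexp (ev lA y)) (fun y => cexp (ev lB y)) (exp (hd 0 lA)) (exp (hd 0 lB)).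
Proof.
  intros He. pose proof PI_RGT_0 as Hpi. pose proof PI_4 as Hpi4. assert (Ht : 0 < t < PI) by lra.
  pose proof (fpos t Ht) as Ft. pose proof (pos_INR M) as HM.
  set (m := INR M) in *. set (W := log_szego). set (w := Cmod (cexp (- W))).
  assert (Hw : 0 <= w) by apply Cmod_ge_0.
  assert (If : 0 <= II f) by (apply (II_ge_0 _ Hf); [now apply dom_self|intros; apply Rlt_le; auto]).
  set (B := 1 + 3 * (f t + L * d)). assert (HB : 1 <= B) by (unfold B; nra).
  (* Weight in the inequality [|eta| <= s / 2 * f + |eta|^2 / (2 s f)], chosen so that the first
     term integrates to at most [e / 2]. *)
  set (s := e / (II f + 1)). assert (Hs : 0 < s) by (apply Rdiv_lt_0_compat; lra).
  assert (HsI : s * II f <= e).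
  { assert (s * (II f + 1) = e) by (unfold s; field; lra). nra. }
  (* The summands belong to the two norms, the integral of the defect ([13824 = 8 * 3 * 24^2]), its
     Lipschitz bound near [t], and the value at [t]. *)
  set (Q := 100 + 13824 / s + 36 * B + 12 * w).
  assert (HQ0 : 0 < 13824 / s) by (apply Rdiv_lt_0_compat; lra).
  assert (HQ : 100 <= Q) by (unfold Q; lra).
  set (e1 := Rmin (/ 8) (e / Q)).
  assert (He1 : 0 < e1) by (apply Rmin_glb_lt; [lra|apply Rdiv_lt_0_compat; lra]).
  assert (He1a : e1 <= / 8) by apply Rmin_l.
  assert (He1b : e1 * Q <= e) by (apply (proj2 (Rle_div_r e1 e Q ltac:(lra))); apply Rmin_r).
  assert (Qle : forall q, q <= Q -> e1 * q <= e).
  { intros q Hq. eapply Rle_trans; [|exact He1b]. apply Rmult_le_compat_l; lra. }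
  destruct (C1_poly_approx G G' HG HG' t Ht e1 He1) as [lh [Lh1 [Lh2 [Lh3 Lh4]]]].
  set (dh := fun y => Re (ev lh y) - G (cos y)).
  assert (dh_t : dh t = 0) by (unfold dh; rewrite Lh1; ring).
  assert (dh1 : forall y, Rabs (dh y) <= e1 * Rabs (y - t)) by exact Lh2.
  assert (dh2 : forall y, Rabs (dh y) <= 2 * e1) by exact Lh3.
  set (Lam := fun y => (RtoC a * log1m y + RtoC b * log1p y + RtoC (/ 2) * ev lh y + RtoC k0)%C).
  assert (feq : forall y, 0 < y < PI -> f y = exp (2 * Re (Lam y) - dh y)).
  { intros y Hy. rewrite (Hfeq y Hy). f_equal. unfold Lam, dh.
    destruct (log1m y), (log1p y), (ev lh y). simpl. field. }
  destruct (log_lipschitz t d Hd Htd1 Htd2) as [K [HK HK']].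
  destruct (ev_lipschitz lh) as [Kh [HKh HKh']].
  set (lam := (Rabs a + Rabs b) * K + Kh).
  assert (Hlam : 0 <= lam).
  { unfold lam. pose proof (Rabs_pos a). pose proof (Rabs_pos b). nra. }
  assert (LamL : forall y, Rabs (y - t) < d -> Cmod (Lam y - Lam t) <= lam * Rabs (y - t)).
  { intros y Hy. destruct (HK' y Hy) as [X1 X2]. specialize (HKh' y t).
    replace (Lam y - Lam t)%C with (RtoC a * (log1m y - log1m t) + RtoC b * (log1p y - log1p t) + RtoC (/ 2) * (ev lh y - ev lh t))%C
      by (unfold Lam; ring).
    eapply Rle_trans; [apply Cmod_triangle|]. eapply Rle_trans; [apply Rplus_le_compat_r, Cmod_triangle|].
    rewrite !Cmod_mult, !Cmod_R, (Rabs_pos_eq (/ 2)) by lra. unfold lam.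
    assert (Rabs a * Cmod (log1m y - log1m t) <= Rabs a * (K * Rabs (y - t))) by (apply Rmult_le_compat_l; [apply Rabs_pos|exact X1]).
    assert (Rabs b * Cmod (log1p y - log1p t) <= Rabs b * (K * Rabs (y - t))) by (apply Rmult_le_compat_l; [apply Rabs_pos|exact X2]).
    pose proof (Cmod_ge_0 (ev lh y - ev lh t)). lra. }
  set (rho := Re (Lam t) + lam * d). set (L1 := 2 * exp rho * lam).
  assert (HL1 : 0 <= L1) by (unfold L1; pose proof (exp_pos rho); apply Rmult_le_pos; lra).
  assert (eLam_lip : forall y, Rabs (y - t) < d -> Cmod (cexp (Lam y) - cexp (Lam t)) <= L1 * Rabs (y - t)).
  { intros y Hy. pose proof (LamL y Hy) as X.
    eapply Rle_trans; [apply (cexp_lipschitz rho)|].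
    - assert (Re (Lam y) - Re (Lam t) <= lam * Rabs (y - t)).
      { eapply Rle_trans; [|exact X]. eapply Rle_trans; [apply Rle_abs|]. exact (re_le_Cmod (Lam y - Lam t)). }
      unfold rho. assert (lam * Rabs (y - t) <= lam * d) by (apply Rmult_le_compat_l; lra). lra.
    - unfold rho. assert (0 <= lam * d) by (apply Rmult_le_pos; lra). lra.
    - unfold L1. pose proof (exp_pos rho). nra. }
  assert (eLam_b : forall y, Rabs (y - t) < d -> Cmod (cexp (Lam y)) <= B).
  { intros y Hy. pose proof Hy as Hy'. apply Rabs_def2 in Hy'. assert (Hyp : 0 < y < PI) by lra.
    rewrite Cmod_cexp. pose proof (exp_pos (Re (Lam y))) as X0.
    assert (X : exp (Re (Lam y)) ^ 2 <= 3 * f y).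
    { rewrite (feq y Hyp). replace (exp (Re (Lam y)) ^ 2) with (exp (dh y) * exp (2 * Re (Lam y) - dh y)).
      - apply Rmult_le_compat_r; [apply Rlt_le, exp_pos|]. eapply Rle_trans; [|apply exp_le_3]. apply exp_le.
        specialize (dh2 y). apply Rabs_le_between in dh2. lra.
      - rewrite <- exp_plus. simpl. rewrite Rmult_1_r, <- exp_plus. f_equal. ring. }
    specialize (Hnear y Hy). apply Rabs_le_between in Hnear.
    assert (L * Rabs (y - t) <= L * d) by (apply Rmult_le_compat_l; lra).
    unfold B. nra. }
  (* A second tolerance, for the logarithms at the endpoints: it must beat the Lipschitz constant
     [L1] of [exp Lam], which is known only once [lh] has been chosen with tolerance [e1]. *)
  set (e2 := Rmin e1 (e / (24 * L1 + 1))).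
  assert (He2 : 0 < e2) by (apply Rmin_glb_lt; [lra|apply Rdiv_lt_0_compat; lra]).
  assert (He2a : e2 <= e1) by apply Rmin_l.
  assert (He2b : 24 * L1 * e2 <= e).
  { assert (e2 <= e / (24 * L1 + 1)) by apply Rmin_r.
    assert (e2 * (24 * L1 + 1) <= e) by (now apply (proj2 (Rle_div_r e2 e (24 * L1 + 1) ltac:(lra)))). lra. }
  set (eps := e2 / (4 * m + 1)). assert (Heps : 0 < eps) by (apply Rdiv_lt_0_compat; lra).
  assert (Heps' : 4 * m * eps <= e2).
  { assert (eps * (4 * m + 1) = e2) by (unfold eps; field; lra). lra. }
  set (E0 := exp (8 * m + 1)). assert (HE0 : 0 < E0) by apply exp_pos.
  assert (HE1 : exp (16 * m + 1) <= E0 * E0).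
  { unfold E0. rewrite <- exp_plus. apply exp_le. lra. }
  assert (HEE : 0 < E0 * E0) by now apply Rmult_lt_0_compat.
  set (V0 := 12 * (E0 * E0)). assert (HV0 : 0 < V0) by (unfold V0; lra).
  (* Width of the endpoint layers. It leaves the neighborhood of [t] in the middle and is small
     against the bounds on the layers, which depend on [m] alone. *)
  set (d0 := Rmin (Rmin (t - d) (PI - (t + d))) (Rmin (e / (4 * (E0 * E0 + 1))) (Rmin (s * e / (4 * V0)) (PI / 4)))).
  assert (Hd0 : 0 < d0).
  { unfold d0. repeat apply Rmin_glb_lt; try lra.
    - apply Rdiv_lt_0_compat; lra.
    - apply Rdiv_lt_0_compat; [now apply Rmult_lt_0_compat|lra]. }
  assert (Hd0a : d0 <= t - d) by (eapply Rle_trans; [apply Rmin_l|apply Rmin_l]).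
  assert (Hd0b : d0 <= PI - (t + d)) by (eapply Rle_trans; [apply Rmin_l|apply Rmin_r]).
  assert (Hd0c : 2 * d0 * (E0 * E0 + 1) <= e / 2).
  { assert (X : d0 <= e / (4 * (E0 * E0 + 1))) by (eapply Rle_trans; [apply Rmin_r|apply Rmin_l]).
    apply (proj2 (Rle_div_r d0 e (4 * (E0 * E0 + 1)) ltac:(lra))) in X. lra. }
  assert (Hd0d : 2 * d0 * V0 <= s * e / 2).
  { assert (X : d0 <= s * e / (4 * V0)) by (eapply Rle_trans; [apply Rmin_r|]; eapply Rle_trans; [apply Rmin_r|apply Rmin_l]).
    apply (proj2 (Rle_div_r d0 (s * e) (4 * V0) ltac:(lra))) in X. lra. }
  assert (Hd0e : d0 <= PI / 4) by (eapply Rle_trans; [apply Rmin_r|]; eapply Rle_trans; [apply Rmin_r|apply Rmin_r]).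
  destruct (log1m_approx d0 eps ltac:(lra) Heps) as [lm [m0 [m1 [m2 m3]]]].
  destruct (log1p_approx d0 eps ltac:(lra) Heps) as [lp [q0 [q1 [q2 q3]]]].
  set (D1 := fun y => (ev lm y - log1m y)%C) in *. set (D2 := fun y => (ev lp y - log1p y)%C) in *.
  set (sg := fun y => (RtoC (m + a) * D1 y + RtoC (m + b) * D2 y)%C) in *.
  set (ta := fun y => (RtoC (m - a) * D1 y + RtoC (m - b) * D2 y)%C) in *.
  (* Applied to [sg] and to [ta]. The bound [8 * m] is two coefficients of at most [2 * m] times the
     loss 2 in each logarithm. *)
  assert (comb : forall c1 c2 (S : R -> Complex.C), 0 <= c1 <= 2 * m -> 0 <= c2 <= 2 * m ->
     (forall y, S y = (RtoC c1 * D1 y + RtoC c2 * D2 y)%C) ->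
     (forall y, 0 < y < PI -> - (8 * m) <= Re (S y)) /\
     (forall y, d0 <= y <= PI - d0 -> Cmod (S y) <= e2) /\
     (forall y, Rabs (y - t) < d -> Cmod (S y - S t) <= e2 * Rabs (y - t))).
  { intros c1 c2 S Hc1 Hc2 ES. split; [|split].
    - intros y Hy. specialize (m1 y Hy). specialize (q1 y Hy).
      assert (-2 <= Re (D1 y)) by (unfold D1; change (-2 <= Re (ev lm y) - Re (log1m y)); lra).
      assert (-2 <= Re (D2 y)) by (unfold D2; change (-2 <= Re (ev lp y) - Re (log1p y)); lra).
      replace (Re (S y)) with (c1 * Re (D1 y) + c2 * Re (D2 y)).
      + nra.
      + rewrite ES. destruct (D1 y), (D2 y). simpl. ring.
    - intros y Hy. specialize (m2 y ltac:(lra)). specialize (q2 y ltac:(lra)). fold (D1 y) in m2. fold (D2 y) in q2.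
      rewrite ES. eapply Rle_trans; [apply Cmod_triangle|]. rewrite !Cmod_mult, !Cmod_R, !Rabs_pos_eq by lra.
      assert (c1 * Cmod (D1 y) <= 2 * m * eps) by (apply Rmult_le_compat; try lra; apply Cmod_ge_0).
      assert (c2 * Cmod (D2 y) <= 2 * m * eps) by (apply Rmult_le_compat; try lra; apply Cmod_ge_0). lra.
    - intros y Hy. pose proof Hy as Hy'. apply Rabs_def2 in Hy'.
      specialize (m3 y t ltac:(lra) ltac:(lra)). specialize (q3 y t ltac:(lra) ltac:(lra)).
      change (Cmod (D1 y - D1 t) <= eps * Rabs (y - t)) in m3. change (Cmod (D2 y - D2 t) <= eps * Rabs (y - t)) in q3.
      replace (S y - S t)%C with (RtoC c1 * (D1 y - D1 t) + RtoC c2 * (D2 y - D2 t))%C by (rewrite !ES; ring).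
      eapply Rle_trans; [apply Cmod_triangle|]. rewrite !Cmod_mult, !Cmod_R, !Rabs_pos_eq by lra.
      pose proof (Rabs_pos (y - t)).
      assert (c1 * Cmod (D1 y - D1 t) <= 2 * m * (eps * Rabs (y - t))) by (apply Rmult_le_compat; try lra; apply Cmod_ge_0).
      assert (c2 * Cmod (D2 y - D2 t) <= 2 * m * (eps * Rabs (y - t))) by (apply Rmult_le_compat; try lra; apply Cmod_ge_0).
      assert (4 * m * eps * Rabs (y - t) <= e2 * Rabs (y - t)) by (apply Rmult_le_compat_r; lra). lra. }
  destruct (comb (m + a) (m + b) sg ltac:(lra) ltac:(lra) ltac:(reflexivity)) as [sg1 [sg2 sg3]].
  destruct (comb (m - a) (m - b) ta ltac:(lra) ltac:(lra) ltac:(reflexivity)) as [ta1 [ta2 ta3]]. clear comb.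
  (* Approximate logarithms of [1/D] and [D], each after division by [(1 - z^2)^M]. *)
  set (lA := ladd (ladd (lscal (- (m + a)) lm) (lscal (- (m + b)) lp)) (ladd (lscal (- / 2) lh) (- k0 :: nil))).
  set (lB := ladd (ladd (lscal (- (m - a)) lm) (lscal (- (m - b)) lp)) (ladd (lscal (/ 2) lh) (k0 :: nil))).
  exists lA, lB.
  set (Z := ev (lsin M)).
  assert (EA : forall y, 0 < y < PI -> (Z y * cexp (ev lA y) = cexp (- Lam y - sg y))%C).
  { intros y Hy. unfold Z. rewrite ev_lsin by exact Hy. rewrite <- cexp_plus. f_equal. unfold lA, Lam, sg, D1, D2. fold m.
    rewrite !ev_ladd, !ev_lscal. simpl ev. rewrite !RtoC_opp, !RtoC_plus. ring. }
  assert (EB : forall y, 0 < y < PI -> (Z y * cexp (ev lB y) = cexp (Lam y - ta y))%C).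
  { intros y Hy. unfold Z. rewrite ev_lsin by exact Hy. rewrite <- cexp_plus. f_equal. unfold lB, Lam, ta, D1, D2. fold m.
    rewrite !ev_ladd, !ev_lscal. simpl ev. rewrite !RtoC_opp, !RtoC_minus. ring. }
  (* The defect divided by [exp Lam]: with [f = exp (2 Re Lam - dh)], the conjugate of
     [exp (- Lam - sg)] times [f] equals [exp Lam * exp (- conj sg - dh)]. *)
  set (U := fun y => (cexp (- Cconj (sg y) - RtoC (dh y)) - cexp (- ta y))%C).
  assert (ED : forall y, 0 < y < PI ->
    defect_fun f M (fun y => cexp (ev lA y)) (fun y => cexp (ev lB y)) y = (cexp (Lam y) * U y)%C).
  { intros y Hy. unfold defect_fun, U. fold (Z y). rewrite EA, EB, (feq y Hy), <- cexp_R, <- cexp_conj by exact Hy.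
    replace (cexp (Lam y) * (cexp (- Cconj (sg y) - RtoC (dh y)) - cexp (- ta y)))%C
      with (cexp (Lam y) * cexp (- Cconj (sg y) - RtoC (dh y)) - cexp (Lam y) * cexp (- ta y))%C by ring.
    rewrite <- !cexp_plus.
    assert (Q1 : (Cconj (- Lam y - sg y) + RtoC (2 * Re (Lam y) - dh y))%C = (Lam y + (- Cconj (sg y) - RtoC (dh y)))%C).
    { destruct (Lam y) as [l1 l2], (sg y) as [s1 s2]. apply injective_projections; simpl; ring. }
    rewrite Q1. reflexivity. }
  assert (hA : hd 0 lA = - (hd 0 lh / 2 + k0)).
  { unfold lA. rewrite !hd_ladd, !hd_lscal, m0, q0. simpl. field. }
  assert (hB : hd 0 lB = hd 0 lh / 2 + k0).
  { unfold lB. rewrite !hd_ladd, !hd_lscal, m0, q0. simpl. field. }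
  assert (Umid : forall y, d0 <= y <= PI - d0 -> Cmod (U y) <= 24 * e1).
  { intros y Hy. pose proof (sg2 y Hy) as S. pose proof (ta2 y Hy) as T. specialize (dh2 y).
    pose proof (re_le_Cmod (sg y)) as S'. pose proof (re_le_Cmod (ta y)) as T'. 
    apply Rabs_le_between in S', T'. pose proof dh2 as dh2'. apply Rabs_le_between in dh2'.
    unfold U. eapply Rle_trans; [apply cexp_near|].
    - replace (Re (- Cconj (sg y) - RtoC (dh y))%C) with (- Re (sg y) - dh y) by (destruct (sg y); simpl; ring). lra.
    - replace (Re (- ta y)%C) with (- Re (ta y)) by (destruct (ta y); simpl; ring). lra.
    - assert (X : Cmod (- Cconj (sg y) - RtoC (dh y) - - ta y) <= e2 + 2 * e1 + e2).
      { replace (- Cconj (sg y) - RtoC (dh y) - - ta y)%C with (- Cconj (sg y) + - RtoC (dh y) + ta y)%C by ring.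
        eapply Rle_trans; [apply Cmod_triangle|]. apply Rplus_le_compat; [|exact T].
        eapply Rle_trans; [apply Cmod_triangle|]. rewrite !Cmod_opp, Cmod_conj, Cmod_R. lra. }
      lra. }
  assert (Ut : Cmod (U t) <= 12 * e2).
  { pose proof (sg2 t ltac:(lra)) as S. pose proof (ta2 t ltac:(lra)) as T.
    pose proof (re_le_Cmod (sg t)) as S'. pose proof (re_le_Cmod (ta t)) as T'. apply Rabs_le_between in S', T'.
    unfold U. rewrite dh_t. replace (- Cconj (sg t) - RtoC 0)%C with (- Cconj (sg t))%C by ring.
    eapply Rle_trans; [apply cexp_near|].
    - replace (Re (- Cconj (sg t))%C) with (- Re (sg t)) by (destruct (sg t); simpl; ring). lra.
    - replace (Re (- ta t)%C) with (- Re (ta t)) by (destruct (ta t); simpl; ring). lra.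
    - assert (X : Cmod (- Cconj (sg t) - - ta t) <= e2 + e2).
      { replace (- Cconj (sg t) - - ta t)%C with (- Cconj (sg t) + ta t)%C by ring.
        eapply Rle_trans; [apply Cmod_triangle|]. rewrite !Cmod_opp, Cmod_conj. lra. }
      lra. }
  assert (Ulip : forall y, Rabs (y - t) < d -> Cmod (U y - U t) <= 18 * e1 * Rabs (y - t)).
  { intros y Hy. pose proof Hy as Hy'. apply Rabs_def2 in Hy'.
    pose proof (sg2 y ltac:(lra)) as S1. pose proof (ta2 y ltac:(lra)) as T1.
    pose proof (sg2 t ltac:(lra)) as S2. pose proof (ta2 t ltac:(lra)) as T2.
    pose proof (re_le_Cmod (sg y)) as S1'. pose proof (re_le_Cmod (ta y)) as T1'.
    pose proof (re_le_Cmod (sg t)) as S2'. pose proof (re_le_Cmod (ta t)) as T2'. apply Rabs_le_between in S1', T1', S2', T2'.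
    pose proof (dh2 y) as dh2'. apply Rabs_le_between in dh2'. pose proof (dh1 y) as dh1'.
    specialize (sg3 y Hy). specialize (ta3 y Hy).
    replace (U y - U t)%C with ((cexp (- Cconj (sg y) - RtoC (dh y)) - cexp (- Cconj (sg t) - RtoC (dh t)))
       + - (cexp (- ta y) - cexp (- ta t)))%C by (unfold U; ring).
    eapply Rle_trans; [apply Cmod_triangle|]. rewrite Cmod_opp.
    assert (X1 : Cmod (cexp (- Cconj (sg y) - RtoC (dh y)) - cexp (- Cconj (sg t) - RtoC (dh t))) <= 6 * (e2 * Rabs (y - t) + e1 * Rabs (y - t))).
    { eapply Rle_trans; [apply cexp_near|].
      - replace (Re (- Cconj (sg y) - RtoC (dh y))%C) with (- Re (sg y) - dh y) by (destruct (sg y); simpl; ring). lra.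
      - rewrite dh_t. replace (Re (- Cconj (sg t) - RtoC 0)%C) with (- Re (sg t)) by (destruct (sg t); simpl; ring). lra.
      - apply Rmult_le_compat_l; [lra|]. rewrite dh_t.
        replace (- Cconj (sg y) - RtoC (dh y) - (- Cconj (sg t) - RtoC 0))%C with (- Cconj (sg y - sg t) + - RtoC (dh y))%C
          by (rewrite Cminus_conj; ring).
        eapply Rle_trans; [apply Cmod_triangle|]. rewrite !Cmod_opp, Cmod_conj, Cmod_R. lra. }
    assert (X2 : Cmod (cexp (- ta y) - cexp (- ta t)) <= 6 * (e2 * Rabs (y - t))).
    { eapply Rle_trans; [apply cexp_near|].
      - replace (Re (- ta y)%C) with (- Re (ta y)) by (destruct (ta y); simpl; ring). lra.
      - replace (Re (- ta t)%C) with (- Re (ta t)) by (destruct (ta t); simpl; ring). lra.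
      - apply Rmult_le_compat_l; [lra|].
        replace (- ta y - - ta t)%C with (- (ta y - ta t))%C by ring. now rewrite Cmod_opp. }
    assert (e2 * Rabs (y - t) <= e1 * Rabs (y - t)) by (apply Rmult_le_compat_r; [apply Rabs_pos|lra]). lra. }
  assert (vcA : forall y, ccont (fun y => cexp (ev lA y)) y) by (intros; apply ccont_cexp, ccont_ev).
  assert (vcB : forall y, ccont (fun y => cexp (ev lB y)) y) by (intros; apply ccont_cexp, ccont_ev).
  assert (Zc : forall y, ccont Z y) by (intros; apply ccont_ev).
  (* Both weighted squares are exponentials of a quantity that is small in the middle and bounded
     above near the endpoints. *)
  assert (near_one : forall (F S : R -> R),
      (forall y, 0 < y < PI -> continuous F y) ->
      (forall y, 0 < y < PI -> F y = exp (S y)) ->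
      (forall y, 0 < y < PI -> S y <= 16 * m + 1) ->
      (forall y, d0 <= y <= PI - d0 -> Rabs (S y) <= 4 * e1) -> II F <= PI + e).
  { intros F S Fc FS Sb Sm.
    assert (X : Rabs (II (fun y => F y - 1)) <= PI * (12 * e1) + 2 * d0 * (E0 * E0 + 1)).
    { apply (II_small _ Hf); try lra.
      - intros; apply cont_minus; [auto|cont].
      - intros y Hy. rewrite FS by exact Hy. pose proof (exp_pos (S y)).
        assert (exp (S y) <= E0 * E0) by (eapply Rle_trans; [apply exp_le, Sb, Hy|exact HE1]). apply Rabs_le. lra.
      - intros y Hy. rewrite FS by lra. specialize (Sm y Hy).
        eapply Rle_trans; [apply exp_near_1; lra|lra]. }
    assert (DF : dom f F).
    { apply (dom_bounded _ Hf _ (E0 * E0)); [exact Fc|]. intros y Hy. rewrite FS, Rabs_pos_eq by (try exact Hy; apply Rlt_le, exp_pos).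
      eapply Rle_trans; [apply exp_le, Sb, Hy|exact HE1]. }
    rewrite (II_minus _ Hf) in X by (try exact DF; now apply dom_const). rewrite II_const in X. apply Rabs_le_between in X.
    assert (e1 * 100 <= e) by (apply Qle; unfold Q; lra).
    assert (PI * (12 * e1) <= 4 * (12 * e1)) by (apply Rmult_le_compat_r; lra). lra. }
  unfold szego_fun. fold Z. split; [apply exp_pos|]. split; [apply exp_pos|].
  split; [|split; [|split; [|split; [|split; [|split]]]]].
  (* The approximants of the logarithms vanish at [z = 0], so the two values there are exactly
     reciprocal. *)
  - rewrite <- exp_plus, hA, hB. replace (- (hd 0 lh / 2 + k0) + (hd 0 lh / 2 + k0)) with 0 by ring. rewrite exp_0. lra.
  - apply (near_one _ (fun y => - 2 * Re (sg y) - dh y)).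
    + intros y Hy. apply cont_mult; [|auto]. apply cont_pow, ccont_mod, ccont_mult; auto.
    + intros y Hy. rewrite EA, Cmod_cexp, (feq y Hy) by exact Hy. rewrite <- Rsqr_pow2. unfold Rsqr. rewrite <- !exp_plus. f_equal.
      replace (Re (- Lam y - sg y)%C) with (- Re (Lam y) - Re (sg y)) by (destruct (Lam y), (sg y); simpl; ring). ring.
    + intros y Hy. specialize (sg1 y Hy). specialize (dh2 y). apply Rabs_le_between in dh2. lra.
    + intros y Hy. specialize (sg2 y Hy). specialize (dh2 y). pose proof (re_le_Cmod (sg y)) as X.
      apply Rabs_le_between in X, dh2. apply Rabs_le. lra.
  - apply (near_one _ (fun y => - 2 * Re (ta y) + dh y)).
    + intros y Hy. apply cont_mult; [apply cont_pow, ccont_mod, ccont_mult; auto|]. apply cont_inv; [auto|].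
      apply Rgt_not_eq, fpos, Hy.
    + intros y Hy. rewrite EB, Cmod_cexp, (feq y Hy), <- exp_Ropp by exact Hy. rewrite <- Rsqr_pow2. unfold Rsqr. rewrite <- !exp_plus. f_equal.
      replace (Re (Lam y - ta y)%C) with (Re (Lam y) - Re (ta y)) by (destruct (Lam y), (ta y); simpl; ring). ring.
    + intros y Hy. specialize (ta1 y Hy). specialize (dh2 y). apply Rabs_le_between in dh2. lra.
    + intros y Hy. specialize (ta2 y Hy). specialize (dh2 y). pose proof (re_le_Cmod (ta y)) as X.
      apply Rabs_le_between in X, dh2. apply Rabs_le. lra.
  - set (eta := defect_fun f M (fun y => cexp (ev lA y)) (fun y => cexp (ev lB y))) in *.
    assert (etac : forall y, 0 < y < PI -> ccont eta y).
    { intros y Hy. unfold eta, defect_fun. fold Z. apply ccont_minus; [|now apply ccont_mult].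
      apply ccont_mult; [apply ccont_conj; now apply ccont_mult|apply ccont_real; auto]. }
    (* Near the endpoints the defect has no uniform bound, but this quotient is [exp dh * |U|^2],
       which is bounded. *)
    set (V := fun y => Cmod (eta y) ^ 2 / f y).
    assert (Vc : forall y, 0 < y < PI -> continuous V y).
    { intros y Hy. apply cont_div; [apply cont_pow, ccont_mod; auto|auto|]. apply Rgt_not_eq, fpos, Hy. }
    assert (VE : forall y, 0 < y < PI -> V y = exp (dh y) * Cmod (U y) ^ 2).
    { intros y Hy. unfold V. rewrite ED, Cmod_mult, Cmod_cexp, (feq y Hy) by exact Hy.
      unfold Rdiv. rewrite <- exp_Ropp, Rpow_mult_distr. rewrite <- (Rsqr_pow2 (exp _)). unfold Rsqr. rewrite <- exp_plus.
      rewrite (Rmult_comm (exp _) (Cmod (U y) ^ 2)), Rmult_assoc, <- exp_plus, Rmult_comm. do 2 f_equal. ring. }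
    assert (edh : forall y, exp (dh y) <= 3).
    { intros y. eapply Rle_trans; [|apply exp_le_3]. apply exp_le. specialize (dh2 y). apply Rabs_le_between in dh2. lra. }
    assert (V0b : forall y, 0 < y < PI -> Rabs (V y) <= V0).
    { intros y Hy. rewrite VE by exact Hy. rewrite Rabs_pos_eq.
      2:{ apply Rmult_le_pos; [apply Rlt_le, exp_pos|apply pow2_ge_0]. }
      replace V0 with (3 * (E0 + E0) ^ 2) by (unfold V0; ring).
      apply Rmult_le_compat; [apply Rlt_le, exp_pos|apply pow2_ge_0|apply edh|].
      apply pow_incr. split; [apply Cmod_ge_0|]. unfold U.
      eapply Rle_trans; [apply Cmod_triangle|]. rewrite Cmod_opp, !Cmod_cexp.
      specialize (sg1 y Hy). specialize (ta1 y Hy). specialize (dh2 y). apply Rabs_le_between in dh2.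
      apply Rplus_le_compat; apply exp_le.
      - replace (Re (- Cconj (sg y) - RtoC (dh y))%C) with (- Re (sg y) - dh y) by (destruct (sg y); simpl; ring). lra.
      - replace (Re (- ta y)%C) with (- Re (ta y)) by (destruct (ta y); simpl; ring). lra. }
    assert (DV : dom f V) by (now apply (dom_bounded _ Hf _ V0)).
    assert (IV : II V <= s * e).
    { assert (X : Rabs (II V) <= PI * (1728 * e1) + 2 * d0 * V0).
      { apply (II_small _ Hf); auto; try lra. intros y Hy. rewrite VE by lra. rewrite Rabs_pos_eq.
        2:{ apply Rmult_le_pos; [apply Rlt_le, exp_pos|apply pow2_ge_0]. }
        specialize (Umid y Hy). apply Rle_trans with (3 * (24 * e1) ^ 2).
        - apply Rmult_le_compat; [apply Rlt_le, exp_pos|apply pow2_ge_0|apply edh|].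
          apply pow_incr. split; [apply Cmod_ge_0|exact Umid].
        - nra. }
      apply Rabs_le_between in X.
      assert (X2 : e1 * (13824 / s) <= e) by (apply Qle; unfold Q; lra).
      assert (X3 : 13824 * e1 <= s * e).
      { replace (13824 * e1) with (s * (e1 * (13824 / s))) by (field; lra). apply Rmult_le_compat_l; lra. }
      assert (PI * (1728 * e1) <= 4 * (1728 * e1)) by (apply Rmult_le_compat_r; lra). lra. }
    assert (amgm : forall y, 0 < y < PI -> Cmod (eta y) <= s / 2 * f y + / (2 * s) * V y).
    { intros y Hy. pose proof (fpos y Hy) as Fy. unfold V.
      apply Rmult_le_reg_r with (2 * s * f y); [nra|].
      replace ((s / 2 * f y + / (2 * s) * (Cmod (eta y) ^ 2 / f y)) * (2 * s * f y))
        with ((s * f y) ^ 2 + Cmod (eta y) ^ 2) by (field; lra).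
      pose proof (pow2_ge_0 (s * f y - Cmod (eta y))). lra. }
    assert (Df := dom_self f Hf).
    apply Rle_trans with (II (fun y => s / 2 * f y + / (2 * s) * V y)).
    + apply (II_le _ Hf); auto using dom_plus, dom_scal.
      apply (dom_dominated _ _ (fun y => s / 2 * f y + / (2 * s) * V y)); auto using dom_plus, dom_scal.
      * intros; apply ccont_mod; auto.
      * exists 1. intros y Hy. rewrite Rmult_1_l, Rabs_pos_eq by apply Cmod_ge_0.
        eapply Rle_trans; [now apply amgm|apply Rle_abs].
    + rewrite (II_plus _ Hf), !(II_scal _ Hf) by auto using dom_scal.
      assert (/ (2 * s) * II V <= / (2 * s) * (s * e)).
      { apply Rmult_le_compat_l; [|exact IV]. apply Rlt_le, Rinv_0_lt_compat. lra. }
      replace (/ (2 * s) * (s * e)) with (e / 2) in H by (field; lra). lra.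
  - rewrite ED by exact Ht. rewrite Cmod_mult.
    assert (Cmod (cexp (Lam t)) <= B) by (apply eLam_b; rewrite Rminus_diag, Rabs_R0; exact Hd).
    assert (Cmod (cexp (Lam t)) * Cmod (U t) <= B * (12 * e2)) by (apply Rmult_le_compat; auto using Cmod_ge_0).
    assert (e1 * (36 * B) <= e) by (apply Qle; unfold Q; lra).
    assert (B * e2 <= B * e1) by (apply Rmult_le_compat_l; lra). nra.
  - intros y Hy. pose proof Hy as Hy'. apply Rabs_def2 in Hy'. rewrite !ED by lra.
    replace (cexp (Lam y) * U y - cexp (Lam t) * U t)%C
      with (cexp (Lam y) * (U y - U t) + (cexp (Lam y) - cexp (Lam t)) * U t)%C by ring.
    eapply Rle_trans; [apply Cmod_triangle|]. rewrite !Cmod_mult.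
    specialize (Ulip y Hy). specialize (eLam_b y Hy). specialize (eLam_lip y Hy).
    set (r := Rabs (y - t)) in *. assert (Hr : 0 <= r) by apply Rabs_pos.
    assert (X1 : Cmod (cexp (Lam y)) * Cmod (U y - U t) <= B * (18 * e1 * r)) by (apply Rmult_le_compat; auto using Cmod_ge_0).
    assert (X2 : Cmod (cexp (Lam y) - cexp (Lam t)) * Cmod (U t) <= L1 * r * (12 * e2)) by (apply Rmult_le_compat; auto using Cmod_ge_0).
    assert (X3 : e1 * (36 * B) <= e) by (apply Qle; unfold Q; lra).
    assert (e1 * (36 * B) * r <= e * r) by (apply Rmult_le_compat_r; lra).
    assert (24 * L1 * e2 * r <= e * r) by (apply Rmult_le_compat_r; lra). lra.
  - fold Z. rewrite EA by exact Ht.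
    pose proof (sg2 t ltac:(lra)) as S. pose proof (re_le_Cmod (sg t)) as S'. apply Rabs_le_between in S'.
    (* Purely imaginary, because [lh] has the exact real part at [t]; its size is the error in the
       conjugate function. *)
    set (V := (Lam t - W)%C).
    assert (HV : V = (0, (Im (ev lh t) - conj_value G G' t) / 2)).
    { unfold V, W, log_szego, Lam. destruct (log1m t), (log1p t), (ev lh t) as [h1 h2]. simpl in Lh1. subst h1.
      apply injective_projections; simpl; field. }
    assert (Vm : Cmod V <= e1).
    { rewrite HV. eapply Rle_trans; [apply Cmod_le_sum|]. simpl. rewrite Rabs_R0, Rplus_0_l.
      unfold Rdiv. rewrite Rabs_mult, (Rabs_pos_eq (/ 2)) by lra.
      pose proof (Rabs_pos (Im (ev lh t) - conj_value G G' t)). unfold Im in *. lra. }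
    assert (RV : Re V = 0) by (rewrite HV; reflexivity).
    replace (- Lam t - sg t)%C with (- W + (- V - sg t))%C by (unfold V; ring).
    rewrite cexp_plus.
    replace (cexp (- W) * cexp (- V - sg t) - cexp (- W))%C with (cexp (- W) * (cexp (- V - sg t) - RtoC 1))%C by ring.
    rewrite Cmod_mult. fold w.
    assert (X : Cmod (cexp (- V - sg t) - RtoC 1) <= 6 * (e1 + e2)).
    { replace (RtoC 1) with (cexp (RtoC 0)) by (now rewrite cexp_R, exp_0).
      eapply Rle_trans; [apply cexp_near|].
      - replace (Re (- V - sg t)%C) with (- Re V - Re (sg t)) by (destruct V, (sg t); simpl; ring). lra.
      - simpl. lra.
      - apply Rmult_le_compat_l; [lra|]. replace (- V - sg t - RtoC 0)%C with (- V + - sg t)%C by ring.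
        eapply Rle_trans; [apply Cmod_triangle|]. rewrite !Cmod_opp. lra. }
    apply Rle_trans with (w * (6 * (e1 + e2))); [now apply Rmult_le_compat_l|].
    assert (e1 * (12 * w) <= e) by (apply Qle; unfold Q; lra).
    assert (w * e2 <= w * e1) by (apply Rmult_le_compat_l; lra). lra.
Qed.

End SzegoFunction.

(** * Averages and the entropy *)

Definition mean_lim (a : nat -> R) (l : R) : Prop := is_lim_seq (fun n => sum_lt a n / INR n) l.

Lemma sum_lt_f_R0 (a : nat -> R) n : sum_f_R0 a n = sum_lt a (S n).
Proof. induction n as [|n IH]; [simpl; ring|]. simpl sum_f_R0. rewrite IH. reflexivity. Qed.

Lemma mean_lim_cesaro a (l : R) : is_lim_seq a l -> mean_lim a l.
Proof.
  intros H. apply is_lim_seq_Reals in H. apply Cesaro_1 in H. apply is_lim_seq_Reals in H.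
  unfold mean_lim. apply is_lim_seq_incr_1. apply is_lim_seq_incr_1 in H.
  eapply is_lim_seq_ext; [|exact H]. intros n. cbv beta. simpl pred. now rewrite sum_lt_f_R0.
Qed.
Lemma mean_lim_plus a b l m : mean_lim a l -> mean_lim b m -> mean_lim (fun n => a n + b n) (l + m).
Proof.
  intros H1 H2. unfold mean_lim. eapply is_lim_seq_ext; [|exact (is_lim_seq_plus' _ _ _ _ H1 H2)].
  intros n. cbv beta. rewrite sum_lt_plus. unfold Rdiv. ring.
Qed.
Lemma mean_lim_scal c a l : mean_lim a l -> mean_lim (fun n => c * a n) (c * l).
Proof.
  intros H. unfold mean_lim. eapply is_lim_seq_ext; [|exact (is_lim_seq_scal_l _ c _ H)].
  intros n. cbv beta. rewrite sum_lt_scal. unfold Rdiv. ring.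
Qed.
Lemma mean_lim_eq a l m : mean_lim a l -> l = m -> mean_lim a m.
Proof. now intros H <-. Qed.
Lemma mean_lim_ext a b l : (forall n, a n = b n) -> mean_lim a l -> mean_lim b l.
Proof.
  intros H. unfold mean_lim. apply is_lim_seq_ext. intros n. f_equal. apply sum_lt_ext. auto.
Qed.
Lemma mean_lim_const c : mean_lim (fun _ => c) c.
Proof. apply mean_lim_cesaro, is_lim_seq_const. Qed.

Lemma mean_lim_bounded_sums a C : (forall n, Rabs (sum_lt a n) <= C) -> mean_lim a 0.
Proof.
  intros H. unfold mean_lim. apply is_lim_seq_abs_0.
  apply is_lim_seq_le_le with (fun _ => 0) (fun n => C * / INR n).
  - intros n. split; [apply Rabs_pos|]. unfold Rdiv. rewrite Rabs_mult.
    destruct n as [|n].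
    + simpl. rewrite Rinv_0, Rabs_R0. lra.
    + assert (0 < / INR (S n)) by (apply Rinv_0_lt_compat, lt_0_INR; lia).
      rewrite (Rabs_pos_eq (/ INR (S n))) by lra. apply Rmult_le_compat_r; [lra|apply H].
  - apply is_lim_seq_const.
  - replace (Finite 0) with (Rbar_mult C 0) by (simpl; now rewrite Rmult_0_r).
    apply is_lim_seq_scal_l. replace (Finite 0) with (Rbar_inv p_infty) by reflexivity.
    apply is_lim_seq_inv; [apply is_lim_seq_INR|discriminate].
Qed.

Lemma mean_lim_approx a l :
  (forall e, 0 < e -> exists b m, mean_lim b m /\ (forall n, Rabs (a n - b n) <= e) /\ Rabs (m - l) <= e) ->
  mean_lim a l.
Proof.
  intros H. unfold mean_lim. apply is_lim_seq_spec. intros eps. pose proof (cond_pos eps) as He.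
  destruct (H (eps / 4) ltac:(lra)) as [b [m [H1 [H2 H3]]]].
  apply is_lim_seq_spec in H1. destruct (H1 (mkposreal (eps / 4) ltac:(lra))) as [N HN]. simpl in HN.
  exists (S N). intros n Hn. specialize (HN n ltac:(lia)).
  assert (Nn : 0 < INR n) by (apply lt_0_INR; lia).
  assert (X : Rabs (sum_lt a n / INR n - sum_lt b n / INR n) <= eps / 4).
  { replace (sum_lt a n / INR n - sum_lt b n / INR n) with (sum_lt (fun k => a k - b k) n / INR n).
    - unfold Rdiv. rewrite Rabs_mult, (Rabs_pos_eq (/ INR n)) by (apply Rlt_le, Rinv_0_lt_compat; lra).
      apply Rle_trans with (INR n * (eps / 4) * / INR n); [|right; field; lra].
      apply Rmult_le_compat_r; [apply Rlt_le, Rinv_0_lt_compat; lra|].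
      eapply Rle_trans; [apply sum_lt_abs|]. rewrite <- sum_lt_const. apply sum_lt_le. auto.
    - rewrite (sum_lt_ext _ (fun k => a k + -1 * b k)) by (intros; ring).
      rewrite sum_lt_plus, sum_lt_scal. field. lra. }
  replace (sum_lt a n / INR n - l) with ((sum_lt a n / INR n - sum_lt b n / INR n) + ((sum_lt b n / INR n - m) + (m - l))) by ring.
  eapply Rle_lt_trans; [apply Rabs_triang|].
  pose proof (Rabs_triang (sum_lt b n / INR n - m) (m - l)). lra.
Qed.

(** Multiplied by [2 * sin (w / 2)] the sum telescopes, so the partial sums are bounded. *)
Lemma mean_cos_zero w c : sin (w / 2) <> 0 -> mean_lim (fun j => cos (INR j * w + c)) 0.
Proof.
  intros Hs. apply mean_lim_bounded_sums with (/ Rabs (sin (w / 2))). intros n.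
  assert (E : 2 * sin (w / 2) * sum_lt (fun j => cos (INR j * w + c)) n
     = sin (INR n * w + c - w / 2) - sin (c - w / 2)).
  { induction n as [|n IH]; [simpl; replace (0 * w + c - w / 2) with (c - w / 2) by ring; ring|].
    simpl sum_lt. rewrite Rmult_plus_distr_l, IH, S_INR.
    replace ((INR n + 1) * w + c - w / 2) with ((INR n * w + c) + w / 2) by field.
    rewrite sin_plus, (sin_minus (INR n * w + c)). ring. }
  assert (P : 0 < Rabs (sin (w / 2))) by now apply Rabs_pos_lt.
  apply Rmult_le_reg_l with (2 * Rabs (sin (w / 2))); [lra|].
  rewrite <- (Rabs_pos_eq 2) at 1 by lra. rewrite <- !Rabs_mult, E.
  replace (2 * Rabs (sin (w / 2)) * / Rabs (sin (w / 2))) with 2 by (field; lra).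
  eapply Rle_trans; [apply Rabs_triang|]. rewrite Rabs_Ropp.
  pose proof (SIN_bound (INR n * w + c - w / 2)). pose proof (SIN_bound (c - w / 2)).
  assert (Rabs (sin (INR n * w + c - w / 2)) <= 1) by (apply Rabs_le; lra).
  assert (Rabs (sin (c - w / 2)) <= 1) by (apply Rabs_le; lra). lra.
Qed.

(** After subtraction of the mean, the sum over one period is 0 and the partial sums are bounded. *)
Lemma mean_periodic (a : nat -> R) k : (0 < k)%nat -> (forall j, a (j + k)%nat = a j) ->
  mean_lim a (/ INR k * sum_lt a k).
Proof.
  intros Hk Hp. assert (Nk : 0 < INR k) by (apply lt_0_INR; lia).
  set (m := / INR k * sum_lt a k). set (b := fun j => a j - m).
  apply mean_lim_ext with (fun j => b j + m); [intros; unfold b; ring|].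
  enough (X : mean_lim b 0) by (apply (mean_lim_eq _ _ _ (mean_lim_plus _ _ _ _ X (mean_lim_const m))); ring).
  assert (Sk : sum_lt b k = 0).
  { unfold b. rewrite (sum_lt_ext _ (fun j => a j + - m)) by (intros; ring).
    rewrite sum_lt_plus, sum_lt_const. unfold m. field. lra. }
  assert (bp : forall j, b (j + k)%nat = b j) by (intros; unfold b; now rewrite Hp).
  assert (per : forall n, sum_lt b (k + n) = sum_lt b n).
  { intros n. rewrite sum_lt_add, Sk, Rplus_0_l. apply sum_lt_ext. intros i _.
    rewrite Nat.add_comm. apply bp. }
  apply mean_lim_bounded_sums with (sum_lt (fun j => Rabs (b j)) k).
  intros n. induction n as [n IH] using lt_wf_ind. destruct (le_lt_dec k n) as [L|L].
  - replace n with (k + (n - k))%nat by lia. rewrite per. apply IH. lia.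
  - eapply Rle_trans; [apply sum_lt_abs|]. replace k with (n + (k - n))%nat by lia.
    rewrite sum_lt_add. assert (0 <= sum_lt (fun i => Rabs (b (n + i)%nat)) (k - n)); [|lra].
    rewrite <- (sum_lt_zero (fun _ => 0) (k - n)) by reflexivity. apply sum_lt_le. intros; apply Rabs_pos.
Qed.

Lemma Fent_zero : Fent 0 = 0.
Proof. unfold Fent. destruct (Req_EM_T 0 0); [reflexivity|contradiction]. Qed.
Lemma Fent_nonzero y : y <> 0 -> Fent y = y ^ 2 * ln (y ^ 2).
Proof. intros H. unfold Fent. destruct (Req_EM_T y 0); [contradiction|reflexivity]. Qed.
Lemma Fent_opp y : Fent (- y) = Fent y.
Proof.
  destruct (Req_dec y 0) as [->|N]; [now rewrite Ropp_0|].
  rewrite !Fent_nonzero by lra. now replace ((- y) ^ 2) with (y ^ 2) by ring.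
Qed.

(** From [- ln z <= 1 / z] with [z = |y|]; this suffices for continuity at 0. *)
Lemma Fent_small y : Rabs y <= 1 -> Rabs (Fent y) <= 2 * Rabs y.
Proof.
  intros Hy. destruct (Req_dec y 0) as [->|N].
  { rewrite Fent_zero, Rabs_R0. lra. }
  rewrite Fent_nonzero by exact N. set (z := Rabs y) in *.
  assert (Hz : 0 < z) by now apply Rabs_pos_lt.
  rewrite <- (pow2_abs y). fold z. simpl. rewrite Rmult_1_r, ln_mult, Rabs_mult by lra.
  rewrite (Rabs_pos_eq (z * z)) by nra.
  assert (ln z <= 0) by (rewrite <- ln_1; destruct (Req_dec z 1) as [->|]; [lra|left; apply ln_increasing; lra]).
  assert (L : - ln z <= / z).
  { rewrite <- ln_Rinv by lra. assert (0 < / z) by now apply Rinv_0_lt_compat.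
    pose proof (exp_ineq1_le (ln (/ z))) as X. rewrite exp_ln in X by lra. lra. }
  rewrite Rabs_left1 by lra.
  replace (z * z * - (ln z + ln z)) with (2 * z * (z * - ln z)) by ring.
  assert (z * - ln z <= 1).
  { replace 1 with (z * / z) by (field; lra). apply Rmult_le_compat_l; lra. }
  nra.
Qed.

Lemma Fent_cont y : continuous Fent y.
Proof.
  destruct (Req_dec y 0) as [->|N].
  - apply continuity_pt_filterlim. intros e He. exists (Rmin 1 (e / 3)). split.
    + apply Rmin_glb_lt; lra.
    + intros x [_ Hx]. simpl in *. unfold Rdist in *. rewrite Fent_zero, Rminus_0_r in *.
      assert (Rmin 1 (e / 3) <= 1) by apply Rmin_l. assert (Rmin 1 (e / 3) <= e / 3) by apply Rmin_r.
      pose proof (Fent_small x ltac:(lra)). lra.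
  - apply continuous_ext_loc with (fun x => x ^ 2 * ln (x ^ 2)).
    + exists (mkposreal (Rabs y) ltac:(now apply Rabs_pos_lt)). intros x Hx.
      change (Rabs (x - y) < Rabs y) in Hx. rewrite Fent_nonzero; [reflexivity|].
      intros ->. rewrite Rminus_0_l, Rabs_Ropp in Hx. lra.
    + apply cont_mult; [cont|]. apply cont_ln; [cont|]. now apply pow2_gt_0.
Qed.

(** Uniform continuity on [[-(K + 1), K + 1]], which eventually contains both sequences. *)
Lemma lim_uniform_image (F : R -> R) (u v : nat -> R) K :
  (forall y, continuous F y) -> (forall n, Rabs (v n) <= K) ->
  is_lim_seq (fun n => u n - v n) 0 -> is_lim_seq (fun n => F (u n) - F (v n)) 0.
Proof.
  intros HF HK Hl. apply is_lim_seq_spec. intros eps.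
  assert (Hc : forall x, - (K + 1) <= x <= K + 1 -> continuity_pt F x).
  { intros x _. apply continuity_pt_filterlim, HF. }
  destruct (Heine_cor2 Hc eps) as [d Hd].
  apply is_lim_seq_spec in Hl.
  destruct (Hl (mkposreal (Rmin 1 d) ltac:(apply Rmin_glb_lt; [lra|apply cond_pos]))) as [N HN]. simpl in HN.
  exists N. intros n Hn. specialize (HN n Hn). rewrite Rminus_0_r in *. specialize (HK n).
  assert (Rmin 1 d <= 1) by apply Rmin_l. assert (Rmin 1 d <= d) by apply Rmin_r.
  assert (H1 : Rabs (u n - v n) < 1) by lra. apply Rabs_def2 in H1. apply Rabs_le_between in HK.
  apply Hd; lra.
Qed.

(** Splits the logarithm of [p_j^2 / S] and uses that the [Psi] add up to 1. The convention at 0 is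
    the same in [xlogx] and [Fent]. *)
Lemma entropy_sum (p : nat -> R -> R) n x : 0 < sum_lt (fun j => p j x ^ 2) n ->
  Dent p n x = ln (INR n) - ln (sum_lt (fun j => p j x ^ 2) n)
     + sum_lt (fun j => Fent (p j x)) n / sum_lt (fun j => p j x ^ 2) n.
Proof.
  intros HS. unfold Dent, entropy. set (S := sum_lt (fun j => p j x ^ 2) n) in *.
  assert (E : forall j, xlogx (Psi p n j x) = - ln S / S * p j x ^ 2 + / S * Fent (p j x)).
  { intros j. unfold Psi, lambda_n. fold S. unfold xlogx.
    destruct (Req_dec (p j x) 0) as [E|N].
    - rewrite E, Fent_zero. destruct (Req_EM_T (/ S * 0 ^ 2) 0) as [_|X]; [field; lra|].
      exfalso. apply X. ring.
    - assert (P2 : 0 < p j x ^ 2) by now apply pow2_gt_0.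
      assert (Si : 0 < / S) by now apply Rinv_0_lt_compat.
      destruct (Req_EM_T (/ S * p j x ^ 2) 0) as [X|_].
      + exfalso. assert (0 < / S * p j x ^ 2) by now apply Rmult_lt_0_compat. lra.
      + rewrite Fent_nonzero by exact N. rewrite ln_mult, ln_Rinv by lra. field. lra. }
  rewrite (sum_lt_ext _ _ n (fun j _ => E j)), sum_lt_plus, !sum_lt_scal. fold S. field. lra.
Qed.

(** The amplitude cancels: [Fent (A z) = A^2 ln (A^2) z^2 + A^2 Fent z], and the mean of [cos^2] is
    [1/2] because [sin w] is nonzero, so the limit is [- ln (A^2 / 2) + ln (A^2) + 2 m]. *)
Lemma entropy_limit (p : nat -> R -> R) x A w c m : 0 < A -> sin w <> 0 ->
  is_lim_seq (fun n => p n x - A * cos (INR n * w + c)) 0 ->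
  mean_lim (fun n => Fent (cos (INR n * w + c))) m ->
  is_lim_seq (fun n => Dent p n x) (ln 2 + 2 * m).
Proof.
  intros HA Hw Hl Hm.
  set (v := fun n => A * cos (INR n * w + c)).
  assert (vb : forall n, Rabs (v n) <= A).
  { intros n. unfold v. rewrite Rabs_mult, (Rabs_pos_eq A) by lra.
    pose proof (COS_bound (INR n * w + c)).
    assert (Rabs (cos (INR n * w + c)) <= 1) by (apply Rabs_le; lra). nra. }
  assert (M2 : mean_lim (fun n => p n x ^ 2) (A ^ 2 / 2)).
  { apply mean_lim_ext with (fun n => (p n x ^ 2 - v n ^ 2) + v n ^ 2); [intros; ring|].
    apply (mean_lim_eq _ (0 + A ^ 2 / 2)); [|ring]. apply mean_lim_plus.
    - apply mean_lim_cesaro. apply (lim_uniform_image (fun y => y ^ 2) _ v A); auto. intros; cont.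
    - apply mean_lim_ext with (fun n => A ^ 2 / 2 + A ^ 2 / 2 * cos (INR n * (2 * w) + 2 * c)).
      + intros n. unfold v. replace (INR n * (2 * w) + 2 * c) with (2 * (INR n * w + c)) by ring.
        rewrite cos_2a_cos. field.
      + apply (mean_lim_eq _ (A ^ 2 / 2 + A ^ 2 / 2 * 0)); [|ring].
        apply mean_lim_plus; [apply mean_lim_const|]. apply mean_lim_scal. apply mean_cos_zero.
        now replace (2 * w / 2) with w by field. }
  assert (MF : mean_lim (fun n => Fent (p n x)) (A ^ 2 * ln (A ^ 2) / 2 + A ^ 2 * m)).
  { apply mean_lim_ext with (fun n => (Fent (p n x) - Fent (v n)) + Fent (v n)); [intros; ring|].
    apply (mean_lim_eq _ (0 + (A ^ 2 * ln (A ^ 2) / 2 + A ^ 2 * m))); [|ring].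
    apply mean_lim_plus.
    - apply mean_lim_cesaro. apply (lim_uniform_image Fent _ v A); auto using Fent_cont.
    - apply mean_lim_ext with (fun n => (A ^ 2 * ln (A ^ 2) / 2 + A ^ 2 * ln (A ^ 2) / 2 * cos (INR n * (2 * w) + 2 * c))
          + A ^ 2 * Fent (cos (INR n * w + c))).
      + intros n. unfold v. replace (INR n * (2 * w) + 2 * c) with (2 * (INR n * w + c)) by ring.
        rewrite cos_2a_cos. set (z := cos (INR n * w + c)). destruct (Req_dec z 0) as [->|N].
        * replace (A * 0) with 0 by ring. rewrite Fent_zero. field.
        * rewrite !Fent_nonzero by (try exact N; apply Rmult_integral_contrapositive; lra).
          rewrite Rpow_mult_distr, ln_mult by (apply pow2_gt_0; lra). field.
      + apply mean_lim_plus; [|now apply mean_lim_scal].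
        apply (mean_lim_eq _ (A ^ 2 * ln (A ^ 2) / 2 + A ^ 2 * ln (A ^ 2) / 2 * 0)); [|ring].
        apply mean_lim_plus; [apply mean_lim_const|]. apply mean_lim_scal. apply mean_cos_zero.
        now replace (2 * w / 2) with w by field. }
  assert (A2 : 0 < A ^ 2) by (apply pow_lt; lra).
  set (S := fun n => sum_lt (fun j => p j x ^ 2) n / INR n).
  set (T := fun n => sum_lt (fun j => Fent (p j x)) n / INR n).
  assert (Sp : eventually (fun n => 0 < S n)).
  { apply is_lim_seq_spec in M2. destruct (M2 (mkposreal (A ^ 2 / 2) ltac:(lra))) as [N HN]. simpl in HN.
    exists N. intros n Hn. specialize (HN n Hn). apply Rabs_def2 in HN. unfold S. simpl. lra. }
  apply is_lim_seq_ext_loc with (fun n => - ln (S n) + T n / S n).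
  - destruct Sp as [N HN]. exists (Datatypes.S N). intros n Hn. specialize (HN n ltac:(lia)).
    assert (Nn : 0 < INR n) by (apply lt_0_INR; lia). unfold S, T in *.
    assert (HS : 0 < sum_lt (fun j => p j x ^ 2) n).
    { replace (sum_lt (fun j => p j x ^ 2) n) with (sum_lt (fun j => p j x ^ 2) n / INR n * INR n) by (field; lra).
      now apply Rmult_lt_0_compat. }
    rewrite entropy_sum by exact HS. rewrite ln_div by lra. field. lra.
  - replace (Finite (ln 2 + 2 * m)) with
      (Finite (- ln (A ^ 2 / 2) + (A ^ 2 * ln (A ^ 2) / 2 + A ^ 2 * m) / (A ^ 2 / 2))).
    + apply is_lim_seq_plus'.
      * apply (is_lim_seq_opp _ (ln (A ^ 2 / 2))).
        apply (is_lim_seq_continuous ln S (A ^ 2 / 2)); [|exact M2].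
        apply derivable_continuous_pt. exists (/ (A ^ 2 / 2)). apply derivable_pt_lim_ln. lra.
      * apply is_lim_seq_div'; [exact MF|exact M2|lra].
    + f_equal. rewrite ln_div by lra. field. lra.
Qed.

Lemma hpol_low k l : low (k + length l) (hpol k l).
Proof.
  revert k. induction l as [|x l IH]; intros k.
  - apply low_ext with (fun _ => 0); [intros; unfold hpol; simpl; ring|apply low_zero].
  - apply low_ext with (fun y => x * cosn k y + hpol (S k) l y); [intros; now rewrite hpol_cons|].
    simpl length. rewrite Nat.add_succ_r. apply low_plus; [apply low_scal, low_cosn; lia|apply (IH (S k))].
Qed.

(** Weyl's equidistribution on cosine polynomials: every nonconstant frequency averages to 0. *)
Lemma mean_low N u w c : low N u -> (forall k, (0 < k)%nat -> sin (INR k * w / 2) <> 0) ->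
  mean_lim (fun j => u (INR j * w + c)) (II u / PI).
Proof.
  intros Hu Hw. pose proof PI_RGT_0 as Hpi.
  assert (H : low N u /\ mean_lim (fun j => u (INR j * w + c)) (II u / PI)); [|apply H].
  revert u Hu. apply (low_ind (fun u => low N u /\ mean_lim (fun j => u (INR j * w + c)) (II u / PI))).
  - split; [apply low_zero|]. rewrite II_zero. unfold Rdiv. rewrite Rmult_0_l. apply mean_lim_const.
  - intros u v [Lu Mu] [Lv Mv]. split; [now apply low_plus|].
    rewrite (II_plus _ weight_one); [|now apply low_dom with N|now apply low_dom with N].
    rewrite Rdiv_plus_distr. now apply mean_lim_plus.
  - intros a j Hj. split; [now apply low_scal, low_cosn|].
    rewrite (II_scal _ weight_one), II_cosn.
    2:{ apply low_dom with N. now apply low_cosn. }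
    replace (a * (if Nat.eqb j 0 then PI else 0) / PI) with (a * (if Nat.eqb j 0 then 1 else 0))
      by (destruct (Nat.eqb j 0); field; lra).
    apply mean_lim_scal. destruct (Nat.eqb_spec j 0) as [->|Nj].
    + apply mean_lim_ext with (fun _ => 1); [intros; now rewrite cosn_0|apply mean_lim_const].
    + apply mean_lim_ext with (fun i => cos (INR i * (INR j * w) + INR j * c)).
      * intros i. unfold cosn. f_equal. ring.
      * apply mean_cos_zero. apply Hw. lia.
  - intros u v E [Lu Mu]. split; [now apply low_ext with u|].
    rewrite <- (II_ext u v) by (intros; apply E). eapply mean_lim_ext; [|exact Mu]. intros; apply E.
Qed.

Lemma angle_reduce y : exists z, 0 <= z <= 2 * PI /\ cos z = cos y /\ sin z = sin y.
Proof.
  pose proof PI_RGT_0 as Hpi.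
  assert (U : forall n y, exists z, (y <= 0 -> - (INR n * (2 * PI)) <= y -> 0 <= z <= 2 * PI) /\
       (0 <= y -> y <= INR n * (2 * PI) + 2 * PI -> 0 <= z <= 2 * PI) /\ cos z = cos y /\ sin z = sin y).
  { induction n as [|n IH]; intros x.
    - exists x. simpl. split; [intros; lra|]. split; [intros; lra|auto].
    - destruct (Rle_dec x 0) as [Hx|Hx].
      + destruct (Rle_dec (x + 2 * PI) 0) as [H|H].
        * destruct (IH (x + 2 * PI)) as [z [A [B [C D]]]]. exists z. rewrite cos_plus, sin_plus, cos_2PI, sin_2PI in *.
          split; [intros; apply A; rewrite S_INR in *; lra|]. split; [|lra].
          intros. assert (x = 0) by lra. lra.
        * exists (x + 2 * PI). rewrite cos_plus, sin_plus, cos_2PI, sin_2PI. repeat split; lra.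
      + destruct (Rle_dec x (2 * PI)) as [H|H].
        * exists x. repeat split; lra.
        * destruct (IH (x - 2 * PI)) as [z [A [B [C D]]]]. exists z. rewrite cos_minus, sin_minus, cos_2PI, sin_2PI in *.
          split; [lra|]. split; [|lra]. intros; apply B; rewrite S_INR in *; lra. }
  destruct (nfloor_ex (Rabs y / (2 * PI))) as [n Hn].
  { apply Rdiv_le_0_compat; [apply Rabs_pos|lra]. }
  assert (Hy : Rabs y <= INR (S n) * (2 * PI)).
  { rewrite S_INR. apply Rmult_le_reg_r with (/ (2 * PI)); [apply Rinv_0_lt_compat; lra|].
    replace ((INR n + 1) * (2 * PI) * / (2 * PI)) with (INR n + 1) by (field; lra). unfold Rdiv in Hn. lra. }
  apply Rabs_le_between in Hy.
  destruct (U (S n) y) as [z [A [B [C D]]]]. exists z. split; [|auto].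
  destruct (Rle_dec y 0) as [H|H]; [apply A; lra|apply B; lra].
Qed.

Lemma ev_periodic l y z : cos z = cos y -> sin z = sin y -> ev l z = ev l y.
Proof.
  intros Hc Hs. induction l as [|a l IH]; [reflexivity|]. simpl. rewrite IH. unfold ei. now rewrite Hc, Hs.
Qed.

Lemma log_real_approx_all r n y : 0 < r < 1 ->
  Rabs (Re (ev (llog r n) y) - ln (qr r y) / 2) <= (PI / (1 - r) + 1) * r ^ n.
Proof.
  intros Hr. destruct (angle_reduce y) as [z [Hz [Hc Hs]]].
  rewrite <- (ev_periodic _ y z Hc Hs). unfold qr. rewrite <- Hc. now apply log_real_approx.
Qed.

(* [ln (y^2)] for [y = cos z] is [ln |1 + e^{2 i z}|^2 - ln 4], here with [e^{2 i z}] shrunk by [r]. *)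
Lemma Fent_cos_approx x z : 0 < x <= / 2 ->
  Rabs (Fent (cos z) - cos z ^ 2 * (ln (qr (1 - x) (2 * z + PI)) - ln 4)) <= 3 * x.
Proof.
  intros Hx. set (r := 1 - x). assert (Hr : 0 < r < 1) by (unfold r; lra).
  set (u := cos z ^ 2). assert (Hu : 0 <= u <= 1).
  { unfold u. pose proof (COS_bound z). split; [apply pow2_ge_0|nra]. }
  assert (Q : qr r (2 * z + PI) = x ^ 2 + 4 * r * u).
  { unfold qr, u. rewrite neg_cos, cos_2a_cos. unfold r. ring. }
  pose proof (qr_pos r (2 * z + PI) Hr) as Qp. rewrite Q in *.
  destruct (Req_dec (cos z) 0) as [E|N].
  { unfold u. rewrite E, Fent_zero. replace (0 - 0 ^ 2 * (ln (x ^ 2 + 4 * r * 0 ^ 2) - ln 4)) with 0 by ring.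
    rewrite Rabs_R0. lra. }
  rewrite Fent_nonzero by exact N. fold u. assert (Hu0 : 0 < u) by (now apply pow2_gt_0).
  set (X := 4 * u / (x ^ 2 + 4 * r * u)). assert (HX : 0 < X) by (apply Rdiv_lt_0_compat; lra).
  replace (u * ln u - u * (ln (x ^ 2 + 4 * r * u) - ln 4)) with (u * ln X).
  2:{ unfold X. rewrite ln_div, ln_mult by lra. ring. }
  assert (Lup : ln X <= 2 * x).
  { apply Rle_trans with (X - 1).
    - pose proof (exp_ineq1_le (ln X)) as Y. rewrite exp_ln in Y by exact HX. lra.
    - assert (X <= 1 + 2 * x); [|lra]. unfold X. apply Rle_div_l; [lra|]. unfold r.
      assert (0 <= u * (x * (1 - 2 * x))) by (apply Rmult_le_pos; nra).
      assert (0 <= (1 + 2 * x) * x ^ 2) by (apply Rmult_le_pos; nra). nra. }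
  assert (Llow : - ln X * u <= x ^ 2 / 4).
  { rewrite <- ln_Rinv by exact HX. assert (HXi : 0 < / X) by now apply Rinv_0_lt_compat.
    pose proof (exp_ineq1_le (ln (/ X))) as Y. rewrite exp_ln in Y by exact HXi.
    apply Rle_trans with ((/ X - 1) * u); [apply Rmult_le_compat_r; lra|].
    replace ((/ X - 1) * u) with ((x ^ 2 + 4 * r * u - 4 * u) / 4) by (unfold X; field; split; lra).
    unfold r. nra. }
  apply Rabs_le. split; nra.
Qed.

(** With [y = 2 z + PI] one has [2 cos^2 z = 1 - cos y], and replacing the logarithm by its
    truncated series turns [Fent (cos z)] into a cosine polynomial [T] up to a uniform error. Only
    the first coefficient [- r] survives in its mean [r / 2 - ln 2], and [r] tends to 1. *)
Lemma mean_Fent_irrational w c : (forall k, (0 < k)%nat -> sin (INR k * w) <> 0) ->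
  mean_lim (fun j => Fent (cos (INR j * w + c))) (/ 2 - ln 2).
Proof.
  intros Hw. pose proof PI_RGT_0 as Hpi. apply mean_lim_approx. intros e He.
  set (x := Rmin (/ 2) (e / 8)). assert (Hx : 0 < x <= / 2) by (unfold x; split; [apply Rmin_glb_lt; lra|apply Rmin_l]).
  assert (Hxe : x <= e / 8) by apply Rmin_r.
  set (r := 1 - x). assert (Hr : 0 < r < 1) by (unfold r; lra).
  set (C := PI / (1 - r) + 1). assert (HC : 0 < C) by (unfold C; assert (0 < PI / (1 - r)) by (apply Rdiv_lt_0_compat; lra); lra).
  destruct (pow_lt_1_zero r ltac:(rewrite Rabs_pos_eq; lra) (e / 4 / C)) as [n0 Hn0].
  { apply Rdiv_lt_0_compat; lra. }
  (* At least one term, so that the head of [l] is the coefficient [- r]. *)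
  set (n := S n0). specialize (Hn0 n ltac:(unfold n; lia)). rewrite Rabs_pos_eq in Hn0 by (apply pow_le; lra).
  assert (Hcn : C * r ^ n <= e / 4).
  { replace (e / 4) with (C * (e / 4 / C)) by (field; lra). apply Rmult_le_compat_l; lra. }
  set (l := log_coefs r 1 n).
  set (T := fun y => (1 - cos y) * hpol 1 l y - ln 2 * (1 - cos y)).
  assert (L1 : low 2 (fun y => 1 - cos y)).
  { apply low_ext with (fun y => cosn 0 y - cosn 1 y); [intros; now rewrite cosn_0, cosn_1|].
    apply low_minus; apply low_cosn; lia. }
  assert (Lh : low (1 + length l) (hpol 1 l)) by apply hpol_low.
  assert (LT : low (S (S (1 + length l))) T).
  { unfold T. apply low_minus.
    - apply low_ext with (fun y => hpol 1 l y - cos y * hpol 1 l y); [intros; ring|].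
      apply low_minus; [now do 2 apply low_weaken1|]. now apply low_weaken1, low_mult_cos.
    - apply low_scal. apply low_weaken with 2%nat; [lia|exact L1]. }
  assert (IT : II T = PI * (r / 2 - ln 2)).
  { unfold T.
    assert (Lc0 : low 1 (fun _ => 1)) by (apply low_ext with (cosn 0); [intros; apply cosn_0|apply low_cosn; lia]).
    assert (Dc1 : deg 1 1 (cosn 1)) by (exists (fun _ => 0); split; [apply low_zero|intros; ring]).
    assert (Lc1 : low 2 (cosn 1)) by (apply low_cosn; lia).
    rewrite (II_ext _ (fun y => (1 * hpol 1 l y - cosn 1 y * hpol 1 l y) - (ln 2 * 1 - ln 2 * cosn 1 y)))
      by (intros; rewrite cosn_1; ring).
    assert (X1 := hpol_low_dom 1 (fun _ => 1) 1 l Lc0). assert (X2 := hpol_low_dom 2 (cosn 1) 1 l Lc1).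
    assert (X3 := low_dom _ _ Lc0). assert (X4 := low_dom _ _ Lc1). cbv beta in X1, X2.
    rewrite (II_minus _ weight_one _ _ (dom_minus _ _ _ X1 X2)
       (dom_minus _ _ _ (dom_scal _ (ln 2) _ X3) (dom_scal _ (ln 2) _ X4))).
    rewrite (II_minus _ weight_one _ _ X1 X2).
    rewrite (II_minus _ weight_one _ _ (dom_scal _ (ln 2) _ X3) (dom_scal _ (ln 2) _ X4)).
    rewrite (II_scal _ weight_one (ln 2) _ X3), (II_scal _ weight_one (ln 2) _ X4).
    rewrite (II_low_hpol 1 (fun _ => 1) 1 l Lc0) by lia.
    rewrite (II_deg_hpol 1 1 (cosn 1) l ltac:(lia) Dc1), II_cosn, (II_one _ weight_one).
    unfold l, n. simpl. field. }
  exists (fun j => T (INR j * (2 * w) + (2 * c + PI))), (r / 2 - ln 2). split; [|split].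
  - replace (r / 2 - ln 2) with (II T / PI) by (rewrite IT; field; lra).
    eapply mean_low; [exact LT|]. intros k Hk. replace (INR k * (2 * w) / 2) with (INR k * w) by field. now apply Hw.
  - intros j. set (z := INR j * w + c). replace (INR j * (2 * w) + (2 * c + PI)) with (2 * z + PI) by (unfold z; ring).
    pose proof (Fent_cos_approx x z Hx) as F1. fold r in F1.
    pose proof (log_real_approx_all r n (2 * z + PI) Hr) as F2. fold C in F2.
    assert (Eh : Re (ev (llog r n) (2 * z + PI)) = hpol 1 l (2 * z + PI)).
    { rewrite ev_llog. reflexivity. }
    rewrite Eh in F2. unfold T. set (h := hpol 1 l (2 * z + PI)) in *. set (q := ln (qr r (2 * z + PI))) in *.
    replace (1 - cos (2 * z + PI)) with (2 * cos z ^ 2) by (rewrite neg_cos, cos_2a_cos; ring).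
    assert (L4 : ln 4 = 2 * ln 2) by (replace 4 with (2 * 2) by ring; rewrite ln_mult by lra; ring).
    rewrite L4 in F1.
    assert (Hu : 0 <= cos z ^ 2 <= 1) by (pose proof (COS_bound z); split; [apply pow2_ge_0|nra]).
    set (u := cos z ^ 2) in *.
    replace (Fent (cos z) - (2 * u * h - ln 2 * (2 * u)))
      with ((Fent (cos z) - u * (q - 2 * ln 2)) + - (2 * u * (h - q / 2))) by field.
    eapply Rle_trans; [apply Rabs_triang|]. rewrite Rabs_Ropp, !Rabs_mult, (Rabs_pos_eq 2), (Rabs_pos_eq u) by lra.
    pose proof (Rabs_pos (h - q / 2)). nra.
  - replace (r / 2 - ln 2 - (/ 2 - ln 2)) with (- (x / 2)) by (unfold r; field).
    rewrite Rabs_Ropp, Rabs_pos_eq; lra.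
Qed.

(** * The principal value integral *)

Lemma at_right_interval a b : a < b -> at_right a (fun x => a < x < b).
Proof.
  intros H. exists (mkposreal (b - a) ltac:(lra)). intros x Hx Hax.
  change (Rabs (x - a) < b - a) in Hx. apply Rabs_def2 in Hx. lra.
Qed.
Lemma at_left_interval a b : a < b -> at_left b (fun x => a < x < b).
Proof.
  intros H. exists (mkposreal (b - a) ltac:(lra)). intros x Hx Hax.
  change (Rabs (x - b) < b - a) in Hx. apply Rabs_def2 in Hx. lra.
Qed.

Lemma is_RInt_gen_primitive (F Y : R -> R) (Fa Fb : (R -> Prop) -> Prop) a b la lb :
  Filter Fa -> Filter Fb ->
  (forall x, a < x < b -> is_derive Y x (F x)) -> (forall x, a < x < b -> continuous F x) ->
  filter_prod Fa Fb (fun p => a < fst p < b /\ a < snd p < b) ->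
  filterlim Y Fa (locally la) -> filterlim Y Fb (locally lb) ->
  is_RInt_gen F Fa Fb (lb - la).
Proof.
  intros FFa FFb HY HF Hp Ha Hb.
  assert (HD : forall x, a < x < b -> Derive Y x = F x) by (intros; now apply is_derive_unique, HY).
  assert (In : forall p x, a < fst p < b /\ a < snd p < b ->
     Rmin (fst p) (snd p) <= x <= Rmax (fst p) (snd p) -> a < x < b).
  { intros p x [H1 H2] [H3 H4]. split.
    - eapply Rlt_le_trans; [|exact H3]. apply Rmin_glb_lt; lra.
    - eapply Rle_lt_trans; [exact H4|]. apply Rmax_lub_lt; lra. }
  apply is_RInt_gen_ext with (Derive Y).
  - eapply filter_imp; [|exact Hp]. intros p H x Hx. apply HD. apply (In p); [exact H|lra].
  - apply is_RInt_gen_Derive; auto.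
    + eapply filter_imp; [|exact Hp]. intros p H x Hx. exists (F x). apply HY. now apply (In p).
    + eapply filter_imp; [|exact Hp]. intros p H x Hx. specialize (In p x H Hx).
      apply continuous_ext_loc with F; [|now apply HF].
      exists (mkposreal (Rmin (x - a) (b - x)) ltac:(apply Rmin_glb_lt; lra)). intros z Hz.
      change (Rabs (z - x) < Rmin (x - a) (b - x)) in Hz. symmetry. apply HD.
      assert (Rmin (x - a) (b - x) <= x - a) by apply Rmin_l. assert (Rmin (x - a) (b - x) <= b - x) by apply Rmin_r.
      apply Rabs_def2 in Hz. lra.
Qed.

Lemma acos_left_limit : filterlim acos (at_right (-1)) (locally PI).
Proof.
  intros P [e He]. pose proof PI_RGT_0 as Hpi. pose proof (cond_pos e) as He0.
  set (r := Rmin e (PI / 2)). assert (Hr : 0 < r) by (apply Rmin_glb_lt; lra).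
  assert (r <= e) by apply Rmin_l. assert (r <= PI / 2) by apply Rmin_r.
  assert (Hc : -1 < cos (PI - r)).
  { rewrite <- cos_PI. apply cos_decreasing_1; lra. }
  unfold filtermap. eapply filter_imp; [|exact (at_right_interval (-1) (cos (PI - r)) Hc)].
  intros x Hx. apply He. change (Rabs (acos x - PI) < e). pose proof (acos_bound x).
  pose proof (COS_bound (PI - r)).
  assert (PI - r < acos x).
  { apply Rnot_le_lt. intros L. assert (cos (PI - r) <= cos (acos x)) by (apply cos_decr_1; lra).
    rewrite cos_acos in H3 by lra. lra. }
  apply Rabs_def1; lra.
Qed.

Lemma acos_right_limit : filterlim acos (at_left 1) (locally 0).
Proof.
  intros P [e He]. pose proof PI_RGT_0 as Hpi. pose proof (cond_pos e) as He0.
  set (r := Rmin e (PI / 2)). assert (Hr : 0 < r) by (apply Rmin_glb_lt; lra).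
  assert (r <= e) by apply Rmin_l. assert (r <= PI / 2) by apply Rmin_r.
  assert (Hc : cos r < 1).
  { rewrite <- cos_0. apply cos_decreasing_1; lra. }
  unfold filtermap. eapply filter_imp; [|exact (at_left_interval (cos r) 1 Hc)].
  intros x Hx. apply He. change (Rabs (acos x - 0) < e). pose proof (acos_bound x).
  pose proof (COS_bound r).
  assert (acos x < r).
  { apply Rnot_le_lt. intros L. assert (cos (acos x) <= cos r) by (apply cos_decr_1; lra).
    rewrite cos_acos in H3 by lra. lra. }
  apply Rabs_def1; lra.
Qed.

Lemma acos_der x : -1 < x < 1 -> is_derive acos x (- / sqrt (1 - x ^ 2)).
Proof.
  intros Hx. apply is_derive_Reals. apply (derive_pt_eq_1 _ _ _ (derivable_pt_acos x Hx)).
  rewrite derive_pt_acos, Rsqr_pow2. field. apply Rgt_not_eq, sqrt_lt_R0. nra.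
Qed.

Lemma acos_cont x : -1 < x < 1 -> continuous acos x.
Proof.
  intros Hx. apply (ex_derive_continuous acos). eexists. now apply acos_der.
Qed.

Section PrincipalValue.
Variables G G' : R -> R.
Hypothesis HG : forall x, -1 <= x <= 1 -> is_derive G x (G' x).
Variable t : R.
Hypothesis Ht : 0 < t < PI.

Let prim_quot (y : R) : R := RInt (cos_quotient G G' t) 0 y.
Let smooth_part (y : R) : R := prim_quot y + G (cos t) * (2 / sin t * ln (sin ((t + y) / 2))).
(* The second summand of [smooth_part] and the last term of [prim] together form
   a primitive of [1 / (cos y - cos t)]. *)
Let prim (y : R) : R := - (smooth_part y - G (cos t) / sin t * ln (Rabs (cos y - cos t) / 2)).

Lemma half_sum_pos y : 0 <= y <= PI -> 0 < sin ((t + y) / 2).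
Proof. intros; apply sin_gt_0; lra. Qed.

Lemma prim_quot_der y : is_derive prim_quot y (cos_quotient G G' t y).
Proof.
  apply (is_derive_RInt (cos_quotient G G' t) prim_quot 0 y).
  - exists (mkposreal 1 Rlt_0_1). intros z _. unfold prim_quot.
    apply (RInt_correct (V := R_CompleteNormedModule)).
    apply (ex_RInt_continuous (V := R_CompleteNormedModule)). intros w _. apply cos_quotient_cont; auto.
  - apply cos_quotient_cont; auto.
Qed.

Lemma smooth_part_cont y : 0 <= y <= PI -> continuous smooth_part y.
Proof.
  intros Hy. unfold smooth_part. apply cont_plus.
  - apply (ex_derive_continuous prim_quot). eexists. apply prim_quot_der.
  - apply cont_mult; [cont|]. apply cont_mult; [cont|]. apply cont_ln; [|now apply half_sum_pos].
    apply cont_sin. apply cont_div; [cont|cont|lra].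
Qed.

Lemma prim_cont y : 0 <= y <= PI -> cos y <> cos t -> continuous prim y.
Proof.
  intros Hy N. unfold prim. apply cont_opp, cont_minus; [now apply smooth_part_cont|].
  apply cont_mult; [cont|]. apply cont_ln.
  - apply cont_div; [apply cont_abs, cont_minus; cont|cont|lra].
  - apply Rdiv_lt_0_compat; [apply Rabs_pos_lt; lra|lra].
Qed.

(** In the variable [y = acos x] the regular part of the integrand is integrated by [prim_quot], and
    the part proportional to [G (cos t)] by elementary logarithms. *)
Lemma prim_der x : -1 < x < 1 -> x <> cos t ->
  is_derive (fun x => prim (acos x)) x (G x / sqrt (1 - x ^ 2) / (x - cos t)).
Proof.
  intros Hx N. pose proof (acos_bound x) as Hb. pose proof (cos_acos x ltac:(lra)) as Hc.
  assert (Hs : 0 < sqrt (1 - x ^ 2)) by (apply sqrt_lt_R0; nra).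
  assert (Hst : 0 < sin t) by (apply sin_gt_0; lra).
  assert (Da : is_derive acos x (- / sqrt (1 - x ^ 2))) by (now apply acos_der).
  pose proof (half_sum_pos (acos x) Hb) as Hh.
  set (y := acos x) in *. set (A := (t + y) / 2) in *. set (Bm := (t - y) / 2).
  assert (sy : sin y = sqrt (1 - x ^ 2)).
  { unfold y. rewrite sin_acos by lra. now rewrite Rsqr_pow2. }
  assert (D1 : is_derive (fun x => prim_quot (acos x)) x (- / sqrt (1 - x ^ 2) * ((G x - G (cos t)) / (x - cos t)))).
  { apply (der_eq _ _ (- / sqrt (1 - x ^ 2) * cos_quotient G G' t (acos x))).
    - apply (der_comp prim_quot acos); [apply prim_quot_der|exact Da].
    - f_equal. unfold cos_quotient, quotient. rewrite cos_acos by lra.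
      destruct (Req_EM_T x (cos t)); [contradiction|reflexivity]. }
  assert (D2 : is_derive (fun x => ln (sin ((t + acos x) / 2))) x ((- / sqrt (1 - x ^ 2) * / 2 * cos A) * / sin A)).
  { apply (der_comp ln (fun x => sin ((t + acos x) / 2))); [now apply is_derive_ln|].
    apply (der_comp sin (fun x => (t + acos x) / 2)); [apply is_derive_sin|].
    apply (der_eq _ _ ((0 + - / sqrt (1 - x ^ 2)) * / 2 + (t + acos x) * 0)); [|ring].
    apply (der_mult (fun x => t + acos x) (fun _ => / 2)); [|exact (der_const _ x)].
    apply der_plus; [exact (der_const _ x)|exact Da]. }
  assert (D3 : is_derive (fun x => ln (Rabs (cos (acos x) - cos t) / 2)) x (/ (x - cos t))).
  { apply is_derive_ext_loc with (fun z => ln (Rabs (z - cos t) / 2)).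
    - exists (mkposreal (Rmin (1 - x) (x + 1)) ltac:(apply Rmin_glb_lt; lra)). intros z Hz.
      change (Rabs (z - x) < Rmin (1 - x) (x + 1)) in Hz. rewrite cos_acos; [reflexivity|].
      assert (Rmin (1 - x) (x + 1) <= 1 - x) by apply Rmin_l. assert (Rmin (1 - x) (x + 1) <= x + 1) by apply Rmin_r.
      apply Rabs_def2 in Hz. lra.
    - set (sg := if Rle_dec 0 (x - cos t) then 1 else -1).
      assert (Hsg : sg * sg = 1) by (unfold sg; destruct Rle_dec; ring).
      assert (Hpos : 0 < sg * (x - cos t)) by (unfold sg; destruct Rle_dec; lra).
      apply is_derive_ext_loc with (fun z => ln (sg * (z - cos t) / 2)).
      + exists (mkposreal (Rabs (x - cos t)) ltac:(apply Rabs_pos_lt; lra)). intros z Hz.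
        change (Rabs (z - x) < Rabs (x - cos t)) in Hz. do 2 f_equal. unfold sg in *.
        unfold Rabs in *. repeat destruct Rcase_abs; destruct Rle_dec; lra.
      + apply (der_eq _ _ ((sg * / 2) * / (sg * (x - cos t) / 2))).
        * apply (der_comp ln (fun z => sg * (z - cos t) / 2)); [apply is_derive_ln; lra|].
          apply (der_eq _ _ ((0 * (x - cos t) + sg * (1 - 0)) * / 2 + sg * (x - cos t) * 0)); [|ring].
          apply (der_mult (fun z => sg * (z - cos t)) (fun _ => / 2)); [|exact (der_const _ x)].
          apply (der_mult (fun _ => sg) (fun z => z - cos t)); [exact (der_const _ x)|].
          apply der_minus; [exact (is_derive_id (K := R_AbsRing) x)|exact (der_const _ x)].
        * field. split; [lra|]. intros E. rewrite E in Hpos. lra. }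
  apply (der_eq _ _ (- ((- / sqrt (1 - x ^ 2) * ((G x - G (cos t)) / (x - cos t))
      + (0 * ln (sin ((t + acos x) / 2)) + G (cos t) * (2 / sin t) * ((- / sqrt (1 - x ^ 2) * / 2 * cos A) * / sin A)))
      - (0 * ln (Rabs (cos (acos x) - cos t) / 2) + G (cos t) / sin t * / (x - cos t))))).
  - unfold prim. apply der_opp. apply der_minus.
    + unfold smooth_part. apply der_plus; [exact D1|].
      apply is_derive_ext with (fun x => (G (cos t) * (2 / sin t)) * ln (sin ((t + acos x) / 2))).
      { intros z. match goal with |- ?p = ?q => change (@eq R p q) end. ring. }
      apply (der_mult (fun _ => G (cos t) * (2 / sin t)) (fun x => ln (sin ((t + acos x) / 2)))); [exact (der_const _ x)|exact D2].
    + apply (der_mult (fun _ => G (cos t) / sin t) (fun x => ln (Rabs (cos (acos x) - cos t) / 2))); [exact (der_const _ x)|exact D3].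
  - assert (X1 : x - cos t = 2 * (sin A * sin Bm)).
    { transitivity (cos y - cos t); [now rewrite Hc|].
      replace (cos y) with (cos (A - Bm)) by (f_equal; unfold A, Bm; field).
      replace (cos t) with (cos (A + Bm)) by (f_equal; unfold A, Bm; field).
      rewrite cos_minus, cos_plus. ring. }
    assert (X2 : sin t - sqrt (1 - x ^ 2) = 2 * (cos A * sin Bm)).
    { rewrite <- sy. replace (sin y) with (sin (A - Bm)) by (f_equal; unfold A, Bm; field).
      replace (sin t) with (sin (A + Bm)) by (f_equal; unfold A, Bm; field).
      rewrite sin_minus, sin_plus. ring. }
    (* Sum-to-product formulas express the derivative of [ln (sin ((t + y) / 2))] through
       [x - cos t]; the terms regular at [cos t] cancel and the factor [1 / (x - cos t)] remains. *)
    assert (X3 : cos A / sin A = (sin t - sqrt (1 - x ^ 2)) / (x - cos t)).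
    { rewrite X1, X2. field. split; [|lra]. intros E. apply N. rewrite E in X1. lra. }
    replace (- / sqrt (1 - x ^ 2) * / 2 * cos A * / sin A) with (- / sqrt (1 - x ^ 2) * / 2 * (cos A / sin A)) by (field; lra).
    rewrite X3. field. repeat split; lra.
Qed.

(** Excision is symmetric in [x], so at [cos t - e] and [cos t + e] the singular logarithm takes the
    same value and cancels; what remains is continuous in [e]. *)
Lemma principal_value (h : R -> R) :
  (forall x, -1 < x < 1 -> ln (h x) = G x) ->
  is_pv_integral (fun s => ln (h s) / sqrt (1 - s ^ 2) / (s - cos t)) (-1) 1 (cos t) (II (cos_quotient G G' t)).
Proof.
  intros Hh. assert (Hst : 0 < sin t) by (apply sin_gt_0; lra). pose proof PI_RGT_0 as Hpi.
  assert (Hct : -1 < cos t < 1).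
  { rewrite <- cos_PI, <- cos_0. split; apply cos_decreasing_1; lra. }
  set (F := fun s => ln (h s) / sqrt (1 - s ^ 2) / (s - cos t)). set (Y := fun x => prim (acos x)).
  assert (HY : forall x, -1 < x < 1 -> x <> cos t -> is_derive Y x (F x)).
  { intros x Hx N. unfold F. rewrite Hh by exact Hx. now apply prim_der. }
  assert (HF : forall x, -1 < x < 1 -> x <> cos t -> continuous F x).
  { intros x Hx N. apply continuous_ext_loc with (fun s => G s / sqrt (1 - s ^ 2) / (s - cos t)).
    - exists (mkposreal (Rmin (1 - x) (x + 1)) ltac:(apply Rmin_glb_lt; lra)). intros z Hz.
      change (Rabs (z - x) < Rmin (1 - x) (x + 1)) in Hz. unfold F. rewrite Hh; [reflexivity|].
      assert (Rmin (1 - x) (x + 1) <= 1 - x) by apply Rmin_l. assert (Rmin (1 - x) (x + 1) <= x + 1) by apply Rmin_r.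
      apply Rabs_def2 in Hz. lra.
    - assert (Gc : continuous G x) by (apply (ex_derive_continuous G); exists (G' x); apply HG; lra).
      apply cont_div; [apply cont_div; [exact Gc|cont|]|apply cont_minus; cont|lra].
      apply Rgt_not_eq, sqrt_lt_R0. nra. }
  (* The half-angle formulas [(1 - cos t) / 2 = sin^2 (t/2)] here and
     [(1 + cos t) / 2 = cos^2 (t/2)] at [PI] make the logarithms cancel at the endpoints. *)
  assert (P0 : prim 0 = - prim_quot 0).
  { unfold prim, smooth_part. rewrite cos_0, Rplus_0_r. rewrite (Rabs_pos_eq (1 - cos t)) by lra.
    assert (S : 0 < sin (t / 2)) by (apply sin_gt_0; lra).
    replace ((1 - cos t) / 2) with (sin (t / 2) * sin (t / 2)).
    - rewrite ln_mult by lra. field. lra.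
    - replace (cos t) with (cos (2 * (t / 2))) by (f_equal; field). rewrite cos_2a_sin. field. }
  assert (PP : prim PI = - prim_quot PI).
  { unfold prim, smooth_part. rewrite cos_PI. rewrite (Rabs_left (-1 - cos t)) by lra.
    assert (S : 0 < cos (t / 2)) by (apply cos_gt_0; lra).
    replace (sin ((t + PI) / 2)) with (cos (t / 2)).
    2:{ replace ((t + PI) / 2) with (PI / 2 + t / 2) by field. apply cos_sin. }
    replace (- (-1 - cos t) / 2) with (cos (t / 2) * cos (t / 2)).
    - rewrite ln_mult by lra. field. lra.
    - replace (cos t) with (cos (2 * (t / 2))) by (f_equal; field). rewrite cos_2a_cos. field. }
  assert (Q0 : prim_quot 0 = 0) by (unfold prim_quot; exact (RInt_point (V := R_CompleteNormedModule) 0 _)).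
  assert (QP : prim_quot PI = II (cos_quotient G G' t)).
  { rewrite (II_FTC (fun _ => 1) _ prim_quot).
    - rewrite Q0. ring.
    - now apply cos_quotient_dom.
    - intros; apply prim_quot_der.
    - apply (ex_derive_continuous prim_quot). eexists. apply prim_quot_der.
    - apply (ex_derive_continuous prim_quot). eexists. apply prim_quot_der. }
  (* [acos] reverses the orientation: [x = -1] corresponds to [PI] and [x = 1] to 0. *)
  exists (fun e => Y (cos t - e) - prim PI), (fun e => prim 0 - Y (cos t + e)). split.
  - intros e He H1 H2. split.
    + apply (is_RInt_gen_primitive F Y (at_right (-1)) (at_point (cos t - e)) (-1) (cos t)).
      * apply at_right_proper_filter.
      * apply at_point_filter.
      * intros; apply HY; lra.
      * intros; apply HF; lra.
      * apply Filter_prod with (fun x => -1 < x < cos t) (fun x => x = cos t - e).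
        -- apply at_right_interval. lra.
        -- reflexivity.
        -- intros x z Hx ->. simpl. lra.
      * unfold Y. apply (filterlim_comp _ _ _ acos prim _ (locally PI)); [apply acos_left_limit|].
        apply prim_cont; [lra|]. rewrite cos_PI. lra.
      * intros P HP. unfold filtermap, at_point. exact (locally_singleton _ _ HP).
    + apply (is_RInt_gen_primitive F Y (at_point (cos t + e)) (at_left 1) (cos t) 1).
      * apply at_point_filter.
      * apply at_left_proper_filter.
      * intros; apply HY; lra.
      * intros; apply HF; lra.
      * apply Filter_prod with (fun x => x = cos t + e) (fun x => cos t < x < 1).
        -- reflexivity.
        -- apply at_left_interval. lra.
        -- intros x z -> Hz. simpl. lra.
      * intros P HP. unfold filtermap, at_point. exact (locally_singleton _ _ HP).
      * unfold Y. apply (filterlim_comp _ _ _ acos prim _ (locally 0)); [apply acos_right_limit|].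
        apply prim_cont; [lra|]. rewrite cos_0. lra.
  - set (k := fun e => II (cos_quotient G G' t) - (smooth_part (acos (cos t - e)) - smooth_part (acos (cos t + e)))).
    apply filterlim_ext_loc with k.
    + set (r := Rmin (1 - cos t) (cos t + 1)). assert (Hr : 0 < r) by (apply Rmin_glb_lt; lra).
      assert (r <= 1 - cos t) by apply Rmin_l. assert (r <= cos t + 1) by apply Rmin_r.
      eapply filter_imp; [|exact (at_right_interval 0 r Hr)]. intros e He. unfold k, Y.
      rewrite P0, PP, Q0, QP. unfold prim. rewrite !cos_acos by lra.
      replace (cos t - e - cos t) with (- e) by ring. replace (cos t + e - cos t) with e by ring.
      rewrite Rabs_Ropp. match goal with |- ?p = ?q => change (@eq R p q) end. ring.
    + assert (kc : continuous k 0).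
      { unfold k. apply cont_minus; [cont|]. apply cont_minus.
        - apply (continuous_comp (fun e => cos t - e) (fun x => smooth_part (acos x))); [apply cont_minus; cont|].
          rewrite Rminus_0_r. apply (continuous_comp acos smooth_part); [now apply acos_cont|].
          apply smooth_part_cont, acos_bound.
        - apply (continuous_comp (fun e => cos t + e) (fun x => smooth_part (acos x))); [apply cont_plus; cont|].
          rewrite Rplus_0_r. apply (continuous_comp acos smooth_part); [now apply acos_cont|].
          apply smooth_part_cont, acos_bound. }
      assert (k0 : k 0 = II (cos_quotient G G' t)).
      { unfold k. rewrite Rminus_0_r, Rplus_0_r. ring. }
      rewrite <- k0. unfold at_right. eapply filterlim_filter_le_1; [apply filter_le_within|exact kc].
Qed.

End PrincipalValue.

(** * Generalized Jacobi weights *)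

(** Convergence at a point between [|u|] and [r] would fail if the radius were at most [|u|]. *)
Lemma power_series_radius (a : nat -> R) r u :
  (forall v, Rabs v < r -> ex_series (fun k => a k * v ^ k)) -> Rabs u < r -> Rbar_lt (Rabs u) (CV_radius a).
Proof.
  intros H Hu. apply Rbar_not_le_lt. intros L.
  set (v := (Rabs u + r) / 2). pose proof (Rabs_pos u) as P.
  assert (Hv : Rabs v = v) by (apply Rabs_pos_eq; unfold v; lra).
  apply (CV_disk_outside a v).
  - eapply Rbar_le_lt_trans; [exact L|]. simpl. rewrite Hv. unfold v. lra.
  - apply ex_series_lim_0, H. rewrite Hv. unfold v. lra.
Qed.

(** Near each point [h] is a power series, differentiated termwise inside its disc of
    convergence. *)
Lemma analytic_C1 h x : analytic_near_interval h -> -1 <= x <= 1 ->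
  is_derive h x (Derive h x) /\ continuous (Derive h) x.
Proof.
  intros [d [Hd Han]] Hx. destruct (Han x ltac:(lra)) as [a [r [Hr Ha]]].
  assert (R : forall u, Rabs u < r -> Rbar_lt (Rabs u) (CV_radius a)).
  { intros u. apply power_series_radius. intros v Hv. exists (h (x + v)).
    specialize (Ha (x + v)). replace (x + v - x) with v in Ha by ring. now apply Ha. }
  assert (D : forall y, Rabs (y - x) < r -> is_derive h y (PSeries (PS_derive a) (y - x))).
  { intros y Hy. apply is_derive_ext_loc with (fun z => PSeries a (z - x)).
    - exists (mkposreal (r - Rabs (y - x)) ltac:(lra)). intros z Hz.
      change (Rabs (z - y) < r - Rabs (y - x)) in Hz.
      apply is_series_unique, Ha. replace (z - x) with ((z - y) + (y - x)) by ring.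
      pose proof (Rabs_triang (z - y) (y - x)). lra.
    - apply (der_eq _ _ ((1 - 0) * PSeries (PS_derive a) (y - x))); [|ring].
      apply (der_comp (PSeries a) (fun z => z - x)); [apply is_derive_PSeries; auto|].
      apply der_minus; [exact (is_derive_id (K := R_AbsRing) y)|exact (der_const x y)]. }
  assert (X0 : Rabs (x - x) < r) by (rewrite Rminus_diag, Rabs_R0; exact Hr).
  split; [apply Derive_correct; eexists; now apply D|].
  apply continuous_ext_loc with (fun y => PSeries (PS_derive a) (y - x)).
  - exists (mkposreal r Hr). intros y Hy. change (Rabs (y - x) < r) in Hy. symmetry. now apply is_derive_unique, D.
  - apply (continuous_comp (fun y => y - x) (PSeries (PS_derive a))); [apply cont_minus; cont|].
    apply (ex_derive_continuous (PSeries (PS_derive a))). eexists. apply is_derive_PSeries.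
    rewrite CV_radius_derive. now apply R.
Qed.

Lemma RInt_cos_substitution (g : R -> R) a b :
  (forall x, -1 < x < 1 -> continuous g x) -> 0 < a -> a <= b -> b < PI ->
  RInt (fun y => g (cos y) * sin y) a b = RInt g (cos b) (cos a).
Proof.
  intros Hg Ha Hab Hb.
  assert (Hc : forall y, 0 < y < PI -> -1 < cos y < 1).
  { intros y Hy. rewrite <- cos_PI, <- cos_0. split; apply cos_decreasing_1; lra. }
  rewrite <- (opp_RInt_swap g (cos a) (cos b)).
  - rewrite <- (RInt_comp g cos (fun y => - sin y) a b).
    + rewrite <- (RInt_opp (V := R_CompleteNormedModule)).
      * apply RInt_ext. intros y _. unfold opp, scal; simpl; unfold mult; simpl.
        match goal with |- ?p = ?q => change (@eq R p q) end. ring.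
      * apply (ex_RInt_continuous (V := R_CompleteNormedModule)). intros y Hy.
        rewrite Rmin_left, Rmax_right in Hy by lra.
        apply (cont_mult (fun y => - sin y) (fun y => g (cos y))); [cont|].
        apply (continuous_comp cos g); [apply continuous_cos|]. apply Hg, Hc. lra.
    + intros y Hy. rewrite Rmin_left, Rmax_right in Hy by lra. apply Hg, Hc. lra.
    + intros y _. split; [apply is_derive_cos|cont].
  - apply (ex_RInt_continuous (V := R_CompleteNormedModule)). intros x Hx. apply Hg.
    pose proof (Hc a ltac:(lra)). pose proof (Hc b ltac:(lra)). split.
    + eapply Rlt_le_trans; [|apply Hx]. now apply Rmin_glb_lt.
    + eapply Rle_lt_trans; [apply Hx|]. now apply Rmax_lub_lt.
Qed.

(** The improper integral is evaluated along the particular endpoints [cos (PI - cut n)] and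
    [cos (cut n)], which approach -1 and 1 from inside. *)
Lemma RInt_gen_trunc_lim (g : R -> R) (l : R) :
  (forall x, -1 < x < 1 -> continuous g x) ->
  is_RInt_gen g (at_right (-1)) (at_left 1) l ->
  is_lim_seq (trunc_int (fun y => g (cos y) * sin y)) l.
Proof.
  intros Hg HI P HP. destruct (HI P HP) as [A B HA HB HAB]. simpl in HAB.
  assert (Hc : forall n, -1 < cos (PI - cut n) /\ cos (cut n) < 1).
  { intros n. pose proof (cut_bounds n). pose proof (cut_half n).
    rewrite <- cos_PI at 1. rewrite <- cos_0. split; apply cos_decreasing_1; lra. }
  assert (L1 : is_lim_seq (fun n => cos (PI - cut n)) (-1)).
  { rewrite <- cos_PI. apply (is_lim_seq_continuous cos (fun n => PI - cut n) PI).
    - apply continuity_pt_filterlim, continuous_cos.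
    - replace (Finite PI) with (Finite (PI - 0)) by (f_equal; ring).
      apply is_lim_seq_minus'; [apply is_lim_seq_const|apply cut_lim]. }
  assert (L2 : is_lim_seq (fun n => cos (cut n)) 1).
  { rewrite <- cos_0. apply (is_lim_seq_continuous cos cut 0); [|apply cut_lim].
    apply continuity_pt_filterlim, continuous_cos. }
  destruct (L1 _ HA) as [N1 H1]. destruct (L2 _ HB) as [N2 H2].
  exists (N1 + N2)%nat. intros n Hn. specialize (H1 n ltac:(lia)). specialize (H2 n ltac:(lia)).
  destruct (Hc n) as [C1 C2]. destruct (HAB _ _ (H1 C1) (H2 C2)) as [v [Hv Pv]].
  unfold trunc_int. pose proof (cut_bounds n). pose proof (cut_half n).
  rewrite (RInt_cos_substitution g) by (auto; lra). now rewrite (is_RInt_unique _ _ _ _ Hv).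
Qed.

(** One interval containing [[cos b, cos a]] whose integral is within 1 of [l] suffices, by
    positivity. *)
Lemma RInt_gen_bound (g : R -> R) (l : R) :
  (forall x, -1 < x < 1 -> continuous g x) -> (forall x, -1 < x < 1 -> 0 <= g x) ->
  is_RInt_gen g (at_right (-1)) (at_left 1) l ->
  forall a b, 0 < a -> a <= b -> b < PI -> RInt (fun y => g (cos y) * sin y) a b <= l + 1.
Proof.
  intros Hg Hp HI a b Ha Hab Hb.
  assert (Hc : forall y, 0 < y < PI -> -1 < cos y < 1).
  { intros y Hy. rewrite <- cos_PI, <- cos_0. split; apply cos_decreasing_1; lra. }
  pose proof (Hc a ltac:(lra)) as Ca. pose proof (Hc b ltac:(lra)) as Cb.
  assert (Cab : cos b <= cos a) by (apply cos_decr_1; lra).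
  rewrite RInt_cos_substitution by auto.
  destruct (HI (fun z => z <= l + 1)) as [A B HA HB HAB].
  { exists (mkposreal 1 Rlt_0_1). intros z Hz. change (Rabs (z - l) < 1) in Hz. apply Rabs_def2 in Hz. lra. }
  simpl in HAB.
  assert (EA : exists u, A u /\ -1 < u < cos b).
  { assert (X : at_right (-1) (fun u => A u /\ -1 < u < cos b)).
    { apply filter_and; [exact HA|]. apply at_right_interval. lra. }
    destruct (filter_ex (F := at_right (-1)) _ X) as [u Hu]. now exists u. }
  assert (EB : exists v, B v /\ cos a < v < 1).
  { assert (X : at_left 1 (fun v => B v /\ cos a < v < 1)).
    { apply filter_and; [exact HB|]. apply at_left_interval. lra. }
    destruct (filter_ex (F := at_left 1) _ X) as [v Hv]. now exists v. }
  destruct EA as [u [Au Hu]]. destruct EB as [v [Bv Hv]].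
  destruct (HAB u v Au Bv) as [z [Hz Pz]]. rewrite <- (is_RInt_unique _ _ _ _ Hz) in Pz.
  eapply Rle_trans; [|exact Pz].
  assert (Ex : forall p q, -1 < p -> p <= q -> q < 1 -> ex_RInt g p q).
  { intros p q Hpq1 Hpq2 Hpq3. apply (ex_RInt_continuous (V := R_CompleteNormedModule)). intros x Hx.
    rewrite Rmin_left, Rmax_right in Hx by lra. apply Hg. lra. }
  assert (E1 : ex_RInt g u (cos b)) by (apply Ex; lra).
  assert (E2 : ex_RInt g (cos b) (cos a)) by (apply Ex; lra).
  assert (E3 : ex_RInt g (cos a) v) by (apply Ex; lra).
  rewrite <- (RInt_Chasles g u (cos b) v E1) by (eapply ex_RInt_Chasles; eauto).
  rewrite <- (RInt_Chasles g (cos b) (cos a) v E2 E3).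
  change (RInt g (cos b) (cos a) <= RInt g u (cos b) + (RInt g (cos b) (cos a) + RInt g (cos a) v)).
  assert (0 <= RInt g u (cos b)) by (apply RInt_ge_0; auto; [lra|intros; apply Hp; lra]).
  assert (0 <= RInt g (cos a) v) by (apply RInt_ge_0; auto; [lra|intros; apply Hp; lra]). lra.
Qed.

Lemma poly_deg_cont q n x : poly_deg_pos_lead q n -> continuous q x.
Proof.
  intros [c [_ Hq]]. apply continuous_ext with (fun x => sum_lt (fun k => c k * x ^ k) (S n)).
  - intros z. now rewrite Hq, sum_lt_f_R0.
  - apply (cont_sum (fun k x => c k * x ^ k)). intros. cont.
Qed.

Section Jacobi.
Variables (alpha beta : R) (h : R -> R).
Hypothesis Han : analytic_near_interval h.
Hypothesis Hpos : forall x, -1 <= x <= 1 -> 0 < h x.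

Definition log_h (x : R) : R := ln (h x).
Definition log_h' (x : R) : R := Derive h x / h x.
Definition trig_weight (y : R) : R := weight alpha beta h (cos y) * sin y.
(** The factor [sin y] adds [1/2] to both exponents; [k0] collects the powers of 2 in
    [1 - cos y = |1 - z|^2 / 2] and [1 + cos y = |1 + z|^2 / 2]. *)
Let a := alpha + / 2.
Let b := beta + / 2.
Let k0 := - (alpha + beta + 1) * ln 2 / 2.

Lemma log_h_der x : -1 <= x <= 1 -> is_derive log_h x (log_h' x).
Proof.
  intros Hx. destruct (analytic_C1 h x Han Hx) as [D _]. unfold log_h, log_h'.
  apply (der_comp ln h); [now apply is_derive_ln, Hpos|exact D].
Qed.
Lemma h_cont x : -1 <= x <= 1 -> continuous h x.
Proof.
  intros Hx. apply (ex_derive_continuous h). eexists. apply (proj1 (analytic_C1 h x Han Hx)).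
Qed.
Lemma log_h'_cont x : -1 <= x <= 1 -> continuous log_h' x.
Proof.
  intros Hx. destruct (analytic_C1 h x Han Hx) as [_ C]. unfold log_h'.
  apply cont_div; [exact C|now apply h_cont|]. apply Rgt_not_eq, Hpos, Hx.
Qed.

Lemma cos_open y : 0 < y < PI -> -1 < cos y < 1.
Proof. intros Hy. rewrite <- cos_PI, <- cos_0. split; apply cos_decreasing_1; lra. Qed.

Lemma trig_weight_exp y : 0 < y < PI ->
  trig_weight y = exp (2 * (a * Re (log1m y) + b * Re (log1p y) + k0) + log_h (cos y)).
Proof.
  intros Hy. pose proof (cos_open y Hy) as Hc. assert (Hs : 0 < sin y) by (apply sin_gt_0; lra).
  unfold trig_weight, weight, Rpower, log_h.
  rewrite <- (exp_ln (h (cos y))) at 1 by (apply Hpos; lra).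
  rewrite <- (exp_ln (sin y)) by exact Hs. rewrite <- !exp_plus. f_equal.
  assert (E1 : ln (2 - 2 * cos y) = ln 2 + ln (1 - cos y)).
  { rewrite <- ln_mult by lra. f_equal. ring. }
  assert (E2 : ln (2 + 2 * cos y) = ln 2 + ln (1 + cos y)).
  { rewrite <- ln_mult by lra. f_equal. ring. }
  assert (E3 : 2 * ln (sin y) = ln (1 - cos y) + ln (1 + cos y)).
  { rewrite <- ln_mult by lra. replace (2 * ln (sin y)) with (ln (sin y) + ln (sin y)) by ring.
    rewrite <- ln_mult by lra. f_equal. pose proof (sin2_cos2 y) as S. unfold Rsqr in S. lra. }
  change (Re (log1m y)) with (ln (2 - 2 * cos y) / 2). change (Re (log1p y)) with (ln (2 + 2 * cos y) / 2).
  rewrite E1, E2. unfold a, b, k0. lra.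
Qed.

Lemma weight_cont x : -1 < x < 1 -> continuous (weight alpha beta h) x.
Proof.
  intros Hx. unfold weight, Rpower. apply cont_mult; [|apply h_cont; lra].
  apply cont_mult; apply cont_exp; (apply cont_mult; [cont|]); apply cont_ln;
    try (apply cont_minus; cont); try (apply cont_plus; cont); lra.
Qed.
Lemma weight_pos x : -1 < x < 1 -> 0 < weight alpha beta h x.
Proof.
  intros Hx. unfold weight. apply Rmult_lt_0_compat; [|apply Hpos; lra].
  apply Rmult_lt_0_compat; apply exp_pos.
Qed.

Lemma log_h_bound : exists C, 0 <= C /\ forall x, -1 <= x <= 1 -> Rabs (log_h x) <= C.
Proof.
  destruct (continuity_ab_maj (fun x => Rabs (log_h x)) (-1) 1) as [m [Hm _]]; [lra| |].
  - intros x Hx. apply continuity_pt_filterlim, cont_abs. unfold log_h. apply cont_ln; [now apply h_cont|now apply Hpos].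
  - exists (Rabs (log_h m)). split; [apply Rabs_pos|exact Hm].
Qed.

Lemma log_h_lip : exists C, 0 <= C /\ forall x y, Rabs (log_h (cos x) - log_h (cos y)) <= C * Rabs (x - y).
Proof.
  destruct (continuity_ab_maj (fun x => Rabs (log_h' x)) (-1) 1) as [m [Hm _]]; [lra| |].
  - intros x Hx. apply continuity_pt_filterlim, cont_abs. now apply log_h'_cont.
  - exists (Rabs (log_h' m)). split; [apply Rabs_pos|]. intros x y.
    apply Rle_trans with (Rabs (log_h' m) * Rabs (cos x - cos y)).
    { apply (lipschitz_unit_interval log_h log_h'); [exact log_h_der|exact Hm|apply COS_bound|apply COS_bound]. }
    apply Rmult_le_compat_l; [apply Rabs_pos|apply cos_lip].
Qed.

(** Both products are exponentials in which the logarithms of [|1 - z|^2] and [|1 + z|^2], each at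
    most [ln 4], carry nonnegative coefficients such as [M + a] or [M - a]. *)
Lemma trig_weight_sin_bounds M : - INR M <= a <= INR M -> - INR M <= b <= INR M ->
  exists Cb, (forall y, 0 < y < PI -> sin y ^ (2 * M) * trig_weight y <= Cb) /\
             (forall y, 0 < y < PI -> sin y ^ (2 * M) <= Cb * trig_weight y).
Proof.
  intros Ha Hb. destruct log_h_bound as [C [HC HC']]. pose proof (pos_INR M) as HM.
  set (E := 4 * INR M * ln 4 + Rabs (2 * k0) + C). exists (exp E).
  assert (Hl4 : 0 <= ln 4) by (rewrite <- ln_1; left; apply ln_increasing; lra).
  assert (S : forall y, 0 < y < PI -> exists l1 l2 H, l1 <= ln 4 /\ l2 <= ln 4 /\ Rabs H <= C /\
     sin y ^ (2 * M) <= exp (INR M * (l1 + l2)) /\ trig_weight y = exp (a * l1 + b * l2 + 2 * k0 + H)).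
  { intros y Hy. pose proof (cos_open y Hy) as Hc. assert (Hs : 0 < sin y) by (apply sin_gt_0; lra).
    exists (ln (2 - 2 * cos y)), (ln (2 + 2 * cos y)), (log_h (cos y)).
    split; [left; apply ln_increasing; lra|]. split; [left; apply ln_increasing; lra|].
    split; [apply HC', COS_bound|]. split.
    - rewrite <- ln_mult by lra.
      replace (INR M * ln ((2 - 2 * cos y) * (2 + 2 * cos y))) with (ln ((2 - 2 * cos y) * (2 + 2 * cos y)) * INR M) by ring.
      rewrite <- Rmult_comm. fold (Rpower ((2 - 2 * cos y) * (2 + 2 * cos y)) (INR M)).
      rewrite Rpower_pow by nra. rewrite pow_mult. apply pow_incr. split; [apply pow2_ge_0|].
      pose proof (sin2_cos2 y) as S. unfold Rsqr in S. nra.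
    - rewrite trig_weight_exp by exact Hy. f_equal.
      change (Re (log1m y)) with (ln (2 - 2 * cos y) / 2). change (Re (log1p y)) with (ln (2 + 2 * cos y) / 2). field. }
  pose proof (Rle_abs (2 * k0)) as K1. pose proof (Rle_abs (- (2 * k0))) as K2. rewrite Rabs_Ropp in K2.
  split; intros y Hy; destruct (S y Hy) as [l1 [l2 [H [H1 [H2 [H3 [H4 ->]]]]]]]; apply Rabs_le_between in H3.
  - apply Rle_trans with (exp (INR M * (l1 + l2)) * exp (a * l1 + b * l2 + 2 * k0 + H)).
    + apply Rmult_le_compat_r; [apply Rlt_le, exp_pos|exact H4].
    + rewrite <- exp_plus. apply exp_le. unfold E.
      assert ((INR M + a) * l1 <= (INR M + a) * ln 4) by (apply Rmult_le_compat_l; lra).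
      assert ((INR M + b) * l2 <= (INR M + b) * ln 4) by (apply Rmult_le_compat_l; lra).
      assert ((INR M + a) * ln 4 <= 2 * INR M * ln 4) by (apply Rmult_le_compat_r; lra).
      assert ((INR M + b) * ln 4 <= 2 * INR M * ln 4) by (apply Rmult_le_compat_r; lra). lra.
  - eapply Rle_trans; [exact H4|]. rewrite <- exp_plus. apply exp_le. unfold E.
    assert ((INR M - a) * l1 <= (INR M - a) * ln 4) by (apply Rmult_le_compat_l; lra).
    assert ((INR M - b) * l2 <= (INR M - b) * ln 4) by (apply Rmult_le_compat_l; lra).
    assert ((INR M - a) * ln 4 <= 2 * INR M * ln 4) by (apply Rmult_le_compat_r; lra).
    assert ((INR M - b) * ln 4 <= 2 * INR M * ln 4) by (apply Rmult_le_compat_r; lra). lra.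
Qed.

Lemma trig_weight_near t d : 0 < d -> 0 < t - d -> t + d < PI ->
  exists L m0, 0 <= L /\ 0 < m0 /\ forall y, Rabs (y - t) < d ->
    0 < y < PI /\ m0 <= trig_weight y /\ Rabs (trig_weight y - trig_weight t) <= L * Rabs (y - t).
Proof.
  intros Hd H1 H2. destruct (log_lipschitz t d Hd H1 H2) as [K [HK HK']]. destruct log_h_lip as [C [HC HC']].
  set (E := fun y => 2 * (a * Re (log1m y) + b * Re (log1p y) + k0) + log_h (cos y)).
  set (Q := 2 * (Rabs a * K + Rabs b * K) + C).
  assert (HQ : 0 <= Q) by (unfold Q; pose proof (Rabs_pos a); pose proof (Rabs_pos b); nra).
  assert (EL : forall y, Rabs (y - t) < d -> Rabs (E y - E t) <= Q * Rabs (y - t)).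
  { intros y Hy. destruct (HK' y Hy) as [X1 X2]. specialize (HC' y t).
    assert (Y1 : Rabs (Re (log1m y) - Re (log1m t)) <= K * Rabs (y - t)).
    { eapply Rle_trans; [|exact X1]. exact (re_le_Cmod (log1m y - log1m t)). }
    assert (Y2 : Rabs (Re (log1p y) - Re (log1p t)) <= K * Rabs (y - t)).
    { eapply Rle_trans; [|exact X2]. exact (re_le_Cmod (log1p y - log1p t)). }
    replace (E y - E t) with (2 * (a * (Re (log1m y) - Re (log1m t))) + (2 * (b * (Re (log1p y) - Re (log1p t)))
       + (log_h (cos y) - log_h (cos t)))) by (unfold E; ring).
    eapply Rle_trans; [apply Rabs_triang|]. eapply Rle_trans; [apply Rplus_le_compat_l, Rabs_triang|].
    rewrite !Rabs_mult, (Rabs_pos_eq 2) by lra.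
    assert (Rabs a * Rabs (Re (log1m y) - Re (log1m t)) <= Rabs a * (K * Rabs (y - t))) by (apply Rmult_le_compat_l; [apply Rabs_pos|exact Y1]).
    assert (Rabs b * Rabs (Re (log1p y) - Re (log1p t)) <= Rabs b * (K * Rabs (y - t))) by (apply Rmult_le_compat_l; [apply Rabs_pos|exact Y2]).
    unfold Q. lra. }
  exists (2 * exp (E t + Q * d) * Q), (exp (E t - Q * d)).
  split; [apply Rmult_le_pos; [pose proof (exp_pos (E t + Q * d)); lra|exact HQ]|]. split; [apply exp_pos|].
  intros y Hy. pose proof (EL y Hy) as X. pose proof Hy as Hy'. apply Rabs_def2 in Hy'.
  assert (Q * Rabs (y - t) <= Q * d) by (apply Rmult_le_compat_l; lra).
  pose proof X as X'. apply Rabs_le_between in X'.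
  split; [lra|]. rewrite !trig_weight_exp by lra. fold (E y). fold (E t). split; [apply exp_le; lra|].
  rewrite <- Cmod_R, RtoC_minus, <- !cexp_R.
  eapply Rle_trans; [apply (cexp_lipschitz (E t + Q * d))|].
  - simpl. lra.
  - simpl. assert (0 <= Q * d) by (apply Rmult_le_pos; lra). lra.
  - rewrite <- RtoC_minus, Cmod_R. pose proof (exp_pos (E t + Q * d)).
    replace (2 * exp (E t + Q * d) * Q * Rabs (y - t)) with (2 * exp (E t + Q * d) * (Q * Rabs (y - t))) by ring.
    apply Rmult_le_compat_l; lra.
Qed.

Variable p : nat -> R -> R.
Hypothesis Hp : orthonormal_family (weight alpha beta h) p.

Let P (n : nat) (y : R) : R := p n (cos y).
(** The leading coefficient in the basis [cosn], given by a formula because a function of [n] is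
    needed while [deg_polynomial] only asserts existence for each [n]. *)
Let top (n : nat) : R := match n with O => P 0 0 | S _ => 2 / PI * II (fun y => P n y * cosn n y) end.

Lemma top_deg n : 0 < top n /\ deg n (top n) (P n).
Proof.
  pose proof PI_RGT_0 as Hpi. destruct (deg_polynomial (p n) n (proj1 Hp n)) as [c [Hc Hdeg]].
  assert (E : top n = c); [|rewrite E; split; assumption].
  destruct n as [|n]; simpl.
  - destruct Hdeg as [v [[d Hv] He]]. unfold P. rewrite (He 0), Hv, cosn_0. simpl. ring.
  - fold (P (S n)) in Hdeg. change (fun y => p (S n) (cos y)) with (P (S n)) in Hdeg.
    rewrite (II_deg_cosn (S n) c (P (S n))) by (try lia; exact Hdeg). field. lra.
Qed.

Lemma product_cont m n x : -1 < x < 1 -> continuous (fun x => p m x * p n x * weight alpha beta h x) x.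
Proof.
  intros Hx. apply cont_mult; [|now apply weight_cont].
  apply cont_mult; eapply poly_deg_cont; apply Hp.
Qed.

(** Integrability is read off from the normalization of [p 0], a positive constant. *)
Lemma trig_weight_integrable : integrable_weight trig_weight.
Proof.
  assert (Cc : forall y, 0 < y < PI -> continuous trig_weight y).
  { intros y Hy. unfold trig_weight. apply cont_mult; [|cont].
    apply (continuous_comp cos (weight alpha beta h)); [apply continuous_cos|]. now apply weight_cont, cos_open. }
  split; [exact Cc|]. split.
  - intros y Hy. rewrite trig_weight_exp by exact Hy. apply exp_pos.
  - destruct Hp as [Hpd Hpo]. destruct (Hpd 0%nat) as [c [Hc0 Hc]].
    assert (P0 : forall x, p 0%nat x = c 0%nat) by (intros; rewrite Hc; simpl; ring).
    pose proof (RInt_gen_bound _ 1 (product_cont 0 0)) as B. specialize (B ltac:(intros x Hx; cbv beta; rewrite P0; pose proof (weight_pos x Hx); nra)).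
    specialize (B (Hpo 0%nat 0%nat)). simpl in B.
    exists ((1 + 1) / (c 0%nat * c 0%nat)). intros u v Hu Huv Hv. specialize (B u v Hu Huv Hv).
    assert (K : 0 < c 0%nat * c 0%nat) by nra.
    apply (proj1 (Rle_div_r _ _ _ K)). rewrite Rmult_comm.
    rewrite <- (RInt_scal (V := R_CompleteNormedModule) trig_weight).
    + eapply Rle_trans; [|exact B]. right. apply RInt_ext. intros y _. unfold scal; simpl; unfold mult; simpl.
      unfold trig_weight. rewrite P0. match goal with |- ?r = ?q => change (@eq R r q) end. ring.
    + apply ex_RInt_open; auto.
Qed.

Lemma trig_orthonormal m n :
  II (fun y => P m y * P n y * trig_weight y) = if Nat.eqb m n then 1 else 0.
Proof.
  apply II_eq. eapply is_lim_seq_ext; [|exact (RInt_gen_trunc_lim _ _ (product_cont m n) (proj2 Hp m n))].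
  intros k. apply RInt_ext. intros y _. unfold P, trig_weight.
  match goal with |- ?r = ?q => change (@eq R r q) end. ring.
Qed.

(** The imaginary part of [log_szego]; [t / 2] and [- PI / 4] stem from the two exponents [1/2]
    contributed by [sin y]. *)
Definition limit_phase (t : R) : R :=
  / 2 * ((alpha + beta) * t - alpha * PI) + t / 2 - PI / 4 + conj_value log_h log_h' t / 2.

(** The conjugate of [exp (- W)] has modulus [exp (- Re W)] and argument [Im W], which give the
    amplitude and the phase. *)
Lemma jacobi_asymptotics t : 0 < t < PI ->
  exists A, 0 < A /\ is_lim_seq (fun n => p n (cos t) - A * cos (INR n * t + limit_phase t)) 0.
Proof.
  intros Ht. pose proof PI_RGT_0 as Hpi.
  set (d := Rmin t (PI - t) / 2).
  assert (Hd : 0 < d) by (unfold d; assert (0 < Rmin t (PI - t)) by (apply Rmin_glb_lt; lra); lra).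
  assert (Hd1 : d <= t / 2) by (unfold d; pose proof (Rmin_l t (PI - t)); lra).
  assert (Hd2 : d <= (PI - t) / 2) by (unfold d; pose proof (Rmin_r t (PI - t)); lra).
  (* [M] exceeds [|a|] and [|b|], as required for all combinations of exponents to be
     nonnegative. *)
  destruct (nfloor_ex (Rabs a + Rabs b)) as [M0 HM0].
  { pose proof (Rabs_pos a); pose proof (Rabs_pos b); lra. }
  set (M := S M0). assert (HM : Rabs a + Rabs b <= INR M) by (unfold M; rewrite S_INR; lra).
  assert (Ha : - INR M <= a <= INR M).
  { pose proof (Rabs_pos b). apply Rabs_le_between. lra. }
  assert (Hb : - INR M <= b <= INR M).
  { pose proof (Rabs_pos a). apply Rabs_le_between. lra. }
  destruct (trig_weight_sin_bounds M Ha Hb) as [Cb [Cb1 Cb2]].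
  destruct (trig_weight_near t d Hd ltac:(lra) ltac:(lra)) as [L [m0 [HL [Hm0 Hnear]]]].
  pose proof trig_weight_integrable as Hf.
  set (W := log_szego a b k0 log_h log_h' t).
  assert (Ex : forall e, 0 < e -> exists l1 l2, szego_pair trig_weight M t d (cexp (- W)) e l1 l2).
  { intros e He.
    destruct (szego_fun_exists trig_weight Hf a b k0 M Ha Hb log_h log_h' log_h_der log_h'_cont trig_weight_exp
       t d L Hd ltac:(lra) ltac:(lra) HL ltac:(intros y Hy; apply (Hnear y Hy)) (e / 2) ltac:(lra)) as [lA [lB HAB]].
    replace e with (2 * (e / 2)) by field.
    exact (szego_polynomials trig_weight Hf M Cb t d L m0 Cb1 Cb2 Ht Hd Hnear _ (e / 2) lA lB ltac:(lra) HAB). }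
  pose proof (pointwise_asymptotics trig_weight P top M Cb t d L m0 (cexp (- W)) Hf
     (fun n => proj1 (top_deg n)) (fun n => proj2 (top_deg n)) trig_orthonormal Cb1 Cb2 Ht Hd Hm0 Hnear Ex) as Lim.
  exists (sqrt (2 / PI) * exp (- Re W)). split.
  { apply Rmult_lt_0_compat; [apply sqrt_lt_R0, Rdiv_lt_0_compat; lra|apply exp_pos]. }
  assert (EW : Im W = limit_phase t).
  { unfold W, log_szego, limit_phase, log1m, log1p, a, b. simpl. field. }
  rewrite <- EW. eapply is_lim_seq_ext; [|exact Lim]. intros n. cbv beta. unfold P.
  rewrite <- cexp_conj. unfold zn, cexp, cosn, sinn. destruct W as [w1 w2]. simpl.
  rewrite cos_plus, !Ropp_involutive. ring.
Qed.

End Jacobi.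

(** * The entropy limit at rational and irrational angles *)

Theorem theorem1 (alpha beta : R) (h : R -> R) (p : nat -> R -> R) :
  -1 < alpha -> -1 < beta ->
  analytic_near_interval h ->
  (forall x, -1 <= x <= 1 -> 0 < h x) ->
  orthonormal_family (weight alpha beta h) p ->
  forall theta : R, 0 < theta < PI ->
    let x := cos theta in
    ((forall s k : nat, (0 < k)%nat -> theta / PI <> INR s / INR k) ->
       is_lim_seq (fun n => Dent p n x) (1 - ln 2)) /\
    (forall s k : nat, (s < k)%nat -> Nat.gcd s k = 1%nat -> theta / PI = INR s / INR k ->
       exists pv : R,
         is_pv_integral (fun t => ln (h t) / sqrt (1 - t ^ 2) / (t - x)) (-1) 1 x pv /\
         is_lim_seq (fun n => Dent p n x)
           (ln 2 + 2 * Shat k s (phi_val alpha beta (PI * INR s / INR k)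
                                     (cos (PI * INR s / INR k)) pv))).
Proof.
  intros _ _ Han Hpos Hp theta Ht x. unfold x. clear x. pose proof PI_RGT_0 as Hpi.
  destruct (jacobi_asymptotics alpha beta h Han Hpos p Hp theta Ht) as [A [HA Lim]].
  assert (Hs : 0 < sin theta) by (apply sin_gt_0; lra).
  split.
  - intros Hirr. replace (1 - ln 2) with (ln 2 + 2 * (/ 2 - ln 2)) by field.
    apply (entropy_limit p (cos theta) A theta _ _ HA ltac:(lra) Lim), mean_Fent_irrational.
    (* A zero of [sin (k theta)] would make [theta / PI] a quotient [s / k] of natural numbers. *)
    intros k Hk E. destruct (sin_eq_0_0 _ E) as [z Hz].
    assert (Kp : 0 < INR k) by (apply lt_0_INR; lia).
    assert (0 <= z)%Z.
    { apply le_IZR. apply Rmult_le_reg_r with PI; [exact Hpi|]. rewrite <- Hz. nra. }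
    destruct (IZN z) as [s ->]; [assumption|]. rewrite <- INR_IZR_INZ in Hz. apply (Hirr s k Hk).
    apply Rmult_eq_reg_r with (INR k * PI); [|nra]. field_simplify; [|lra|lra]. lra.
  - intros s k Hsk _ Erat.
    assert (Kp : 0 < INR k) by (apply lt_0_INR; lia).
    assert (Et : PI * INR s / INR k = theta).
    { unfold Rdiv in *. rewrite Rmult_assoc, <- Erat. field. lra. }
    exists (II (cos_quotient (log_h h) (log_h' h) theta)). split.
    { apply (principal_value (log_h h) (log_h' h) (log_h_der h Han Hpos) theta Ht h). reflexivity. }
    rewrite Et.
    apply (entropy_limit p (cos theta) A theta _ _ HA ltac:(lra) Lim).
    unfold Shat. rewrite Et. set (ph := phi_val _ _ _ _ _).
    assert (Ep : forall i, cos ((INR i + / 2) * theta + ph - PI / 4) =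
                           cos (INR i * theta + limit_phase alpha beta h theta)).
    (* Since [sqrt (1 - x^2) = sin theta], the principal value term of the phase is half of
       [conj_value], and [theta / 2] is absorbed by the shift [i + 1/2]. *)
    { intros i. f_equal. unfold ph, phi_val, limit_phase, conj_value.
      replace (1 - cos theta ^ 2) with (sin theta ^ 2) by (pose proof (sin2_cos2 theta) as S2; unfold Rsqr in S2; lra).
      rewrite <- Rsqr_pow2, sqrt_Rsqr by lra. field. lra. }
    apply mean_lim_ext with (fun i => Fent (cos ((INR i + / 2) * theta + ph - PI / 4))).
    { intros i. now rewrite Ep. }
    apply (mean_periodic (fun i => Fent (cos ((INR i + / 2) * theta + ph - PI / 4)))); [lia|].
    (* Raising the index by [k] adds [k theta = s PI] to the angle, which changes at most the sign
       of the cosine, and [Fent] is even. *)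
    intros j. rewrite plus_INR.
    replace ((INR j + INR k + / 2) * theta + ph - PI / 4) with ((INR j + / 2) * theta + ph - PI / 4 + INR s * PI)
      by (rewrite <- Et; field; lra).
    clear. generalize ((INR j + / 2) * theta + ph - PI / 4). intros y.
    induction s as [|s IH]; [f_equal; f_equal; simpl; ring|].
    rewrite S_INR. replace (y + (INR s + 1) * PI) with (y + INR s * PI + PI) by ring.
    now rewrite neg_cos, Fent_opp.
Qed.
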